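(* Let $S$ be a Noetherian formal scheme, let $X$ be a formal scheme locally of formal finite presentation over $S$, and let $R\rightrightarrows X$ be an infinitesimal groupoid on $X$ over $S$ whose source morphism $s$ is formally smooth and locally of formal finite presentation. Let $\mathcal{X}$ denote the formal stack $[X/R]$, let $x \in X$ be a closed point with residue field $\kappa(x)$, and suppose that its formal group stabiliser $G$ is formally smooth over $\kappa(x)$. Let $v : V \hookrightarrow X$ be a transversal of $R$ through $x \in X$. Then, up to replacing $V$ with an open subset containing $x$: (A) the closed point $x \in V$ is $R_V$-invariant, where $R_V$ is the restriction groupoid $R|_V$; (B) the induced morphism $V \to \mathcal{X}$ is representable and formally smooth of formal finite presentation; (C) the immersion $v : V \hookrightarrow X$ is a local complete intersection. Suppose further that the topological space of $X$ consists of the single closed point $x$. Then: (D) there exists a (non-unique) formally smooth morphism of formal finite presentation $u : X \to V$ of formal schemes over $\mathcal{X}$, split by $v$ (i.e. $u\circ v=\mathrm{id}_V$); (E) if $G$ is trivial, then $V = \mathcal{X}$ and $u : X \to V$ is unique. Suppose further that $S = \mathrm{Spec}\, k$ is the spectrum of a field and that $x$ is a $k$-point. Let $l : L \hookrightarrow X$ be the leaf of $R$ through $x$. Then, after fixing $u : X \to V$: (F) there exists a (non-unique) decomposition of $X$ into a product $X \cong L \times_k V$ compatible with the morphisms $l : L \hookrightarrow X$, $v : V \hookrightarrow X$ and $u : X \to V$.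
   Context: Formal schemes are locally topologically ringed spaces locally isomorphic to $\mathrm{Spf}$ of an adic ring with finitely generated ideal of definition. A morphism of locally Noetherian formal schemes is locally of formal finite presentation if locally it has the form $\mathrm{Spf}\,B\to\mathrm{Spf}\,A$ and for suitable ideals of definition $I\subseteq A$, $J\subseteq B$ with $IB\subseteq J$ the map $A/I\to B/J$ is of finite presentation. It is formally smooth if it has the infinitesimal lifting property. Groupoids: a formal groupoid $R\rightrightarrows X$ over $S$ is a groupoid object in formal schemes over $S$, with source $s$, target $t:R\to X$, unit $e:X\to R$, inverse $i$, and composition $c:R\times_{(s,t)}R\to R$. It is infinitesimal if $e$ is a thickening (a closed immersion that is a homeomorphism), equivalently if $s$ is a homeomorphism on underlying spaces. For a formal subscheme $\iota:Z\to X$, the restriction is $R|_Z=R\times_{X\times_SX}(Z\times_SZ)$; $Z$ is $R$-invariant if the natural morphisms $R|_Z\to R\times_{(s,\iota)}Z$ and $R|_Z\to Z\times_{(\iota,t)}R$ are isomorphisms (either implies the other). Stabiliser: $G$ is the restriction of $R$ to $\mathrm{Spec}\,\kappa(x)$, that is $G=s^{-1}(x)\times_{t,X}\mathrm{Spec}\,\kappa(x)$. It is trivial if $G=\mathrm{Spec}\,\kappa(x)$. Leaf: let $\hat X=\mathrm{Spf}\,\hat A$ be the infinitesimal neighbourhood (formal completion) of $x$ in $X$, with $\hat A$ a complete Noetherian local ring with maximal ideal $\hat{\mathfrak m}$, and let $\hat R\rightrightarrows\hat X$ be the completion of $R$ at $e(x)$, which is the restriction of $R$ to $\hat X$. The leaf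 $L$ of $R$ through $x$ is the unique non-empty $\hat R$-invariant formal subscheme of $\hat X$ that contains no proper non-empty $\hat R$-invariant formal subscheme. Transversal: a locally closed formal subscheme $v:V\to X$ containing $x$ such that, if the infinitesimal neighbourhood $\hat V$ of $x\in V$ and the leaf $L$ are cut out in $\hat X$ by ideals $\hat J$ and $K$ of $\hat A$, then $\mathrm{Tor}_0^{\hat A}(\hat A/\hat J,\hat A/K)=\hat A/\hat{\mathfrak m}$ and $\mathrm{Tor}_1^{\hat A}(\hat A/\hat J,\hat A/K)=0$. Stack: $\mathcal{X}=[X/R]$ is the quotient stack of the groupoid; $X\to\mathcal{X}$ is a formally smooth presentation with $X\times_{\mathcal{X}}X=R$ (projections $t,s$). The base change of $V\to\mathcal{X}$ along $X\to\mathcal{X}$ is the morphism $s:N:=V\times_{(v,t)}R\to X$; thus (B) means that this morphism is formally smooth of formal finite presentation, and ''$V=\mathcal{X}$'' in (E) means that $V\to\mathcal{X}$ is an isomorphism, i.e. $N\to X$ is an isomorphism. A morphism $u:X\to V$ over $\mathcal{X}$ is one for which there is a morphism $\rho:X\to R$ with $s\circ\rho=\mathrm{id}_X$ and $t\circ\rho=v\circ u$. A closed immersion of locally Noetherian formal schemes is a local complete intersection if its ideal is locally generated by a regular sequence (for an immersion, after restricting to an open subset in which it is closed). In (F), compatibility means that under the isomorphism $X\cong L\times_kV$, $l$ corresponds to $\mathrm{id}_L\times x$, $v$ to $x\times\mathrm{id}_V$, and $u$ to the projection onto $V$. *)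

(* Defs.v *)
From HB Require Import structures.
From mathcomp Require Import all_boot all_algebra.
From mathcomp Require Import boolp classical_sets functions cardinality.
From mathcomp Require Import topology tvs.
From mathcomp.multinomials Require mpoly.
Import (canonicals, coercions) mpoly.

Set Implicit Arguments.
Unset Strict Implicit.
Unset Printing Implicit Defensive.

Import GRing.Theory.
Local Open Scope classical_set_scope.
Local Open Scope ring_scope.

(* Rings of sections may be zero (over the empty set), hence ComPzRing. *)
HB.mixin Record TopologicalZmodule_isTopologicalComRing R
    & TopologicalZmodule R & GRing.ComPzRing R := {
  mul_continuous_subproof : continuous (fun x : R * R => x.1 * x.2) ;
}.

#[short(type="topComRingType")]
HB.structure Definition TopologicalComRing :=
  {R of TopologicalZmodule R & GRing.ComPzRing R
      & TopologicalZmodule_isTopologicalComRing R}.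

Section Algebra.
Variable A : comPzRingType.
Implicit Types (I J : set A).

Definition is_unit (a : A) : Prop := exists b, a * b = 1.

Definition nonunits : set A := [set a | ~ is_unit a].

Definition is_ideal I : Prop :=
  [/\ I 0, forall a b, I a -> I b -> I (a + b) & forall c a, I a -> I (c * a)].

Definition prime_ideal I : Prop :=
  [/\ is_ideal I, ~ I 1 & forall a b, I (a * b) -> I a \/ I b].

Definition ideal_span (G : set A) : set A :=
  [set a | exists n (c g : 'I_n -> A),
     (forall i, G (g i)) /\ a = \sum_(i < n) c i * g i].

Definition ideal_mul I J : set A :=
  ideal_span [set a | exists x y, [/\ I x, J y & a = x * y]].

Definition ideal_pow I (n : nat) : set A := iter n (ideal_mul I) setT.

Definition fg_ideal I : Prop :=
  exists n (g : 'I_n -> A), I = ideal_span (range g).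

Definition noetherian_ring : Prop := forall I, is_ideal I -> fg_ideal I.

Definition nilpotent_ideal I : Prop := exists n, ideal_pow I n `<=` [set 0].

(* A -> lim A / I^n is bijective *)
Definition adically_complete I : Prop :=
  (forall a, (forall n, ideal_pow I n a) -> a = 0) /\
  (forall u : nat -> A, (forall n, ideal_pow I n (u n.+1 - u n)) ->
     exists l, forall n, ideal_pow I n (l - u n)).

Definition field_ring : Prop :=
  (1 : A) <> 0 /\ forall a : A, a <> 0 -> is_unit a.

Definition regular_sequence (m : nat) (r : 'I_m -> A) : Prop :=
  ~ ideal_span (range r) 1 /\
  forall (i : 'I_m) (a : A),
    let prev := [set b | exists2 j : 'I_m, (j < i)%N & b = r j] in
    ideal_span prev (r i * a) -> ideal_span prev a.

(* A resolution of A / J by finite free modules,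
     ... -> A^(rk 2) -> A^(rk 1) -> A^(rk 0) -> A / J -> 0,
   with elements written as row vectors. *)
Record free_resolution J (rk : nat -> nat)
    (d : forall i, 'M[A]_(rk i.+1, rk i)) (aug : 'cV[A]_(rk 0%N)) : Prop := {
  resolution_aug_surj : forall a, exists u : 'rV[A]_(rk 0%N),
    J (a - (u *m aug) 0 0);
  resolution_exact0 : forall u : 'rV[A]_(rk 0%N),
    J ((u *m aug) 0 0) <-> exists w, u = w *m d 0%N;
  resolution_exactS : forall i (u : 'rV[A]_(rk i.+1)),
    u *m d i = 0 <-> exists w, u = w *m d i.+1 }.

(* Cycles and boundaries of the tensor product of the resolution with A / K,
   a complex with terms (A / K)^(rk i), lifted to A^(rk i). *)
Definition tor_cycle K (rk : nat -> nat)
    (d : forall i, 'M[A]_(rk i.+1, rk i)) (i : nat) : set 'rV[A]_(rk i) :=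
  match i return set 'rV[A]_(rk i) with
  | 0%N => setT
  | k.+1 => [set u | forall j, K ((u *m d k) 0 j)]
  end.

Definition tor_boundary K (rk : nat -> nat)
    (d : forall i, 'M[A]_(rk i.+1, rk i)) (i : nat) : set 'rV[A]_(rk i) :=
  [set u | exists w, forall j, K ((u - w *m d i) 0 j)].

(* Tor_i^A(A / J, A / K) is isomorphic to A / a, that is, generated by one
   element of annihilator a *)
Definition tor_is_cyclic J K (i : nat) (a : set A) : Prop :=
  exists (rk : nat -> nat) (d : forall i, 'M[A]_(rk i.+1, rk i)) aug,
    free_resolution J d aug /\
    exists g : 'rV[A]_(rk i),
      [/\ tor_cycle K d g,
          forall z, tor_cycle K d z -> exists c, tor_boundary K d (z - c *: g) &
          forall c, tor_boundary K d (c *: g) <-> a c].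

End Algebra.

(* The map A / I -> B / J induced by g is of finite presentation: B / J is the
   quotient of (A / I)[X_1, ..., X_n] by finitely many relations. *)
Definition finitely_presented_mod (A B : comNzRingType) (g : {rmorphism A -> B})
    (I : set A) (J : set B) : Prop :=
  exists n (b : 'I_n -> B),
    (forall y, exists p : mpoly.mpoly n A, J (y - mpoly.mmap g b p)) /\
    exists m (r : 'I_m -> mpoly.mpoly n A), forall p,
      J (mpoly.mmap g b p) <->
      @ideal_span (mpoly.mpoly n A) ([set mpoly.mpolyC n a | a in I] `|` range r) p.

Definition adic_topology (A : topComRingType) (I : set A) : Prop :=
  forall W : set A, open W <->
    forall w, W w -> exists n, forall a, ideal_pow I n a -> W (w + a).

(* [sec U] is meaningful for open U only; every operation on sections takes a
   proof of openness. *)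
Record ringedSpace := RingedSpace {
  space :> topologicalType;
  sec : set space -> topComRingType;
  res : forall U V, open U -> open V -> V `<=` U -> {rmorphism sec U -> sec V};
  res_continuous : forall U V (oU : open U) (oV : open V) (VU : V `<=` U),
    continuous (res oU oV VU);
  res_id : forall U (oU oU' : open U) (UU : U `<=` U) s, res oU oU' UU s = s;
  res_res : forall U V W (oU : open U) (oV : open V) (oW : open W)
    (VU : V `<=` U) (WV : W `<=` V) (WU : W `<=` U) s,
    res oV oW WV (res oU oV VU s) = res oU oW WU s;
  sheaf_separated : forall U (C : set (set space)) (oU : open U)
    (oC : forall W, C W -> open W) (CU : forall W, C W -> W `<=` U) s,
    U `<=` \bigcup_(W in C) W ->
    (forall W (CW : C W), res oU (oC W CW) (CU W CW) s = 0) -> s = 0;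
  sheaf_glue : forall U (C : set (set space)) (oU : open U)
    (oC : forall W, C W -> open W) (CU : forall W, C W -> W `<=` U)
    (f : forall W, sec W),
    U `<=` \bigcup_(W in C) W ->
    (forall W W' (CW : C W) (CW' : C W') V (oV : open V)
       (VW : V `<=` W) (VW' : V `<=` W'),
       res (oC W CW) oV VW (f W) = res (oC W' CW') oV VW' (f W')) ->
    exists s, forall W (CW : C W), res oU (oC W CW) (CU W CW) s = f W;
  (* [sec U] has the topology induced from the product of the [sec W]. *)
  sheaf_topology : forall U (C : set (set space)) (oU : open U)
    (oC : forall W, C W -> open W) (CU : forall W, C W -> W `<=` U)
    (N : set (sec U)),
    U `<=` \bigcup_(W in C) W -> nbhs 0 N ->
    exists (D : set (set space)) (M : forall W, set (sec W)),
      [/\ finite_set D, D `<=` C, forall W, nbhs 0 (M W) &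
          forall s, (forall W (CW : C W), D W ->
            M W (res oU (oC W CW) (CU W CW) s)) -> N s] }.

Arguments sec : clear implicits.
Arguments sec {r} U.

(* The germ of s at x is a unit of the stalk. *)
Definition unit_at (X : ringedSpace) (U : set X) (s : sec U) (x : X) : Prop :=
  exists W (oU : open U) (oW : open W) (WU : W `<=` U),
    W x /\ is_unit (res oU oW WU s).

Definition basic_open (X : ringedSpace) (U : set X) (s : sec U) : set X :=
  [set x | unit_at s x].

(* The inverse image in O(U) of the maximal ideal of the stalk at x. *)
Definition vanishing (X : ringedSpace) (U : set X) (x : X) : set (sec U) :=
  [set s | ~ unit_at s x].

Lemma basic_open_sub (X : ringedSpace) (U : set X) (s : sec U) :
  basic_open s `<=` U.
Proof. by move=> x [W [oU [oW [WU [Wx _]]]]]; exact: WU. Qed.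

Lemma basic_open_open (X : ringedSpace) (U : set X) (s : sec U) :
  open (basic_open s).
Proof.
rewrite openE => x [W [oU [oW [WU [Wx su]]]]].
rewrite /interior nbhsE; exists W; first by [].
by move=> y Wy; exists W, oU, oW, WU.
Qed.

(* All stalks are local rings. *)
Definition locally_ringed (X : ringedSpace) : Prop :=
  forall (U : set X) (x : X), open U -> U x ->
    ~ unit_at (0 : sec U) x /\
    forall s t : sec U, unit_at (s + t) x -> unit_at s x \/ unit_at t x.

Record mor (X Y : ringedSpace) := Mor {
  mfun :> X -> Y;
  mor_open : forall V, open V -> open (mfun @^-1` V);
  comap : forall V, open V -> {rmorphism sec V -> sec (mfun @^-1` V)};
  comap_continuous : forall V (oV : open V), continuous (comap oV);
  comap_res : forall U V (oU : open U) (oV : open V) (VU : V `<=` U)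
    (VU' : mfun @^-1` V `<=` mfun @^-1` U) s,
    comap oV (res oU oV VU s) =
    res (mor_open oU) (mor_open oV) VU' (comap oU s);
  mor_local : forall V (oV : open V) (s : sec V) x, V (mfun x) ->
    unit_at (comap oV s) x -> unit_at s (mfun x) }.

Section Category.
Variables X Y Z : ringedSpace.

Lemma idm_comap_res (U V : set X) (oU : open U) (oV : open V) (VU : V `<=` U)
    (VU' : id @^-1` V `<=` id @^-1` U) (s : sec U) :
  res oU oV VU s = res oU oV VU' s.
Proof. by rewrite (Prop_irrelevance VU VU'). Qed.

Definition idm : mor X X := {|
  mfun := id;
  mor_open := fun V oV => oV;
  comap := fun V oV => idfun;
  comap_continuous := fun V oV s => @cvg_id _ _;
  comap_res := idm_comap_res;
  mor_local := fun V oV s x Vx su => su |}.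

Variables (g : mor Y Z) (f : mor X Y).

Definition compm_comap (V : set Z) (oV : open V) :
    {rmorphism sec V -> sec ((g \o f) @^-1` V)} :=
  GRing.RMorphism.clone _ _ (comap f (mor_open g oV) \o comap g oV) _.

Lemma compm_continuous (V : set Z) (oV : open V) : continuous (compm_comap oV).
Proof.
move=> s; apply: (@continuous_comp _ _ _ (comap g oV)).
  exact: comap_continuous.
exact: comap_continuous.
Qed.

Lemma compm_comap_res (U V : set Z) (oU : open U) (oV : open V)
    (VU : V `<=` U) (VU' : (g \o f) @^-1` V `<=` (g \o f) @^-1` U)
    (s : sec U) :
  compm_comap oV (res oU oV VU s) =
  res (mor_open f (mor_open g oU)) (mor_open f (mor_open g oV)) VU'
    (compm_comap oU s).
Proof.
have gVU : g @^-1` V `<=` g @^-1` U by move=> y; exact: VU.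
rewrite /compm_comap /= (comap_res oU oV VU gVU).
exact: comap_res.
Qed.

Lemma compm_local (V : set Z) (oV : open V) (s : sec V) (x : X) :
  V ((g \o f) x) -> unit_at (compm_comap oV s) x -> unit_at s ((g \o f) x).
Proof.
move=> Vx su; apply: (@mor_local _ _ g V oV) => //.
exact: (@mor_local _ _ f _ (mor_open g oV)).
Qed.

Definition compm : mor X Z := {|
  mfun := g \o f;
  mor_open := fun V oV => mor_open f (mor_open g oV);
  comap := compm_comap;
  comap_continuous := compm_continuous;
  comap_res := compm_comap_res;
  mor_local := compm_local |}.

End Category.

Arguments idm X : clear implicits.

Notation "g \oM f" := (compm g f)
  (at level 50, left associativity, format "g  \oM  f").

Definition is_iso (X Y : ringedSpace) (f : mor X Y) : Prop :=
  exists g : mor Y X, f \oM g = idm Y /\ g \oM f = idm X.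

Definition comap_to (X Y : ringedSpace) (f : mor X Y) (U : set X) (V : set Y)
    (oU : open U) (oV : open V) (UV : U `<=` f @^-1` V) :
    {rmorphism sec V -> sec U} :=
  GRing.RMorphism.clone _ _ (res (mor_open f oV) oU UV \o comap f oV) _.

Definition global_comap (X Y : ringedSpace) (f : mor X Y) :
    {rmorphism sec [set: Y] -> sec [set: X]} := comap f openT.

(* For a closed immersion f into an affine Y, the ideal cutting out X in Y. *)
Definition global_kernel (X Y : ringedSpace) (f : mor X Y) :
    set (sec [set: Y]) := [set a | global_comap f a = 0].

(* The open subspace U is Spf A, for A = O(U) with the I-adic topology:
   - A is an adic ring, with finitely generated ideal of definition I;
   - |U| is the set of primes of A containing I, with the Zariski topology;
   - O(D(a)) is the completed localisation A{1/a} = lim (A / I^n)[1/a], with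
     its adic topology (for a = 1 this covers the completeness of A itself).
   The values on the D(a) determine the sheaf. *)
Record affine (X : ringedSpace) (U : set X) (I : set (sec U)) : Prop := {
  affine_open : open U;
  affine_fg : fg_ideal I;
  affine_vanishing : forall x, U x ->
    prime_ideal (vanishing (U := U) x) /\ I `<=` vanishing x;
  affine_prime : forall p : set (sec U), prime_ideal p -> I `<=` p ->
    exists! x, U x /\ p = vanishing x;
  affine_basis : forall W x, open W -> W x -> U x ->
    exists a : sec U, unit_at a x /\ basic_open a `<=` W;
  affine_sections : forall a : sec U,
    let r := res affine_open (basic_open_open a) (@basic_open_sub X U a) in
    let J := ideal_span (r @` I) in
    [/\ adically_complete J,
        adic_topology J &
        forall n,
          [/\ exists b, ideal_pow J n (r a * b - 1),
              forall b, exists k c, ideal_pow J n (r a ^+ k * b - r c) &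
              forall c, ideal_pow J n (r c) ->
                exists k, ideal_pow I n (a ^+ k * c)]] }.

Record formalScheme := FormalScheme {
  fs_space :> ringedSpace;
  fs_local : locally_ringed fs_space;
  fs_affine : forall x : fs_space, exists (U : set fs_space) (I : set (sec U)),
    U x /\ affine I }.

(* An affine scheme is Spf of a discrete ring. *)
Definition affine_scheme (X : formalScheme) : Prop :=
  affine [set 0 : sec [set: X]].

Definition field_spectrum (X : formalScheme) : Prop :=
  affine_scheme X /\ field_ring (sec [set: X]).

Definition locally_noetherian (X : formalScheme) : Prop :=
  forall x : X, exists (U : set X) (I : set (sec U)),
    [/\ U x, affine I & noetherian_ring (sec U)].

Definition noetherian (X : formalScheme) : Prop :=
  locally_noetherian X /\ compact [set: X].

Definition is_pullback (X Y Z P : formalScheme) (f : mor X Z) (g : mor Y Z)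
    (p : mor P X) (q : mor P Y) : Prop :=
  f \oM p = g \oM q /\
  forall (T : formalScheme) (a : mor T X) (b : mor T Y), f \oM a = g \oM b ->
    exists! m : mor T P, p \oM m = a /\ q \oM m = b.

Definition homeomorphism (X Y : ringedSpace) (f : mor X Y) : Prop :=
  bijective f /\ forall U : set X, open U -> open (f @` U).

Definition open_immersion (X Y : ringedSpace) (f : mor X Y) : Prop :=
  [/\ injective f,
      forall U : set X, open U -> open (f @` U) &
      forall (V : set Y) (oV : open V), V `<=` range f ->
        bijective (comap f oV) /\
        forall W : set (sec V), open W -> open (comap f oV @` W)].

(* Over V = Spf A, f is Spf (A / a) -> Spf A, where A / a has the I-adic
   topology; f @^-1` V may be empty, and A / a zero. *)
Definition closed_immersion_over (X Y : ringedSpace) (f : mor X Y) (V : set Y)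
    (oV : open V) (I : set (sec V)) : Prop :=
  [/\ affine I, affine (ideal_span (comap f oV @` I)) &
      forall b, exists a, comap f oV a = b].

Definition closed_immersion (X Y : ringedSpace) (f : mor X Y) : Prop :=
  forall y : Y, exists (V : set Y) (oV : open V) (I : set (sec V)),
    V y /\ closed_immersion_over f oV I.

Definition immersion (X Y : formalScheme) (f : mor X Y) : Prop :=
  exists (U : formalScheme) (j : mor U Y) (i : mor X U),
    [/\ open_immersion j, closed_immersion i & f = j \oM i].

Definition thickening (X Y : ringedSpace) (f : mor X Y) : Prop :=
  closed_immersion f /\ homeomorphism f.

Definition local_complete_intersection (X Y : formalScheme) (f : mor X Y) :
    Prop :=
  immersion f /\
  forall x : X, exists (V : set Y) (oV : open V) (I : set (sec V)) m
      (r : 'I_m -> sec V),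
    [/\ V (f x), closed_immersion_over f oV I, regular_sequence r &
        [set a | comap f oV a = 0] = ideal_span (range r)].

(* mpoly needs nonzero rings, so O(V) and O(U) are replaced by isomorphic
   comNzRingTypes A and B. *)
Definition locally_formally_fp (X Y : formalScheme) (f : mor X Y) : Prop :=
  [/\ locally_noetherian X, locally_noetherian Y &
  forall x : X, exists (U : set X) (V : set Y) (oU : open U) (oV : open V)
      (UV : U `<=` f @^-1` V) (J : set (sec U)) (I : set (sec V))
      (A B : comNzRingType) (alpha : {rmorphism A -> sec V})
      (beta : {rmorphism B -> sec U}) (g : {rmorphism A -> B}),
    [/\ U x, affine J /\ affine I,
        bijective alpha /\ bijective beta,
        forall a, beta (g a) = comap_to oU oV UV (alpha a) &
        g @` (alpha @^-1` I) `<=` beta @^-1` J /\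
        finitely_presented_mod g (alpha @^-1` I) (beta @^-1` J)]].

Definition quasi_compact (X Y : ringedSpace) (f : mor X Y) : Prop :=
  forall V : set Y, open V -> compact V -> compact (f @^-1` V).

Definition quasi_separated (X Y : formalScheme) (f : mor X Y) : Prop :=
  exists (P : formalScheme) (p q : mor P X) (diag : mor X P),
    [/\ is_pullback f f p q, p \oM diag = idm X, q \oM diag = idm X &
        quasi_compact diag].

Definition formally_fp (X Y : formalScheme) (f : mor X Y) : Prop :=
  [/\ locally_formally_fp f, quasi_compact f & quasi_separated f].

Definition formally_smooth (X Y : formalScheme) (f : mor X Y) : Prop :=
  forall (T0 T : formalScheme) (i : mor T0 T) (a : mor T0 X) (b : mor T Y),
    affine_scheme T -> closed_immersion i -> nilpotent_ideal (global_kernel i) ->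
    f \oM a = b \oM i ->
    exists c : mor T X, c \oM i = a /\ f \oM c = b.

(* k : P -> X is Spec kappa(x) -> X: P is the spectrum of a field, with image x,
   and the stalk at x surjects onto that field. *)
Definition residue_point (X P : formalScheme) (x : X) (k : mor P X) : Prop :=
  [/\ field_spectrum P, forall p, k p = x &
      forall c : sec [set: P], exists (U : set X) (oU : open U) (s : sec U),
        U x /\ comap k oU s = res openT (mor_open k oU) (@subsetT _ _) c].

(* Xh = Spf of the completion of A at the maximal ideal of x, for some open
   neighbourhood Spf A of x.  *)
Definition completion_at (X Xh : formalScheme) (x : X) (h : mor Xh X) : Prop :=
  exists (U : set X) (oU : open U) (I : set (sec U)),
    [/\ U x, affine I, h @^-1` U = setT,
        affine (@nonunits (sec (h @^-1` U))) &
        forall n,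
          (forall b, exists a, ideal_pow (@nonunits _) n (b - comap h oU a)) /\
          (forall a, ideal_pow (@nonunits _) n (comap h oU a) <->
                     ideal_pow (vanishing x) n a)].

(* c (r, r') is defined for s r = t r', with source s r' and target t r. *)
Record groupoid (S X : formalScheme) (pX : mor X S) := Groupoid {
  arr :> formalScheme;
  src : mor arr X;
  tgt : mor arr X;
  unit_arr : mor X arr;
  inv_arr : mor arr arr;
  arr2 : formalScheme;
  fst_arr : mor arr2 arr;
  snd_arr : mor arr2 arr;
  comp_arr : mor arr2 arr;
  arr_over : pX \oM src = pX \oM tgt;
  arr2_pullback : is_pullback src tgt fst_arr snd_arr;
  src_unit : src \oM unit_arr = idm X;
  tgt_unit : tgt \oM unit_arr = idm X;
  src_inv : src \oM inv_arr = tgt;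
  tgt_inv : tgt \oM inv_arr = src;
  src_comp : src \oM comp_arr = src \oM snd_arr;
  tgt_comp : tgt \oM comp_arr = tgt \oM fst_arr;
  comp_unitl : forall m : mor arr arr2,
    fst_arr \oM m = unit_arr \oM tgt -> snd_arr \oM m = idm arr ->
    comp_arr \oM m = idm arr;
  comp_unitr : forall m : mor arr arr2,
    fst_arr \oM m = idm arr -> snd_arr \oM m = unit_arr \oM src ->
    comp_arr \oM m = idm arr;
  comp_invr : forall m : mor arr arr2,
    fst_arr \oM m = idm arr -> snd_arr \oM m = inv_arr ->
    comp_arr \oM m = unit_arr \oM tgt;
  comp_invl : forall m : mor arr arr2,
    fst_arr \oM m = inv_arr -> snd_arr \oM m = idm arr ->
    comp_arr \oM m = unit_arr \oM src;
  (* With T-points ab = (a, b), bc = (b, c), ab_c = (ab, c), a_bc = (a, bc). *)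
  comp_assoc : forall (T : formalScheme) (ab bc ab_c a_bc : mor T arr2),
    snd_arr \oM ab = fst_arr \oM bc ->
    fst_arr \oM ab_c = comp_arr \oM ab -> snd_arr \oM ab_c = snd_arr \oM bc ->
    fst_arr \oM a_bc = fst_arr \oM ab -> snd_arr \oM a_bc = comp_arr \oM bc ->
    comp_arr \oM ab_c = comp_arr \oM a_bc }.

Definition infinitesimal (S X : formalScheme) (pX : mor X S) (R : groupoid pX) :
    Prop := thickening (unit_arr R).

(* RZ = R x_{X x_S X} (Z x_S Z), with projections r to R and s', t' to the two
   factors Z (the source and target of the restricted groupoid).  Its T-points
   are the triples (r, z, z') with s r = iota z and t r = iota z'; that z and z'
   agree over S is then automatic, as s and t are morphisms over S. *)
Definition is_restriction (R X Z RZ : formalScheme) (s t : mor R X)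
    (iota : mor Z X) (r : mor RZ R) (s' t' : mor RZ Z) : Prop :=
  [/\ s \oM r = iota \oM s', t \oM r = iota \oM t' &
  forall (T : formalScheme) (a : mor T R) (z z' : mor T Z),
    s \oM a = iota \oM z -> t \oM a = iota \oM z' ->
    exists! m : mor T RZ, [/\ r \oM m = a, s' \oM m = z & t' \oM m = z']].

(* The natural maps from RZ to R x_{(s, iota)} Z and Z x_{(iota, t)} R are
   isomorphisms, that is, RZ is itself such a fibre product. *)
Definition groupoid_invariant (R X Z : formalScheme) (s t : mor R X)
    (iota : mor Z X) : Prop :=
  exists (RZ : formalScheme) (r : mor RZ R) (s' t' : mor RZ Z),
    [/\ is_restriction s t iota r s' t', is_pullback s iota r s' &
        is_pullback iota t t' r].

Definition nonempty_scheme (X : formalScheme) : Prop := exists x : X, True.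

(* l is minimal among the nonempty invariant formal subschemes of X. *)
Definition is_leaf (R X L : formalScheme) (s t : mor R X) (l : mor L X) : Prop :=
  [/\ immersion l, nonempty_scheme L, groupoid_invariant s t l &
  forall (Z : formalScheme) (zeta : mor Z X) (m : mor Z L),
    immersion zeta -> nonempty_scheme Z -> groupoid_invariant s t zeta ->
    l \oM m = zeta -> is_iso m].

(* h : Xh -> X is the completion at x, and l : L -> Xh the leaf. *)
Definition leaf_transversal (X Xh L V : formalScheme) (x : X) (h : mor Xh X)
    (l : mor L Xh) (v : mor V X) : Prop :=
  immersion v /\
  exists y : V, v y = x /\
  exists (Vh : formalScheme) (hv : mor Vh V) (j : mor Vh Xh),
    [/\ completion_at y hv, h \oM j = v \oM hv, closed_immersion j,
        tor_is_cyclic (global_kernel j) (global_kernel l) 0%N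
          (@nonunits (sec [set: Xh])) &
        tor_is_cyclic (global_kernel j) (global_kernel l) 1%N setT].

(* V -> [X/R] is representable and has the property Q, where V -> [X/R] is
   induced by v : V -> X: its base change s : N = V x_{(v,t)} R -> X along the
   presentation X -> [X/R] is a morphism of formal schemes with property Q. *)
Definition to_quotient_has (R X V : formalScheme) (s t : mor R X) (v : mor V X)
    (Q : forall N : formalScheme, mor N X -> Prop) : Prop :=
  exists (N : formalScheme) (n1 : mor N V) (n2 : mor N R),
    is_pullback v t n1 n2 /\ Q N (s \oM n2).

(* rho is the 2-morphism making u a morphism over [X/R]. *)
Definition over_quotient (R X V : formalScheme) (s t : mor R X) (v : mor V X)
    (u : mor X V) : Prop :=
  exists rho : mor X R, s \oM rho = idm X /\ t \oM rho = v \oM u.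

Definition smooth_retraction (R X V : formalScheme) (s t : mor R X)
    (v : mor V X) (u : mor X V) : Prop :=
  [/\ formally_smooth u, formally_fp u, over_quotient s t v u &
      u \oM v = idm V].

(* Main.v *)
(* Near x the arrows of R with a fixed source form, by smoothness of the source map and of the
   stabiliser, a formal affine space with coordinates w_1, ..., w_n, of which the first m can be
   chosen as w_i(r) = f_i(t r) - f_i(s r), where the f_i generate the ideal of V near x, while
   w_1 = ... = w_m = 0 on arrows out of x cuts out the stabiliser.  Indeed transversality makes the
   f_i coordinates of the leaf L, which is the orbit of x, and the vanishing of Tor_1 leaves no
   further generators of the ideal of V.  Arrows ending in V are then given by their target and w,
   so V x_X R is a formal affine space over V; infinitesimal arrows on which only w_i varies
   differentiate f_i and no other f_k, which makes f_1, ..., f_m regular.  If X is a single point,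
   the arrow out of a with w = (-f(a), 0) ends in V; this defines u and identifies X with the formal
   affine m-space over V by (u, f).  The latter persists for every retraction u over [X/R], since two
   such identifications differ by an endomorphism that fixes the f_i and is the identity modulo
   them.  Over a field, L is the formal affine m-space with coordinates f. *)
From HB Require Import structures.
From mathcomp Require Import all_boot all_algebra.
From mathcomp Require Import boolp classical_sets functions cardinality.
From mathcomp Require Import topology tvs.
From mathcomp Require Import ring zify.
From mathcomp.multinomials Require mpoly.
Import (canonicals, coercions) mpoly.
Require Import Defs.

Set Implicit Arguments.
Unset Strict Implicit.
Unset Printing Implicit Defensive.

Import GRing.Theory.
Local Open Scope classical_set_scope.
Local Open Scope ring_scope.

(** Formal smoothness gives lifts only along nilpotent thickenings of discrete affine schemes. The
    tests used here are the spectra of [O(W) / Q], where [Q] contains a power of the maximal ideal M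
    of a closed point, so every conclusion first holds modulo [M^k]; Artin-Rees and Nakayama then
    spread it to a neighbourhood. Hence the work on noetherian rings, power series rings and
    completed localisations included. The affine space arises as follows. A basis w of the conormal
    space of the unit section at x embeds the arrows near e(x) into formal n-space over X, with
    ideal H inside [M^2]. The subscheme cut out by [H + M^k] maps to R; smoothness extends this map
    to the one cut out by [M^k]. The resulting endomorphism kills H and is the identity modulo
    [H + M^k], hence on [M^2] the identity modulo [M H + M^k]. So H = M H, and H vanishes near the
    point. The same comparison, with the stabiliser in place of R, shows that w_1, ..., w_m cut out
    the stabiliser. From there on everything is done with T-points: an arrow is its source, or its
    target, together with the values of w, and every fibre product that occurs is a formal affine
    space. *)

(** * Ideals, their powers and finite generation *)

Section Ideals.
Variable A : comPzRingType.
Implicit Types (I J K G : set A) (a b c x y : A).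

Lemma ideal0 I : is_ideal I -> I 0. Proof. by case. Qed.
Lemma idealD I x y : is_ideal I -> I x -> I y -> I (x + y).
Proof. by case=> _ h _; exact: h. Qed.
Lemma idealM I c x : is_ideal I -> I x -> I (c * x).
Proof. by case=> _ _ h; exact: h. Qed.
Lemma idealMr I c x : is_ideal I -> I x -> I (x * c).
Proof. by rewrite mulrC; exact: idealM. Qed.
Lemma idealN I x : is_ideal I -> I x -> I (- x).
Proof. by move=> iI Ix; rewrite -mulN1r; exact: idealM. Qed.
Lemma idealB I x y : is_ideal I -> I x -> I y -> I (x - y).
Proof. by move=> iI Ix Iy; apply: idealD => //; exact: idealN. Qed.
Lemma ideal_sum I (T : Type) (r : seq T) (P : pred T) (F : T -> A) :
  is_ideal I -> (forall i, P i -> I (F i)) -> I (\sum_(i <- r | P i) F i).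
Proof.
by move=> iI IF; elim/big_ind : _ => //;
  [exact: ideal0|move=> x y; exact: idealD].
Qed.

Lemma ideal_1 I : is_ideal I -> I 1 -> forall x, I x.
Proof. by move=> iI I1 x; rewrite -[x]mulr1; exact: idealM. Qed.

Lemma span_min I G : is_ideal I -> G `<=` I -> ideal_span G `<=` I.
Proof.
move=> iI GI a [n [c [g [Gg ->]]]]; apply: ideal_sum => // i _.
by apply: idealM => //; exact: GI.
Qed.

Lemma subspan G : G `<=` ideal_span G.
Proof.
move=> a Ga; exists 1%N, (fun=> 1), (fun=> a); split=> //.
by rewrite big_ord1 mul1r.
Qed.

Lemma span_ideal G : is_ideal (ideal_span G).
Proof.
split.
- by exists 0%N, (fun=> 0), (fun=> 0); split; [case|rewrite big_ord0].
- move=> a b [n [c [g [Gg ->]]]] [m [d [h [Gh ->]]]].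
  exists (n + m)%N, (fun i : 'I_(n + m) => match fintype.split i with inl j => c j | inr j => d j end),
    (fun i : 'I_(n + m) => match fintype.split i with inl j => g j | inr j => h j end).
  split; first by move=> i; case: (fintype.split i).
  by rewrite big_split_ord /=; congr (_ + _); apply: eq_bigr => i _;
    rewrite -?[lshift _ _]/(unsplit (inl _)) -?[rshift _ _]/(unsplit (inr _)) unsplitK.
- move=> e a [n [c [g [Gg ->]]]]; exists n, (fun i => e * c i), g; split=> //.
  by rewrite mulr_sumr; apply: eq_bigr => i _; rewrite mulrA.
Qed.
Hint Resolve span_ideal : core.

Lemma span_mono G (H : set A) : G `<=` H -> ideal_span G `<=` ideal_span H.
Proof. by move=> GH; apply: span_min => // x /GH; exact: subspan. Qed.

Lemma spanE I : is_ideal I -> ideal_span I = I.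
Proof. by move=> iI; apply/seteqP; split; [exact: span_min|exact: subspan]. Qed.

Lemma mulid_ideal I J : is_ideal (ideal_mul I J). Proof. exact: span_ideal. Qed.

Lemma mulid_min K I J : is_ideal K -> (forall x y, I x -> J y -> K (x * y)) ->
  ideal_mul I J `<=` K.
Proof. by move=> iK h; apply: span_min => // _ [x [y [Ix Jy ->]]]; exact: h. Qed.

Lemma mulidI I J x y : I x -> J y -> ideal_mul I J (x * y).
Proof. by move=> Ix Jy; apply: subspan; exists x, y. Qed.

Lemma setT_ideal : is_ideal [set: A]. Proof. by []. Qed.

Lemma set0_ideal : is_ideal [set 0 : A].
Proof.
split=> // [a b|c a] /=; first by move=> -> ->; rewrite addr0.
by move=> ->; rewrite mulr0.
Qed.

Lemma pow_ideal I n : is_ideal (ideal_pow I n).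
Proof. by case: n => [|n]; [exact: setT_ideal|exact: mulid_ideal]. Qed.
Hint Resolve pow_ideal mulid_ideal setT_ideal set0_ideal : core.

Lemma powS I n : ideal_pow I n.+1 = ideal_mul I (ideal_pow I n).
Proof. by []. Qed.

Lemma pow_sub I n : ideal_pow I n.+1 `<=` ideal_pow I n.
Proof. by rewrite powS; apply: mulid_min => // x y _; exact: idealM. Qed.

Lemma pow_le I m n : (m <= n)%N -> ideal_pow I n `<=` ideal_pow I m.
Proof.
move=> /subnK <-; elim: (n - m)%N => [|k IH] //.
by rewrite addSn; apply: subset_trans IH; exact: pow_sub.
Qed.

Lemma powD I m n x y : ideal_pow I m x -> ideal_pow I n y ->
  ideal_pow I (m + n) (x * y).
Proof.
elim: m x => [|m IH] x; first by move=> _; exact: idealM.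
rewrite addSn !powS => mx ny.
have : [set z | ideal_pow I (m + n).+1 (z * y)] x.
  move: x mx; apply: mulid_min.
    split=> [|a b|c a] /=; first by rewrite mul0r; exact: ideal0.
      by rewrite mulrDl; exact: idealD.
    by rewrite -mulrA; exact: idealM.
  by move=> u v Iu Iv /=; rewrite -mulrA; apply: mulidI => //; exact: IH.
by [].
Qed.

Lemma pow1 I : is_ideal I -> ideal_pow I 1 = I.
Proof.
move=> iI; apply/seteqP; split; first by apply: mulid_min => // x y; rewrite mulrC => ? _; exact: idealM.
by move=> x Ix; rewrite -[x]mulr1; exact: mulidI.
Qed.

Lemma pow1_sub I : is_ideal I -> ideal_pow I 1 `<=` I.
Proof. by move=> /pow1 ->. Qed.

Lemma sub_pow1 I : I `<=` ideal_pow I 1.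
Proof. by move=> x Ix; rewrite -[x]mulr1; exact: mulidI. Qed.

Lemma pow_mono I J n : I `<=` J -> ideal_pow I n `<=` ideal_pow J n.
Proof.
move=> IJ; elim: n => // n IH; rewrite !powS; apply: mulid_min => // x y Ix Iy.
by apply: mulidI; [exact: IJ|exact: IH].
Qed.

Lemma powX I n x : I x -> ideal_pow I n (x ^+ n).
Proof.
move=> Ix; elim: n => // n IH.
by rewrite exprS; exact: mulidI.
Qed.

Lemma pow_subI I n : is_ideal I -> (0 < n)%N -> ideal_pow I n `<=` I.
Proof. by move=> iI n0 x /(pow_le n0); rewrite pow1. Qed.

Lemma primeX I x n : prime_ideal I -> I (x ^+ n) -> I x.
Proof.
move=> [iI n1 pI]; elim: n => [|n IH]; first by rewrite expr0.
by rewrite exprS => /pI [|/IH].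
Qed.

Definition ideal_add I J := [set x | exists a b, [/\ I a, J b & x = a + b]].

Lemma addid_ideal I J : is_ideal I -> is_ideal J -> is_ideal (ideal_add I J).
Proof.
move=> iI iJ; split.
- by exists 0, 0; split; [exact: ideal0|exact: ideal0|rewrite addr0].
- move=> _ _ [a [b [Ia Jb ->]]] [c [d [Ic Jd ->]]].
  by exists (a + c), (b + d); split; [exact: idealD|exact: idealD|ring].
- move=> e _ [a [b [Ia Jb ->]]]; exists (e * a), (e * b).
  by split; [exact: idealM|exact: idealM|ring].
Qed.

Lemma addidl I J x : is_ideal J -> I x -> ideal_add I J x.
Proof. by move=> iJ Ix; exists x, 0; split=> //; [exact: ideal0|rewrite addr0]. Qed.
Lemma addidr I J x : is_ideal I -> J x -> ideal_add I J x.
Proof. by move=> iI Jx; exists 0, x; split=> //; [exact: ideal0|rewrite add0r]. Qed.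
Lemma addid_min I J K : is_ideal K -> I `<=` K -> J `<=` K -> ideal_add I J `<=` K.
Proof. by move=> iK IK JK _ [a [b [/IK ? /JK ? ->]]]; exact: idealD. Qed.

Lemma pow_addid I J m n : is_ideal I -> is_ideal J ->
  ideal_pow (ideal_add I J) (m + n) `<=`
  ideal_add (ideal_pow I m) (ideal_pow J n).
Proof.
move=> iI iJ; elim: m n => [|m IHm] n.
  by move=> x _; apply: addidl.
elim: n => [|n IHn]; first by move=> x _; apply: addidr.
rewrite addSn powS; apply: mulid_min; first exact: addid_ideal.
move=> _ y [a [b [Ia Jb ->]]] hy; rewrite mulrDl.
apply: idealD; first exact: addid_ideal.
  have [u [v [mu nv ->]]] := IHm n.+1 y hy; rewrite mulrDr.
  exists (a * u), (a * v); split=> //; first exact: mulidI.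
  by apply: idealM.
have [|u [v [mu nv ->]]] := IHn y; first by rewrite addSnnS.
rewrite mulrDr; exists (b * u), (b * v); split=> //; first by apply: idealM.
exact: mulidI.
Qed.

(** Generators form a sequence rather than a family over an ordinal, so that arguments can proceed
    by induction on the generators. *)
Definition spans (s : seq A) : set A := ideal_span [set x | x \in s].

Lemma spans_ideal s : is_ideal (spans s). Proof. exact: span_ideal. Qed.
Hint Resolve spans_ideal : core.

Lemma spans_nil : spans [::] = [set 0].
Proof.
apply/seteqP; split=> [|_ ->]; last exact: ideal0.
by apply: span_min => // x.
Qed.

Lemma spans_min s I : is_ideal I -> (forall x, x \in s -> I x) -> spans s `<=` I.
Proof. by move=> iI h; apply: span_min. Qed.

Lemma mem_spans s x : x \in s -> spans s x. Proof. by move=> xs; exact: subspan. Qed.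

Lemma spans_cons x s :
  spans (x :: s) = ideal_add [set y | exists c, y = c * x] (spans s).
Proof.
have px : is_ideal [set y | exists c, y = c * x].
  split=> [|_ _ [a ->] [b ->]|c _ [a ->]]; first by exists 0; rewrite mul0r.
    by exists (a + b); rewrite mulrDl.
  by exists (c * a); rewrite mulrA.
apply/seteqP; split.
  apply: spans_min; first exact: addid_ideal.
  move=> y; rewrite inE => /orP[/eqP ->|ys].
    by apply: addidl => //; exists 1; rewrite mul1r.
  by apply: addidr => //; exact: mem_spans.
apply: addid_min => //.
  by move=> _ [c ->]; apply: idealM => //; apply: mem_spans; rewrite inE eqxx.
by apply: span_mono => y /= ys; rewrite inE ys orbT.
Qed.

Lemma princ_ideal x : is_ideal [set y | exists c, y = c * x].
Proof.
split=> [|_ _ [a ->] [b ->]|c _ [a ->]]; first by exists 0; rewrite mul0r.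
  by exists (a + b); rewrite mulrDl.
by exists (c * a); rewrite mulrA.
Qed.

Lemma fgP I : fg_ideal I <-> exists s, I = spans s.
Proof.
split=> [[n [g ->]]|[s ->]].
  exists [seq g i | i <- enum 'I_n]; congr ideal_span; apply/seteqP; split.
    by move=> _ [i _ <-]; apply/mapP; exists i => //; rewrite mem_enum.
  by move=> x /mapP [i _ ->]; exists i.
exists (size s), (fun i => s`_i); congr ideal_span; apply/seteqP; split.
  by move=> x xs; exists (Ordinal (etrans (index_mem x s) xs)) => //=; rewrite nth_index.
by move=> _ [i _ <-]; exact: mem_nth.
Qed.

Lemma fg_is_ideal I : fg_ideal I -> is_ideal I.
Proof. by move=> /fgP [s ->]. Qed.

(* pigeonhole *)
Lemma pow_spans_nil s J : is_ideal J ->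
  (forall x, x \in s -> exists k, J (x ^+ k)) ->
  exists N, ideal_pow (spans s) N `<=` J.
Proof.
move=> iJ; elim: s => [|x s IH] h.
  exists 1%N; rewrite pow1 // spans_nil => _ ->; exact: ideal0.
have [N hN] : exists N, ideal_pow (spans s) N `<=` J.
  by apply: IH => y ys; apply: h; rewrite inE ys orbT.
have [k hk] : exists k, J (x ^+ k) by apply: h; rewrite inE eqxx.
exists (k + N)%N; rewrite spans_cons.
apply: subset_trans (@pow_addid _ _ k N (princ_ideal x) (spans_ideal s)) _.
apply: addid_min => //.
suff /subset_trans : ideal_pow [set y | exists c, y = c * x] k `<=`
   [set y | exists c, y = c * x ^+ k].
  by apply=> _ [c ->]; exact: idealM.
elim: k {hk} => [|k IH']; first by move=> y _; exists y; rewrite expr0 mulr1.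
rewrite powS; apply: mulid_min; first exact: princ_ideal.
move=> _ y [c ->] /IH' [d ->]; exists (c * d); rewrite exprS; ring.
Qed.

(** Passes from nilpotence of single elements modulo [J] to nilpotence of the whole ideal; this is
    how ideals of definition get compared. *)
Lemma fg_pow_nil I J : fg_ideal I -> is_ideal J ->
  (forall x, I x -> exists k, J (x ^+ k)) -> exists N, ideal_pow I N `<=` J.
Proof.
move=> /fgP [s ->] iJ h; apply: pow_spans_nil => // x xs.
by apply: h; exact: mem_spans.
Qed.

Lemma unitM a b : is_unit a -> is_unit b -> is_unit (a * b).
Proof. by move=> [c ac] [d bd]; exists (c * d); rewrite mulrACA ac bd mulr1. Qed.
Lemma unit1 : is_unit (1 : A). Proof. by exists 1; rewrite mulr1. Qed.
Lemma unitX a n : is_unit a -> is_unit (a ^+ n).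
Proof.
by move=> ua; elim: n => [|n IH]; [exact: unit1|rewrite exprS; exact: unitM].
Qed.
Lemma unitMl a b : is_unit (a * b) -> is_unit a.
Proof. by move=> [c h]; exists (b * c); rewrite mulrA. Qed.
Lemma unitMr a b : is_unit (a * b) -> is_unit b.
Proof. by rewrite mulrC; exact: unitMl. Qed.
Lemma unit_cancel a x : is_unit a -> a * x = 0 -> x = 0.
Proof. by move=> [c ac] ax; rewrite -[x]mul1r -ac mulrAC ax mul0r. Qed.
Lemma unit_inj a x y : is_unit a -> a * x = a * y -> x = y.
Proof.
by move=> ua e; apply/eqP; rewrite -subr_eq0; apply/eqP/(unit_cancel ua);
  rewrite mulrBr e subrr.
Qed.
Lemma unit_ideal I a x : is_ideal I -> is_unit a -> I (a * x) -> I x.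
Proof. by move=> iI [c ac] h; rewrite -[x]mul1r -ac mulrAC; apply: idealMr. Qed.

End Ideals.

#[export] Hint Resolve span_ideal pow_ideal mulid_ideal setT_ideal set0_ideal spans_ideal : core.

Section Image.
Variables (A B : comPzRingType) (f : {rmorphism A -> B}).
Implicit Types (I : set A) (J : set B).

Lemma preim_ideal J : is_ideal J -> is_ideal (f @^-1` J).
Proof.
move=> iJ; split=> [|a b|c a]; rewrite /preimage /=.
- by rewrite rmorph0; exact: ideal0.
- by rewrite rmorphD; exact: idealD.
- by rewrite rmorphM; exact: idealM.
Qed.

Lemma map_pow I n x : ideal_pow I n x -> ideal_pow (ideal_span (f @` I)) n (f x).
Proof.
elim: n x => // n IH; rewrite !powS.
apply: (mulid_min (preim_ideal (mulid_ideal _ _))) => x y Ix Iy.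
rewrite /preimage /= rmorphM; apply: mulidI; last exact: IH.
by apply: subspan; exists x.
Qed.

Lemma span_map_pow I n :
  ideal_pow (ideal_span (f @` I)) n = ideal_span (f @` ideal_pow I n).
Proof.
apply/seteqP; split; last first.
  by apply: span_min => // _ [x Ix <-]; exact: map_pow.
elim: n => [|n IH].
  by move=> x _; apply: ideal_1 => //; apply: subspan; exists 1 => //; rewrite rmorph1.
rewrite powS; apply: mulid_min => // x y Ix /IH Iy.
set K := ideal_span (f @` ideal_pow I n.+1).
have iKK : is_ideal K := span_ideal _.
have iK (z : B) : is_ideal [set t | K (z * t)].
  split=> [|a b|c a] /=; first by rewrite mulr0; exact: ideal0.
    by rewrite mulrDr; exact: idealD.
  by rewrite mulrCA; exact: idealM.
move: x Ix; suff : ideal_span (f @` I) `<=` [set t | K (y * t)].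
  by move=> h x /h; rewrite mulrC.
apply: span_min => // _ [x Ix <-] /=; rewrite mulrC.
move: y Iy; apply: (span_min (iK (f x))) => _ [y Iy <-] /=.
by rewrite -rmorphM; apply: subspan; exists (x * y) => //; exact: mulidI.
Qed.

Lemma spans_map s : ideal_span (f @` spans s) = spans (map f s).
Proof.
apply/seteqP; split.
  apply: span_min => // _ [x sx <-].
  move: x sx; apply: (spans_min (preim_ideal (spans_ideal _))) => x xs.
  by apply: mem_spans; exact: map_f.
apply: spans_min => // _ /mapP [x xs ->]; apply: subspan; exists x => //.
exact: mem_spans.
Qed.

Lemma fg_map I : fg_ideal I -> fg_ideal (ideal_span (f @` I)).
Proof. by move=> /fgP [s ->]; apply/fgP; exists (map f s); exact: spans_map. Qed.

Lemma preim_prime J : prime_ideal J -> prime_ideal (f @^-1` J).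
Proof.
move=> [iJ n1 pJ]; split; [exact: preim_ideal|by rewrite /preimage /= rmorph1|].
by move=> a b; rewrite /preimage /= rmorphM; exact: pJ.
Qed.

Lemma is_unit_map a : is_unit a -> is_unit (f a).
Proof. by move=> [b ab]; exists (f b); rewrite -rmorphM ab rmorph1. Qed.

Lemma im_ideal I : (forall b, exists a, f a = b) -> is_ideal I -> is_ideal (f @` I).
Proof.
move=> sf iI; split.
- by exists 0; [exact: ideal0|exact: rmorph0].
- move=> _ _ [a Ia <-] [b Ib <-]; exists (a + b); [exact: idealD|exact: rmorphD].
- move=> c _ [a Ia <-]; have [d <-] := sf c.
  by exists (d * a); [exact: idealM|exact: rmorphM].
Qed.

Lemma surj_pow I n y : (forall b, exists a, f a = b) -> is_ideal I ->
  ideal_pow (ideal_span (f @` I)) n y -> exists2 x, ideal_pow I n x & f x = y.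
Proof. by move=> sf iI; rewrite span_map_pow spanE => [[x ? <-]|]; [exists x|exact: im_ideal]. Qed.

Lemma noetherian_surj : (forall b, exists a, f a = b) ->
  noetherian_ring A -> noetherian_ring B.
Proof.
move=> sf nA J iJ; have /fg_map := nA _ (preim_ideal iJ).
suff -> : ideal_span (f @` (f @^-1` J)) = J by [].
apply/seteqP; split; first by apply: span_min => // _ [x Jx <-].
by move=> y Jy; have [x xy] := sf y; apply: subspan; exists x => //; rewrite /preimage /= xy.
Qed.

End Image.

(** * Noetherian rings, Artin-Rees, Nakayama, maximal ideals *)

Section Noetherian.
Variable A : comPzRingType.
Hypothesis nA : noetherian_ring A.

Lemma noetherian_max (F : set (set A)) I0 :
  (forall I, F I -> is_ideal I) -> F I0 ->
  exists2 I, F I & forall J, F J -> I `<=` J -> J = I.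
Proof.
move=> iF F0; pose P := [set I | F I /\ I0 `<=` I] `|` [set set0].
have [F' F'P tot|M [[[FM M0]|M0] Mmax]] := @Zorn_bigcup A P.
- case: (pselect (exists X, F' X /\ X !=set0)) => [[X0 [FX0 X0n]]|none]; last first.
    right; apply/seteqP; split=> // x [X FX Xx].
    by apply: none; exists X; split=> //; exists x.
  left; pose U := \bigcup_(X in F') X.
  have nz X : F' X -> X !=set0 -> F X /\ I0 `<=` X.
    by move=> /F'P [[]//|->] [].
  have iU : is_ideal U.
    split.
    - exists X0 => //; have [/iF iX _] := nz _ FX0 X0n; exact: ideal0.
    - move=> a b [X FX Xa] [Y FY Yb].
      have [XY|YX] := tot _ _ FX FY.
        exists Y => //; have [/iF iY _] : F Y /\ I0 `<=` Y by apply: nz => //; exists b.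
        by apply: idealD => //; exact: XY.
      exists X => //; have [/iF iX _] : F X /\ I0 `<=` X by apply: nz => //; exists a.
      by apply: idealD => //; exact: YX.
    - move=> c a [X FX Xa]; exists X => //.
      have [/iF iX _] : F X /\ I0 `<=` X by apply: nz => //; exists a.
      exact: idealM.
  (* By totality the finitely many generators of the union lie in one member of the chain, which is
     therefore the union. *)
  have [s Us] := (fgP _).1 (nA iU).
  have [X [FX X0X sX]] : exists X, [/\ F' X, X !=set0 & forall x, x \in s -> X x].
    have : forall x, x \in s -> U x by move=> x xs; rewrite Us; exact: mem_spans.
    elim: s {Us} => [_|y s IH h]; first by exists X0.
    have [|X [FX Xn sX]] := IH; first by move=> x xs; apply: h; rewrite inE xs orbT.
    have [Y FY Yy] := h y (mem_head _ _).
    have [XY|YX] := tot _ _ FX FY.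
      exists Y; split=> //; first by exists y.
      by move=> x; rewrite inE => /orP [/eqP ->|/sX /XY].
    exists X; split=> // x; rewrite inE => /orP [/eqP ->|/sX] //; exact: YX.
  have [FX' I0X] := nz _ FX X0X.
  suff UX : U = X by rewrite -/U UX.
  apply/seteqP; split; last by move=> x Xx; exists X.
  by rewrite Us; apply: spans_min => //; exact: iF.
- exists M => // J FJ MJ; apply: contrapT => JM.
  apply: (Mmax J); first by split=> // JM'; apply: JM; apply/seteqP; split.
  by left; split=> //; exact: subset_trans MJ.
- exfalso; apply: (Mmax I0); rewrite ?M0; last by left; split.
  split=> // /(_ 0); apply; apply: ideal0; exact: iF.
Qed.

Lemma noetherian_chain (I : nat -> set A) : (forall n, is_ideal (I n)) ->
  (forall n, I n `<=` I n.+1) -> exists N, forall n, (N <= n)%N -> I n = I N.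
Proof.
move=> iI inc; have [|//|_ [N _ <-] Nmax] := @noetherian_max (range I) (I 0%N).
- by move=> _ [n _ <-].
exists N => n Nn; apply: Nmax; first by exists n.
move: Nn => /subnK <-; elim: (n - N)%N => // k IH.
by rewrite addSn; apply: subset_trans (inc _).
Qed.

(* Artin-Rees, weak form: enlarge J Q to an ideal H maximal with
   H `&` Q = J Q; powers of elements of J lie in H. *)
Lemma artin_rees (J Q : set A) : is_ideal J -> is_ideal Q ->
  exists n, ideal_pow J n `&` Q `<=` ideal_mul J Q.
Proof.
move=> iJ iQ.
have [||H [iH JH HQ] Hmax] := @noetherian_max
   [set H | [/\ is_ideal H, ideal_mul J Q `<=` H & H `&` Q `<=` ideal_mul J Q]]
   (ideal_mul J Q); [by move=> ? []|by split=> // x []|].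
have [n hn] : exists n, ideal_pow J n `<=` H.
  apply: fg_pow_nil => // [|a Ja]; first exact: nA.
  (* The colon ideals (H : a^k) become stationary at some [N]; then adding [a ^+ N] to [H] does not
     enlarge the intersection with [Q], and maximality puts [a ^+ N] into [H]. *)
  have [|n|N hN] := @noetherian_chain (fun k => [set b | H (a ^+ k * b)]).
  - move=> k; split=> [|b c|c b] /=; first by rewrite mulr0; exact: ideal0.
      by rewrite mulrDr; exact: idealD.
    by rewrite mulrCA; exact: idealM.
  - by move=> b /= Hb; rewrite exprS -mulrA; exact: idealM.
  exists N; pose H' := ideal_add H [set y | exists c, y = c * a ^+ N].
  have iP := princ_ideal (a ^+ N).
  suff HH : H' = H.
    by rewrite -HH; apply: addidr => //; exists 1; rewrite mul1r.
  apply: Hmax; last by move=> x; apply: addidl.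
  split; [exact: addid_ideal|by move=> x /JH Hx; apply: addidl|].
  move=> _ [[h [_ [Hh [b ->] ->]]] Qx]; apply: HQ; split=> //.
  apply: idealD => //; rewrite mulrC.
  have /seteqP [+ _] := hN N.+1 (leqnSn N); apply => /=.
  have -> : a ^+ N.+1 * b = a * (h + b * a ^+ N) - a * h by rewrite exprS; ring.
  apply: idealB => //; last exact: idealM.
  by apply: JH; exact: mulidI.
by exists n => x [/hn Hx Qx]; apply: HQ.
Qed.

End Noetherian.

(* Nakayama, by eliminating the generators of Q one at a time. *)
Lemma nakayama (A : comPzRingType) (J Q Q0 : set A) : is_ideal J -> is_ideal Q0 ->
  fg_ideal Q -> Q `<=` ideal_add Q0 (ideal_mul J Q) ->
  exists2 a, J (1 - a) & forall x, Q x -> Q0 (a * x).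
Proof.
move=> iJ iQ0 /fgP [s ->] hQ.
suff [a Ja ha] : exists2 a, J (1 - a) & forall x, x \in s -> Q0 (a * x).
  exists a => // x; move: x; apply: spans_min => //.
  by split=> [|x y|c x] /=; rewrite ?mulr0 ?mulrDr;
    [exact: ideal0|exact: idealD|rewrite mulrCA; exact: idealM].
have : forall x, x \in s -> ideal_add Q0 (ideal_mul J (spans s)) x.
  by move=> x /mem_spans /hQ.
elim: s Q0 iQ0 {hQ} => [|x t IH] Q1 iQ1 h.
  by exists 1 => //; rewrite subrr; exact: ideal0.
pose Px := [set y | exists c, y = c * x].
have iPx : is_ideal Px := princ_ideal x.
have [y yt|a Ja ha] := IH (ideal_add Q1 Px) (addid_ideal iQ1 iPx).
  have iK := addid_ideal (addid_ideal iQ1 iPx) (mulid_ideal J (spans t)).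
  have : y \in x :: t by rewrite inE yt orbT.
  move=> /h; apply: addid_min => //.
    by move=> z Q1z; apply: addidl => //; exact: addidl.
  apply: mulid_min => // j z Jj; rewrite spans_cons => -[_ [u [[c ->] tu ->]]].
  rewrite mulrDr; apply: idealD => //.
    by apply: addidl => //; apply: addidr => //; exists (j * c); rewrite mulrA.
  by apply: addidr; [exact: addid_ideal|exact: mulidI].
have [j Jj hj] : exists2 j, J j & Q1 (a * x - j * x).
  have : [set z | exists2 j, J j & Q1 (a * z - j * x)] x.
    have iK : is_ideal [set z | exists2 j, J j & Q1 (a * z - j * x)].
      split=> [|u v [j Jj hj] [k Jk hk]|c u [j Jj hj]].
      - by exists 0; [exact: ideal0|rewrite mulr0 mul0r subrr; exact: ideal0].
      - exists (j + k); first exact: idealD.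
        have -> : a * (u + v) - (j + k) * x = (a * u - j * x) + (a * v - k * x) by ring.
        exact: idealD.
      - exists (c * j); first exact: idealM.
        have -> : a * (c * u) - c * j * x = c * (a * u - j * x) by ring.
        exact: idealM.
    move: (h x (mem_head _ _)); apply: addid_min => //.
      by move=> z Q1z; exists 0; [exact: ideal0|rewrite mul0r subr0; exact: idealM].
    apply: mulid_min => // j z Jj; rewrite spans_cons => -[_ [u [[c ->] tu ->]]].
    rewrite mulrDr; apply: idealD => //.
      exists (a * (j * c)); first by apply: idealM => //; exact: idealMr.
      by rewrite !mulrA subrr; exact: ideal0.
    suff : ideal_add Q1 Px (a * u).
      move=> [q [_ [Q1q [d ->] e]]]; exists (j * d); first exact: idealMr.
      by rewrite mulrCA e mulrDr !mulrA addrK; exact: idealM.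
    move: u tu; apply: spans_min ha.
    have iS := addid_ideal iQ1 iPx.
    by split=> [|u v|e u] /=; rewrite ?mulr0 ?mulrDr;
      [exact: ideal0|exact: idealD|rewrite mulrCA; exact: idealM].
  by [].
(* [a] sends the other generators into [Q1] plus multiples of [x], and [a - j] sends [x] into
   [Q1]. *)
exists ((a - j) * a).
  have -> : 1 - (a - j) * a = (1 - a) * (1 + a) + j * a by ring.
  by apply: idealD => //; exact: idealMr.
move=> y; rewrite inE => /orP [/eqP ->|/ha [q [_ [Q1q [c ->] e]]]].
  by rewrite mulrAC mulrBl; exact: idealMr.
rewrite -mulrA e mulrDr; apply: idealD => //; first exact: idealM.
have -> : (a - j) * (c * x) = c * (a * x - j * x) by ring.
exact: idealM.
Qed.

Lemma maximal_ideal (A : comPzRingType) (I : set A) : is_ideal I -> ~ I 1 ->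
  exists2 M, I `<=` M & prime_ideal M /\ forall a, ~ M a -> exists b, M (1 - a * b).
Proof.
move=> iI n1; pose P := [set M | [/\ is_ideal M, I `<=` M & ~ M 1]] `|` [set set0].
have [F' F'P tot|M [[[iM IM M1]|M0] Mmax]] := @Zorn_bigcup A P.
- case: (pselect (exists X, F' X /\ X !=set0)) => [[X0 [FX0 X0n]]|none]; last first.
    right; apply/seteqP; split=> // x [X FX Xx].
    by apply: none; exists X; split=> //; exists x.
  left; have nz X : F' X -> X !=set0 -> [/\ is_ideal X, I `<=` X & ~ X 1].
    by move=> /F'P [//|->] [].
  have [iX0 IX0 _] := nz _ FX0 X0n.
  split; last by move=> [X FX X1]; have [//|_ _] := nz _ FX; [exists 1|exact].
    split.
    - by exists X0 => //; exact: ideal0.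
    - move=> a b [X FX Xa] [Y FY Yb].
      have [XY|YX] := tot _ _ FX FY.
        exists Y => //; have [|iY _ _] := nz _ FY; first by exists b.
        by apply: idealD => //; exact: XY.
      exists X => //; have [|iX _ _] := nz _ FX; first by exists a.
      by apply: idealD => //; exact: YX.
    - move=> c a [X FX Xa]; exists X => //.
      have [|iX _ _] := nz _ FX; first by exists a.
      exact: idealM.
  by move=> x Ix; exists X0 => //; exact: IX0.
- have hM a : ~ M a -> exists b, M (1 - a * b).
    move=> Ma; pose H := ideal_add M [set y | exists c, y = c * a].
    have iP := princ_ideal a.
    have MH : M `<=` H by move=> x; exact: addidl.
    have Ha : H a by apply: addidr => //; exists 1; rewrite mul1r.
    apply: contrapT => nb; apply: (Mmax H).
      by split=> // HM; apply: Ma; exact: HM.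
    left; split; [exact: addid_ideal|exact: subset_trans MH|].
    move=> [m [_ [Mm [c ->] e]]]; apply: nb; exists c.
    by rewrite e mulrC addrK.
  exists M => //; split=> //; split=> // a b Mab.
  have [Ma|/hM [c hc]] := pselect (M a); [by left|right].
  have -> : b = b * (1 - a * c) + c * (a * b) by ring.
  by apply: idealD => //; exact: idealM.
- exfalso; apply: (Mmax I); rewrite ?M0; last by left; split.
  split=> // /(_ 0); apply; exact: ideal0.
Qed.

(** * Sections of a ringed space: gluing and units *)

Section Sections.
Variable X : ringedSpace.
Implicit Types (U V W : set X).

Lemma resP U V (oU oU' : open U) (oV oV' : open V) (VU VU' : V `<=` U) s :
  res oU oV VU s = res oU' oV' VU' s.
Proof.
by rewrite (Prop_irrelevance oU oU') (Prop_irrelevance oV oV')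
  (Prop_irrelevance VU VU').
Qed.

Lemma sec_sep U (oU : open U) (K : Type) (W : K -> set X)
    (oW : forall k, open (W k)) (WU : forall k, W k `<=` U) (s t : sec U) :
  U `<=` \bigcup_k W k -> (forall k, res oU (oW k) (WU k) s = res oU (oW k) (WU k) t) ->
  s = t.
Proof.
move=> cov h; apply/eqP; rewrite -subr_eq0; apply/eqP.
have oC W' : range W W' -> open W' by move=> [k _ <-].
have CU W' : range W W' -> W' `<=` U by move=> [k _ <-].
apply: (sheaf_separated (oU := oU) (oC := oC) (CU := CU)).
  by move=> x /cov [k _ Wx]; exists (W k) => //; exists k.
move=> W' CW; move: (oC _ CW) (CU _ CW); case: CW => k _ WW'; case: _ / WW' => oW' W'U.
by rewrite rmorphB (resP _ oU _ (oW k) _ (WU k)) h (resP _ oU _ (oW k) _ (WU k)) subrr.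
Qed.

Lemma sec_sep_pt U (oU : open U) (s t : sec U) :
  (forall x, U x -> exists W (oW : open W) (WU : W `<=` U),
     W x /\ res oU oW WU s = res oU oW WU t) -> s = t.
Proof.
move=> h.
pose K := {W | exists (oW : open W) (WU : W `<=` U), res oU oW WU s = res oU oW WU t}.
have oW (k : K) : open (sval k) by case: k => W /= [].
have WU (k : K) : sval k `<=` U by case: k => W /= [? []].
apply: (@sec_sep U oU K sval oW WU).
  by move=> x /h [W [oW' [WU' [Wx e]]]]; exists (exist _ W (ex_intro _ oW' (ex_intro _ WU' e))).
move=> [W [oW' [WU' e]]] /=.
by rewrite (resP _ oU _ oW' _ WU') e; exact: resP.
Qed.

Lemma sec_glue U (oU : open U) (K : Type) (W : K -> set X)
    (oW : forall k, open (W k)) (WU : forall k, W k `<=` U) (f : forall k, sec (W k)) :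
  U `<=` \bigcup_k W k ->
  (forall k l V (oV : open V) (Vk : V `<=` W k) (Vl : V `<=` W l),
     res (oW k) oV Vk (f k) = res (oW l) oV Vl (f l)) ->
  exists s, forall k, res oU (oW k) (WU k) s = f k.
Proof.
move=> cov h.
have oC W' : range W W' -> open W' by move=> [k _ <-].
have CU W' : range W W' -> W' `<=` U by move=> [k _ <-].
(* [sheaf_glue] expects a section over every set. Sets outside the covering get 0; a set with
   several indices gets any of its sections, which agree by [h]. *)
pose f' W' : sec W' :=
  match pselect (exists k, W k = W') with
  | left e => let: exist k ek := cid e in eq_rect _ (fun Z => sec Z) (f k) _ ek
  | right _ => 0 end.
have f'E k V (oV : open V) (Vk Vk' : V `<=` W k) (o : open (W k)) :
    res o oV Vk' (f' (W k)) = res (oW k) oV Vk (f k).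
  rewrite /f'; case: pselect => [e|[]]; last by exists k.
  case: (cid e) => l el; have Vl : V `<=` W l by rewrite el.
  rewrite -(h l k V oV Vl Vk).
  by case: _ / el o Vk' {Vk} => o Vk'; exact: resP.
have [||s hs] := @sheaf_glue X U (range W) oU oC CU f'.
- by move=> x /cov [k _ Wx]; exists (W k) => //; exists k.
- move=> W1 W2 CW1 CW2 V oV VW1 VW2.
  have [k _ e1] := CW1; have [l _ e2] := CW2.
  case: _ / e1 CW1 VW1 => CW1 VW1; case: _ / e2 CW2 VW2 => CW2 VW2.
  by rewrite !f'E; exact: h.
exists s => k; have Wk : range W (W k) by exists k.
rewrite (resP oU oU (oW k) (oC _ Wk) (WU k) (CU _ Wk)) hs.
rewrite -[f' _](@res_id X _ (oW k) (oW k) (@subset_refl _ _)).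
by rewrite (f'E k (W k) (oW k) (@subset_refl _ _)) res_id.
Qed.

Lemma sec_empty U (s : sec U) : open U -> U `<=` set0 -> s = 0.
Proof.
move=> oU U0.
by apply: (@sec_sep U oU False (fun=> set0) (fun=> open0) (fun=> @sub0set _ U)) => // x /U0.
Qed.

Lemma unit_atW U V (oU : open U) (oV : open V) (VU : V `<=` U) (s : sec U) x :
  V x -> unit_at (res oU oV VU s) x <-> unit_at s x.
Proof.
move=> Vx; split=> [[W [oV' [oW [WV [Wx ut]]]]]|[W [oU' [oW [WU [Wx ut]]]]]].
  have WU : W `<=` U by move=> y /WV /VU.
  exists W, oU, oW, WU; split=> //.
  by move: ut; rewrite (resP _ oV _ oW _ WV) (res_res _ _ _ _ _ WU).
have oWV : open (W `&` V) by exact: openI.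
have WV : W `&` V `<=` V by move=> ? [].
have WVW : W `&` V `<=` W by move=> ? [].
have WVU : W `&` V `<=` U by move=> ? [/WU].
exists (W `&` V), oV, oWV, WV; split=> //.
rewrite (res_res _ _ _ _ _ WVU) -(res_res oU oW oWV WU WVW).
by apply: is_unit_map; move: ut; rewrite (resP _ oU _ oW _ WU).
Qed.

Lemma unit_at_in U (s : sec U) x : unit_at s x -> U x.
Proof. by move=> [W [oU [oW [WU [Wx _]]]]]; exact: WU. Qed.

Lemma unit_unit_at U (oU : open U) (s : sec U) x : U x -> is_unit s -> unit_at s x.
Proof.
move=> Ux us; exists U, oU, oU, (@subset_refl _ _); split=> //.
by rewrite res_id.
Qed.

Lemma unit_at1 U (oU : open U) x : U x -> unit_at (1 : sec U) x.
Proof. by move=> Ux; apply: unit_unit_at => //; exact: unit1. Qed.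

Lemma unit_atM U (s t : sec U) x : unit_at (s * t) x <-> unit_at s x /\ unit_at t x.
Proof.
split=> [[W [oU [oW [WU [Wx]]]]]|].
  rewrite rmorphM => ut; split; exists W, oU, oW, WU; split=> //.
    exact: unitMl ut.
  exact: unitMr ut.
move=> [[W [oU [oW [WU [Wx us]]]]] [W' [oU' [oW' [WU' [Wx' ut]]]]]].
have oWW : open (W `&` W') by exact: openI.
have sW : W `&` W' `<=` W by move=> ? [].
have sW' : W `&` W' `<=` W' by move=> ? [].
have sU : W `&` W' `<=` U by move=> ? [/WU].
exists (W `&` W'), oU, oWW, sU; split=> //; rewrite rmorphM; apply: unitM.
  by rewrite -(res_res oU oW oWW WU sW); exact: is_unit_map.
by rewrite (resP oU oU' oWW oWW sU sU) -(res_res oU' oW' oWW WU' sW'); exact: is_unit_map.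
Qed.

Lemma unit_atX U (oU : open U) (s : sec U) n x : unit_at s x -> unit_at (s ^+ n) x.
Proof.
move=> us; elim: n => [|n IH]; first by apply: unit_at1 => //; exact: unit_at_in us.
by rewrite exprS; apply/unit_atM.
Qed.

Lemma inv_uniq (A : comPzRingType) (a b c : A) : a * b = 1 -> a * c = 1 -> b = c.
Proof. by move=> ab ac; rewrite -[b]mulr1 -ac mulrCA mulrA ab mul1r. Qed.

(** Inverses are unique, so the local ones glue. *)
Lemma unit_all U (oU : open U) (s : sec U) : (forall x, U x -> unit_at s x) -> is_unit s.
Proof.
move=> us.
pose K := {W : set X | exists (oW : open W) (WU : W `<=` U), is_unit (res oU oW WU s)}.
have oW (k : K) : open (sval k) by case: k => W /= [].
have WU (k : K) : sval k `<=` U by case: k => W /= [? []].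
have uk (k : K) : {g | res oU (oW k) (WU k) s * g = 1}.
  apply: cid; case: k (oW k) (WU k) => W /= [oW' [WU' [g gs]]] o w.
  by exists g; rewrite -gs; congr (_ * _); exact: resP.
have cov : U `<=` \bigcup_k sval (k : K).
  move=> x /us [W [oU' [oW' [WU' [Wx ut]]]]].
  have e : exists (oW : open W) (WU : W `<=` U), is_unit (res oU oW WU s).
    by exists oW', WU'; move: ut; rewrite (resP _ oU _ oW' _ WU').
  by exists (exist _ W e).
have [|g hg] := @sec_glue U oU K sval oW WU (fun k => sval (uk k)) cov.
  move=> k l V oV Vk Vl; have VU : V `<=` U by move=> y /Vk /WU.
  apply: (@inv_uniq _ (res oU oV VU s)).
    by rewrite -(res_res oU (oW k) oV (WU k) Vk) -rmorphM; case: (uk k) => /= ? ->; rewrite rmorph1.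
  by rewrite -(res_res oU (oW l) oV (WU l) Vl) -rmorphM; case: (uk l) => /= ? ->; rewrite rmorph1.
exists g; apply: (@sec_sep U oU K sval oW WU) => // k.
by rewrite rmorphM hg rmorph1; case: (uk k).
Qed.

Lemma vanishing_res U V (oU : open U) (oV : open V) (VU : V `<=` U) x (s : sec U) :
  V x -> vanishing x (res oU oV VU s) <-> vanishing x s.
Proof. by move=> Vx; split=> h /(unit_atW oU oV VU s Vx). Qed.

Lemma vanishing_prime U x : locally_ringed X -> open U -> U x ->
  prime_ideal (@vanishing X U x).
Proof.
move=> lr oU Ux; have [n0 nD] := lr U x oU Ux; split.
- split=> // [a b na nb /nD []//|c a na /unit_atM [] //].
- by move=> h; apply: h; exact: unit_at1.
- move=> a b nab; apply: contrapT => /not_orP [/contrapT ua /contrapT ub].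
  by apply: nab; apply/unit_atM.
Qed.

Lemma basic_open_res U V (oU : open U) (oV : open V) (VU : V `<=` U) (s : sec U) :
  basic_open (res oU oV VU s) = basic_open s `&` V.
Proof.
apply/seteqP; split=> x.
  by move=> us; have Vx := unit_at_in us; split=> //; apply/(unit_atW oU oV VU).
by move=> [us Vx]; apply/(unit_atW oU oV VU).
Qed.

Lemma basic_openM U (s t : sec U) : basic_open (s * t) = basic_open s `&` basic_open t.
Proof. by apply/seteqP; split=> x /unit_atM. Qed.

Lemma basic_open1 U : open U -> basic_open (1 : sec U) = U.
Proof.
by move=> oU; apply/seteqP; split; [exact: basic_open_sub|move=> x; exact: unit_at1].
Qed.

Lemma res_unit U V (oU : open U) (oV : open V) (VU : V `<=` U) (s : sec U) :
  V `<=` basic_open s -> is_unit (res oU oV VU s).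
Proof.
by move=> h; apply: (unit_all oV) => x Vx; apply/unit_atW => //; exact: h.
Qed.

End Sections.

(** * Null sequences *)

Section TendsToZero.

(** Sequences suffice for continuity and completeness below, because an adic topology has a
    countable basis at 0. *)
Definition tz (A : topComRingType) (u : nat -> A) :=
  forall N : set A, nbhs 0 N -> exists K, forall k, (K <= k)%N -> N (u k).

Lemma cont0P (A B : topComRingType) (f : {rmorphism A -> B}) :
  continuous f <-> forall N : set B, nbhs 0 N -> nbhs 0 (f @^-1` N).
Proof.
split=> [cf N N0|h x N Nx]; first by apply: (cf 0); rewrite rmorph0.
have hN : nbhs 0 [set y | N (f x + y)].
  have := @cvg_comp _ _ _ (fun y : B => (f x, y)) (fun z : B * B => z.1 + z.2)
    (nbhs 0) (nbhs (f x, 0)) (nbhs (f x + 0)).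
  rewrite addr0; apply=> //; first by apply: cvg_pair; [exact: cvg_cst|exact: cvg_id].
  by have := @add_continuous B (f x, 0); rewrite /continuous_at /= addr0.
have {}hN := h _ hN.
have : nbhs x ((fun y => y - x) @^-1` (f @^-1` [set y | N (f x + y)])).
  have := @cvg_comp _ _ _ (fun y : A => (y, x)) (fun z : A * A => z.1 - z.2)
    (nbhs x) (nbhs (x, x)) (nbhs 0).
  apply=> //; first by apply: cvg_pair; [exact: cvg_id|exact: cvg_cst].
  by have := @sub_continuous A (x, x); rewrite /continuous_at /= subrr.
apply: filterS => y /=; rewrite /preimage /= rmorphB.
by rewrite addrC subrK.
Qed.

Lemma tz_map (A B : topComRingType) (f : {rmorphism A -> B}) u :
  continuous f -> tz u -> tz (f \o u).
Proof. by move=> /cont0P cf tu N /cf /tu. Qed.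

Lemma tz0 (A : topComRingType) (u : nat -> A) :
  (exists K, forall k, (K <= k)%N -> u k = 0) -> tz u.
Proof. by move=> [K h] N /nbhs_singleton N0; exists K => k /h ->. Qed.

Lemma tzD (A : topComRingType) (u v : nat -> A) : tz u -> tz v -> tz (fun k => u k + v k).
Proof.
move=> tu tv N N0.
have : nbhs ((0 : A), (0 : A)) [set z | N (z.1 + z.2)].
  by have := @add_continuous A (0, 0); rewrite /continuous_at /= addr0; apply.
move=> [[P Q] /= [P0 Q0] PQ]; have [K hK] := tu _ P0; have [L hL] := tv _ Q0.
exists (maxn K L) => k; rewrite geq_max => /andP [/hK Pk /hL Qk].
by apply: (PQ (u k, v k)).
Qed.

Lemma tzN (A : topComRingType) (u : nat -> A) : tz u -> tz (fun k => - u k).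
Proof.
move=> tu N N0; apply: (tu (-%R @^-1` N)).
by have := @opp_continuous A 0; rewrite /continuous_at oppr0; apply.
Qed.

Lemma tzB (A : topComRingType) (u v : nat -> A) : tz u -> tz v -> tz (fun k => u k - v k).
Proof. by move=> tu /tzN; exact: tzD. Qed.

Lemma eq_tz (A : topComRingType) (u v : nat -> A) : u =1 v -> tz u -> tz v.
Proof. by move=> /funext ->. Qed.

Lemma nbhs_adic (A : topComRingType) (I : set A) : adic_topology I ->
  forall N : set A, nbhs 0 N <-> exists n, ideal_pow I n `<=` N.
Proof.
move=> top N; split.
  rewrite nbhsE => -[W [/top oW W0] WN].
  have [n hn] := oW _ W0; exists n => a /hn; rewrite add0r; exact: WN.
move=> [n hn]; rewrite nbhsE; exists (ideal_pow I n) => //; split; last exact: ideal0.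
by apply/top => w ww; exists n => a; exact: idealD.
Qed.

Lemma tz_adic (A : topComRingType) (I : set A) (u : nat -> A) : adic_topology I ->
  tz u <-> forall n, exists K, forall k, (K <= k)%N -> ideal_pow I n (u k).
Proof.
move=> top; split=> [h n|h N /(nbhs_adic top) [n hn]].
  by apply: h; apply/(nbhs_adic top); exists n.
by have [K hK] := h n; exists K => k /hK /hn.
Qed.

Lemma tz_pow (A : topComRingType) (I : set A) (u : nat -> A) : adic_topology I ->
  (forall k, ideal_pow I k (u k)) -> tz u.
Proof. by move=> top h; apply/tz_adic => // n; exists n => k /pow_le; apply. Qed.

Lemma finite_bound (T : Type) (D : set T) (P : T -> nat -> Prop) : finite_set D ->
  (forall x, D x -> exists K, forall k, (K <= k)%N -> P x k) ->
  exists K, forall k, (K <= k)%N -> forall x, D x -> P x k.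
Proof.
move=> fD h.
have /choice [f hf] : forall x, exists K, D x -> forall k, (K <= k)%N -> P x k.
  by move=> x; have [/h [K hK]|nD] := pselect (D x); [exists K|exists 0%N].
have /finite_seqP [s fs] := finite_image f fD.
exists (\max_(i <- s) i) => k hk x Dx; apply: hf => //.
apply: leq_trans hk; apply: (@leq_bigmax_seq _ s xpredT id (f x)) => //.
suff : [set` s] (f x) by [].
by rewrite -fs; exists x.
Qed.

End TendsToZero.

Section TzSheaf.
Variable X : ringedSpace.

Lemma tz_res (U V : set X) (oU : open U) (oV : open V) (VU : V `<=` U) u :
  tz u -> tz (fun k => res oU oV VU (u k)).
Proof. by apply: tz_map; exact: res_continuous. Qed.

Lemma nbhs_loc (U : set X) (oU : open U) (N : set (sec U)) :
  forall C : set (set X), U `<=` \bigcup_(W in C) W -> forall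
    (oC : forall W, C W -> open W) (CU : forall W, C W -> W `<=` U),
  nbhs 0 N ->
    exists (D : set (set X)) (M : forall W, set (sec W)),
      [/\ finite_set D, D `<=` C, forall W, nbhs 0 (M W) &
          forall s, (forall W (CW : C W), D W ->
            M W (res oU (oC W CW) (CU W CW) s)) -> N s].
Proof. by move=> C cov oC CU N0; exact: sheaf_topology. Qed.

(** By [sheaf_topology] a neighbourhood of 0 constrains only finitely many members of a covering, so
    the bounds over these members have a common majorant. *)
Lemma tz_loc (U : set X) (oU : open U) (u : nat -> sec U) :
  (forall x, U x -> exists W (oW : open W) (WU : W `<=` U),
     W x /\ tz (fun k => res oU oW WU (u k))) -> tz u.
Proof.
move=> h N N0.
pose C := [set W | exists (oW : open W) (WU : W `<=` U), tz (fun k => res oU oW WU (u k))].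
have oC W : C W -> open W by case.
have CU W : C W -> W `<=` U by case=> ? [].
have [|D [M [fD DC M0 DN]]] := @nbhs_loc U oU N C _ oC CU N0.
  by move=> x /h [W [oW [WU [Wx tW]]]]; exists W => //; exists oW, WU.
have [|K hK] := @finite_bound _ D (fun W k => forall CW : C W, M W (res oU (oC W CW) (CU W CW) (u k))) fD.
  move=> W DW; have [oW [WU tW]] := DC _ DW.
  have [K hK] := tW _ (M0 W); exists K => k /hK Mk CW.
  by rewrite (resP _ oU _ oW _ WU).
by exists K => k kK; apply: DN => W CW DW; exact: hK.
Qed.

Lemma cont_loc (B : topComRingType) (U : set X) (oU : open U) (f : {rmorphism B -> sec U}) :
  (forall x, U x -> exists W (oW : open W) (WU : W `<=` U),
     W x /\ forall N, nbhs 0 N -> nbhs 0 [set b | N (res oU oW WU (f b))]) -> continuous f.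
Proof.
move=> h; apply/cont0P => N N0.
pose C := [set W | exists (oW : open W) (WU : W `<=` U),
  forall N, nbhs 0 N -> nbhs 0 [set b | N (res oU oW WU (f b))]].
have oC W : C W -> open W by case.
have CU W : C W -> W `<=` U by case=> ? [].
have [|D [M [fD DC M0 DN]]] := @nbhs_loc U oU N C _ oC CU N0.
  by move=> x /h [W [oW [WU [Wx tW]]]]; exists W => //; exists oW, WU.
pose F W := [set b | forall CW : C W, M W (res oU (oC W CW) (CU W CW) (f b))].
have : nbhs 0 (\bigcap_(W in D) F W).
  have F0 W : D W -> nbhs 0 (F W).
    move=> DW; have [oW [WU tW]] := DC _ DW.
    by apply: filterS (tW _ (M0 W)) => b Mb CW; rewrite (resP _ oU _ oW _ WU).
  have /finite_seqP [s Ds] := fD; rewrite Ds.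
  have : forall W, W \in s -> nbhs 0 (F W) by move=> W Ws; apply: F0; rewrite Ds.
  elim: s {Ds} => [_|W s IH hs]; first by apply: filterE => b W.
  have hW : nbhs 0 (F W) by apply: hs; rewrite inE eqxx.
  have {}IH : nbhs 0 (\bigcap_(W in [set` s]) F W).
    by apply: IH => W' W's; apply: hs; rewrite inE W's orbT.
  by apply: filterS (filterI hW IH) => b [FW Fs] W' /=; rewrite inE => /orP [/eqP ->|/Fs].
by apply: filterS => b Fb; apply: DN => W CW DW; exact: Fb.
Qed.

End TzSheaf.

Arguments sec_sep_pt [X U] oU [s t] _.
Arguments tz_loc [X U] oU [u] _ _ _.
Arguments cont_loc [X B U] oU f _.

(** High powers of an element congruent to [y] modulo [J] are multiples of [y ^+ k] up to [J^n].
    This permits exchanging denominators that agree only modulo an ideal of definition. *)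
Lemma pow_subX (A : comPzRingType) (J : set A) (y j : A) k n : J j ->
  exists g, ideal_pow J n ((y - j) ^+ (k + n) - y ^+ k * g).
Proof.
move=> Jj; elim: n k => [|n IHn] k; first by exists 0.
elim: k => [|k [g hg]].
  exists ((y - j) ^+ n.+1); rewrite expr0 mul1r subrr; exact: ideal0.
have [g' hg'] := IHn k.+1; exists (g - j * g').
have -> : (y - j) ^+ (k.+1 + n.+1) - y ^+ k.+1 * (g - j * g') =
   y * ((y - j) ^+ (k + n.+1) - y ^+ k * g) -
   j * ((y - j) ^+ (k.+1 + n) - y ^+ k.+1 * g').
  have -> : (y - j) ^+ (k.+1 + n.+1) = (y - j) * (y - j) ^+ (k + n.+1).
    by rewrite addSn exprS.
  by rewrite (addSnnS k n) exprS; ring.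
by apply: idealB => //; [exact: idealM|exact: mulidI].
Qed.

(** The clause [affine_sections] for an arbitrary ring map, so that it can be moved along equalities
    of opens and isomorphisms of rings. *)
Definition is_loc (A B : topComRingType) (r : {rmorphism A -> B}) (I : set A) (a : A) :=
  let J := ideal_span (r @` I) in
  [/\ adically_complete J, adic_topology J & forall n,
    [/\ exists b, ideal_pow J n (r a * b - 1),
        forall b, exists k c, ideal_pow J n (r a ^+ k * b - r c) &
        forall c, ideal_pow J n (r c) -> exists k, ideal_pow I n (a ^+ k * c)]].

(** * Affine opens and their basic opens *)

Section Affine.
Variable X : ringedSpace.
Implicit Types (U V W : set X).

Lemma affine_loc U I (h : @affine X U I) W a (oU : open U) (oW : open W)
  (WU : W `<=` U) : W = basic_open a -> is_loc (res oU oW WU) I a.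
Proof.
move=> e; case: _ / (esym e) oW WU => oW WU.
have := affine_sections h a.
rewrite (Prop_irrelevance (affine_open h) oU)
  (Prop_irrelevance (basic_open_open a) oW)
  (Prop_irrelevance (@basic_open_sub X U a) WU).
by move=> [? ? ?].
Qed.

Lemma affine_ideal U I : @affine X U I -> is_ideal I.
Proof. by move=> /affine_fg /fg_is_ideal. Qed.

Lemma affine_self U I (h : @affine X U I) : adically_complete I /\ adic_topology I.
Proof.
have [+ + _] := affine_loc h (affine_open h) (affine_open h) (@subset_refl _ U)
  (esym (basic_open1 (affine_open h))).
set r := res _ _ _; have rid s : r s = s by exact: res_id.
suff -> : r @` I = I by rewrite spanE //; exact: affine_ideal h.
by apply/seteqP; split=> [_ [x Ix <-]|x Ix]; [rewrite rid|exists x].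
Qed.

Lemma affine_complete U I (h : @affine X U I) : adically_complete I.
Proof. by case: (affine_self h). Qed.

Lemma affine_top U I (h : @affine X U I) : adic_topology I.
Proof. by case: (affine_self h). Qed.

(** D(a) is empty, so 1 restricts to 0 on it; the clause on elements with small restriction then
    yields a power of [a] in [I^n]. *)
Lemma affine_nil U I (h : @affine X U I) (a : sec U) : (forall x, ~ unit_at a x) ->
  forall n, exists k, ideal_pow I n (a ^+ k).
Proof.
move=> na n.
have [_ _ /(_ n) [_ _ /(_ 1)]] := affine_loc h (affine_open h) (basic_open_open a)
  (@basic_open_sub _ _ a) erefl.
have -> : res (affine_open h) (basic_open_open a) (@basic_open_sub _ _ a) 1 = 0.
  by apply: sec_empty; [exact: basic_open_open|move=> x /na].
move=> []; first exact: ideal0.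
by move=> k; rewrite mulr1; exists k.
Qed.

Lemma affine_van U I (h : @affine X U I) x : U x -> prime_ideal (vanishing (U := U) x).
Proof. by move=> /(affine_vanishing h) []. Qed.

Lemma affine_vanI U I (h : @affine X U I) x : U x -> I `<=` vanishing (U := U) x.
Proof. by move=> /(affine_vanishing h) []. Qed.
Arguments affine_vanI [U I] h [x] _ _ _.

Lemma ideal_nounit U I (h : @affine X U I) (a : sec U) x : I a -> ~ unit_at a x.
Proof. by move=> Ia ux; exact: (affine_vanI h (unit_at_in ux) _ Ia ux). Qed.

Lemma van_congr U I (h : @affine X U I) (a b : sec U) x : I (a - b) -> unit_at a x -> unit_at b x.
Proof.
move=> Iab ua; apply: contrapT => nb; have Ux := unit_at_in ua.
have [iV _ _] := affine_van h Ux.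
by have := idealD iV (affine_vanI h Ux _ Iab) nb; rewrite subrK; apply.
Qed.

(** Over D(a) the section [a^k b] is congruent to the restriction of some [c] modulo the ideal of
    definition, which vanishes at every point; thus [b] and [c] are units at the same points of
    D(a). *)
Lemma basic_basic U I (h : @affine X U I) (lr : locally_ringed X)
   (a : sec U) W (oU : open U) (oW : open W) (WU : W `<=` U) (b : sec W) :
   W = basic_open a ->
   exists k c, basic_open b = basic_open (a * c) /\
     ideal_span (res oU oW WU @` I) (res oU oW WU a ^+ k * b - res oU oW WU c).
Proof.
move=> e; have [_ _ /(_ 1%N) [_ + _]] := affine_loc h oU oW WU e.
move=> /(_ b) [k [c hc]]; exists k, c; split; last exact: pow1_sub hc.
rewrite basic_openM -e; apply/seteqP; split.
  move=> x ub; have Wx : W x := unit_at_in ub.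
  have pV := vanishing_prime lr oW Wx; have [iV _ _] := pV.
  split=> //; apply/(unit_atW oU oW WU) => //; apply: contrapT => nc.
  have hJ : vanishing x (res oU oW WU a ^+ k * b - res oU oW WU c).
    move: hc; rewrite pow1 //; apply: span_min => // _ [i Ii <-].
    apply/(vanishing_res oU oW WU i Wx); exact: (affine_vanI h (WU _ Wx) _ Ii).
  have : vanishing x (res oU oW WU a ^+ k * b).
    by rewrite -[_ * b](subrK (res oU oW WU c)); exact: (idealD iV hJ nc).
  apply; apply/unit_atM; split=> //; apply: unit_atX => //.
  by apply/unit_atW => //; move: Wx; rewrite e.
move=> x [Wx uc]; have pV := vanishing_prime lr oW Wx; have [iV _ _] := pV.
have hJ : vanishing x (res oU oW WU a ^+ k * b - res oU oW WU c).
  move: hc; rewrite pow1 //; apply: span_min => // _ [i Ii <-].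
  apply/(vanishing_res oU oW WU i Wx); exact: (affine_vanI h (WU _ Wx) _ Ii).
apply: contrapT => nb.
have /(vanishing_res oU oW WU c Wx) : vanishing x (res oU oW WU c).
  rewrite -[res _ _ _ _](subKr (res oU oW WU a ^+ k * b)).
  exact: (idealB iV (@idealM _ _ _ _ iV nb) hJ).
exact.
Qed.

Lemma affine_basic_aux U I (h : @affine X U I) (lr : locally_ringed X)
   (a : sec U) W (oU : open U) (oW : open W) (WU : W `<=` U) :
   W = basic_open a -> affine (ideal_span (res oU oW WU @` I)).
Proof.
move=> e; set r := res oU oW WU; set J := ideal_span _.
have iJ : is_ideal J := span_ideal _.
have iI := affine_ideal h.
have Jr i : I i -> J (r i) by move=> Ii; rewrite /J; apply: subspan; exists i.
have [compJ topJ locJ] := affine_loc h oU oW WU e.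
have JV x : W x -> J `<=` vanishing (U := W) x.
  move=> Wx; have [iV _ _] := vanishing_prime lr oW Wx.
  apply: span_min => // _ [i Ii <-].
  apply/(vanishing_res oU oW WU i Wx); exact: (affine_vanI h (WU _ Wx) _ Ii).
have ura : is_unit (r a) by apply: res_unit; rewrite e.
apply: (@Build_affine _ _ _ oW).
- exact: fg_map (affine_fg h).
- by move=> x Wx; split; [exact: vanishing_prime|exact: JV].
- move=> p pp Jp; have [ip p1 pp'] := pp.
  have pq : prime_ideal (r @^-1` p) := preim_prime r pp.
  have [|x [[Ux qx] uniq]] := affine_prime h pq.
    by move=> i Ii; exact: (Jp (r i) (Jr i Ii)).
  have na : ~ p (r a).
    move=> pra; apply: p1; have [d <-] := ura; exact: idealMr.
  have Wx : W x.
    by rewrite e; apply: contrapT => nu; apply: na; rewrite -[p _]/((r @^-1` p) a) qx.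
  have pE c : p (r c) <-> vanishing (U := W) x (r c).
    by rewrite -[p _]/((r @^-1` p) c) qx; split=> /vanishing_res; apply.
  exists x; split.
    split=> //; have [iV V1 pV] := vanishing_prime lr oW Wx.
    (* A prime that contains [J] and not [r a] is determined by the restrictions in it, because
       [r a ^+ k * b] is congruent to a restriction modulo [J]. *)
    have key (P Q : set (sec W)) : prime_ideal P -> J `<=` P -> J `<=` Q -> prime_ideal Q ->
        ~ Q (r a) -> (forall c, P (r c) -> Q (r c)) -> P `<=` Q.
      move=> [iP _ pP] JP JQ pQQ nQ PQ b Pb; have [iQ _ pQ] := pQQ.
      have [_ /(_ b) [k [c hc]] _] := locJ 1%N; rewrite pow1 // in hc.
      have Pc : P (r c).
        rewrite -[r c](subKr (r a ^+ k * b)); exact: (idealB iP (@idealM _ _ _ _ iP Pb) (JP _ hc)).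
      have : Q (r a ^+ k * b).
        rewrite -[_ * b](subrK (r c)); exact: (idealD iQ (JQ _ hc) (PQ _ Pc)).
      by move=> /pQ [qx2|//]; case: nQ; exact: (primeX pQQ qx2).
    apply/seteqP; split; apply: key => //; try exact: JV.
    + by move=> h'; apply: h'; apply: unit_unit_at.
    + by move=> c /pE.
    + by move=> c /pE.
  move=> y [Wy py]; apply: uniq; split; first exact: (WU y Wy).
  by apply/seteqP; split=> c; rewrite /preimage /= py => hc;
    apply/(vanishing_res oU oW WU c Wy).
- move=> V x oV Vx Wx.
  have [a' [ua' a'V]] := affine_basis h (openI oV oW) (conj Vx Wx) (WU x Wx).
  exists (r a'); split; first by apply/unit_atW.
  by move=> y; rewrite basic_open_res => -[/a'V []].
move=> b r' J'; have iJ' : is_ideal J' := span_ideal _.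
have [k1 [c [Eb hc]]] := basic_basic h lr oU oW WU b e.
have EU : basic_open b `<=` U by move=> y /basic_open_sub /WU.
set r'' := res oU (basic_open_open b) EU.
have rr s : r' (r s) = r'' s by exact: res_res.
have [compJ'' topJ'' locJ''] := affine_loc h oU (basic_open_open b) EU Eb.
have JJ : J' = ideal_span (r'' @` I).
  rewrite /J'; apply/seteqP; split.
    apply: span_min => // _ [j Jj <-].
    have iK : is_ideal (r' @^-1` ideal_span (r'' @` I)) by exact: preim_ideal.
    move: j Jj; apply: span_min => // _ [i Ii <-].
    by apply: subspan; exists i => //; rewrite rr.
  apply: span_min => // _ [i Ii <-]; apply: subspan; exists (r i); [exact: Jr|exact: rr].
split; [by rewrite JJ|by rewrite JJ|].
(* [r a ^+ k1.+1 * b] is congruent to [r (a * c)] modulo [J], so [pow_subX] compares their powers.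
   As [r a] is invertible, the denominator [a * c], for which the localisation over U is known, may
   be exchanged for [b]. *)
have pb k n : exists N l g, ideal_pow J n (r a ^+ l * b ^+ N - r (a * c) ^+ k * g).
  have [] := @pow_subX _ J (r (a * c)) (- (r a * (r a ^+ k1 * b - r c))) k n.
    by apply: idealN => //; apply: idealM.
  move=> g hg; exists (k + n)%N, (k1.+1 * (k + n))%N, g.
  suff -> : r a ^+ (k1.+1 * (k + n)) * b ^+ (k + n) =
      (r (a * c) - - (r a * (r a ^+ k1 * b - r c))) ^+ (k + n) by [].
  rewrite exprM -exprMn; congr (_ ^+ _); rewrite rmorphM exprS; ring.
move=> n; have [_ l2 l3] := locJ'' n; split.
- have [d hd] : is_unit (r' b) by exact: res_unit.
  by exists d; rewrite hd subrr; exact: ideal0.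
- move=> f; have [k [d hd]] := l2 f.
  have [N [l [g hg]]] := pb k n; have [v hv] := unitX l ura.
  exists N, (v * g * r d).
  have hg' : ideal_pow J' n (r' (r a ^+ l * b ^+ N - r (a * c) ^+ k * g)) by exact: map_pow.
  have -> : r' b ^+ N * f - r' (v * g * r d) =
     r' v * (r' (r a ^+ l * b ^+ N - r (a * c) ^+ k * g) * f
        + r' g * (r'' (a * c) ^+ k * f - r'' d)).
    rewrite -!rr rmorphB !rmorphM !rmorphXn !rmorphM.
    have e1 : r' (r a) ^+ l * r' v = 1 by rewrite -rmorphXn -rmorphM hv rmorph1.
    rewrite -[LHS]mul1r -[X in _ - X]mul1r; ring: e1.
  apply: idealM => //; apply: idealD => //; first exact: idealMr.
  by apply: idealM => //; rewrite JJ.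
- move=> c' hc'.
  have [_ /(_ c') [l [d hd]] _] := locJ n.
  have [|k hk] := l3 d.
    rewrite -JJ -rr -[r d](subKr (r a ^+ l * c')) rmorphB rmorphM.
    by apply: idealB => //; [exact: idealM|exact: map_pow].
  have hk' : ideal_pow J n (r (a * c) ^+ k * c').
    have : ideal_pow J n (r a ^+ l * (r (a * c) ^+ k * c')).
      have -> : r a ^+ l * (r (a * c) ^+ k * c') =
        r (a * c) ^+ k * (r a ^+ l * c' - r d) + r ((a * c) ^+ k * d).
        by rewrite !rmorphM !rmorphXn !rmorphM; ring.
      by apply: idealD => //; [exact: idealM|exact: map_pow].
    by apply: unit_ideal => //; exact: unitX.
  have [N [l' [g hg]]] := pb k n; exists N.
  apply: (@unit_ideal _ _ (r a ^+ l')) => //; first exact: unitX.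
  have -> : r a ^+ l' * (b ^+ N * c') =
     c' * (r a ^+ l' * b ^+ N - r (a * c) ^+ k * g) + g * (r (a * c) ^+ k * c') by ring.
  by apply: idealD => //; exact: idealM.
Qed.

End Affine.

(** Ring maps below are given by limits, gluing or descent, that is, by their graphs. *)
Lemma hom_of_rel (A B : pzRingType) (G : A -> B -> Prop) :
  (forall a, exists b, G a b) -> (forall a b b', G a b -> G a b' -> b = b') ->
  G 1 1 -> (forall a b a' b', G a b -> G a' b' -> G (a - a') (b - b')) ->
  (forall a b a' b', G a b -> G a' b' -> G (a * a') (b * b')) ->
  exists f : {rmorphism A -> B}, forall a, G a (f a).
Proof.
move=> tot fct G1 GB GM; have [f hf] := choice tot.
have fB : zmod_morphism f by move=> x y; apply: fct (hf _) _; exact: GB.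
have fM : monoid_morphism f.
  by split=> [|x y]; [exact: fct (hf _) _|apply: fct (hf _) _; exact: GM].
pose F := HB.pack_for {rmorphism A -> B} f (GRing.isZmodMorphism.Build A B f fB)
  (GRing.isMonoidMorphism.Build A B f fM).
by exists F.
Qed.

(** * Limits, completeness and extension by density *)

Definition lims (A : topComRingType) (u : nat -> A) (l : A) := tz (fun k => u k - l).

Section Lims.
Variable A : topComRingType.
Implicit Types (u v : nat -> A).

Lemma lims_cst (l : A) : lims (fun=> l) l.
Proof. by apply: tz0; exists 0%N => k _; rewrite subrr. Qed.

Lemma limsB u v l m : lims u l -> lims v m -> lims (fun k => u k - v k) (l - m).
Proof. by move=> hu hv; apply: eq_tz (tzB hu hv) => k; ring. Qed.

Lemma lims_tz u v l : lims u l -> tz (fun k => u k - v k) -> lims v l.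
Proof. by move=> hu hv; apply: eq_tz (tzB hu hv) => k; ring. Qed.

Lemma lims_map (B : topComRingType) (f : {rmorphism A -> B}) u l :
  continuous f -> lims u l -> lims (f \o u) (f l).
Proof. by move=> cf hu; apply: eq_tz (tz_map cf hu) => k /=; rewrite rmorphB. Qed.

Lemma lims_shift u l n : lims u l -> lims (fun k => u (k + n)%N) l.
Proof.
move=> h N /h [K hK]; exists K => k Kk; apply: hK.
exact: leq_trans (leq_addr _ _).
Qed.

End Lims.

Lemma seqcont_cont (B C : topComRingType) (J : set B) (f : {rmorphism B -> C}) :
  adic_topology J -> (forall u, tz u -> tz (f \o u)) -> continuous f.
Proof.
move=> top h; apply/cont0P => N N0; apply/(nbhs_adic top); apply: contrapT => nn.
have /choice [u hu] : forall n, exists x, ideal_pow J n x /\ ~ N (f x).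
  move=> n; apply: contrapT => ne; apply: nn; exists n => x Jx.
  by apply: contrapT => nN; apply: ne; exists x.
have [|K hK] := h u _ _ N0; first by apply: tz_pow top _ => k; case: (hu k).
by have [_] := hu K; apply; exact: hK.
Qed.

(** Vanishing at all points; on formal schemes this is topological nilpotence, by [nil_tz] and
    [tz_nil]. *)
Definition nil (X : ringedSpace) (U : set X) (s : sec U) := forall x, ~ unit_at s x.

Section FormalSections.
Variable T : formalScheme.
Implicit Types (U V W : set T).

Lemma affine_nbhd W x : open W -> W x -> exists U (I : set (sec U)),
  [/\ affine I, U x & U `<=` W].
Proof.
move=> oW Wx; have [U [I [Ux aI]]] := fs_affine x.
have [a [ua aW]] := affine_basis aI oW Wx Ux.
have aD := affine_basic_aux aI (@fs_local T) (affine_open aI) (basic_open_open a)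
  (@basic_open_sub _ _ a) erefl.
by exists (basic_open a), (ideal_span (res (affine_open aI) (basic_open_open a)
  (@basic_open_sub _ _ a) @` I)).
Qed.

(** The second factor may be any sequence, since the topology is locally given by ideals. *)
Lemma tz_mulr W (oW : open W) (u v : nat -> sec W) : tz u -> tz (fun k => u k * v k).
Proof.
move=> tu; apply: (tz_loc oW) => x Wx; have [U [I [aI Ux UW]]] := affine_nbhd oW Wx.
exists U, (affine_open aI), UW; split=> //.
have top := affine_top aI; apply/(tz_adic _ top) => n.
have /(tz_adic _ top)/(_ n) [K hK] := tz_res oW (affine_open aI) UW tu.
by exists K => k /hK h; rewrite rmorphM; exact: idealMr.
Qed.

Lemma tz_mull W (oW : open W) (u v : nat -> sec W) : tz u -> tz (fun k => v k * u k).
Proof. by move=> tu; apply: eq_tz (tz_mulr oW v tu) => k; rewrite mulrC. Qed.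

Lemma limsM W (oW : open W) (u v : nat -> sec W) l m :
  lims u l -> lims v m -> lims (fun k => u k * v k) (l * m).
Proof.
move=> hu hv; apply: eq_tz (tzD (tz_mulr oW v hu) (tz_mull oW (fun=> l) hv)) => k.
by ring.
Qed.

Lemma tz_cst W (oW : open W) (a : sec W) : tz (fun=> a) -> a = 0.
Proof.
move=> ta; apply: (sec_sep_pt oW) => x Wx; have [U [I [aI Ux UW]]] := affine_nbhd oW Wx.
exists U, (affine_open aI), UW; split=> //; rewrite rmorph0.
have [sep _] := affine_complete aI; apply: sep => n.
have /(tz_adic _ (affine_top aI))/(_ n) [K /(_ K (leqnn K))] :=
  tz_res oW (affine_open aI) UW ta.
by [].
Qed.

Lemma lims_uniq W (oW : open W) (u : nat -> sec W) l m : lims u l -> lims u m -> l = m.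
Proof.
move=> hl hm; apply/eqP; rewrite -subr_eq0; apply/eqP/(tz_cst oW).
by apply: eq_tz (tzB hm hl) => k; ring.
Qed.

Lemma lims0 W (oW : open W) (u : nat -> sec W) l : lims u l -> tz u -> l = 0.
Proof.
move=> hl hu; apply: (lims_uniq oW hl); apply: eq_tz hu => k; by rewrite subr0.
Qed.

Lemma pow_tele (A : comPzRingType) (I : set A) n (u : nat -> A) K : 
  (forall k, (K <= k)%N -> ideal_pow I n (u k.+1 - u k)) ->
  forall k l, (K <= k <= l)%N -> ideal_pow I n (u l - u k).
Proof.
move=> h k l /andP [Kk kl]; rewrite -(subnK kl); elim: (l - k)%N => [|m IH].
  by rewrite add0n subrr; exact: ideal0.
have -> : u (m.+1 + k)%N - u k = (u (m + k).+1 - u (m + k)%N) + (u (m + k)%N - u k).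
  by rewrite addSn; ring.
by apply: idealD => //; apply: h; apply: leq_trans Kk _; exact: leq_addl.
Qed.

Lemma adic_lim (A : topComRingType) (I : set A) (u : nat -> A) : adically_complete I ->
  adic_topology I -> tz (fun k => u k.+1 - u k) -> exists l, lims u l.
Proof.
move=> [_ comp] top /(tz_adic _ top) hu.
have /choice [K hK] : forall n, exists K, forall k, (K <= k)%N -> ideal_pow I n (u k.+1 - u k).
  by [].
(* A monotone majorant of [K]: along the subsequence [L] the n-th step lies in [I^n], as
   [adically_complete] requires. *)
pose L n := (\sum_(i < n.+1) K i)%N.
have KL n : (K n <= L n)%N by rewrite /L big_ord_recr leq_addl.
have LS n : (L n <= L n.+1)%N by rewrite [leqRHS]/L big_ord_recr leq_addr.
have [|l hl] := comp (fun n => u (L n)).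
  by move=> n; apply: (pow_tele (hK n)); rewrite KL LS.
exists l; apply/(tz_adic _ top) => n; exists (L n) => k Lk.
have -> : u k - l = (u k - u (L n)) - (l - u (L n)) by ring.
by apply: idealB => //; apply: (pow_tele (hK n)); rewrite KL.
Qed.

(** Limits exist over affine opens and are unique, so they glue. *)
Lemma sec_complete W (oW : open W) (u : nat -> sec W) :
  tz (fun k => u k.+1 - u k) -> exists l, lims u l.
Proof.
move=> hu.
pose K := {U : set T | exists (oU : open U) (UW : U `<=` W) (l : sec U),
   lims (fun k => res oW oU UW (u k)) l}.
have oU (k : K) : open (sval k) by case: k => U /= [].
have UW (k : K) : sval k `<=` W by case: k => U /= [? []].
have lk (k : K) : {l | lims (fun i => res oW (oU k) (UW k) (u i)) l}.
  apply: cid; case: k (oU k) (UW k) => U /= [o1 [o2 [l hl]]] o1' o2'.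
  by exists l; apply: eq_tz hl => k; rewrite (resP _ oW _ o1 _ o2).
have cov : W `<=` \bigcup_k sval (k : K).
  move=> x Wx; have [U [I [aI Ux UW']]] := affine_nbhd oW Wx.
  have [|l hl] := @adic_lim _ I (fun k => res oW (affine_open aI) UW' (u k))
    (affine_complete aI) (affine_top aI).
    by apply: eq_tz (tz_res oW (affine_open aI) UW' hu) => k /=; rewrite rmorphB.
  have e : exists (oU : open U) (UW : U `<=` W) (l : sec U),
     lims (fun k => res oW oU UW (u k)) l by exists (affine_open aI), UW', l.
  by exists (exist _ U e).
have [|l hl] := @sec_glue T W oW K sval oU UW (fun k => sval (lk k)) cov.
  move=> k1 k2 V oV V1 V2; have VW : V `<=` W by move=> y /V1 /UW.
  apply: (@lims_uniq _ oV (fun i => res oW oV VW (u i))).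
    have := lims_map (@res_continuous _ _ _ (oU k1) oV V1) (svalP (lk k1)).
    by apply: eq_tz => i /=; rewrite (res_res _ _ _ _ _ VW).
  have := lims_map (@res_continuous _ _ _ (oU k2) oV V2) (svalP (lk k2)).
  by apply: eq_tz => i /=; rewrite (res_res _ _ _ _ _ VW).
exists l; apply: (tz_loc oW) => x /cov [k _ kx]; exists (sval k), (oU k), (UW k); split=> //.
by apply: eq_tz (svalP (lk k)) => i; rewrite rmorphB hl.
Qed.

Lemma nil_tz W (oW : open W) (s : sec W) : nil s -> tz (fun k => s ^+ k).
Proof.
move=> ns; apply: (tz_loc oW) => x Wx; have [U [I [aI Ux UW]]] := affine_nbhd oW Wx.
exists U, (affine_open aI), UW; split=> //.
apply/(tz_adic _ (affine_top aI)) => n.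
have [|k hk] := affine_nil aI (a := res oW (affine_open aI) UW s) _ n.
  by move=> y us; apply: (ns y); have Uy := unit_at_in us; apply/(unit_atW oW (affine_open aI) UW).
by exists k => l /subnKC <-; rewrite rmorphXn exprD; apply: idealMr.
Qed.

Lemma tz_nil W (oW : open W) (s : sec W) : tz (fun k => s ^+ k) -> nil s.
Proof.
move=> ts x us; have Wx := unit_at_in us; have [U [I [aI Ux UW]]] := affine_nbhd oW Wx.
have /(tz_adic _ (affine_top aI))/(_ 1%N) [K /(_ K (leqnn K))] :=
  tz_res oW (affine_open aI) UW ts.
rewrite (pow1 (affine_ideal aI)) => Is; apply: (ideal_nounit aI (x := x) Is).
rewrite rmorphXn; apply: unit_atX; first exact: affine_open aI.
by apply/(unit_atW oW (affine_open aI) UW).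
Qed.

Lemma affine_open_nil U (I : set (sec U)) a : affine I -> I a -> nil a.
Proof. by move=> aI Ia x; exact: (ideal_nounit aI Ia). Qed.

(** [S] is the graph of a partial ring map with dense domain, and [G] is its closure under limits,
    which exist by [sec_complete]. The last hypothesis gives both the independence of the
    approximating sequence and the continuity. *)
Lemma dense_extend (B : topComRingType) (J : set B) W (oW : open W)
    (S : B -> sec W -> Prop) : adic_topology J -> 
  S 1 1 -> (forall b g b' g', S b g -> S b' g' -> S (b - b') (g - g')) ->
  (forall b g b' g', S b g -> S b' g' -> S (b * b') (g * g')) ->
  (forall b n, exists b' g, S b' g /\ ideal_pow J n (b' - b)) ->
  (forall b g, (forall n, S (b n) (g n)) -> tz b -> tz g) ->
  exists f : {rmorphism B -> sec W}, continuous f /\ forall b g, S b g -> f b = g.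
Proof.
move=> top S1 SB SM dense cont.
pose G b l := exists b' g', [/\ forall n, S (b' n) (g' n), lims b' b & lims g' l].
have GB b g b' g' : G b g -> G b' g' -> G (b - b') (g - g').
  move=> [c [d [h1 h2 h3]]] [c' [d' [h1' h2' h3']]].
  exists (fun n => c n - c' n), (fun n => d n - d' n).
  by split=> [n||]; [exact: SB|exact: limsB|exact: limsB].
have SG b g : S b g -> G b g.
  by exists (fun=> b), (fun=> g); split=> //; exact: lims_cst.
have fct b g g' : G b g -> G b g' -> g = g'.
  move=> h /(GB _ _ _ _ h); rewrite subrr => -[c [d [h1 h2 h3]]].
  apply/eqP; rewrite -subr_eq0; apply/eqP/(lims0 oW h3); apply: cont h1 _.
  by apply: eq_tz h2 => k; rewrite subr0.
have [||||f hf] := @hom_of_rel _ _ G _ fct.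
- move=> b; have /choice [b' hb'] := dense b; have /choice [g hg] := hb'.
  have tb : lims b' b by apply: tz_pow top _ => k; case: (hg k).
  have [|l hl] := @sec_complete W oW g.
    apply: (cont (fun n => b' n.+1 - b' n)).
      by move=> n; apply: SB; case: (hg n) => //; case: (hg n.+1).
    by apply: eq_tz (tzB (lims_shift 1 tb) tb) => k; rewrite addn1; ring.
  by exists l, b', g; split=> // n; case: (hg n).
- exact: SG.
- exact: GB.
- move=> b g b' g' [c [d [h1 h2 h3]]] [c' [d' [h1' h2' h3']]].
  exists (fun n => c n * c' n), (fun n => d n * d' n); split=> [n||]; [exact: SM| |exact: limsM].
  apply/(tz_adic _ top) => n.
  have /(tz_adic _ top)/(_ n) [K hK] := h2; have /(tz_adic _ top)/(_ n) [L hL] := h2'.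
  exists (maxn K L) => k; rewrite geq_max => /andP [/hK x1 /hL x2].
  have -> : c k * c' k - b * b' = c' k * (c k - b) + b * (c' k - b') by ring.
  by apply: idealD => //; exact: idealM.
exists f; split=> [|b g Sbg]; last by apply: fct (hf b) _; exact: SG.
apply: (seqcont_cont top) => u tu; apply: (tz_loc oW) => x Wx.
have [U [I [aI Ux UW]]] := affine_nbhd oW Wx.
exists U, (affine_open aI), UW; split=> //.
have topI := affine_top aI.
(* Each [u k] is replaced by an element of the domain of [S] that is k-close to it and whose value
   is k-close to [f (u k)]; for these the hypothesis on [S] applies. *)
have /choice [b hb] : forall k, exists b, exists g, [/\ S b g, ideal_pow J k (b - u k) &
   ideal_pow I k (res oW (affine_open aI) UW (g - f (u k)))].
  move=> k; have [b [g [h1 h2 h3]]] := hf (u k).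
  have /(tz_adic _ top)/(_ k) [K hK] := h2.
  have /(tz_adic _ topI)/(_ k) [L hL] := tz_res oW (affine_open aI) UW h3.
  exists (b (maxn K L)), (g (maxn K L)); split=> //.
    by apply: hK; exact: leq_maxl.
  by apply: hL; exact: leq_maxr.
have {hb} /choice [g hg] := hb.
have tg : tz g.
  apply: (cont b) => [n|]; first by case: (hg n).
  have hbu : tz (fun k => b k - u k) by apply: tz_pow top _ => k; case: (hg k).
  by apply: eq_tz (tzD hbu tu) => k; ring.
have t2 : tz (fun k => res oW (affine_open aI) UW (g k - f (u k))).
  by apply: tz_pow topI _ => k; case: (hg k).
by apply: eq_tz (tzB (tz_res oW (affine_open aI) UW tg) t2) => k; rewrite rmorphB; ring.
Qed.

End FormalSections.

Arguments comap_res [X Y] m [U V] oU oV VU VU' s.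

Arguments comap_to [X Y] f [U V] oU oV UV.

(** * Equality of morphisms and pullback of sections *)

Lemma rmorph_eq (A B : pzRingType) (f g : {rmorphism A -> B}) : f =1 g -> f = g.
Proof.
case: f g => f cf [g cg] /= fg; have e : f = g by apply: funext.
case: _ / e in cg fg *; congr GRing.RMorphism.Pack.
case: cf cg => [[a] [b]] [[c] [d]].
by rewrite (Prop_irrelevance a c) (Prop_irrelevance b d).
Qed.

Lemma mor_ext (X Y : ringedSpace) (f g : mor X Y) : (forall p, f p = g p) ->
  (forall V (oV : open V) (s : sec V) p, V (f p) ->
     exists W (oW : open W) (Wf : W `<=` f @^-1` V) (Wg : W `<=` g @^-1` V),
       W p /\ res (mor_open f oV) oW Wf (comap f oV s) =
              res (mor_open g oV) oW Wg (comap g oV s)) -> f = g.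
Proof.
case: f g => f fo fc fcc fcr fl [g go gc gcc gcr gl] /= fg.
have e : f = g by apply: funext.
case: _ / e in go gc gcc gcr gl fg * => h.
have eo : fo = go by exact: Prop_irrelevance.
case: _ / eo in gc gcc gcr gl h *.
have ec : fc = gc.
  apply: functional_extensionality_dep => V; apply: functional_extensionality_dep => oV.
  apply: rmorph_eq => s; apply: (sec_sep_pt (fo _ oV)) => p /(h V oV s) [W [oW [Wf [Wg [Wp e]]]]].
  by exists W, oW, Wf; split=> //; rewrite e; exact: resP.
case: _ / ec in gcc gcr gl h *.
by rewrite (Prop_irrelevance gcc fcc) (Prop_irrelevance gcr fcr) (Prop_irrelevance gl fl).
Qed.

Lemma mor_ext' (X Y : ringedSpace) (f g : mor X Y) (e : forall p, f p = g p) :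
  (forall V (oV : open V) (s : sec V) (fg : f @^-1` V `<=` g @^-1` V),
     comap f oV s = res (mor_open g oV) (mor_open f oV) fg (comap g oV s)) -> f = g.
Proof.
move=> h; apply: mor_ext => // V oV s p Vp.
have fg : f @^-1` V `<=` g @^-1` V by move=> q; rewrite /preimage /= e.
exists (f @^-1` V), (mor_open f oV), (@subset_refl _ _), fg; split=> //.
by rewrite res_id.
Qed.

Section MorBasics.
Variables X Y Z W : ringedSpace.

Lemma compmA (h : mor Z W) (g : mor Y Z) (f : mor X Y) : compm h (compm g f) = compm (compm h g) f.
Proof. by apply: mor_ext' => // V oV s fg; rewrite res_id. Qed.

Lemma comp1m (f : mor X Y) : compm (idm Y) f = f.
Proof. by apply: mor_ext' => // V oV s fg; rewrite res_id. Qed.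

Lemma compm1 (f : mor X Y) : compm f (idm X) = f.
Proof. by apply: mor_ext' => // V oV s fg; rewrite res_id. Qed.

Lemma comap_unit (f : mor X Y) V (oV : open V) (s : sec V) x : V (f x) ->
  unit_at (comap f oV s) x <-> unit_at s (f x).
Proof.
move=> Vx; split; first exact: mor_local.
move=> [U [oV' [oU [UV [Ux us]]]]].
have fUV : f @^-1` U `<=` f @^-1` V by move=> y; exact: UV.
exists (f @^-1` U), (mor_open f oV), (mor_open f oU), fUV; split=> //.
rewrite -(comap_res f oV oU UV fUV); apply: is_unit_map.
by move: us; rewrite (resP _ oV _ oU _ UV).
Qed.

Lemma comap_toE (f : mor X Y) (U : set X) (V : set Y) (oU : open U) (oV : open V)
   (UV : U `<=` f @^-1` V) s : comap_to f oU oV UV s = res (mor_open f oV) oU UV (comap f oV s).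
Proof. by []. Qed.

Lemma comap_to_cont (f : mor X Y) (U : set X) (V : set Y) (oU : open U) (oV : open V)
   (UV : U `<=` f @^-1` V) : continuous (comap_to f oU oV UV).
Proof.
move=> s; apply: (@continuous_comp _ _ _ (comap f oV)); first exact: comap_continuous.
exact: res_continuous.
Qed.

Lemma comap_to_unit (f : mor X Y) (U : set X) (V : set Y) (oU : open U) (oV : open V)
   (UV : U `<=` f @^-1` V) s x : U x -> unit_at (comap_to f oU oV UV s) x <-> unit_at s (f x).
Proof.
move=> Ux; rewrite comap_toE; split.
  by move=> /(unit_atW (mor_open f oV) oU UV _ Ux)/comap_unit; apply; exact: UV.
by move=> us; apply/(unit_atW (mor_open f oV) oU UV _ Ux)/comap_unit => //; exact: UV.
Qed.

Lemma comap_to_res (f : mor X Y) (U U' : set X) (V V' : set Y) (oU : open U) (oV : open V)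
   (oU' : open U') (oV' : open V') (UV : U `<=` f @^-1` V) (UV' : U' `<=` f @^-1` V')
   (VV : V' `<=` V) (UU : U' `<=` U) s :
   comap_to f oU' oV' UV' (res oV oV' VV s) = res oU oU' UU (comap_to f oU oV UV s).
Proof.
rewrite !comap_toE; have fVV : f @^-1` V' `<=` f @^-1` V by move=> y; exact: VV.
have UfV : U' `<=` f @^-1` V by move=> y /UV' /VV.
by rewrite (comap_res f oV oV' VV fVV) !(res_res _ _ _ _ _ UfV).
Qed.

Lemma comap_toP (f : mor X Y) (U : set X) (V : set Y) (oU oU' : open U) (oV oV' : open V)
   (UV UV' : U `<=` f @^-1` V) s : comap_to f oU oV UV s = comap_to f oU' oV' UV' s.
Proof.
by rewrite (Prop_irrelevance oU oU') (Prop_irrelevance oV oV') (Prop_irrelevance UV UV').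
Qed.

Lemma comap_to_comp (g : mor Y Z) (f : mor X Y) (U : set X) (V : set Y) (O : set Z) (oU : open U)
  (oV : open V) (oO : open O) (UV : U `<=` f @^-1` V) (VO : V `<=` g @^-1` O)
  (UO : U `<=` (compm g f) @^-1` O) s :
  comap_to (compm g f) oU oO UO s = comap_to f oU oV UV (comap_to g oV oO VO s).
Proof.
rewrite !comap_toE /=.
have fg : f @^-1` V `<=` f @^-1` (g @^-1` O) by move=> y; exact: VO.
by rewrite (comap_res f (mor_open g oO) oV VO fg) (res_res _ _ _ _ _ UO).
Qed.

Lemma comap_to_id (U V : set X) (oU : open U) (oV : open V) (UV : U `<=` (idm X) @^-1` V) s :
  comap_to (idm X) oU oV UV s = res oV oU UV s.
Proof. exact: resP. Qed.

End MorBasics.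

Lemma affine_pt_uniq (Y : ringedSpace) (U : set Y) (I : set (sec U)) (aI : affine I) y y' :
  U y -> U y' -> (forall c : sec U, unit_at c y <-> unit_at c y') -> y = y'.
Proof.
move=> Uy Uy' h; have [Vp IV] := affine_vanishing aI Uy.
have [z [_ uz]] := affine_prime aI Vp IV.
rewrite -(uz y) //; apply: uz; split=> //.
by apply/seteqP; split=> c nc /h.
Qed.

Lemma loc_dense (Y : ringedSpace) (U : set Y) (I : set (sec U)) (aI : affine I)
  (c : sec U) W (oU : open U) (oW : open W) (WU : W `<=` U) (e : W = basic_open c) (b : sec W) n :
  exists f d b', [/\ W `<=` basic_open f, res oU oW WU f * b' = res oU oW WU d &
     ideal_pow (ideal_span (res oU oW WU @` I)) n (b' - b)].
Proof.
have [_ _ /(_ n) [_ /(_ b) [k [d hd]] _]] := affine_loc aI oU oW WU e.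
have [v hv] : is_unit (res oU oW WU c ^+ k) by apply: unitX; apply: res_unit; rewrite e.
exists (c ^+ k), d, (v * res oU oW WU d); split.
- by move=> y; rewrite e; apply: unit_atX.
- by rewrite rmorphXn mulrA hv mul1r.
- have -> : v * res oU oW WU d - b = - v * (res oU oW WU c ^+ k * b - res oU oW WU d).
    by ring: hv.
  exact: idealM.
Qed.

(** * Morphisms into an affine open correspond to continuous ring maps *)

Section HomAffine.
Variables (T : formalScheme) (Y : ringedSpace) (U : set Y) (I : set (sec U)).
Hypotheses (lrY : locally_ringed Y) (aI : affine I).
Let oU := affine_open aI.

(** Points of [U] are told apart by the functions that are units there, and over a basic open the
    sections are limits of fractions, whose pullbacks are determined by numerator and
    denominator. *)
Lemma hom_affine_uniq (f g : mor T Y) (fU : setT `<=` f @^-1` U) (gU : setT `<=` g @^-1` U) :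
  comap_to f openT oU fU =1 comap_to g openT oU gU -> f = g.
Proof.
move=> fg.
have pfg p : f p = g p.
  apply: (affine_pt_uniq aI (fU p Logic.I) (gU p Logic.I)) => c.
  rewrite -(comap_to_unit openT oU fU c Logic.I) -(comap_to_unit openT oU gU c Logic.I).
  by rewrite fg.
apply: mor_ext => // V oV s p Vp.
have [c [uc cV]] := affine_basis aI oV Vp (fU p Logic.I).
have oc := basic_open_open c; have cU := @basic_open_sub _ _ c.
set D := basic_open c in oc cU *.
have Df : f @^-1` D `<=` f @^-1` D by [].
have Dg : f @^-1` D `<=` g @^-1` D by move=> q; rewrite /preimage /= pfg.
have ofD := mor_open f oc.
have fV : f @^-1` D `<=` f @^-1` V by move=> q /cV.
have gV : f @^-1` D `<=` g @^-1` V by move=> q /Dg /cV.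
exists (f @^-1` D), ofD, fV, gV; split=> //.
have key (b : sec D) : comap_to f ofD oc Df b = comap_to g ofD oc Dg b.
  have top := affine_top (affine_basic_aux aI lrY oU oc cU erefl).
  have /choice [b' hb'] : forall n, exists b', (exists e d, D `<=` basic_open e /\
    res oU oc cU e * b' = res oU oc cU d) /\
     ideal_pow (ideal_span (res oU oc cU @` I)) n (b' - b).
    move=> n; have [e [d [b' [h1 h2 h3]]]] := loc_dense aI oU oc cU erefl b n.
    by exists b'; split=> //; exists e, d.
  have lb : lims b' b by apply: tz_pow top _ => n; case: (hb' n).
  apply: (@lims_uniq _ _ ofD (comap_to f ofD oc Df \o b')).
    by apply: lims_map lb; exact: comap_to_cont.
  have lg : lims (comap_to g ofD oc Dg \o b') (comap_to g ofD oc Dg b).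
    by apply: lims_map lb; exact: comap_to_cont.
  apply: eq_tz lg => n /=; congr (_ - _).
  have [[e [d [De ed]]] _] := hb' n.
  have rE (z : sec U) : comap_to f ofD oc Df (res oU oc cU z) = comap_to g ofD oc Dg (res oU oc cU z).
    rewrite (comap_to_res openT oU ofD oc fU Df cU (@subsetT _ _)).
    by rewrite fg -(comap_to_res openT oU ofD oc gU Dg cU (@subsetT _ _)).
  have ue : is_unit (comap_to f ofD oc Df (res oU oc cU e)).
    by apply: is_unit_map; exact: res_unit.
  by apply: (unit_inj ue); rewrite {1}rE -!rmorphM ed rE.
have rf := comap_to_res (mor_open f oV) oV ofD oc (@subset_refl _ _) Df cV fV s.
have rg := comap_to_res (mor_open g oV) oV ofD oc (@subset_refl _ _) Dg cV gV s.
rewrite -{}key {}rf !comap_toE !res_id in rg.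
exact: rg.
Qed.

Variable phi : {rmorphism sec U -> sec [set: T]}.
Hypothesis cphi : continuous phi.

(** The inverse image under [phi] of the prime of [p] contains [I]: powers of an element of [I] tend
    to 0, hence so do those of its image, which therefore vanishes at [p]. *)
Let pt_ex p : exists y, U y /\ forall c, unit_at c y <-> unit_at (phi c) p.
Proof.
have pp : prime_ideal (phi @^-1` vanishing p).
  exact: (preim_prime phi (vanishing_prime (@fs_local T) openT Logic.I)).
have [|y [[Uy e] _]] := affine_prime aI pp.
  move=> c Ic; suff : nil (phi c) by apply.
  apply: tz_nil; first exact: openT.
  have : tz (fun k => c ^+ k).
    by apply: tz_pow (affine_top aI) _ => k; exact: powX.
  by move=> /(tz_map cphi); apply: eq_tz => k /=; rewrite rmorphXn.
exists y; split=> // c.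
have ec : vanishing y c <-> vanishing p (phi c).
  by rewrite -[X in X <-> _](_ : (phi @^-1` vanishing p) c = _) // e.
by split=> uc; apply: contrapT => nu; [have /ec := nu|have /ec := nu]; apply.
Qed.

Let f p : Y := sval (cid (pt_ex p)).
Let fU p : U (f p). Proof. by rewrite /f; case: cid => y /= []. Qed.
Let fE p c : unit_at c (f p) <-> unit_at (phi c) p.
Proof. by rewrite /f; case: cid => y /= []. Qed.

Let f_open V : open V -> open (f @^-1` V).
Proof.
move=> oV; rewrite openE => p Vp.
have [c [uc cV]] := affine_basis aI oV Vp (fU p).
rewrite /interior nbhsE; exists (basic_open (phi c)).
  by split; [exact: basic_open_open|apply/fE].
by move=> q /fE /cV.
Qed.

Let oT : open [set: T] := openT.

(** The fraction [d / e] over [W] is sent to [phi d / phi e]. Such fractions are dense, and the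
    comorphism is the continuous extension. *)
Let S W (oW : open W) (WU : W `<=` U) (b : sec W) (g : sec (f @^-1` W)) :=
  exists e d : sec U, [/\ W `<=` basic_open e, res oU oW WU e * b = res oU oW WU d &
    res oT (f_open oW) (@subsetT _ _) (phi e) * g = res oT (f_open oW) (@subsetT _ _) (phi d)].

Let phi_unit W (oW : open W) e : W `<=` basic_open e ->
  is_unit (res oT (f_open oW) (@subsetT _ _) (phi e)).
Proof. by move=> We; apply: res_unit => p /We /fE. Qed.

Let S1 W (oW : open W) (WU : W `<=` U) : S oW WU 1 1.
Proof. by exists 1, 1; split; rewrite ?mulr1 // basic_open1. Qed.

Let SB W (oW : open W) (WU : W `<=` U) b g b' g' :
  S oW WU b g -> S oW WU b' g' -> S oW WU (b - b') (g - g').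
Proof.
move=> [e [d [h1 h2 h3]]] [e' [d' [h1' h2' h3']]].
exists (e * e'), (e' * d - e * d'); split.
- by rewrite basic_openM => x Wx; split; [exact: h1|exact: h1'].
- by rewrite rmorphB !rmorphM -h2 -h2'; ring.
- by rewrite !rmorphB !rmorphM -h3 -h3'; ring.
Qed.

Let SM W (oW : open W) (WU : W `<=` U) b g b' g' :
  S oW WU b g -> S oW WU b' g' -> S oW WU (b * b') (g * g').
Proof.
move=> [e [d [h1 h2 h3]]] [e' [d' [h1' h2' h3']]].
exists (e * e'), (d * d'); split.
- by rewrite basic_openM => x Wx; split; [exact: h1|exact: h1'].
- by rewrite !rmorphM -h2 -h2'; ring.
- by rewrite !rmorphM -h3 -h3'; ring.
Qed.

Let Sdense W (oW : open W) (WU : W `<=` U) (c : sec U) (e : W = basic_open c) (b : sec W) n :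
  exists b' g, S oW WU b' g /\ ideal_pow (ideal_span (res oU oW WU @` I)) n (b' - b).
Proof.
have [a [d [b' [h1 h2 h3]]]] := loc_dense aI oU oW WU e b n.
have [v hv] := phi_unit oW h1.
exists b', (v * res oT (f_open oW) (@subsetT _ _) (phi d)); split=> //.
by exists a, d; split=> //; rewrite mulrA hv mul1r.
Qed.

(** If the fraction [d / e] is small, then [c ^+ l * d] lies in a high power of [I] by the kernel
    clause of [is_loc]; its image is small, and [phi c] and [phi e] are units over the preimage of
    [W]. *)
Let Scont W (oW : open W) (WU : W `<=` U) (c : sec U) (ec : W = basic_open c) b g :
  (forall n, S oW WU (b n) (g n)) -> tz b -> tz g.
Proof.
move=> hS tb.
have [_ top loc] := affine_loc aI oU oW WU ec.
have oF := f_open oW.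
apply: (tz_loc (f_open oW)) => p Wp; have [V [K [aK Vp VW]]] := affine_nbhd oF Wp.
exists V, (affine_open aK), VW; split=> //.
apply/(tz_adic _ (affine_top aK)) => n.
pose r := res oT (affine_open aK) (@subsetT _ V).
have [N hN] : exists N, forall x, ideal_pow I N x -> ideal_pow K n (r (phi x)).
  have : nbhs 0 (phi @^-1` [set z | ideal_pow K n (r z)]).
    have /cont0P : continuous (res oT (affine_open aK) (@subsetT _ V)) by exact: res_continuous.
    move=> /(_ (ideal_pow K n)) h.
    apply: (cont0P phi).1 => //; apply: h.
    by apply/(nbhs_adic (affine_top aK)); exists n.
  by move=> /(nbhs_adic (affine_top aI)) [N hN]; exists N => x /hN.
have /(tz_adic _ top)/(_ N) [M hM] := tb.
exists M => k /hM hk; have [e [d [h1 h2 h3]]] := hS k.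
have [_ _ /(_ d)] := loc N; rewrite -h2 => -[|l hl]; first exact: idealM.
have hd := hN _ hl.
have Vc : V `<=` basic_open (phi c) by move=> q /VW /=; rewrite /preimage /= ec => /fE.
have rE z : res (f_open oW) (affine_open aK) VW (res oT (f_open oW) (@subsetT _ _) z) = r z.
  by rewrite /r; exact: res_res.
have e3 : r (phi e) * res (f_open oW) (affine_open aK) VW (g k) = r (phi d).
  by rewrite -!rE -rmorphM h3.
have : ideal_pow K n (r (phi (c ^+ l * e)) * res (f_open oW) (affine_open aK) VW (g k)).
  have -> : r (phi (c ^+ l * e)) * res (f_open oW) (affine_open aK) VW (g k) =
     r (phi (c ^+ l * d)) by rewrite !rmorphM -mulrA e3.
  exact: hd.
apply: unit_ideal => //; rewrite !rmorphM; apply: unitM.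
  by rewrite !rmorphXn; apply: unitX; exact: res_unit.
by apply: res_unit => q /VW /h1 /fE.
Qed.

Let theta_ex (c : sec U) : exists th : {rmorphism sec (basic_open c) -> sec (f @^-1` basic_open c)},
  continuous th /\ forall b g, S (basic_open_open c) (@basic_open_sub _ _ c) b g -> th b = g.
Proof.
have top := affine_top (affine_basic_aux aI lrY oU (basic_open_open c) (@basic_open_sub _ _ c) erefl).
apply: (dense_extend (f_open (basic_open_open c)) top).
- exact: S1.
- exact: SB.
- exact: SM.
- move=> b n; exact: Sdense.
- move=> b g; exact: (Scont (c := c)).
Qed.

Let th c := sval (cid (theta_ex c)).
Let th_cont c : continuous (th c). Proof. by rewrite /th; case: cid => ? []. Qed.
Let thS c b g : S (basic_open_open c) (@basic_open_sub _ _ c) b g -> th c b = g.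
Proof. by rewrite /th; case: cid => ? [? h]; exact: h. Qed.

Let th_res (c c' : sec U) (cc : basic_open c' `<=` basic_open c) (fcc : f @^-1` basic_open c' `<=` f @^-1` basic_open c) b :
  res (f_open (basic_open_open c)) (f_open (basic_open_open c')) fcc (th c b) =
  th c' (res (basic_open_open c) (basic_open_open c') cc b).
Proof.
have top := affine_top (affine_basic_aux aI lrY oU (basic_open_open c) (@basic_open_sub _ _ c) erefl).
have /choice [b' hb'] := Sdense (basic_open_open c) (@basic_open_sub _ _ c) erefl b.
have {hb'} /choice [g hg] := hb'.
have lb : lims b' b by apply: tz_pow top _ => n; case: (hg n).
apply: (@lims_uniq _ _ (f_open (basic_open_open c'))
  (fun n => res (f_open (basic_open_open c)) (f_open (basic_open_open c')) fcc (th c (b' n)))).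
  apply: (lims_map (u := fun n => th c (b' n))); first exact: res_continuous.
  exact: (lims_map (th_cont (c := c)) lb).
have : lims (fun n => th c' (res (basic_open_open c) (basic_open_open c') cc (b' n)))
   (th c' (res (basic_open_open c) (basic_open_open c') cc b)).
  apply: (lims_map (u := fun n => res (basic_open_open c) (basic_open_open c') cc (b' n))).
    exact: th_cont.
  by apply: (lims_map (u := b')) => //; exact: res_continuous.
apply: eq_tz => n; congr (_ - _); have [Sn _] := hg n.
rewrite (thS Sn); apply: thS; have [e [d [h1 h2 h3]]] := Sn.
exists e, d; split; first exact: subset_trans h1.
  have := congr1 (res (basic_open_open c) (basic_open_open c') cc) h2.
  by rewrite rmorphM !(res_res _ _ _ _ _ (@basic_open_sub _ _ c')).
have := congr1 (res (f_open (basic_open_open c)) (f_open (basic_open_open c')) fcc) h3.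
by rewrite rmorphM !(res_res _ _ _ _ _ (@subsetT _ _)).
Qed.

Let Rel V (oV : open V) (s : sec V) (t : sec (f @^-1` V)) :=
  forall (c : sec U) (cV : basic_open c `<=` V) (fcV : f @^-1` basic_open c `<=` f @^-1` V),
    res (f_open oV) (f_open (basic_open_open c)) fcV t = th c (res oV (basic_open_open c) cV s).

Let Rel_fct V (oV : open V) s t t' : Rel oV s t -> Rel oV s t' -> t = t'.
Proof.
move=> h h'; apply: (sec_sep_pt (f_open oV)) => p Vp.
have [c [uc cV]] := affine_basis aI oV Vp (fU p).
have fcV : f @^-1` basic_open c `<=` f @^-1` V by move=> q /cV.
exists (f @^-1` basic_open c), (f_open (basic_open_open c)), fcV; split=> //.
by rewrite (h c cV) (h' c cV).
Qed.

Let Rel_tot V (oV : open V) s : exists t, Rel oV s t.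
Proof.
pose K := {c : sec U | basic_open c `<=` V}.
have fcV (k : K) : f @^-1` basic_open (sval k) `<=` f @^-1` V by move=> q; exact: (svalP k).
have oK (k : K) := f_open (basic_open_open (sval k)).
have [||t ht] := @sec_glue T (f @^-1` V) (f_open oV) K (fun k => f @^-1` basic_open (sval k))
  oK fcV (fun k => th (sval k) (res oV (basic_open_open (sval k)) (svalP k) s)).
- move=> p Vp; have [c [uc cV]] := affine_basis aI oV Vp (fU p).
  by exists (exist _ c cV).
- move=> [c cV] [c' cV'] W oW /= Wc Wc'; pose c2 := c * c'.
  have cc : basic_open c2 `<=` basic_open c by move=> y /unit_atM [].
  have cc' : basic_open c2 `<=` basic_open c' by move=> y /unit_atM [].
  have fcc : f @^-1` basic_open c2 `<=` f @^-1` basic_open c by move=> y /cc.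
  have fcc' : f @^-1` basic_open c2 `<=` f @^-1` basic_open c' by move=> y /cc'.
  have Wc2 : W `<=` f @^-1` basic_open c2.
    by move=> y Wy; apply/unit_atM; split; [exact: Wc|exact: Wc'].
  have c2V : basic_open c2 `<=` V by move=> y /cc /cV.
  rewrite -(res_res (oK (exist _ c cV)) (f_open (basic_open_open c2)) oW fcc Wc2).
  rewrite -(res_res (oK (exist _ c' cV')) (f_open (basic_open_open c2)) oW fcc' Wc2).
  congr (res _ _ _ _).
  rewrite (resP _ (f_open (basic_open_open c)) _ (f_open (basic_open_open c2)) _ fcc) (th_res cc).
  rewrite (resP _ (f_open (basic_open_open c')) _ (f_open (basic_open_open c2)) _ fcc') (th_res cc').
  by rewrite !(res_res _ _ _ _ _ c2V).
exists t => c cV fcV'; apply: (etrans (etrans _ (ht (exist _ c cV)))); first exact: resP.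
by congr (th c _); exact: resP.
Qed.

Let cm_ex V (oV : open V) : exists F : {rmorphism sec V -> sec (f @^-1` V)}, forall s, Rel oV s (F s).
Proof.
apply: hom_of_rel.
- exact: Rel_tot.
- exact: Rel_fct.
- by move=> c cV fcV; rewrite !rmorph1.
- by move=> s t s' t' h h' c cV fcV; rewrite !rmorphB (h c cV) (h' c cV).
- by move=> s t s' t' h h' c cV fcV; rewrite !rmorphM (h c cV) (h' c cV).
Qed.

Let cm V (oV : open V) := sval (cid (cm_ex oV)).
Let cmR V (oV : open V) s : Rel oV s (cm oV s). Proof. by rewrite /cm; case: cid. Qed.

Let cm_cont V (oV : open V) : continuous (cm oV).
Proof.
apply: (cont_loc (f_open oV)) => p Vp.
have [c [uc cV]] := affine_basis aI oV Vp (fU p).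
have fcV : f @^-1` basic_open c `<=` f @^-1` V by move=> q /cV.
exists (f @^-1` basic_open c), (f_open (basic_open_open c)), fcV; split=> // N N0.
have := (cont0P (res oV (basic_open_open c) cV)).1 (@res_continuous _ _ _ _ _ _) _
  ((cont0P (th c)).1 (th_cont (c := c)) _ N0).
by apply: filterS => b /=; rewrite /preimage /= (cmR oV b cV).
Qed.

Let cm_res V W (oV : open V) (oW : open W) (WV : W `<=` V) (WV' : f @^-1` W `<=` f @^-1` V) s :
  cm oW (res oV oW WV s) = res (f_open oV) (f_open oW) WV' (cm oV s).
Proof.
apply: (Rel_fct (cmR oW (res oV oW WV s))) => c cW fcW.
have cV : basic_open c `<=` V by move=> y /cW /WV.
have fcV : f @^-1` basic_open c `<=` f @^-1` V by move=> y /cV.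
by rewrite !(res_res _ _ _ _ _ cV) !(res_res _ _ _ _ _ fcV); exact: cmR.
Qed.

(** Over a basic open the section is congruent to a fraction modulo the ideal of definition. The
    difference pulls back to a nil section, so only the numerator matters, and for functions on [U]
    the claim is [fE]. *)
Let cm_local V (oV : open V) (s : sec V) p : V (f p) -> unit_at (cm oV s) p -> unit_at s (f p).
Proof.
move=> Vp us; have [c [uc cV]] := affine_basis aI oV Vp (fU p).
have fcV : f @^-1` basic_open c `<=` f @^-1` V by move=> q /cV.
pose oc := basic_open_open c.
have {us} : unit_at (res (f_open oV) (f_open oc) fcV (cm oV s)) p by apply/unit_atW.
rewrite (cmR oV s cV fcV) => us; apply/(unit_atW oV oc cV s uc).
move: (res oV _ cV s) us => b us.
have [a [d [b' [h1 h2 h3]]]] := loc_dense aI oU oc (@basic_open_sub _ _ c) erefl b 1.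
have aJ := affine_basic_aux aI lrY oU oc (@basic_open_sub _ _ c) erefl.
rewrite (pow1 (affine_ideal aJ)) in h3.
have [v hv] := phi_unit oc h1.
pose g := v * res oT (f_open oc) (@subsetT _ _) (phi d).
have Sb : S oc (@basic_open_sub _ _ c) b' g.
  by exists a, d; split=> //; rewrite mulrA hv mul1r.
have nb : nil (th c (b' - b)).
  apply: tz_nil; first exact: f_open.
  have : tz (fun k => (b' - b) ^+ k) by apply: tz_pow (affine_top aJ) _ => k; exact: powX.
  by move=> /(tz_map (th_cont (c := c))); apply: eq_tz => k /=; rewrite rmorphXn.
have ug : unit_at g p.
  have [iv _ _] := vanishing_prime (@fs_local T) (f_open oc) (uc : (f @^-1` basic_open c) p).
  apply: contrapT => ng; have := idealB iv ng (nb p).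
  by rewrite -(thS Sb) rmorphB opprB addrC subrK; apply.
apply: (van_congr aJ h3).
have ud : unit_at d (f p).
  apply/fE; apply/(unit_atW oT (f_open oc) (@subsetT _ _) _ (uc : (f @^-1` basic_open c) p)).
  have : unit_at (res oT (f_open oc) (@subsetT _ _) (phi a) * g) p.
    by apply/unit_atM; split=> //; apply: unit_unit_at; [exact: f_open|exact: uc|exact: phi_unit].
  by rewrite /g mulrA hv mul1r.
have : unit_at (res oU oc (@basic_open_sub _ _ c) d) (f p) by apply/unit_atW.
by rewrite -h2 => /unit_atM [].
Qed.

Lemma hom_affine_ex : exists (F : mor T Y) (FU : setT `<=` F @^-1` U),
  forall s, comap_to F openT oU FU s = phi s.
Proof.
pose F := Mor cm_cont cm_res cm_local.
have FU : setT `<=` F @^-1` U by move=> p _; exact: fU.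
exists F, FU => s; rewrite comap_toE /=.
pose oc := basic_open_open (1 : sec U).
have c1 : setT `<=` f @^-1` basic_open (1 : sec U).
  by move=> p _; apply: unit_at1 => //; exact: fU.
have fcU : f @^-1` basic_open (1 : sec U) `<=` f @^-1` U by move=> p _; exact: fU.
have cU := @basic_open_sub _ _ (1 : sec U).
rewrite -(res_res (f_open oU) (f_open oc) openT fcU c1).
rewrite (resP _ (f_open oU) _ (f_open (basic_open_open 1)) _ fcU) (cmR oU s cU).
have -> : th 1 (res oU (basic_open_open 1) cU s) = res oT (f_open oc) (@subsetT _ _) (phi s).
  apply: thS; exists 1, s; split; rewrite ?rmorph1 ?mul1r //; exact: resP.
by rewrite (res_res _ _ _ _ _ (@subset_refl _ _)) res_id.
Qed.

End HomAffine.

Arguments comap_unit [X Y] f [V] oV s [x] _.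

(** * Ring topologies from a basis of neighbourhoods of 0 *)

Record nbase (A : comPzRingType) := NBase {
  nb : set (set A);
  nb_ex : exists N, nb N;
  nb_0 : forall N, nb N -> N 0;
  nb_I : forall N M, nb N -> nb M -> exists2 K, nb K & K `<=` N `&` M;
  nb_B : forall N, nb N -> exists2 M, nb M & forall x y, M x -> M y -> N (x - y);
  nb_Z : forall N a, nb N -> exists2 M, nb M & forall x, M x -> N (a * x);
  nb_M : forall N, nb N -> exists2 M, nb M & forall x y, M x -> M y -> N (x * y) }.

(** A copy of [A] that mentions the basis, so that the topology can be attached to it as a canonical
    structure. *)
Definition topd (A : comPzRingType) (B : nbase A) : Type := A.

Section Topd.
Variables (A : comPzRingType) (B : nbase A).

HB.instance Definition _ := GRing.ComPzRing.on (topd B).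

Let nbh (x : topd B) : set_system (topd B) :=
  [set S | exists2 N, nb B N & forall y, N y -> S ((x : A) + y)].

Let nbh_filter x : ProperFilter (nbh x).
Proof.
apply: Build_ProperFilter_ex.
  by move=> S [N BN h]; exists (x + 0); apply: h; exact: nb_0 BN.
split.
- by have [N BN] := nb_ex B; exists N.
- move=> S S' [N BN h] [N' BN' h']; have [K BK KN] := nb_I BN BN'.
  by exists K => // y /KN [/h ? /h' ?].
- by move=> S S' SS [N BN h]; exists N => // y /h /SS.
Qed.

Let nbh_sing x S : nbh x S -> S x.
Proof. by move=> [N BN h]; rewrite -[x]addr0; apply: h; exact: nb_0 BN. Qed.

Let nb_D N : nb B N -> exists2 M, nb B M & forall x y, M x -> M y -> N (x + y).
Proof.
move=> BN; have [M BM hM] := nb_B BN; have [M' BM' hM'] := nb_B BM.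
have [K BK KM] := nb_I BM BM'; exists K => // x y /KM [Mx _] /KM [_ My].
rewrite -[y]opprK; apply: hM => //; rewrite -[- y]add0r; apply: hM' => //.
exact: nb_0 BM'.
Qed.

Let nbh_nbh x S : nbh x S -> nbh x (nbh^~ S).
Proof.
move=> [N BN h]; have [M BM hM] := nb_D BN.
by exists M => // y My; exists M => // z Mz; rewrite -addrA; apply: h; exact: hM.
Qed.

HB.instance Definition _ := hasNbhs.Build (topd B) nbh.
HB.instance Definition _ := Nbhs_isNbhsTopological.Build (topd B) nbh_filter nbh_sing nbh_nbh.

Lemma nbhs_topd (x : topd B) (S : set (topd B)) :
  nbhs x S <-> exists2 N, nb B N & forall y : A, N y -> S (x + y).
Proof. by []. Qed.

Let sub_cont : continuous (fun x : topd B * topd B => x.1 - x.2).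
Proof.
move=> [x y] S [N BN h]; have [M BM hM] := nb_B BN.
exists ([set z | M (z - x)], [set z | M (z - y)]).
  by split; exists M => // z Mz; rewrite /= addrAC subrr add0r.
move=> [a b] [/= Ma Mb].
have -> : a - b = (x - y) + ((a - x) - (b - y)) by ring.
by apply: h; exact: hM.
Qed.

HB.instance Definition _ := PreTopologicalNmodule_isTopologicalZmodule.Build (topd B) sub_cont.

Let mul_cont : continuous (fun x : topd B * topd B => x.1 * x.2).
Proof.
move=> [x y] S [N BN h].
have [M BM hM] := nb_D BN; have [M' BM' hM'] := nb_D BM.
have [P BP hP] := nb_Z (x : A) BM'; have [Q BQ hQ] := nb_Z (y : A) BM'; have [R BR hR] := nb_M BM.
have [P' BP' hP'] := nb_I BP BR; have [Q' BQ' hQ'] := nb_I BQ BR.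
exists ([set z | Q' (z - x)], [set z | P' (z - y)]).
  by split; [exists Q'|exists P'] => // z Mz; rewrite /= addrAC subrr add0r.
move=> [a b] [/= /hQ' [Qa Ra] /hP' [Pb Rb]].
have -> : a * b = x * y + ((x * (b - y) + y * (a - x)) + (a - x) * (b - y)) by ring.
by apply: h; apply: hM; [apply: hM'; [exact: hP|exact: hQ]|exact: hR].
Qed.

HB.instance Definition _ := TopologicalZmodule_isTopologicalComRing.Build (topd B) mul_cont.

End Topd.

(** * Power series rings *)

Definition pser (A : Type) := nat -> A.

Section PserRing.
Variable A : comPzRingType.
Implicit Types (s t : pser A).

HB.instance Definition _ := gen_eqMixin (pser A).
HB.instance Definition _ := gen_choiceMixin (pser A).

Let addp s t : pser A := fun n => s n + t n.
Let oppp s : pser A := fun n => - s n.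
Let mulp s t : pser A := fun n => \sum_(i < n.+1) s i * t (n - i)%N.
Let onep : pser A := fun n => if n is 0%N then 1 else 0.

Let addpA : associative addp. Proof. by move=> s t u; apply: funext => n; exact: addrA. Qed.
Let addpC : commutative addp. Proof. by move=> s t; apply: funext => n; exact: addrC. Qed.
Let add0p : left_id (fun=> 0) addp. Proof. by move=> s; apply: funext => n; exact: add0r. Qed.
Let addNp : left_inverse (fun=> 0) oppp addp. Proof. by move=> s; apply: funext => n; exact: addNr. Qed.

HB.instance Definition _ := GRing.isZmodule.Build (pser A) addpA addpC add0p addNp.

Let mulpC : commutative mulp.
Proof.
move=> s t; apply: funext => n; rewrite /mulp (reindex_inj rev_ord_inj) /=.
by apply: eq_bigr => i _; rewrite mulrC subSS subKn // -ltnS.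
Qed.

Let mulpA : associative mulp.
Proof.
move=> p q r; apply: funext => i.
rewrite [RHS]/mulp /= {1}/mulp.
have rev u v n : mulp u v n = \sum_(j < n.+1) u (n - j)%N * v j.
  by rewrite mulpC /mulp; apply: eq_bigr => j _; rewrite mulrC.
rewrite -/(mulp (mulp p q) r i) rev.
pose coef3 j k := p j * (q (i - j - k)%N * r k).
transitivity (\sum_(j < i.+1) \sum_(k < i.+1 | (k <= i - j)%N) coef3 j k).
  apply: eq_bigr => /= j _; rewrite rev big_distrr /=.
  by rewrite (big_ord_narrow_leq (leq_subr _ _)).
rewrite (exchange_big_dep predT) //=; apply: eq_bigr => k _.
transitivity (\sum_(j < i.+1 | (j <= i - k)%N) coef3 j k).
  apply: eq_bigl => j; rewrite -ltnS -(ltnS j) -!subSn ?leq_ord //.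
  by rewrite -subn_gt0 -(subn_gt0 j) -!subnDA addnC.
rewrite (big_ord_narrow_leq (leq_subr _ _)) /mulp big_distrl /=.
by apply: eq_bigr => j _; rewrite /coef3 -!subnDA addnC mulrA.
Qed.

Let mul1p : left_id onep mulp.
Proof.
move=> s; apply: funext => n; rewrite /mulp big_ord_recl big1 ?addr0 ?subn0 ?mul1r //.
by move=> i _; rewrite mul0r.
Qed.

Let mulpDl : left_distributive mulp addp.
Proof.
move=> s t u; apply: funext => n; rewrite /mulp /addp -big_split.
by apply: eq_bigr => i _; rewrite mulrDl.
Qed.

HB.instance Definition _ := GRing.Zmodule_isComPzRing.Build (pser A) mulpA mulpC mul1p mulpDl.

Lemma pserD s t n : (s + t) n = s n + t n. Proof. by []. Qed.
Lemma pserB s t n : (s - t) n = s n - t n. Proof. by []. Qed.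
Lemma pser0 n : (0 : pser A) n = 0. Proof. by []. Qed.
Lemma pserM s t n : (s * t) n = \sum_(i < n.+1) s i * t (n - i)%N. Proof. by []. Qed.

Lemma pserM0 s t : (s * t) 0%N = s 0%N * t 0%N.
Proof. by rewrite pserM big_ord1. Qed.

Definition pconst (a : A) : pser A := fun n => if n is 0%N then a else 0.

Lemma pconstM (a : A) s n : (pconst a * s) n = a * s n.
Proof.
by rewrite pserM big_ord_recl big1 ?addr0 ?subn0 // => i _; rewrite mul0r.
Qed.

Let pconstB : zmod_morphism pconst.
Proof. by move=> a b; apply: funext => -[|n] //=; rewrite pserB subrr. Qed.
Let pconstMM : monoid_morphism pconst.
Proof.
split=> [|a b]; first by apply: funext => -[|n].
by apply: funext => n; rewrite pconstM; case: n => //= n; rewrite mulr0.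
Qed.
HB.instance Definition _ := GRing.isZmodMorphism.Build A (pser A) pconst pconstB.
HB.instance Definition _ := GRing.isMonoidMorphism.Build A (pser A) pconst pconstMM.

Definition pcoef0 s : A := s 0%N.
Let pcoef0B : zmod_morphism pcoef0. Proof. by []. Qed.
Let pcoef0M : monoid_morphism pcoef0. Proof. by split=> // s t; exact: pserM0. Qed.
HB.instance Definition _ := GRing.isZmodMorphism.Build (pser A) A pcoef0 pcoef0B.
HB.instance Definition _ := GRing.isMonoidMorphism.Build (pser A) A pcoef0 pcoef0M.

Definition pX : pser A := fun n => if n is 1%N then 1 else 0.

Lemma pXM s n : (pX * s) n = if n is n'.+1 then s n' else 0.
Proof.
rewrite pserM; case: n => [|n]; first by rewrite big_ord1 mul0r.
rewrite big_ord_recl mul0r add0r big_ord_recl /= mul1r subSS subn0 big1 ?addr0 //.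
by move=> i _; rewrite mul0r.
Qed.

Definition pshift s : pser A := fun n => s n.+1.

Lemma pser_recl s : s = pconst (s 0%N) + pX * pshift s.
Proof. by apply: funext => -[|n]; rewrite pserD pXM ?addr0 ?add0r. Qed.

Lemma pXnM s n k : (pX ^+ n * s) k = if (k < n)%N then 0 else s (k - n)%N.
Proof.
elim: n k => [|n IH] k; first by rewrite expr0 mul1r subn0.
by rewrite exprS -mulrA pXM; case: k => [|k] //; rewrite IH ltnS subSS.
Qed.

Lemma pshiftM s t : pshift (s * t) = pconst (s 0%N) * pshift t + pshift s * t.
Proof.
apply: funext => n; have -> : pshift (s * t) n = (s * t) n.+1 by [].
by rewrite {1}[s]pser_recl mulrDl !pserD !pconstM -mulrA pXM.
Qed.

(** After scaling, [s] is 1 - T g. The n-th coefficient of the inverse is read off the geometric sum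
    with n + 1 terms, since later terms have higher order. *)
Lemma pser_unit s : is_unit (s 0%N) -> is_unit s.
Proof.
move=> [b sb]; pose g := - (pconst b * pshift s).
have es : pconst b * s = 1 - pX * g.
  have e0 : pconst (s 0%N) * pconst b = 1 by rewrite -rmorphM sb rmorph1.
  by rewrite [X in _ * X]pser_recl /g; ring: e0.
pose P n := \sum_(k < n) (pX * g) ^+ k.
have PS n : P n.+1 = P n + (pX * g) ^+ n by rewrite /P big_ord_recr.
have eP n : (1 - pX * g) * P n = 1 - (pX * g) ^+ n.
  elim: n => [|n IH]; first by rewrite /P big_ord0 mulr0 expr0 subrr.
  by rewrite PS mulrDr IH exprS; ring.
have Plow n k m : (k < n)%N -> P (n + m)%N k = P n k.
  move=> kn; elim: m => [|m IH]; first by rewrite addn0.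
  rewrite addnS PS pserD IH exprMn pXnM ltn_addr // ?addr0 //.
suff u : is_unit (pconst b * s) by exact: unitMr u.
exists (fun n => P n.+1 n); rewrite es; apply: funext => n.
transitivity ((((1 - pX * g) * P n.+1) : pser A) n).
  rewrite !pserM; apply: eq_bigr => i _; congr (_ * _).
  have e : ((n - i).+1 + i)%N = n.+1 by have := ltn_ord i; lia.
  by rewrite -(Plow _ _ i (ltnSn _)) e.
by rewrite eP pserB exprMn pXnM ltnSn subr0.
Qed.

Definition pideal (I : set A) : set (pser A) := [set s | I (s 0%N)].

Lemma pideal_ideal I : is_ideal I -> is_ideal (pideal I).
Proof. exact: (preim_ideal pcoef0). Qed.

(** [pideal I] is generated by [I] and T, so its n-th power is generated by the products of
    [I^(n-k)] with T^k. *)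
Lemma pow_pideal I n s : is_ideal I ->
  ideal_pow (pideal I) n s <-> forall k, (k < n)%N -> ideal_pow I (n - k) (s k).
Proof.
move=> iI; have iP := pideal_ideal iI; split.
  elim: n s => // n IH; rewrite powS; apply: mulid_min.
    split=> [k _|s t hs ht k kn|c s hs k kn]; first exact: ideal0.
      by apply: idealD => //; [exact: hs|exact: ht].
    rewrite pserM; apply: ideal_sum => // i _; apply: idealM => //.
    apply: (@pow_le _ _ _ (n.+1 - (k - i))); first by lia.
    by apply: hs; lia.
  move=> s t s0 /IH ht k kn; rewrite pserM; apply: ideal_sum => // i _.
  case: (posnP i) => [->|i0].
    have [kn'|kn'] := ltnP k n.
      by rewrite subn0 subSn 1?ltnW //; apply: mulidI => //; exact: ht.
    have -> : (n.+1 - k = 1)%N by lia.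
    by rewrite pow1 //; apply: idealMr.
  have ik := ltn_ord i.
  apply: idealM => //; apply: (@pow_le _ _ _ (n - (k - i))); first by lia.
  by apply: ht; lia.
elim: n s => // n IH s h; rewrite [s]pser_recl; apply: idealD => //.
  have := map_pow pconst (h 0%N (ltn0Sn _)); rewrite subn0; apply: pow_mono.
  by apply: span_min => // _ [x Ix <-].
rewrite powS; apply: mulidI; first exact: ideal0.
by apply: IH => k kn; have := h k.+1; rewrite subSS; apply.
Qed.

Lemma pideal_gen I : is_ideal I ->
  pideal I = ideal_add (ideal_span (pconst @` I)) [set t | exists c, t = c * pX].
Proof.
move=> iI; apply/seteqP; split=> [s s0|].
  exists (pconst (s 0%N)), (pX * pshift s); split; last exact: pser_recl.
    by apply: subspan; exists (s 0%N).
  by exists (pshift s); rewrite mulrC.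
apply: addid_min; first exact: pideal_ideal.
  by apply: span_min => [|_ [x Ix <-]//]; exact: pideal_ideal.
by move=> _ [c ->]; rewrite /pideal /= pserM0 mulr0; exact: ideal0.
Qed.

Lemma pideal_fg I : fg_ideal I -> fg_ideal (pideal I).
Proof.
move=> fI; have iI := fg_is_ideal fI; rewrite pideal_gen //.
have /fgP [s ->] := fg_map pconst fI; apply/fgP; exists (pX :: s).
rewrite spans_cons; apply/seteqP.
by split=> x [a [b [ha hb ->]]]; exists b, a; rewrite addrC.
Qed.

Lemma pideal_complete I : is_ideal I -> adically_complete I -> adically_complete (pideal I).
Proof.
move=> iI [sep comp]; split=> [s hs|u hu].
  apply: funext => k; apply: sep => n.
  by have /(pow_pideal _ _ iI)/(_ k) := hs (n + k).+1; move=> /(_ _)/pow_le; apply; lia.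
have /choice [l hl] : forall k, exists l, forall n, ideal_pow I n (l - u (n + k)%N k).
  move=> k; apply: comp => -[|n] //.
  by have /(pow_pideal _ _ iI)/(_ k) := hu (n.+1 + k)%N; rewrite addnK; apply; lia.
exists l => n; apply/pow_pideal => // k kn; have := hl k (n - k)%N.
by rewrite subnK // ltnW.
Qed.

End PserRing.

Section PserMap.
Variables (A B : comPzRingType) (f : {rmorphism A -> B}).

Definition pmap (s : pser A) : pser B := fun n => f (s n).

Let pmapB : zmod_morphism pmap.
Proof. by move=> s t; apply: funext => n; exact: rmorphB. Qed.
Let pmapM : monoid_morphism pmap.
Proof.
split; first by apply: funext => -[|n]; rewrite /pmap ?rmorph1 ?rmorph0.
by move=> s t; apply: funext => n; rewrite /pmap !pserM rmorph_sum;
  apply: eq_bigr => i _; exact: rmorphM.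
Qed.
HB.instance Definition _ := GRing.isZmodMorphism.Build (pser A) (pser B) pmap pmapB.
HB.instance Definition _ := GRing.isMonoidMorphism.Build (pser A) (pser B) pmap pmapM.

Lemma pmap_const a : pmap (pconst a) = pconst (f a).
Proof. by apply: funext => -[|n] //=; rewrite /pmap rmorph0. Qed.

Lemma pmap_X : pmap (pX A) = pX B.
Proof. by apply: funext => -[|[|n]]; rewrite /pmap ?rmorph0 ?rmorph1. Qed.

Lemma pmap_pideal I : is_ideal I -> 
  ideal_span (pmap @` pideal I) = pideal (ideal_span (f @` I)).
Proof.
move=> iI; apply/seteqP; split.
  apply: span_min; first exact: pideal_ideal.
  by move=> _ [s Is <-]; apply: subspan; exists (s 0%N).
move=> t t0; rewrite [t]pser_recl; apply: (idealD (span_ideal _)).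
  have iK : is_ideal (@pconst B @^-1` ideal_span (pmap @` pideal I)) by exact: preim_ideal.
  have {t0} : ideal_span (f @` I) (t 0%N) by [].
  move: (t 0%N); apply: span_min => // _ [x Ix <-]; rewrite /preimage /=.
  by apply: subspan; exists (pconst x) => //; exact: pmap_const.
apply: (@idealMr _ _ (pshift t) (pX B) (span_ideal _)); apply: subspan.
by exists (pX A); [exact: ideal0 iI|exact: pmap_X].
Qed.

End PserMap.

Section PserTop.
Variable A : topComRingType.

(** The topology of coefficientwise convergence; it is the (I, T)-adic one when [A] is I-adic
    ([pser_adic]). *)
Let base : set (set (pser A)) :=
  [set S | exists n (N : set A), nbhs 0 N /\ S = [set s | forall k, (k < n)%N -> N (s k)]].

Let nbhsB (N : set A) : nbhs 0 N -> exists2 M : set A, nbhs 0 M & forall x y, M x -> M y -> N (x - y).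
Proof.
move=> N0; have : nbhs ((0 : A), (0 : A)) [set z | N (z.1 - z.2)].
  by have := @sub_continuous A (0, 0); rewrite /continuous_at /= subr0; apply.
move=> [[P Q] /= [P0 Q0] PQ]; exists (P `&` Q); first exact: filterI.
by move=> x y [Px _] [_ Qy]; exact: (PQ (x, y)).
Qed.

Let nbhsM (N : set A) : nbhs 0 N -> exists2 M : set A, nbhs 0 M & forall x y, M x -> M y -> N (x * y).
Proof.
move=> N0; have : nbhs ((0 : A), (0 : A)) [set z | N (z.1 * z.2)].
  by have := @mul_continuous_subproof A (0, 0); rewrite /continuous_at /= mulr0; apply.
move=> [[P Q] /= [P0 Q0] PQ]; exists (P `&` Q); first exact: filterI.
by move=> x y [Px _] [_ Qy]; exact: (PQ (x, y)).
Qed.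

Let nbhsZ (N : set A) a : nbhs 0 N -> exists2 M : set A, nbhs 0 M & forall x, M x -> N (a * x).
Proof.
move=> N0; have : nbhs (a, (0 : A)) [set z | N (z.1 * z.2)].
  by have := @mul_continuous_subproof A (a, 0); rewrite /continuous_at /= mulr0; apply.
move=> [[P Q] /= [P0 Q0] PQ]; exists Q => // x Qx.
by apply: (PQ (a, x)); split=> //=; exact: nbhs_singleton P0.
Qed.

Let nbhs_sum (n : nat) (N : set A) : nbhs 0 N -> exists2 M : set A, nbhs 0 M & 
  forall k (F : nat -> A), (k <= n)%N -> (forall i, (i < k)%N -> M (F i)) -> N (\sum_(i < k) F i).
Proof.
elim: n N => [|n IH] N N0.
  by exists N => // k F; rewrite leqn0 => /eqP -> _; rewrite big_ord0; exact: nbhs_singleton N0.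
have [M M0 hM] := nbhsB N0; have [M' M'0 hM'] := nbhsB M0; have [P P0 hP] := IH M M0.
exists (P `&` M' `&` N); first by apply: filterI => //; exact: filterI.
move=> [|k] F kn hF; first by rewrite big_ord0; exact: nbhs_singleton N0.
rewrite big_ord_recr /= -[F k]opprK; apply: hM.
  by apply: hP => // i ik; have [[]] := hF i (ltnW ik).
rewrite -[- _]add0r; apply: hM'; first exact: nbhs_singleton M'0.
by have [[]] := hF k (ltnSn k).
Qed.

Let base_ex : exists N, base N. Proof. by exists setT, 0%N, setT; split; [exact: filterT|apply/seteqP]. Qed.
Let base_0 N : base N -> N 0. Proof. by move=> [n [M [M0 ->]]] k _; exact: nbhs_singleton M0. Qed.
Let base_I N M : base N -> base M -> exists2 K, base K & K `<=` N `&` M.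
Proof.
move=> [n [P [P0 ->]]] [m [Q [Q0 ->]]].
exists [set s | forall k, (k < maxn n m)%N -> (P `&` Q) (s k)].
  by exists (maxn n m), (P `&` Q); split=> //; exact: filterI.
by move=> s hs; split=> k kn; have [] := hs k; rewrite ?leq_max ?kn ?orbT.
Qed.
Let base_B N : base N -> exists2 M, base M & forall x y, M x -> M y -> N (x - y).
Proof.
move=> [n [P [P0 ->]]]; have [M M0 hM] := nbhsB P0.
exists [set s | forall k, (k < n)%N -> M (s k)]; first by exists n, M.
by move=> s t hs ht k kn; apply: hM; [exact: hs|exact: ht].
Qed.
Let base_Z N a : base N -> exists2 M, base M & forall x, M x -> N (a * x).
Proof.
move=> [n [P [P0 ->]]]; have [M M0 hM] := nbhs_sum n P0.
have [M' M'0 hM'] : exists2 M' : set A, nbhs 0 M' & forall i x, (i < n)%N -> M' x -> M (a i * x).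
  elim: (n) => [|m [L L0 hL]]; first by exists setT => //; exact: filterT.
  have [L' L'0 hL'] := nbhsZ (a m) M0.
  exists (L `&` L'); first exact: filterI.
  by move=> i x; rewrite ltnS leq_eqVlt => /orP [/eqP ->|im] [Lx L'x]; [exact: hL'|exact: hL].
exists [set s | forall k, (k < n)%N -> M' (s k)]; first by exists n, M'.
move=> s hs k kn; rewrite pserM; apply: (hM k.+1 (fun i => a i * s (k - i)%N)) => // i ik.
by apply: hM'; [lia|apply: hs; lia].
Qed.
Let base_M N : base N -> exists2 M, base M & forall x y, M x -> M y -> N (x * y).
Proof.
move=> [n [P [P0 ->]]]; have [M M0 hM] := nbhs_sum n P0; have [M' M'0 hM'] := nbhsM M0.
exists [set s | forall k, (k < n)%N -> M' (s k)]; first by exists n, M'.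
move=> s t hs ht k kn; rewrite pserM; apply: (hM k.+1 (fun i => s i * t (k - i)%N)) => // i ik.
by apply: hM'; [apply: hs; lia|apply: ht; lia].
Qed.

Definition pser_nbase : nbase (pser A) := NBase base_ex base_0 base_I base_B base_Z base_M.

Definition pserT : topComRingType := topd pser_nbase.

Lemma nbhs_pser (S : set pserT) : nbhs (0 : pserT) S <->
  exists n (N : set A), nbhs 0 N /\ forall s : pser A, (forall k, (k < n)%N -> N (s k)) -> S s.
Proof.
split.
  move=> /nbhs_topd [_ [n [N [N0 ->]]] h]; exists n, N; split=> // s hs.
  by rewrite -[s]add0r; exact: h.
move=> [n [N [N0 h]]]; apply/nbhs_topd; exists [set s | forall k, (k < n)%N -> N (s k)].
  by exists n, N.
by move=> s hs; rewrite add0r; exact: h.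
Qed.

Lemma pser_adic I : is_ideal I -> adic_topology I -> @adic_topology pserT (pideal I).
Proof.
move=> iI top W.
have key (S : set pserT) : nbhs (0 : pserT) S <-> exists n, ideal_pow (pideal I) n `<=` S.
  split=> [/nbhs_pser [n [N [/(nbhs_adic top) [m hm] h]]]|[n hn]].
    exists (n + m)%N => s /(pow_pideal _ _ iI) hs; apply: h => k kn; apply: hm.
    by apply: (@pow_le _ _ _ (n + m - k)); [lia|apply: hs; lia].
  apply/nbhs_pser; exists n, (ideal_pow I n); split; first by apply/(nbhs_adic top); exists n.
  move=> s hs; apply: hn; apply/pow_pideal => // k kn.
  by apply: (@pow_le _ _ _ n); [lia|exact: hs].
have sh (w : pserT) : nbhs w W <-> nbhs (0 : pserT) [set a | W (w + a)].
  by split=> /nbhs_topd [N BN h]; apply/nbhs_topd; exists N => // y Ny;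
    have := h y Ny; rewrite /= add0r.
rewrite openE; split=> [oW w Ww|h w Ww].
  by have /sh/key [n hn] := oW w Ww; exists n => a /hn.
by apply/sh/key; have [n hn] := h w Ww; exists n => a /hn.
Qed.

End PserTop.

Lemma pmap_cont (A B : topComRingType) (f : {rmorphism A -> B}) : continuous f ->
  continuous (pmap f : {rmorphism pserT A -> pserT B}).
Proof.
move=> /cont0P cf; apply/cont0P => S /nbhs_pser [n [N [N0 h]]].
apply/nbhs_pser; exists n, (f @^-1` N); split; first exact: cf.
by move=> s hs; apply: h.
Qed.

(** * The formal affine line over a formal scheme *)

Section PserSpace.
Variable Y : ringedSpace.
Implicit Types (U V W : set Y).

Let pres U V (oU : open U) (oV : open V) (VU : V `<=` U) :
  {rmorphism pserT (sec U) -> pserT (sec V)} := pmap (res oU oV VU).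

Let pres_cont U V (oU : open U) (oV : open V) (VU : V `<=` U) : continuous (pres oU oV VU).
Proof. by apply: pmap_cont; exact: res_continuous. Qed.

Let pres_id U (oU oU' : open U) (UU : U `<=` U) (s : pserT (sec U)) : pres oU oU' UU s = s.
Proof. by apply: funext => n; exact: res_id. Qed.

Let pres_res U V W (oU : open U) (oV : open V) (oW : open W)
    (VU : V `<=` U) (WV : W `<=` V) (WU : W `<=` U) s :
  pres oV oW WV (pres oU oV VU s) = pres oU oW WU s.
Proof. by apply: funext => n; exact: res_res. Qed.

Let psep U (C : set (set Y)) (oU : open U)
    (oC : forall W, C W -> open W) (CU : forall W, C W -> W `<=` U) (s : pserT (sec U)) :
    U `<=` \bigcup_(W in C) W ->
    (forall W (CW : C W), pres oU (oC W CW) (CU W CW) s = 0) -> s = 0.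
Proof.
move=> cov h; apply: funext => n.
apply: (sheaf_separated (oU := oU) (oC := oC) (CU := CU)) => // W CW.
exact: (congr1 (@^~ n) (h W CW)).
Qed.

Let pglue U (C : set (set Y)) (oU : open U)
    (oC : forall W, C W -> open W) (CU : forall W, C W -> W `<=` U)
    (f : forall W, pserT (sec W)) :
    U `<=` \bigcup_(W in C) W ->
    (forall W W' (CW : C W) (CW' : C W') V (oV : open V)
       (VW : V `<=` W) (VW' : V `<=` W'),
       pres (oC W CW) oV VW (f W) = pres (oC W' CW') oV VW' (f W')) ->
    exists s, forall W (CW : C W), pres oU (oC W CW) (CU W CW) s = f W.
Proof.
move=> cov h.
have /choice [s hs] : forall n : nat, exists s, forall W (CW : C W),
    res oU (oC W CW) (CU W CW) s = f W n.
  move=> n; apply: sheaf_glue => // W W' CW CW' V oV VW VW'.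
  exact: (congr1 (@^~ n) (h W W' CW CW' V oV VW VW')).
by exists s => W CW; apply: funext => n; exact: hs.
Qed.

Let ptop U (C : set (set Y)) (oU : open U)
    (oC : forall W, C W -> open W) (CU : forall W, C W -> W `<=` U)
    (N : set (pserT (sec U))) :
    U `<=` \bigcup_(W in C) W -> nbhs 0 N ->
    exists (D : set (set Y)) (M : forall W, set (pserT (sec W))),
      [/\ finite_set D, D `<=` C, forall W, nbhs 0 (M W) &
          forall s, (forall W (CW : C W), D W ->
            M W (pres oU (oC W CW) (CU W CW) s)) -> N s].
Proof.
move=> cov /nbhs_pser [n [N0 [hN0 h]]].
have [D [M [fD DC M0 DN]]] := sheaf_topology oU oC CU cov hN0.
exists D, (fun W => [set s : pser (sec W) | forall k, (k < n)%N -> M W (s k)]); split=> //.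
  by move=> W; apply/nbhs_pser; exists n, (M W).
move=> s hs; apply: h => k kn; apply: DN => W CW DW; exact: hs.
Qed.

(** The coordinate T is topologically nilpotent, so the formal affine line has the points and opens
    of [Y], and power series as sections. *)
Definition pserS : ringedSpace := {|
  space := Y;
  sec := fun U => pserT (sec U);
  res := pres;
  res_continuous := pres_cont;
  res_id := pres_id;
  res_res := pres_res;
  sheaf_separated := psep;
  sheaf_glue := pglue;
  sheaf_topology := ptop |}.

Lemma pser_unit_at U (s : @sec pserS U) x : @unit_at pserS U s x <-> unit_at ((s : pser _) 0%N) x.
Proof.
split=> [] [W [oU [oW [WU [Wx us]]]]]; exists W, oU, oW, WU; split=> //.
  case: us => b hb; exists ((b : pser _) 0%N).
  by have := congr1 (fun z : pser (@sec Y W) => z 0%N) hb; rewrite pserM0.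
exact: (@pser_unit (@sec Y W)).
Qed.

Lemma pser_basic_open U (s : @sec pserS U) : @basic_open pserS U s = basic_open ((s : pser _) 0%N).
Proof. by apply/seteqP; split=> x /pser_unit_at. Qed.

Lemma pser_locally_ringed : locally_ringed Y -> locally_ringed pserS.
Proof.
move=> lr U x oU Ux; have [n0 nD] := lr U x oU Ux; split; first by move=> /pser_unit_at.
by move=> s t /pser_unit_at /nD [] us; [left|right]; apply/pser_unit_at.
Qed.

Lemma pser_affine U (I : set (sec U)) : affine I -> @affine pserS U (pideal I).
Proof.
move=> aI; have iI := affine_ideal aI; have oU := affine_open aI.
have iP := pideal_ideal iI.
apply: (@Build_affine pserS _ _ oU).
- exact: pideal_fg (affine_fg aI).
- move=> x Ux; have [pV IV] := affine_vanishing aI Ux.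
  have -> : @vanishing pserS U x = (@pcoef0 (sec U)) @^-1` (@vanishing Y U x).
    by apply/seteqP; split=> s h /pser_unit_at.
  by split; [exact: preim_prime|move=> s /IV].
- move=> p pp Ip; have pq := preim_prime (@pconst (sec U)) pp.
  have [ip p1 ppM] := pp.
  have [|x [[Ux qx] uniq]] := affine_prime aI pq; first by move=> i Ii; exact: Ip.
  have pX0 : p (pX (sec U)) by apply: Ip; exact: ideal0 iI.
  have pE s : p s <-> p (pconst ((s : pser _) 0%N)).
    rewrite {1}[s]pser_recl; split=> [h|h]; last first.
      by apply: idealD => //; exact: idealMr.
    rewrite -[pconst _](addrK (pX (sec U) * pshift s)).
    by apply: idealB => //; exact: idealMr.
  have vE y (s : pser (sec U)) : @vanishing pserS U y s <-> @vanishing Y U y (s 0%N).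
    by split=> h /pser_unit_at.
  exists x; split.
    split=> //; apply/seteqP; split=> s.
      by move=> /pE ps; apply/vE; rewrite -qx.
    by move=> /vE; rewrite -qx => ps; apply/pE.
  move=> y [Uy py]; apply: uniq; split=> //.
  apply/seteqP; split=> c; rewrite /preimage /= py; first by move=> /vE.
  by move=> h; apply/vE.
- move=> W x oW Wx Ux; have [a [ua aW]] := affine_basis aI oW Wx Ux.
  exists (pconst a); split; first by apply/pser_unit_at.
  by rewrite pser_basic_open.
move=> s; have := pser_basic_open s.
move: (@basic_open pserS U s) (@basic_open_open pserS U s) (@basic_open_sub pserS U s).
move=> W oW WU eW r J; pose a : sec U := (s : pser _) 0%N.
have [compJ topJ locJ] := affine_loc aI oU oW WU eW.
set r0 := @res Y U W oU oW WU in compJ topJ locJ.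
set J0 := ideal_span (r0 @` I) in compJ topJ locJ.
have iJ0 : is_ideal J0 := span_ideal _.
have JE : J = pideal J0 by exact: pmap_pideal.
have iJ : is_ideal J by rewrite JE; exact: pideal_ideal.
(* [s] is congruent to its constant term modulo [pideal I], so denominators [s] may be exchanged for
   constant denominators [a], for which localisation is coefficientwise. *)
have sa K n : exists g, ideal_pow (pideal I) n ((s : pser _) ^+ (K + n) - pconst a ^+ K * g).
  have [] := @pow_subX _ (pideal I) (pconst a) (pconst a - s) K n.
    by rewrite /pideal /= pserB subrr; exact: ideal0.
  by move=> g; rewrite subKr; exists g.
split; [by rewrite JE; exact: pideal_complete|by rewrite JE; exact: pser_adic|].
move=> n; split.
- have [d hd] : is_unit (r s : pser (@sec Y W)).
    by apply: pser_unit; apply: res_unit; rewrite eW.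
  by exists d; rewrite hd subrr; exact: ideal0.
- move=> b.
  (* Modulo the n-th power only the first n coefficients count, so one denominator serves for all of
     them. *)
  have /(_ n) [K hK] : forall m, exists K, forall k, (k < m)%N ->
      exists c, ideal_pow J0 n (r0 a ^+ K * (b : pser _) k - r0 c).
    elim=> [|m [K hK]]; first by exists 0%N.
    have [_ /(_ ((b : pser _) m)) [k [c hc]] _] := locJ n.
    exists (K + k)%N => i; rewrite ltnS leq_eqVlt => /orP [/eqP ->|/hK [c' hc']].
      exists (a ^+ K * c).
      have -> : r0 a ^+ (K + k) * b m - r0 (a ^+ K * c) = r0 a ^+ K * (r0 a ^+ k * b m - r0 c).
        by rewrite rmorphM rmorphXn exprD; ring.
      exact: idealM.
    exists (a ^+ k * c').
    have -> : r0 a ^+ (K + k) * b i - r0 (a ^+ k * c') = r0 a ^+ k * (r0 a ^+ K * b i - r0 c').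
      by rewrite rmorphM rmorphXn exprD; ring.
    exact: idealM.
  have /choice [c hc] : forall k, exists c, (k < n)%N ->
      ideal_pow J0 n (r0 a ^+ K * (b : pser _) k - r0 c).
    by move=> k; case: (ltnP k n) => [/hK [c hc]|_]; [exists c|exists 0].
  have hb : ideal_pow J n (pconst (r0 a ^+ K) * b - pmap r0 c).
    rewrite JE; apply/pow_pideal => // k kn; rewrite pserB pconstM.
    by apply: (@pow_le _ _ _ n); [exact: leq_subr|exact: hc].
  have [g hg] := sa K n.
  exists (K + n)%N, (g * (c : pser _)).
  have hg' : ideal_pow J n (r ((s : pser _) ^+ (K + n) - pconst a ^+ K * g)) by exact: map_pow.
  have -> : r s ^+ (K + n) * b - r (g * (c : pser _)) =
     r ((s : pser _) ^+ (K + n) - pconst a ^+ K * g) * b +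
     r g * (pconst (r0 a ^+ K) * b - pmap r0 c).
    have e1 : r (pconst a) = pconst (r0 a) by exact: pmap_const.
    have e2 : pmap r0 c = r c by [].
    by rewrite e2 !(rmorphB, rmorphM, rmorphXn) e1; ring.
  by apply: idealD => //; [exact: idealMr|exact: idealM].
- move=> c; rewrite JE => /(pow_pideal _ _ iJ0) hc.
  have [K hK] : exists K, forall k, (k < n)%N -> ideal_pow I (n - k) (a ^+ K * (c : pser _) k).
    have : forall k, (k < n)%N -> exists K, ideal_pow I (n - k) (a ^+ K * (c : pser _) k).
      move=> k kn; have [_ _ h] := locJ (n - k)%N; apply: h; exact: hc.
    move=> h; suff /(_ n (leqnn n)) : forall m, (m <= n)%N -> exists K, forall k, (k < m)%N ->
      ideal_pow I (n - k) (a ^+ K * (c : pser _) k) by [].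
    elim=> [|m IH] mn; first by exists 0%N.
    have [K hK] := IH (ltnW mn).
    have [k hk] := h m mn; exists (K + k)%N => i; rewrite ltnS leq_eqVlt.
    by case/orP => [/eqP ->|/hK h']; rewrite exprD -mulrA; [|rewrite mulrCA]; apply: idealM.
  have hac : ideal_pow (pideal I) n (pconst (a ^+ K) * c).
    by apply/pow_pideal => // k kn; rewrite pconstM; exact: hK.
  have [g hg] := sa K n; exists (K + n)%N.
  have -> : s ^+ (K + n) * c = ((s : pser _) ^+ (K + n) - pconst a ^+ K * g) * c +
     g * (pconst (a ^+ K) * c) by rewrite rmorphXn; ring.
  by apply: idealD => //; [exact: idealMr|exact: idealM].
Qed.

Let proj_loc V (oV : open V) (s : sec V) (x : pserS) : V (id x) ->
  @unit_at pserS V (pconst s) x -> unit_at s x.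
Proof. by move=> Vx /pser_unit_at. Qed.

Let proj_cont V (oV : open V) : continuous (@pconst (sec V) : {rmorphism sec V -> pserT (sec V)}).
Proof.
apply/cont0P => N /nbhs_pser [n [N0 [hN0 h]]].
have N00 := nbhs_singleton hN0.
by apply: filterS hN0 => a Na; apply: h => -[|k] _.
Qed.

Let proj_res U V (oU : open U) (oV : open V) (VU : V `<=` U) (VU' : V `<=` U) s :
  pconst (res oU oV VU s) = pres oU oV VU' (pconst s).
Proof.
by rewrite (Prop_irrelevance VU VU'); exact: (esym (pmap_const (res oU oV VU') s)).
Qed.

Definition pproj : mor pserS Y := @Mor pserS Y id (fun V oV => oV)
  (fun V oV => @pconst (sec V) : {rmorphism sec V -> @sec pserS V}) proj_cont proj_res proj_loc.

End PserSpace.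

Definition pserF (Y : formalScheme) : formalScheme.
Proof.
apply: (@FormalScheme (pserS Y)).
  exact: pser_locally_ringed (@fs_local Y).
move=> x; have [U [I [Ux aI]]] := fs_affine x.
by exists U, (pideal I); split=> //; exact: pser_affine.
Defined.

Definition gX (Y : formalScheme) : @sec (pserF Y) [set: pserF Y] := pX (sec [set: Y]).

(** * Evaluation of power series at topologically nilpotent sections *)

Section PserEval.
Variables (T : formalScheme) (W : set T) (oT : open W) (A : comPzRingType).
Variables (phi : {rmorphism A -> sec W}) (g : sec W).
Hypothesis ng : nil g.
Implicit Types (s t : pser A).

Let P n s := \sum_(k < n) phi (s k) * g ^+ k.

Let PS n s : P n.+1 s = phi (s 0%N) + g * P n (pshift s).
Proof.
rewrite /P big_ord_recl expr0 mulr1 mulr_sumr; congr (_ + _).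
by apply: eq_bigr => i _; rewrite exprS /pshift; ring.
Qed.

(** Truncated evaluation is multiplicative up to a multiple of [g ^+ n], which tends to 0. *)
Let PM n s t : exists c, P n s * P n t - P n (s * t) = g ^+ n * c.
Proof.
elim: n s t => [|n IH] s t.
  by exists 0; rewrite /P !big_ord0; ring.
have [c hc] := IH (pshift s) t.
have PL u : P n.+1 u = P n u + g ^+ n * phi (u n).
  by rewrite /P big_ord_recr /= mulrC; congr (_ + _); rewrite mulrC.
have PB u v : P n (u - v) = P n u - P n v.
  by rewrite /P -sumrB; apply: eq_bigr => i _; rewrite pserB rmorphB mulrBl.
have PD u v : P n (u + v) = P n u + P n v.
  by rewrite /P -big_split; apply: eq_bigr => i _; rewrite pserD rmorphD mulrDl.
have PC a u : P n (pconst a * u) = phi a * P n u.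
  by rewrite /P mulr_sumr; apply: eq_bigr => i _; rewrite pconstM rmorphM mulrA.
exists (c + P n (pshift s) * phi (t n)).
rewrite [P n.+1 (s * t)]PS pshiftM PD PC pserM0 rmorphM [P n.+1 s]PS.
have -> : P n (pshift s * t) = P n (pshift s) * P n t - g ^+ n * c by rewrite -hc; ring.
rewrite mulrDl [in phi (s 0%N) * P n.+1 t]PS [P n.+1 t]PL exprS; ring.
Qed.

Let Pdiff n s : P n.+1 s - P n s = g ^+ n * phi (s n).
Proof. by rewrite /P big_ord_recr /= mulrC addrAC subrr add0r mulrC. Qed.

Lemma pser_eval_ex : exists ev : {rmorphism pser A -> sec W},
  (forall s, lims (fun n => \sum_(k < n) phi (s k) * g ^+ k) (ev s)) /\
  ((forall a, ev (pconst a) = phi a) /\ ev (pX A) = g).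
Proof.
have [|||||ev hev] := @hom_of_rel (pser A) (sec W) (fun s l => lims (P^~ s) l).
- move=> s; apply: sec_complete => //.
  by apply: eq_tz (tz_mulr oT (fun n => phi (s n)) (nil_tz oT ng)) => k; rewrite Pdiff.
- by move=> s l l'; exact: lims_uniq.
- apply: tz0; exists 1%N => -[|k] // _; rewrite PS /P big1 ?mulr0 ?addr0 ?rmorph1 ?subrr //.
  by move=> i _; rewrite rmorph0 mul0r.
- move=> s l s' l' h h'; apply: eq_tz (limsB h h') => n; congr (_ - _).
  by rewrite /P -sumrB; apply: eq_bigr => i _; rewrite pserB rmorphB mulrBl.
- move=> s l s' l' h h'; apply: (lims_tz (limsM oT h h')).
  have /choice [c hc] := fun n => PM n s s'.
  by apply: eq_tz (tz_mulr oT c (nil_tz oT ng)) => n; rewrite hc.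
exists ev; split=> //; split.
  move=> a; apply: (lims_uniq oT (hev _)); apply: tz0; exists 1%N => -[|k] // _.
  rewrite PS /P big1 ?mulr0 ?addr0 ?subrr //.
  by move=> i _; rewrite rmorph0 mul0r.
apply: (lims_uniq oT (hev _)); apply: tz0; exists 2%N => -[|[|k]] // _.
rewrite !PS /P big1; last by move=> i _; rewrite rmorph0 mul0r.
by rewrite rmorph0 rmorph1; ring.
Qed.

Lemma pser_eval_uniq (f f' : {rmorphism pser A -> sec W}) :
  (forall a, f (pconst a) = f' (pconst a)) -> f (pX A) = f' (pX A) -> nil (f (pX A)) -> f =1 f'.
Proof.
move=> fc fX nX s; apply/eqP; rewrite -subr_eq0; apply/eqP.
have h n : forall s, exists c, f s - f' s = f (pX A) ^+ n * c.
  elim: n => [|n IH] s'; first by exists (f s' - f' s'); rewrite mul1r.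
  have [c hc] := IH (pshift s'); exists c.
  rewrite [s']pser_recl !rmorphD !rmorphM fc exprS -mulrA -hc -fX; ring.
have /choice [c hc] := fun n => h n s.
apply: (tz_cst oT); apply: eq_tz (tz_mulr oT c (nil_tz oT nX)) => n.
by rewrite (hc n).
Qed.

End PserEval.

Lemma pser_eval_cont (T : formalScheme) (A : topComRingType) (I : set A)
  (phi : {rmorphism A -> sec [set: T]}) g (ev : {rmorphism pserT A -> sec [set: T]}) :
  is_ideal I -> adic_topology I -> continuous phi -> nil g ->
  (forall s : pser A, lims (fun n => \sum_(k < n) phi (s k) * g ^+ k) (ev s)) -> continuous ev.
Proof.
move=> iI top cphi ng hev.
apply: (seqcont_cont (pser_adic iI top)) => u tu; apply: (tz_loc openT) => x _.
have [U [K [aK Ux UT]]] := affine_nbhd openT (Logic.I : [set: T] x).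
exists U, (affine_open aK), UT; split=> //.
have topK := affine_top aK; apply/(tz_adic _ topK) => n.
have [M hM] := (tz_adic _ topK).1 (tz_res openT (affine_open aK) UT (nil_tz openT ng)) n.
have [N hN] : exists N, forall a, ideal_pow I N a ->
    ideal_pow K n (res openT (affine_open aK) UT (phi a)).
  have : nbhs (0 : A) [set a | ideal_pow K n (res openT (affine_open aK) UT (phi a))].
    have := (cont0P (res openT (affine_open aK) UT)).1 (@res_continuous _ _ _ _ _ _)
      (ideal_pow K n) ((nbhs_adic topK _).2 (ex_intro _ n (@subset_refl _ _))).
    exact: (cont0P phi).1.
  by move=> /(nbhs_adic top) [N hN]; exists N => a /hN.
(* In the (M+N)-th power of [pideal I], the coefficients of index below M lie in [I^N], where [phi]
   is small; from index M on, the power of [g] is small. *)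
have [L hL] := (tz_adic _ (pser_adic iI top)).1 tu (M + N)%N.
exists L => k /hL /(pow_pideal _ _ iI) hk.
have [m hm] := (tz_adic _ topK).1 (tz_res openT (affine_open aK) UT (hev (u k))) n.
have := hm m (leqnn m); rewrite rmorphB => h.
set S := res _ _ _ (\sum_(_ < m) _) in h.
have -> : res openT (affine_open aK) UT ((ev \o u) k) = S - (S - res openT (affine_open aK) UT (ev (u k))).
  by rewrite subKr.
apply: idealB => //; rewrite /S rmorph_sum; apply: ideal_sum => // i _; rewrite rmorphM.
have [iM|iM] := ltnP i M; last by apply: idealM => //; exact: hM.
apply: idealMr => //; apply: hN; apply: (@pow_le _ _ _ (M + N - i)); first by lia.
by apply: hk; lia.
Qed.

Lemma gcomapE (X Y : ringedSpace) (f : mor X Y) (oU : open [set: X]) (oV : open [set: Y])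
  (UV : [set: X] `<=` f @^-1` [set: Y]) s : comap_to f oU oV UV s = global_comap f s.
Proof. by rewrite comap_toE res_id (Prop_irrelevance oV openT). Qed.

Definition gaff (Y : ringedSpace) := exists I : set (sec [set: Y]), affine I.

Lemma hom_gaff_uniq (T Y : formalScheme) (f g : mor T Y) : gaff Y ->
  global_comap f =1 global_comap g -> f = g.
Proof.
move=> [I aI] h; apply: (@hom_affine_uniq T Y setT I (@fs_local Y) aI f g (fun _ _ => Logic.I)
  (fun _ _ => Logic.I)) => s.
by rewrite !gcomapE.
Qed.

Lemma hom_gaff_ex (T Y : formalScheme) (phi : {rmorphism sec [set: Y] -> sec [set: T]}) :
  gaff Y -> continuous phi -> exists f : mor T Y, global_comap f =1 phi.
Proof.
move=> [I aI] cphi; have [f [fU hf]] := hom_affine_ex (@fs_local Y) aI cphi.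
by exists f => s; rewrite -hf gcomapE.
Qed.

Lemma gcomap_cont (T Y : ringedSpace) (f : mor T Y) : continuous (global_comap f).
Proof. exact: comap_continuous. Qed.

Lemma gcomapM (X Y Z : ringedSpace) (g : mor Y Z) (f : mor X Y) s :
  global_comap (compm g f) s = global_comap f (global_comap g s).
Proof.
rewrite /global_comap /=; congr (comap f _ _); exact: Prop_irrelevance.
Qed.

Lemma gcomap_nil (X Y : ringedSpace) (f : mor X Y) s : nil s -> nil (global_comap f s).
Proof. by move=> ns x /comap_unit => /(_ Logic.I) /ns. Qed.

Section PserHom.
Variable Y : formalScheme.

Definition fproj : mor (pserF Y) Y := pproj Y.

Lemma fproj_gaff : gaff Y -> gaff (pserF Y).
Proof. by move=> [I aI]; exists (pideal I); exact: pser_affine. Qed.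

Lemma gX_nil : nil (gX Y).
Proof.
move=> x /pser_unit_at; have [n0 _] := @fs_local Y setT x openT Logic.I; exact: n0.
Qed.

Lemma gcomap_fproj s : global_comap fproj s = pconst s.
Proof. by []. Qed.

Lemma pser_hom (T : formalScheme) (a : mor T Y) (g : sec [set: T]) : gaff Y -> nil g ->
  exists b : mor T (pserF Y), compm fproj b = a /\ global_comap b (gX Y) = g.
Proof.
move=> gY ng; have [I aI] := gY.
have [ev [hev [evc evX]]] := @pser_eval_ex T setT openT _ (global_comap a) g ng.
have [|b hb] := @hom_gaff_ex T (pserF Y) ev (fproj_gaff gY).
  by apply: (pser_eval_cont (affine_ideal aI) (affine_top aI)) ng hev; exact: gcomap_cont.
exists b; split; last by rewrite hb.
by apply: hom_gaff_uniq => // s; rewrite gcomapM gcomap_fproj hb evc.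
Qed.

Lemma pser_hom_uniq (T : formalScheme) (b b' : mor T (pserF Y)) : gaff Y ->
  compm fproj b = compm fproj b' -> global_comap b (gX Y) = global_comap b' (gX Y) -> b = b'.
Proof.
move=> gY e eX; apply: hom_gaff_uniq; first exact: fproj_gaff.
apply: (pser_eval_uniq openT) => //.
  move=> c; have := congr1 (fun f => global_comap f c) e.
  by rewrite !gcomapM.
exact: gcomap_nil gX_nil.
Qed.

End PserHom.

(** * Noetherian power series rings and completed localisations *)

Lemma spans_coef (A : comPzRingType) (l : seq A) x : spans l x ->
  exists c : nat -> A, x = \sum_(i < size l) c i * l`_i.
Proof.
move: x; apply: spans_min.
  split=> [|_ _ [c ->] [d ->]|a _ [c ->]].
  - by exists (fun=> 0); rewrite big1 // => i _; rewrite mul0r.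
  - by exists (fun i => c i + d i); rewrite -big_split; apply: eq_bigr => i _; rewrite mulrDl.
  - by exists (fun i => a * c i); rewrite mulr_sumr; apply: eq_bigr => i _; rewrite mulrA.
move=> x xl; exists (fun i => if i == index x l then 1 else 0).
have il : (index x l < size l)%N by rewrite index_mem.
rewrite (bigD1 (Ordinal il)) //= eqxx mul1r nth_index // big1 ?addr0 //.
by move=> i /eqP ni; case: eqP => [e|_]; [case: ni; apply: val_inj|rewrite mul0r].
Qed.

Section PserNoetherian.
Variable A : comPzRingType.
Hypothesis nA : noetherian_ring A.

(** The basis theorem with lowest coefficients: [L k] consists of the k-th coefficients of the
    series in [Q] of order at least k, and is constant from [d] on. Below order [d] a series is
    reduced in finitely many steps; from there on in infinitely many, which converge T-adically. *)
Lemma pser_noetherian : noetherian_ring (pser A).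
Proof.
move=> Q iQ.
pose ord k (s : pser A) := forall i, (i < k)%N -> s i = 0.
pose L k := [set a | exists s, [/\ Q s, ord k s & s k = a]].
have iL k : is_ideal (L k).
  split.
  - by exists 0; split=> //; exact: ideal0.
  - move=> a b [s [Qs os <-]] [t [Qt ot <-]]; exists (s + t); split=> //; first exact: idealD.
    by move=> i ik; rewrite pserD os // ot // addr0.
  - move=> c a [s [Qs os <-]]; exists (pconst c * s); split; first exact: idealM.
      by move=> i ik; rewrite pconstM os // mulr0.
    exact: pconstM.
have Linc k : L k `<=` L k.+1.
  move=> a [s [Qs os <-]]; exists (pX A * s); split; first exact: idealM.
    by move=> [|i] ik; rewrite pXM // os.
  by rewrite pXM.
have [d hd] := noetherian_chain nA iL Linc.
have /choice [l hl] : forall k, exists l, L k = spans l by move=> k; exact/fgP/nA.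
have /choice [g hg] : forall z : nat * A, exists s, z.2 \in l z.1 -> [/\ Q s, ord z.1 s & s z.1 = z.2].
  move=> [k a] /=; case: (boolP (a \in l k)) => [al|_]; last by exists 0.
  by have : L k a by [rewrite hl; exact: mem_spans]; move=> [s hs]; exists s.
pose gs k := [seq g (k, a) | a <- l k].
have gsQ k s : s \in gs k -> Q s by move=> /mapP [a al ->]; have [] := hg (k, a) al.
pose G := spans (flatten [seq gs k | k <- iota 0 d.+1]).
have iG : is_ideal G := spans_ideal _.
have GQ : G `<=` Q.
  by apply: spans_min => // s /flatten_mapP [k _]; exact: gsQ.
have gG k s : (k <= d)%N -> s \in gs k -> G s.
  move=> kd sk; apply: mem_spans; apply/flatten_mapP; exists k => //.
  by rewrite mem_iota.
have lead k s : Q s -> ord k s -> exists c : nat -> A,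
   ord k.+1 (s - \sum_(i < size (l k)) pconst (c i) * g (k, (l k)`_i)).
  move=> Qs os; have : spans (l k) (s k) by rewrite -hl; exists s.
  move=> /spans_coef [c hc]; exists c => i; rewrite ltnS leq_eqVlt pserB.
  have eS j : (\sum_(i < size (l k)) pconst (c i) * g (k, (l k)`_i)) j =
     \sum_(i < size (l k)) c i * (g (k, (l k)`_i) : pser A) j.
    by elim/big_ind2 : _ => // [x1 x2 y1 y2 <- <-//|i' _]; rewrite pconstM.
  rewrite eS => /orP [/eqP ->|ik].
    rewrite hc; apply/eqP; rewrite subr_eq0; apply/eqP; apply: eq_bigr => j _.
    by have [_ _ ->] := hg (k, (l k)`_j) (mem_nth _ (ltn_ord j)).
  rewrite os // big1 ?subr0 // => j _.
  by have [_ o _] := hg (k, (l k)`_j) (mem_nth _ (ltn_ord j)); rewrite o ?mulr0.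
suff QG : Q = G by apply/fgP; rewrite QG; eexists.
apply/seteqP; split=> // s Qs.
have [s' [Qs' os' Gs']] : exists s', [/\ Q s', ord d s' & G (s - s')].
  suff /(_ d (leqnn d)) : forall k, (k <= d)%N -> exists s', [/\ Q s', ord k s' & G (s - s')] by [].
  elim=> [|k IH] kd.
    by exists s; split=> //; rewrite subrr; exact: ideal0.
  have [s1 [Q1 o1 G1]] := IH (ltnW kd); have [c hc] := lead k s1 Q1 o1.
  have Gt : G (\sum_(i < size (l k)) pconst (c i) * g (k, (l k)`_i)).
    apply: ideal_sum => // i _; apply: idealM => //; apply: (gG k); first exact: ltnW.
    by apply: map_f; exact: mem_nth.
  exists (s1 - \sum_(i < size (l k)) pconst (c i) * g (k, (l k)`_i)); split=> //.
    by apply: idealB => //; exact: GQ.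
  by rewrite opprB addrCA addrC; apply: idealD.
rewrite -[s](subrK s'); apply: idealD => // {s Qs Gs'}.
pose r := size (l d); pose gd i : pser A := g (d, (l d)`_i).
have hgd i : (i < r)%N -> [/\ Q (gd i), ord d (gd i) & gd i d = (l d)`_i].
  by move=> ir; have := hg (d, (l d)`_i) (mem_nth _ ir).
have step : forall z : nat * pser A, exists c : nat -> A, Q z.2 -> ord (d + z.1)%N z.2 ->
   ord (d + z.1).+1 (z.2 - \sum_(i < r) pX A ^+ z.1 * (pconst (c i) * gd i)).
  move=> [n t] /=; case: (pselect (Q t /\ ord (d + n)%N t)) => [[Qt ot]|no]; last first.
    by exists (fun=> 0) => q o; case: no.
  have : spans (l d) (t (d + n)%N) by rewrite -hl -(hd _ (leq_addr n d)); exists t.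
  move=> /spans_coef [c hc]; exists c => _ _ i; rewrite ltnS leq_eqVlt pserB.
  have eS j : (\sum_(i < r) pX A ^+ n * (pconst (c i) * gd i)) j =
     \sum_(i < r) (if (j < n)%N then 0 else c i * gd i (j - n)%N).
    elim/big_ind2 : _ => // [x1 x2 y1 y2 <- <-//|i' _]; rewrite pXnM.
    by case: ifP => // _; rewrite pconstM.
  rewrite eS => /orP [/eqP ->|idn].
    rewrite hc; apply/eqP; rewrite subr_eq0; apply/eqP; apply: eq_bigr => j _.
    by rewrite ltnNge leq_addl /= addnK; have [_ _ ->] := hgd j (ltn_ord j).
  rewrite ot // big1 ?subr0 // => j _; case: ltnP => // ni.
  have [_ o _] := hgd j (ltn_ord j); rewrite o ?mulr0 //; lia.
have {step} [C hC] := choice step.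
(* The n-th remainder has order at least d + n. The coefficients used at the successive steps,
   collected into the series [h i], express [s'] by the generators of order [d]. *)
pose fix S n : pser A := if n is m.+1 then
   S m - \sum_(i < r) pX A ^+ m * (pconst (C (m, S m) i) * gd i) else s'.
have hS n : Q (S n) /\ ord (d + n)%N (S n).
  elim: n => [|n [QS oS]]; first by rewrite addn0.
  rewrite addnS /=; split; last exact: (hC (n, S n)).
  apply: idealB => //; apply: ideal_sum => // i _; apply: idealM => //; apply: idealM => //.
  by have [] := hgd i (ltn_ord i).
pose h i : pser A := fun n => C (n, S n) i.
have gdG i : (i < r)%N -> G (gd i).
  by move=> ir; apply: (gG d) => //; apply: map_f; exact: mem_nth.
suff -> : s' = \sum_(i < r) h i * gd i.
  by apply: ideal_sum => // i _; apply: idealM => //; exact: gdG.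
pose trunc n (u : pser A) : pser A := \sum_(k < n) pX A ^+ k * pconst (u k).
have truncE n u j : (j < n)%N -> trunc n u j = u j.
  move=> jn; have -> : trunc n u j = \sum_(k < n) (pX A ^+ k * pconst (u k)) j.
    by rewrite /trunc; elim/big_ind2 : _ => // x1 x2 y1 y2 <- <-.
  rewrite (bigD1 (Ordinal jn)) //= pXnM ltnn subnn /= big1 ?addr0 // => k /eqP nk.
  rewrite pXnM; case: ltnP => // kj; have : (0 < j - k)%N.
    by rewrite subn_gt0 ltn_neqAle kj andbT; apply/eqP => e; case: nk; apply: val_inj.
  by case: (j - k)%N.
have SE n : S n = s' - \sum_(i < r) trunc n (h i) * gd i.
  elim: n => [|n IH].
    rewrite /= big1 ?subr0 // => i _; by rewrite /trunc big_ord0 mul0r.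
  rewrite /= IH -addrA -opprD -big_split /=; congr (_ - _); apply: eq_bigr => i _.
  by rewrite /trunc big_ord_recr /= mulrDl -IH /h; ring.
apply: funext => j; have [_ oS] := hS j.+1.
have := oS j; rewrite SE pserB => /(_ _)/eqP; rewrite subr_eq0 => /(_ _)/eqP -> //; last by lia.
have sumE (F : 'I_r -> pser A) : (\sum_(i < r) F i) j = \sum_(i < r) F i j.
  by elim/big_ind2 : _ => // x1 x2 y1 y2 <- <-.
rewrite !sumE; apply: eq_bigr => i _; rewrite !pserM; apply: eq_bigr => k _.
by rewrite truncE.
Qed.

End PserNoetherian.

(** Successive approximation: surjectivity modulo [J] lifts through all powers, as [J] is generated
    by the image of [M], [E] is complete and [B] separated. *)
Lemma complete_surj (E B : comPzRingType) (phi : {rmorphism E -> B}) (M : set E) (J : set B) :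
  is_ideal M -> is_ideal J -> adically_complete M -> (forall b, (forall n, ideal_pow J n b) -> b = 0) ->
  J = ideal_span (phi @` M) ->
  (forall b, exists e, J (b - phi e)) -> forall b, exists e, phi e = b.
Proof.
move=> iM iJ [_ comp] sep EJ dense b.
have phiM n m : ideal_pow M n m -> ideal_pow J n (phi m) by rewrite EJ; exact: map_pow.
have step n x : ideal_pow J n x -> exists2 e, ideal_pow M n e & ideal_pow J n.+1 (x - phi e).
  have iK : is_ideal [set x | exists2 e, ideal_pow M n e & ideal_pow J n.+1 (x - phi e)].
    split.
    - by exists 0; [exact: ideal0|rewrite rmorph0 subrr; exact: ideal0].
    - move=> x1 x2 [e1 m1 h1] [e2 m2 h2]; exists (e1 + e2); first exact: idealD.
      have -> : x1 + x2 - phi (e1 + e2) = (x1 - phi e1) + (x2 - phi e2) by rewrite rmorphD; ring.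
      exact: idealD.
    - move=> c x1 [e1 m1 h1]; have [e' he'] := dense c; exists (e' * e1); first exact: idealM.
      have -> : c * x1 - phi (e' * e1) = c * (x1 - phi e1) + (c - phi e') * phi e1.
        by rewrite rmorphM; ring.
      by apply: idealD => //; [exact: idealM|apply: mulidI => //; exact: phiM].
  rewrite {1}EJ span_map_pow; move: x; apply: span_min => // _ [m Mm <-].
  by exists m => //; rewrite subrr; exact: ideal0.
have /choice [f hf] : forall z : nat * B, exists e, ideal_pow J z.1 z.2 ->
    ideal_pow M z.1 e /\ ideal_pow J z.1.+1 (z.2 - phi e).
  move=> [n x] /=; case: (pselect (ideal_pow J n x)) => [/step [e h1 h2]|nx]; last by exists 0.
  by exists e.
pose fix u n : E := if n is m.+1 then u m + f (m, b - phi (u m)) else 0.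
have hu n : ideal_pow J n (b - phi (u n)).
  elim: n => // n IH; rewrite /= rmorphD opprD addrA.
  by have [] := hf (n, b - phi (u n)) IH.
have [|l hl] := comp u.
  by move=> n; rewrite /= addrAC subrr add0r; have [] := hf (n, b - phi (u n)) (hu n).
exists l; apply/eqP; rewrite -subr_eq0; apply/eqP; apply: sep => n.
have -> : phi l - b = phi (l - u n) - (b - phi (u n)) by rewrite rmorphB; ring.
by apply: idealB => //; apply: phiM.
Qed.

(* The ring of fractions c / a^k, as a subring of a ring where a is invertible. *)
Section FractionRing.
Variables (A B : comPzRingType) (r : {rmorphism A -> B}) (a : A).

Definition fracp : {pred B} := [pred b | `[< exists k c, r a ^+ k * b = r c >]].

Lemma fracp_subring : subring_closed fracp.
Proof.
split.
- by apply/asboolP; exists 0%N, 1; rewrite rmorph1 mul1r.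
- move=> x y /asboolP [k [c hc]] /asboolP [l [d hd]]; apply/asboolP.
  exists (k + l)%N, (a ^+ l * c - a ^+ k * d).
  by rewrite rmorphB !rmorphM !rmorphXn -hc -hd exprD; ring.
- move=> x y /asboolP [k [c hc]] /asboolP [l [d hd]]; apply/asboolP.
  by exists (k + l)%N, (c * d); rewrite rmorphM -hc -hd exprD; ring.
Qed.
HB.instance Definition _ := GRing.isSubringClosed.Build B fracp fracp_subring.

Record fracR := FracR { fracv : B; fracvP : fracv \in fracp }.
HB.instance Definition _ := [isSub for fracv].
HB.instance Definition _ := Choice.copy fracR (sub_type fracR).
HB.instance Definition _ := GRing.SubChoice_isSubComPzRing.Build B fracp fracR fracp_subring.

Let rin c : r c \in fracp.
Proof. by apply/asboolP; exists 0%N, c; rewrite mul1r. Qed.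
Definition frac_in c : fracR := FracR (rin c).
Let injB : zmod_morphism frac_in. Proof. by move=> x y; apply: val_inj; exact: rmorphB. Qed.
Let injM : monoid_morphism frac_in.
Proof. by split=> [|x y]; apply: val_inj; [exact: rmorph1|exact: rmorphM]. Qed.
HB.instance Definition _ := GRing.isZmodMorphism.Build A fracR frac_in injB.
HB.instance Definition _ := GRing.isMonoidMorphism.Build A fracR frac_in injM.

Lemma fracR_noetherian : is_unit (r a) -> noetherian_ring A -> noetherian_ring fracR.
Proof.
move=> [v rv] nA Q iQ.
have vin : v \in fracp by apply/asboolP; exists 1%N, 1; rewrite rmorph1 expr1.
have hfg := fg_map frac_in (nA _ (preim_ideal frac_in iQ)).
suff E : ideal_span (frac_in @` (frac_in @^-1` Q)) = Q by rewrite -E.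
apply/seteqP; split; first by apply: span_min => // _ [c Qc <-].
move=> q Qq; have /asboolP [k [c hc]] := fracvP q.
have ea : frac_in a * FracR vin = 1 by exact: val_inj.
have eq1 : frac_in a ^+ k * q = frac_in c.
  by apply: val_inj; rewrite rmorphM rmorphXn.
have -> : q = FracR vin ^+ k * frac_in c.
  by rewrite -eq1 mulrA -exprMn [_ * frac_in a]mulrC ea expr1n mul1r.
by apply: idealM => //; apply: subspan; exists c => //; rewrite /preimage /= -eq1; exact: idealM.
Qed.

Definition frac_val : {rmorphism fracR -> B} := GRing.RMorphism.clone _ _ (val : fracR -> B) _.

End FractionRing.

Fixpoint rtow (A : comPzRingType) n : comPzRingType := if n is m.+1 then pser (rtow A m) else A.

Lemma rtow_noetherian A n : noetherian_ring A -> noetherian_ring (rtow A n).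
Proof. by move=> nA; elim: n => //= n IH; exact: pser_noetherian. Qed.

Fixpoint rtowI (A : comPzRingType) n : set (rtow A n) :=
  if n is m.+1 return set (rtow A n) then pideal (@rtowI A m) else [set 0].

Lemma rtowI_fg A n : fg_ideal (@rtowI A n).
Proof.
elim: n => [|n IH]; last exact: pideal_fg.
by apply/fgP; exists [::]; rewrite spans_nil.
Qed.

Lemma rtowI_complete A n : adically_complete (@rtowI A n).
Proof.
elim: n => [|n IH] /=; last by apply: pideal_complete => //; exact: fg_is_ideal (rtowI_fg _ _).
have p1 : ideal_pow [set 0 : A] 1 = [set 0] by exact: pow1.
split=> [a ha|u hu]; first by have := ha 1%N; rewrite p1.
exists (u 1%N) => -[|n] //.
suff -> : u n.+1 = u 1%N by rewrite subrr; exact: ideal0.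
elim: n => // n <-; apply/eqP; rewrite -subr_eq0; apply/eqP.
by have : ideal_pow [set 0] 1 (u n.+2 - u n.+1) by [apply: pow_le (hu n.+1)]; rewrite p1.
Qed.

(* Evaluation of a power series ring in several variables at elements of an ideal
   of definition. *)
Lemma rtow_eval (X : formalScheme) (W : set X) (oW : open W) (A : comPzRingType)
  (phi : {rmorphism A -> sec W}) (l : seq (sec W)) : (forall g, g \in l -> nil g) ->
  exists ev : {rmorphism rtow A (size l) -> sec W},
   (exists inj : {rmorphism A -> rtow A (size l)}, forall a, ev (inj a) = phi a) /\
   ideal_span (ev @` @rtowI A (size l)) = spans l.
Proof.
elim: l => [|g l IH] hl.
  exists phi; split; first by exists idfun.
  rewrite spans_nil; apply/seteqP; split; last by move=> _ ->; exact: ideal0.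
  by apply: span_min => // _ [_ -> <-]; exact: rmorph0.
have [|ev [[inj hinj] hI]] := IH; first by move=> h hh; apply: hl; rewrite inE hh orbT.
have ng : nil g by apply: hl; rewrite inE eqxx.
have [ev' [_ [evc evX]]] := pser_eval_ex oW ev ng.
exists ev'; split.
  by exists (GRing.RMorphism.clone _ _ (@pconst (rtow A (size l)) \o inj) _) => a; rewrite /= evc.
have iI := fg_is_ideal (rtowI_fg A (size l)).
rewrite spans_cons -hI; apply/seteqP; split.
  apply: span_min; first exact: addid_ideal (princ_ideal g) (span_ideal _).
  move=> _ [s s0 <-]; rewrite [s]pser_recl rmorphD rmorphM evX evc addrC.
  exists (g * ev' (pshift s)), (ev (s 0%N)); split=> //.
    by exists (ev' (pshift s)); rewrite mulrC.
  by apply: subspan; exists (s 0%N).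
apply: addid_min => //.
  move=> _ [c ->]; apply: idealM => //; apply: subspan; exists (pX (rtow A (size l))) => //.
  exact: ideal0.
apply: span_min => // _ [s s0 <-]; apply: subspan; exists (pconst s); first by [].
exact: evc.
Qed.

(** The completed localisation is a quotient of a power series ring over the ring of fractions with
    denominators powers of [a], the variables being sent to generators of [J]. *)
Lemma loc_noetherian (X : formalScheme) (U : set X) (I : set (sec U)) (aI : affine I) (a : sec U)
  W (oU : open U) (oW : open W) (WU : W `<=` U) : W = basic_open a ->
  noetherian_ring (sec U) -> noetherian_ring (sec W).
Proof.
move=> eW nU; pose r := res oU oW WU; pose J := ideal_span (r @` I).
have [compJ topJ locJ] := affine_loc aI oU oW WU eW.
have aJ : affine J := affine_basic_aux aI (@fs_local X) oU oW WU eW.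
have iJ : is_ideal J := affine_ideal aJ.
have ura : is_unit (r a) by apply: res_unit; rewrite eW.
have /fgP [l hl] := affine_fg aJ.
have nl g : g \in l -> nil g.
  move=> gl; apply: (affine_open_nil aJ); rewrite hl; exact: mem_spans.
have [ev [[inj hinj] hev]] := rtow_eval oW (frac_val r a) nl.
apply: (noetherian_surj (f := ev)); last first.
  by apply: rtow_noetherian; exact: fracR_noetherian.
have [sepJ _] := compJ.
apply: (complete_surj (fg_is_ideal (rtowI_fg _ _)) iJ (rtowI_complete _ _) sepJ).
  by rewrite hev.
move=> b; have [_ /(_ b) [k [c hc]] _] := locJ 1%N.
rewrite pow1 // in hc; have [v hv] := unitX k ura.
have vin : v * r c \in fracp r a.
  by apply/asboolP; exists k, c; rewrite mulrA hv mul1r.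
exists (inj (FracR vin)); rewrite hinj /=.
have -> : b - v * r c = v * (r a ^+ k * b - r c) by ring: hv.
exact: idealM.
Qed.

(** * Change of the ideal of definition; transport along isomorphisms *)

Section PowMore.
Variable A : comPzRingType.
Implicit Types (I J : set A).

Lemma mulidA I J K : ideal_mul I (ideal_mul J K) `<=` ideal_mul (ideal_mul I J) K.
Proof.
apply: mulid_min => // x y Ix; move: y; apply: mulid_min.
  split=> [|a b|c a] /=; first by rewrite mulr0; exact: ideal0.
    by rewrite mulrDr; exact: idealD.
  by rewrite mulrCA; exact: idealM.
by move=> y z Jy Kz /=; rewrite mulrA; apply: mulidI => //; exact: mulidI.
Qed.

Lemma pow_addS I m n : ideal_pow I (m + n) `<=` ideal_mul (ideal_pow I m) (ideal_pow I n).
Proof.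
elim: m => [|m IH].
  by move=> x hx; rewrite -[x]mul1r; exact: mulidI.
rewrite addSn !powS => x hx; apply: mulidA; move: x hx.
apply: mulid_min => // x y Ix hy; apply: mulidI => //; exact: IH.
Qed.

Lemma pow_mulS I m n : ideal_pow I (m * n) `<=` ideal_pow (ideal_pow I m) n.
Proof.
elim: n => [|n IH]; first by rewrite muln0.
rewrite mulnS powS => x /pow_addS; move: x; apply: mulid_min => // x y hx hy.
by apply: mulidI => //; exact: IH.
Qed.

Lemma pow_cofinal I J a n : ideal_pow I a `<=` J -> ideal_pow I (a * n) `<=` ideal_pow J n.
Proof. by move=> h x /pow_mulS; exact: pow_mono. Qed.

Lemma complete_change I J a b : ideal_pow I a `<=` J -> ideal_pow J b `<=` I ->
  adically_complete I -> adically_complete J.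
Proof.
move=> hIJ hJI [sep comp]; split=> [x hx|u hu].
  by apply: sep => n; apply: (pow_cofinal hJI).
have tele : forall m n, (n <= m)%N -> ideal_pow J n (u m - u n).
  move=> m n nm; apply: (pow_tele (K := n)); last by rewrite leqnn.
  by move=> k nk; apply: pow_le (hu k).
have [|l hl] := comp (fun n => u (b * n)%N).
  by move=> n; apply: (pow_cofinal hJI); apply: tele; rewrite leq_mul2l leqnSn orbT.
exists l => n.
have h1 := pow_cofinal hIJ (hl (a * n)%N).
have -> : l - u n = (l - u (b * (n + a * n))%N) + (u (b * (n + a * n))%N - u n) by ring.
(* For b = 0 the ideal [I] is the whole ring, and separatedness makes the ring zero. *)
case: (posnP b) => [b0|b0].
  have I1 : I 1 by apply: hJI; rewrite b0.
  have z (x : A) : x = 0.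
    by apply: sep => k; rewrite -[x]mulr1 -(expr1n _ k); apply: idealM => //; exact: powX.
  by rewrite [_ - _]z [X in _ + X]z addr0; exact: ideal0.
apply: idealD => //.
  apply: (pow_cofinal hIJ).
  have := hl (n + a * n)%N; apply: pow_le; exact: leq_addl.
by apply: tele; rewrite (leq_trans (leq_addr (a * n) n)) // leq_pmull.
Qed.

End PowMore.

Lemma top_change (A : topComRingType) (I J : set A) a b :
  ideal_pow I a `<=` J -> ideal_pow J b `<=` I -> adic_topology I -> adic_topology J.
Proof.
move=> hIJ hJI top W; split=> [/top h w /h [n hn]|h].
  by exists (b * n)%N => x hx; apply: hn; exact: (pow_cofinal hJI).
apply/top => w /h [n hn]; exists (a * n)%N => x hx; apply: hn; exact: (pow_cofinal hIJ).
Qed.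

Lemma span_map_map (A B C : comPzRingType) (f : {rmorphism A -> B}) (g : {rmorphism B -> C})
   (G : set A) :
  ideal_span (g @` ideal_span (f @` G)) = ideal_span ((fun x => g (f x)) @` G).
Proof.
apply/seteqP; split.
  apply: span_min => // _ [x hx <-]; move: x hx.
  apply: (span_min (preim_ideal g (span_ideal _))) => _ [y Gy <-].
  by apply: subspan; exists y.
apply: span_min => // _ [x Gx <-]; apply: subspan; exists (f x) => //.
by apply: subspan; exists x.
Qed.

Lemma span_map_pow_sub (A B : comPzRingType) (f : {rmorphism A -> B}) (I J : set A) a :
  ideal_pow I a `<=` J -> ideal_pow (ideal_span (f @` I)) a `<=` ideal_span (f @` J).
Proof. by move=> h; rewrite span_map_pow; apply: span_mono => _ [x /h Jx <-]; exists x. Qed.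

Lemma adic_compare (A : topComRingType) (I J : set A) : is_ideal J -> adic_topology I ->
  adic_topology J -> exists a, ideal_pow I a `<=` J.
Proof.
move=> iJ tI tJ; apply/(nbhs_adic tI)/(nbhs_adic tJ).
by exists 1%N; rewrite pow1.
Qed.

Lemma affine_change (X : ringedSpace) (U : set X) (I J : set (sec U)) a b :
  affine I -> fg_ideal J -> ideal_pow I a `<=` J -> ideal_pow J b `<=` I -> affine J.
Proof.
move=> aI fJ hIJ hJI; have iJ := fg_is_ideal fJ; have iI := affine_ideal aI.
have oU := affine_open aI.
have pIJ (p : set (sec U)) : prime_ideal p -> J `<=` p -> I `<=` p.
  by move=> pp Jp x Ix; apply: (primeX pp (n := a)); apply: Jp; apply: hIJ; exact: powX.
have pJI (p : set (sec U)) : prime_ideal p -> I `<=` p -> J `<=` p.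
  by move=> pp Ip x Jx; apply: (primeX pp (n := b)); apply: Ip; apply: hJI; exact: powX.
apply: (@Build_affine _ _ _ oU) => //.
- by move=> x Ux; have [pV IV] := affine_vanishing aI Ux; split=> //; exact: pJI.
- by move=> p pp Jp; apply: (affine_prime aI) => //; exact: pIJ.
- exact: affine_basis aI.
move=> c r J'.
have [comp top loc] := affine_loc aI oU (basic_open_open c) (@basic_open_sub _ _ c) erefl.
set I' := ideal_span _ in comp top loc.
have h1 : ideal_pow I' a `<=` J' by exact: span_map_pow_sub.
have h2 : ideal_pow J' b `<=` I' by exact: span_map_pow_sub.
have iJ' : is_ideal J' := span_ideal _.
split; [exact: (complete_change h1 h2 comp)|exact: (top_change h1 h2 top)|].
move=> n; have [l1 l2 l3] := loc (a * n)%N; split.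
- by have [v hv] := l1; exists v; exact: (pow_cofinal h1).
- by move=> d; have [k [e he]] := l2 d; exists k, e; exact: (pow_cofinal h1).
move=> d; rewrite span_map_pow => hd.
(* The ideal generated over D(c) by [J^n] may contain restrictions of elements outside [J^n]; up to
   a power of [c] and a high power of [I'] they are restrictions of elements of [J^n]. *)
have [k [e [Je he]]] : exists k e, ideal_pow J n e /\ ideal_pow I' (a * n) (r c ^+ k * r d - r e).
  move: (r d) hd; apply: span_min.
    split.
    - exists 0%N, 0; split; first exact: ideal0.
      by rewrite mulr0 rmorph0 subrr; exact: ideal0.
    - move=> x y [k [e [Je he]]] [k' [e' [Je' he']]].
      exists (k + k')%N, (c ^+ k' * e + c ^+ k * e'); split.
        by apply: idealD => //; exact: idealM.
      have -> : r c ^+ (k + k') * (x + y) - r (c ^+ k' * e + c ^+ k * e') =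
        r c ^+ k' * (r c ^+ k * x - r e) + r c ^+ k * (r c ^+ k' * y - r e').
        by rewrite rmorphD !rmorphM !rmorphXn exprD; ring.
      by apply: idealD => //; exact: idealM.
    - move=> z x [k [e [Je he]]]; have [k' [e' he']] := l2 z.
      exists (k + k')%N, (e' * e); split; first exact: idealM.
      have -> : r c ^+ (k + k') * (z * x) - r (e' * e) =
         r c ^+ k' * z * (r c ^+ k * x - r e) + (r c ^+ k' * z - r e') * r e.
        by rewrite rmorphM exprD; ring.
      by apply: idealD => //; [exact: idealM|exact: idealMr].
  move=> _ [e Je <-]; exists 0%N, e; split=> //.
  by rewrite mul1r subrr; exact: ideal0.
have [|k' hk'] := l3 (c ^+ k * d - e); first by rewrite rmorphB rmorphM rmorphXn.
exists (k' + k)%N; rewrite exprD -mulrA.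
have -> : c ^+ k' * (c ^+ k * d) = c ^+ k' * (c ^+ k * d - e) + c ^+ k' * e by ring.
by apply: idealD => //; [exact: (pow_cofinal hIJ)|exact: idealM].
Qed.

Section RingIso.
Variables (A B : comPzRingType) (f : {rmorphism A -> B}).
Hypothesis bf : bijective f.

Let sf b : exists a, f a = b. Proof. by have [g _ gK] := bf; exists (g b). Qed.
Let jf : injective f := bij_inj bf.

Lemma iso_pow I n x : is_ideal I -> ideal_pow (ideal_span (f @` I)) n (f x) <-> ideal_pow I n x.
Proof.
move=> iI; split; last exact: map_pow.
by move=> /(surj_pow sf iI) [y hy /jf <-].
Qed.

Lemma iso_complete I : is_ideal I -> adically_complete I -> adically_complete (ideal_span (f @` I)).
Proof.
move=> iI [sep comp]; split=> [b hb|u hu].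
  have [a ab] := sf b; rewrite -ab; suff -> : a = 0 by exact: rmorph0.
  by apply: sep => n; apply/(iso_pow _ _ iI); rewrite ab.
have /choice [v hv] : forall n, exists a, f a = u n by move=> n; exact: sf.
have [|l hl] := comp v.
  by move=> n; apply/(iso_pow _ _ iI); rewrite rmorphB !hv.
by exists (f l) => n; rewrite -hv -rmorphB; apply/(iso_pow _ _ iI).
Qed.

End RingIso.

Lemma iso_top (A B : topComRingType) (f : {rmorphism A -> B}) (I : set A) : bijective f ->
  continuous f -> (forall W : set A, open W -> open (f @` W)) -> is_ideal I -> adic_topology I ->
  adic_topology (ideal_span (f @` I)).
Proof.
move=> bf cf of' iI top W; have jf := bij_inj bf; have [g fK gK] := bf; split.
  move=> oW w Ww; have : open (f @^-1` W) by apply: open_comp => // x _; exact: cf.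
  move=> /top /(_ (g w)); rewrite /preimage /= gK => /(_ Ww) [n hn].
  exists n => b hb; rewrite -[b]gK -[w]gK -rmorphD; apply: hn.
  by apply/(iso_pow bf _ _ iI); rewrite gK.
move=> h; have -> : W = f @` (f @^-1` W).
  by apply/seteqP; split=> [w Ww|_ [x Wx <-]//]; exists (g w); rewrite /preimage /= ?gK.
apply: of'; apply/top => x Wx; have [n hn] := h _ Wx; exists n => a Ia.
by rewrite /preimage /= rmorphD; apply: hn; exact: map_pow.
Qed.

Lemma iso_loc (A B A' B' : topComRingType) (r : {rmorphism A -> B}) (r' : {rmorphism A' -> B'})
  (f : {rmorphism A -> A'}) (g : {rmorphism B -> B'}) (I : set A) (a : A) :
  bijective f -> bijective g -> continuous g -> (forall W : set B, open W -> open (g @` W)) ->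
  (forall x, r' (f x) = g (r x)) -> is_ideal I ->
  is_loc r I a -> is_loc r' (ideal_span (f @` I)) (f a).
Proof.
move=> bf bg cg og e iI [comp top loc]; rewrite /is_loc.
have EJ : ideal_span (r' @` ideal_span (f @` I)) = ideal_span (g @` ideal_span (r @` I)).
  rewrite !span_map_map; congr ideal_span; apply/seteqP.
  by split=> _ [x Ix <-]; exists x => //; rewrite e.
have [f' fK f'K] := bf; have [g' gK g'K] := bg.
rewrite EJ; split; [exact: iso_complete|exact: iso_top|].
move=> n; have [l1 l2 l3] := loc n; split.
- have [b hb] := l1; exists (g b); rewrite e -rmorphM -(rmorph1 g) -rmorphB.
  exact/(iso_pow bg _ _ (span_ideal _)).
- move=> b; have [k [c hc]] := l2 (g' b); exists k, (f c).
  rewrite !e -rmorphXn -[b]g'K -rmorphM -rmorphB.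
  exact/(iso_pow bg _ _ (span_ideal _)).
- move=> c; rewrite -[c]f'K e => /(iso_pow bg _ _ (span_ideal _))/l3 [k hk]; exists k.
  by rewrite -rmorphXn -rmorphM; apply/(iso_pow bf _ _ iI).
Qed.

Lemma open_pull (X Y : ringedSpace) (j : mor X Y) (U : set Y) (I : set (sec U)) (oU : open U) :
  open_immersion j -> locally_ringed X -> U `<=` range j -> affine I ->
  affine (ideal_span (comap j oU @` I)).
Proof.
move=> [inj oj bj] lr Uj aI; set r0 := comap j oU; have iI := affine_ideal aI.
have [b0 _] := bj U oU Uj; have [r0' r0K r0'K] := b0.
have ojU := mor_open j oU.
have iI' : is_ideal (ideal_span (r0 @` I)) := span_ideal _.
apply: (@Build_affine _ _ _ ojU).
- exact: fg_map (affine_fg aI).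
- move=> x Ux; have pV := vanishing_prime lr ojU (Ux : (j @^-1` U) x); split=> //.
  have [iV _ _] := pV; apply: span_min => // _ [i Ii <-] /(comap_unit j oU i Ux).
  exact: (affine_vanI aI Ux).
- move=> p pp Ip; have pq := preim_prime r0 pp.
  have [|y [[Uy qy] uniq]] := affine_prime aI pq.
    by move=> i Ii; apply: (Ip (r0 i)); apply: subspan; exists i.
  have [x _ xy] := Uj y Uy; subst y; exists x; split.
    split=> //; apply/seteqP; split=> s.
      move=> ps; have : vanishing (j x) (r0' s) by rewrite -qy /preimage /= /r0 r0'K.
      by move=> h /=; rewrite -[s]r0'K => /(comap_unit j oU _ Uy).
    move=> ns; rewrite -[s]r0'K; suff : (r0 @^-1` p) (r0' s) by [].
    rewrite qy => h; apply: ns; rewrite -[s]r0'K; exact/(comap_unit j oU _ Uy).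
  move=> x' [Ux' px']; apply: inj; apply: uniq; split=> //.
  apply/seteqP; split=> c; rewrite /preimage /= px'.
    by move=> h u; apply: h; apply/(comap_unit j oU _ Ux').
  by move=> h /(comap_unit j oU _ Ux').
- move=> W x oW Wx Ux; have [|c [uc cW]] := affine_basis aI (oj _ oW) _ Ux; first by exists x.
  exists (r0 c); split; first exact/(comap_unit j oU _ Ux).
  move=> y uy; have Uy : U (j y) := unit_at_in uy.
  by have /(comap_unit j oU _ Uy)/cW [y' Wy' /inj <-] := uy.
move=> a' r' J'; rewrite /J'; have ea : a' = r0 (r0' a') by rewrite /r0 r0'K.
set a := r0' a' in ea.
have eE : basic_open a' = j @^-1` basic_open a.
  apply/seteqP; split=> y uy.
    have Uy : U (j y) := unit_at_in uy.
    by move: uy; rewrite ea => /(comap_unit j oU _ Uy).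
  have Uy : U (j y) := unit_at_in uy.
  by rewrite ea; apply/(comap_unit j oU _ Uy).
have oa := basic_open_open a.
have aj : basic_open a `<=` range j by move=> y /basic_open_sub /Uj.
have [b1 o1] := bj _ oa aj.
have loc := affine_loc aI oU oa (@basic_open_sub _ _ a) erefl.
rewrite {}/J' {}/r' ea; rewrite ea in eE.
move: (basic_open_open (r0 a)) (@basic_open_sub _ _ (r0 a)).
move: eE; rewrite -/r0.
move: (basic_open (r0 a)) => E eE oE EU; subst E.
apply: (iso_loc (g := comap j oa) (r := res oU oa (@basic_open_sub _ _ a))) => //.
- exact: comap_continuous.
- have UU : j @^-1` basic_open a `<=` j @^-1` U by move=> y /basic_open_sub.
  by move=> s; rewrite (comap_res j oU oa (@basic_open_sub _ _ a) UU); exact: resP.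
Qed.

(** A basic open D(a) of [U1] inside a basic open D(b) of [U2] is basic in D(b), hence basic in [U2]
    by [basic_basic]. *)
Lemma common_basic (X : ringedSpace) (lr : locally_ringed X) (U1 U2 : set X) (I1 : set (sec U1))
  (I2 : set (sec U2)) (W : set X) x :
  affine I1 -> affine I2 -> open W -> U1 x -> U2 x -> W x ->
  exists (a : sec U1) (b : sec U2), [/\ basic_open a = basic_open b, unit_at a x &
     basic_open a `<=` W].
Proof.
move=> a1 a2 oW U1x U2x Wx; have o1 := affine_open a1; have o2 := affine_open a2.
have [b [ub bU]] := affine_basis a2 (openI o1 oW) (conj U1x Wx) U2x.
have ob := basic_open_open b.
have [a [ua ab]] := affine_basis a1 ob ub U1x.
have bU1 : basic_open b `<=` U1 by move=> y /bU [].
have [k [c [Ec _]]] := basic_basic a2 lr o2 ob (@basic_open_sub _ _ b) (res o1 ob bU1 a) erefl.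
have Ea : basic_open (res o1 ob bU1 a) = basic_open a.
  by rewrite basic_open_res; apply/seteqP; split=> [y []//|y uy]; split=> //; exact: ab.
exists a, (b * c); split=> //; first by rewrite -Ec Ea.
by move=> y /ab /bU [].
Qed.

(** * Closed immersions over smaller opens; quasi-compactness *)

Section ClosedShrink.
Variables (X Y : ringedSpace) (f : mor X Y).
Hypotheses (lrX : locally_ringed X) (lrY : locally_ringed Y).

(** By [complete_surj] surjectivity over [W] need only hold modulo an ideal of definition, where
    every section is a fraction whose numerator lifts. *)
Lemma closed_shrink (V : set Y) (oV : open V) (I : set (sec V)) (c : sec V)
   (W : set Y) (oW : open W) (WV : W `<=` V) : W = basic_open c ->
  closed_immersion_over f oV I ->
  closed_immersion_over f oW (ideal_span (res oV oW WV @` I)).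
Proof.
move=> eW [aI aJ sf]; have aW := affine_basic_aux aI lrY oV oW WV eW.
have ofV := mor_open f oV; have ofW := mor_open f oW.
have fWV : f @^-1` W `<=` f @^-1` V by move=> x /WV.
have WE y : W y <-> unit_at c y by rewrite eW.
have eW' : f @^-1` W = basic_open (comap f oV c).
  apply/seteqP; split=> x.
    by move=> /WE uc; apply/(comap_unit f oV c (unit_at_in uc)).
  move=> uc; have Vx : V (f x) := unit_at_in uc.
  by apply/WE/(comap_unit f oV c Vx).
have := affine_basic_aux aJ lrX ofV ofW fWV eW'.
have eJ : ideal_span (res ofV ofW fWV @` ideal_span (comap f oV @` I)) =
     ideal_span (comap f oW @` ideal_span (res oV oW WV @` I)).
  rewrite !span_map_map; congr ideal_span; apply/seteqP.
  by split=> _ [x Ix <-]; exists x => //; rewrite (comap_res f oV oW WV fWV); exact: resP.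
rewrite eJ => aJW; split=> //.
set M := ideal_span (res oV oW WV @` I) in eJ aJW *.
have iM : is_ideal M := span_ideal _.
have [sep _] := affine_complete aJW.
apply: (@complete_surj _ _ (comap f oW) M (ideal_span (comap f oW @` M))) => //.
- exact: affine_complete aW.
move=> b; have [_ _ /(_ 1%N) [_ /(_ b) [k [d hd]] _]] := affine_loc aJ ofV ofW fWV eW'.
rewrite eJ pow1 // in hd; have [d' ed] := sf d; subst d.
have [v hv] : is_unit (res oV oW WV c ^+ k) by apply: unitX; apply: res_unit; rewrite eW.
exists (v * res oV oW WV d').
have rc s : comap f oW (res oV oW WV s) = res ofV ofW fWV (comap f oV s).
  by rewrite (comap_res f oV oW WV fWV); exact: resP.
have hv' : res ofV ofW fWV (comap f oV c) ^+ k * comap f oW v = 1.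
  by rewrite -rc -rmorphXn -rmorphM hv rmorph1.
have -> : b - comap f oW (v * res oV oW WV d') = comap f oW v *
    (res ofV ofW fWV (comap f oV c) ^+ k * b - res ofV ofW fWV (comap f oV d')).
  by rewrite rmorphM rc; ring: hv'.
exact: idealM.
Qed.

(** The kernel is compatible with completed localisation. This is immediate modulo each [M^n];
    Artin-Rees and Nakayama remove the error up to a factor congruent to 1 modulo [M], which is a
    unit because [M] is an ideal of definition. *)
Lemma closed_kernel_shrink (V : set Y) (oV : open V) (I : set (sec V)) (c : sec V)
   (W : set Y) (oW : open W) (WV : W `<=` V) (Q : set (sec V)) : W = basic_open c ->
  closed_immersion_over f oV I -> noetherian_ring (sec W) ->
  is_ideal Q -> (forall a, comap f oV a = 0 -> Q a) ->
  forall b, comap f oW b = 0 -> ideal_span (res oV oW WV @` Q) b.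
Proof.
move=> eW [aI aJ sf] nW iQ hQ.
have aW := affine_basic_aux aI lrY oV oW WV eW.
have ofV := mor_open f oV; have ofW := mor_open f oW.
have fWV : f @^-1` W `<=` f @^-1` V by move=> x /WV.
have WE y : W y <-> unit_at c y by rewrite eW.
have eW' : f @^-1` W = basic_open (comap f oV c).
  apply/seteqP; split=> x.
    by move=> /WE uc; apply/(comap_unit f oV c (unit_at_in uc)).
  move=> uc; have Vx : V (f x) := unit_at_in uc.
  by apply/WE/(comap_unit f oV c Vx).
have rc s : comap f oW (res oV oW WV s) = res ofV ofW fWV (comap f oV s).
  by rewrite (comap_res f oV oW WV fWV); exact: resP.
set r := res oV oW WV; set M := ideal_span (r @` I); set K := [set b | comap f oW b = 0].
have iM : is_ideal M := span_ideal _.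
have iK : is_ideal K := preim_ideal (comap f oW) (set0_ideal _).
have iQ' : is_ideal (ideal_span (r @` Q)) := span_ideal _.
have iI := affine_ideal aI.
(* Denominators are cleared twice, first in [b] over [W] and then in its vanishing over the preimage
   of [W]; surjectivity over [V] corrects the numerator into the kernel. *)
have key n b : K b -> ideal_add (ideal_span (r @` Q)) (ideal_pow M n) b.
  move=> Kb; have [_ _ loc] := affine_loc aI oV oW WV eW.
  have [_ /(_ b) [k [d hd]] _] := loc n.
  have hd0 : ideal_pow (ideal_span (res ofV ofW fWV @` ideal_span (comap f oV @` I))) n
     (res ofV ofW fWV (comap f oV d)).
    have := map_pow (comap f oW) hd; rewrite rmorphB rmorphM Kb mulr0 sub0r rc => h.
    rewrite -[res _ _ _ _]opprK; apply: idealN => //.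
    rewrite span_map_map; move: h; rewrite span_map_map.
    suff -> : (fun x => comap f oW (res oV oW WV x)) = (fun x => res ofV ofW fWV (comap f oV x)) by [].
    by apply: funext => x; exact: rc.
  have [_ _ /(_ n) [_ _ /(_ _ hd0) [l]]] := affine_loc aJ ofV ofW fWV eW'.
  rewrite -rmorphXn -rmorphM => /(surj_pow sf iI) [y Iy ey].
  have Qy : Q (c ^+ l * d - y) by apply: hQ; rewrite rmorphB ey subrr.
  have [v hv] : is_unit (r c ^+ (k + l)) by apply: unitX; apply: res_unit; rewrite eW.
  exists (v * r (c ^+ l * d - y)), (v * (r y + r c ^+ l * (r c ^+ k * b - r d))); split.
  - by apply: idealM => //; apply: subspan; exists (c ^+ l * d - y).
  - by apply: idealM => //; apply: idealD => //; [exact: map_pow|exact: idealM].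
  - rewrite -{1}[b]mul1r -hv exprD rmorphB rmorphM rmorphXn; ring.
have [n hn] := artin_rees nW iM iK.
have QK : ideal_span (r @` Q) `<=` ideal_span (r @` Q) by [].
have [a Ma ha] : exists2 a, M (1 - a) & forall b, K b -> ideal_span (r @` Q) (a * b).
  pose K' := ideal_add (ideal_span (r @` Q)) K.
  have iK' : is_ideal K' := addid_ideal iQ' iK.
  have [m hm] := artin_rees nW iM iK'.
  have [|a Ma ha] := @nakayama _ M K' (ideal_span (r @` Q)) iM iQ' (nW _ iK').
    apply: addid_min; first exact: addid_ideal.
      by move=> x; exact: addidl.
    move=> x Kx; have [u [y [hu hy ex]]] := key m x Kx.
    exists u, y; split=> //; apply: hm; split=> //.
    have -> : y = x - u by rewrite ex; ring.
    by apply: idealB => //; [exact: addidr|exact: addidl].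
  by exists a => // b Kb; apply: ha; exact: addidr.
have ua : is_unit a.
  apply: (unit_all oW) => x Wx; apply: (van_congr aW (a := 1)) => //; exact: unit_at1.
by move=> b Kb; apply: (unit_ideal iQ' ua); exact: ha.
Qed.

End ClosedShrink.

(** For a filter on [W] without cluster point, the functions c such that the filter lives off D(c)
    form an ideal with no common zero in [W]. It has finitely many generators, so the filter lives
    on their common zeros, a contradiction. *)
Lemma noeth_compact (X : ringedSpace) (U : set X) (I : set (sec U)) (W : set X) :
  affine I -> noetherian_ring (sec U) -> open W -> W `<=` U -> compact W.
Proof.
move=> aI nU oW WU F FF FW; apply: contrapT => nc.
pose Q := [set c : sec U | F (~` basic_open c)].
have van y : U y -> is_ideal (@vanishing X U y) by move=> /(affine_van aI) [].
have iQ : is_ideal Q.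
  split.
  - apply: filterE => y u0; have Uy := unit_at_in u0; exact: (ideal0 (van _ Uy) u0).
  - move=> a b Qa Qb; apply: filterS (filterI Qa Qb) => y [na nb] uab.
    exact: (idealD (van _ (unit_at_in uab)) na nb uab).
  - by move=> c a; apply: filterS => y na /unit_atM [].
have cQ y : W y -> exists2 c, Q c & unit_at c y.
  move=> Wy; have : ~ cluster F y by move=> Fy; apply: nc; exists y.
  move=> /existsNP [S /existsNP [N /not_implyP [FS /not_implyP [Ny SN]]]].
  have [O [oO Oy] ON] : exists2 O, open O /\ O y & O `<=` N.
    by move: Ny; rewrite nbhsE => -[O [oO Oy] ON]; exists O.
  have [c [uc cO]] := affine_basis aI oO Oy (WU _ Wy).
  exists c => //; apply: filterS FS => z Sz /cO /ON Nz.
  by apply: SN; exists z.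
have /fgP [l hl] := nU _ iQ.
have Fl : F [set y | forall c, c \in l -> ~ unit_at c y].
  have : forall c, c \in l -> Q c by move=> c cl; rewrite hl; exact: mem_spans.
  elim: (l) => [_|c l' IH h]; first exact: filterE.
  have hc : Q c by apply: h; rewrite inE eqxx.
  have {}IH := IH (fun d dl => h d (mem_behead (s := c :: l') dl)).
  apply: filterS (filterI hc IH) => y [ny nl] d; rewrite inE => /orP [/eqP ->|] //.
  exact: nl.
have [y [Wy ny]] := filter_ex (filterI FW Fl).
have [c Qc uc] := cQ y Wy.
have iv := van y (WU _ Wy).
have : spans l `<=` @vanishing X U y by apply: spans_min.
by move=> /(_ c); rewrite -hl => /(_ Qc); apply.
Qed.

(** * Open formal subschemes *)

Section OpenSub.
Variables (Y : ringedSpace) (D : set Y).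
Hypothesis oD : open D.

Definition osub : Type := {y : Y | D y}.
HB.instance Definition _ := gen_eqMixin osub.
HB.instance Definition _ := gen_choiceMixin osub.

Definition oval (p : osub) : Y := sval p.
Definition oimg (U : set osub) : set Y := [set y | exists p, U p /\ oval p = y].

Let oval_inj : injective oval.
Proof. by move=> [x Dx] [y Dy] /= e; case: _ / e Dy => Dy; rewrite (Prop_irrelevance Dx Dy). Qed.

Lemma oimgE U p : oimg U (oval p) <-> U p.
Proof. by split=> [[q [Uq /oval_inj <-]]|Up]; [|exists p]. Qed.

Lemma oimg_D U : oimg U `<=` D. Proof. by move=> _ [[y Dy] [_ <-]]. Qed.

Lemma oimg_pre (V : set Y) : V `<=` D -> oimg (oval @^-1` V) = V.
Proof.
move=> VD; apply/seteqP; split=> [_ [p [Vp <-]]//|y Vy].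
by exists (exist _ y (VD y Vy)).
Qed.

Lemma oimg_sub U V : V `<=` U -> oimg V `<=` oimg U.
Proof. by move=> VU _ [p [/VU Up <-]]; exists p. Qed.

Let opT : open (oimg setT).
Proof.
have -> : oimg setT = D by apply/seteqP; split; [exact: oimg_D|move=> y Dy; exists (exist _ y Dy)].
exact: oD.
Qed.
Let opI : setI_closed [set U | open (oimg U)].
Proof.
move=> U V oU oV; rewrite /=.
have -> : oimg (U `&` V) = oimg U `&` oimg V.
  apply/seteqP; split=> [_ [p [[Up Vp] <-]]|_ [[p [Up <-]] /oimgE Vp]].
    by split; exists p.
  by exists p.
exact: openI.
Qed.
Let op_bigU (K : Type) (f : K -> set osub) : (forall i, open (oimg (f i))) ->
  open (oimg (\bigcup_i f i)).
Proof.
move=> h; have -> : oimg (\bigcup_i f i) = \bigcup_i oimg (f i).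
  apply/seteqP; split=> [_ [p [[i _ fp] <-]]|_ [i _ [p [fp <-]]]].
    by exists i => //; exists p.
  by exists p; split=> //; exists i.
exact: bigcup_open.
Qed.

HB.instance Definition _ := isOpenTopological.Build osub opT opI op_bigU.

Lemma osub_openE (U : set osub) : open U = open (oimg U). Proof. by []. Qed.

Let ores U V (oU : open U) (oV : open V) (VU : V `<=` U) :
  {rmorphism sec (oimg U) -> sec (oimg V)} := res (oU : open (oimg U)) (oV : open (oimg V)) (oimg_sub VU).

Let ores_cont U V (oU : open U) (oV : open V) (VU : V `<=` U) : continuous (ores oU oV VU).
Proof. exact: res_continuous. Qed.
Let ores_id U (oU oU' : open U) (UU : U `<=` U) s : ores oU oU' UU s = s.
Proof. exact: res_id. Qed.
Let ores_res U V W (oU : open U) (oV : open V) (oW : open W)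
    (VU : V `<=` U) (WV : W `<=` V) (WU : W `<=` U) s :
    ores oV oW WV (ores oU oV VU s) = ores oU oW WU s.
Proof. exact: res_res. Qed.

Let osep U (C : set (set osub)) (oU : open U)
    (oC : forall W, C W -> open W) (CU : forall W, C W -> W `<=` U) (s : sec (oimg U)) :
    U `<=` \bigcup_(W in C) W ->
    (forall W (CW : C W), ores oU (oC W CW) (CU W CW) s = 0) -> s = 0.
Proof.
move=> cov h; pose K := {W | C W}.
apply: (@sec_sep Y _ (oU : open (oimg U)) K (fun k => oimg (sval k))
  (fun k => oC _ (svalP k)) (fun k => oimg_sub (CU _ (svalP k)))).
  by move=> _ [p [/cov [W CW Wp] <-]]; exists (exist _ W CW) => //; exists p.
by move=> k; rewrite rmorph0; exact: h.
Qed.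

Let oglue U (C : set (set osub)) (oU : open U)
    (oC : forall W, C W -> open W) (CU : forall W, C W -> W `<=` U)
    (f : forall W, sec (oimg W)) :
    U `<=` \bigcup_(W in C) W ->
    (forall W W' (CW : C W) (CW' : C W') V (oV : open V)
       (VW : V `<=` W) (VW' : V `<=` W'),
       ores (oC W CW) oV VW (f W) = ores (oC W' CW') oV VW' (f W')) ->
    exists s, forall W (CW : C W), ores oU (oC W CW) (CU W CW) s = f W.
Proof.
move=> cov h; pose K := {W | C W}.
have [||s hs] := @sec_glue Y _ (oU : open (oimg U)) K (fun k => oimg (sval k))
  (fun k => oC _ (svalP k)) (fun k => oimg_sub (CU _ (svalP k))) (fun k => f (sval k)).
- by move=> _ [p [/cov [W CW Wp] <-]]; exists (exist _ W CW) => //; exists p.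
- move=> [W CW] [W' CW'] V oV /= VW VW'.
  have VD : V `<=` D by move=> y /VW /oimg_D.
  (* Every open subset of [D] is the image of its preimage; substituting the image for the set makes
     the types of sections agree. *)
  have eV := oimg_pre VD; move: (oval @^-1` V) eV => V0 eV; subst V.
  have V0W : V0 `<=` W by move=> p p0; apply/oimgE; apply: VW; exists p.
  have V0W' : V0 `<=` W' by move=> p p0; apply/oimgE; apply: VW'; exists p.
  by apply: etrans (etrans _ (h W W' CW CW' V0 oV V0W V0W')) _; exact: resP.
exists s => W CW; have /= := hs (exist _ W CW); move=> <-; exact: resP.
Qed.

Let otop U (C : set (set osub)) (oU : open U)
    (oC : forall W, C W -> open W) (CU : forall W, C W -> W `<=` U)
    (N : set (sec (oimg U))) :
    U `<=` \bigcup_(W in C) W -> nbhs 0 N ->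
    exists (E : set (set osub)) (M : forall W, set (sec (oimg W))),
      [/\ finite_set E, E `<=` C, forall W, nbhs 0 (M W) &
          forall s, (forall W (CW : C W), E W ->
            M W (ores oU (oC W CW) (CU W CW) s)) -> N s].
Proof.
move=> cov N0; pose C' := [set oimg W | W in C].
have oC' W : C' W -> open W by move=> [V CV <-]; exact: oC.
have CU' W : C' W -> W `<=` oimg U by move=> [V CV <-]; exact/oimg_sub/CU.
have [|E' [M' [fE EC M0 EN]]] := @sheaf_topology Y _ C' (oU : open (oimg U)) oC' CU' N _ N0.
  by move=> _ [p [/cov [W CW Wp] <-]]; exists (oimg W); [exists W|exists p].
exists [set oval @^-1` W | W in E'], (fun W => M' (oimg W)); split.
- exact: finite_image.
- move=> _ [W' /EC [W CW <-] <-]; suff -> : oval @^-1` oimg W = W by [].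
  by apply/seteqP; split=> p /oimgE.
- by move=> W; exact: M0.
move=> s hs; apply: EN => W' CW' EW'; have [W CW eW] := CW'.
have eW2 : oval @^-1` W' = W by rewrite -eW; apply/seteqP; split=> p /oimgE.
have := hs W CW; rewrite /ores; case: _ / eW in CW' EW' eW2 *.
rewrite (resP _ oU _ (oC' _ CW') _ (CU' _ CW')); apply.
by exists (oimg W).
Qed.

Definition rsub : ringedSpace := {|
  space := osub;
  sec := fun U => sec (oimg U);
  res := ores;
  res_continuous := ores_cont;
  res_id := ores_id;
  res_res := ores_res;
  sheaf_separated := osep;
  sheaf_glue := oglue;
  sheaf_topology := otop |}.

Let inc_open (V : set Y) : open V -> open (oval @^-1` V).
Proof.
move=> oV; rewrite osub_openE.
have -> : oimg (oval @^-1` V) = V `&` D.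
  apply/seteqP; split=> [_ [p [Vp <-]]|y [Vy Dy]]; first by split=> //; exact: (svalP p).
  by exists (exist _ y Dy).
exact: openI.
Qed.

Let inc_sub (V : set Y) : oimg (oval @^-1` V) `<=` V.
Proof. by move=> _ [p [Vp <-]]. Qed.

Let inc_comap (V : set Y) (oV : open V) : {rmorphism sec V -> @sec rsub (oval @^-1` V)} :=
  res oV (inc_open oV : open (oimg _)) (@inc_sub V).

Let inc_cont (V : set Y) (oV : open V) : continuous (inc_comap oV).
Proof. exact: res_continuous. Qed.

Let inc_res (U V : set Y) (oU : open U) (oV : open V) (VU : V `<=` U)
    (VU' : oval @^-1` V `<=` oval @^-1` U) s :
    inc_comap oV (res oU oV VU s) = ores (inc_open oU) (inc_open oV) VU' (inc_comap oU s).
Proof.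
have h : oimg (oval @^-1` V) `<=` U by move=> y /inc_sub /VU.
by rewrite /inc_comap /ores !(res_res _ _ _ _ _ h).
Qed.

Lemma rsub_unit_at (U : set osub) (oU : open U) (s : @sec rsub U) p :
  @unit_at rsub U s p <-> @unit_at Y (oimg U) s (oval p).
Proof.
split=> [[W [oU' [oW [WU [Wp us]]]]]|[W [oU' [oW [WU [Wp us]]]]]].
  exists (oimg W), (oU' : open (oimg U)), (oW : open (oimg W)), (oimg_sub WU).
  by split=> //; apply/oimgE.
have WD : W `<=` D by move=> y /WU /oimg_D.
have eW := oimg_pre WD; move: (oval @^-1` W) eW => W0 eW; subst W.
have W0U : W0 `<=` U by move=> q q0; apply/oimgE; exact: (WU _ (ex_intro _ q (conj q0 erefl))).
exists W0, (oU' : open U), (oW : open W0), W0U; split; first exact/oimgE.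
by move: us; rewrite (resP _ oU' _ oW _ (oimg_sub W0U)).
Qed.

Let inc_local (V : set Y) (oV : open V) (s : sec V) (p : rsub) : V (oval p) ->
  @unit_at rsub _ (inc_comap oV s) p -> unit_at s (oval p).
Proof.
move=> Vp /(rsub_unit_at (inc_open oV)) us.
apply/(unit_atW oV (inc_open oV : open (oimg _)) (@inc_sub V)); last exact: us.
exact/oimgE.
Qed.

Definition rinc : mor rsub Y := @Mor rsub Y oval inc_open inc_comap inc_cont inc_res inc_local.

Lemma rinc_open_immersion : open_immersion rinc.
Proof.
split; first exact: oval_inj.
  move=> U oU; have -> : rinc @` U = oimg U; last exact: oU.
  by apply/seteqP; split=> [_ [p Up <-]|_ [p [Up <-]]]; [exists p|exists p].
move=> V oV VD.
have {}VD : V `<=` D by move=> y /VD [p _ <-]; exact: (svalP p).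
have eV : oimg (oval @^-1` V) = V := oimg_pre VD.
have Ve : V `<=` oimg (oval @^-1` V) by rewrite eV.
pose r' : {rmorphism sec (oimg (oval @^-1` V)) -> sec V} := res (inc_open oV : open (oimg _)) oV Ve.
have k1 : cancel (comap rinc oV) r' by move=> s; rewrite /r' /= (res_res _ _ _ _ _ (@subset_refl _ _)) res_id.
have k2 : cancel r' (comap rinc oV).
  by move=> s; rewrite /r' /= (res_res _ _ _ _ _ (@subset_refl _ _)) res_id.
split; first by exists r'.
move=> W oW; have -> : comap rinc oV @` W = r' @^-1` W.
  apply/seteqP; split=> [_ [s Ws <-]|s Ws]; first by rewrite /preimage /= k1.
  by exists (r' s) => //; exact: k2.
by apply: open_comp => // s _; exact: res_continuous.
Qed.

Lemma rinc_range y : D y -> range rinc y.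
Proof. by move=> Dy; exists (exist _ y Dy). Qed.

Lemma rsub_locally_ringed : locally_ringed Y -> locally_ringed rsub.
Proof.
move=> lr U p oU Up.
have [n0 nD] := lr (oimg U) (oval p) oU ((oimgE _ _).2 Up).
split; first by move=> /(rsub_unit_at oU).
move=> s t /(rsub_unit_at oU) /nD [] us; [left|right]; exact/(rsub_unit_at oU).
Qed.

End OpenSub.

Definition fsub (Y : formalScheme) (D : set Y) (oD : open D) : formalScheme.
Proof.
apply: (@FormalScheme (rsub oD)).
  exact: rsub_locally_ringed (@fs_local Y).
move=> p; have [U [I [aI Up UD]]] := affine_nbhd oD (svalP p).
have UR : U `<=` range (rinc oD) by move=> y /UD; exact: rinc_range.
exists (rinc oD @^-1` U), (ideal_span (comap (rinc oD) (affine_open aI) @` I)).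
split=> //; apply: open_pull aI => //; first exact: rinc_open_immersion.
exact: rsub_locally_ringed (@fs_local Y).
Defined.

Definition finc (Y : formalScheme) (D : set Y) (oD : open D) : mor (fsub oD) Y := rinc oD.

Lemma iso_open_immersion (X Y : ringedSpace) (f : mor X Y) : is_iso f -> open_immersion f.
Proof.
move=> [g [fg gf]].
have fgp y : f (g y) = y by have := congr1 (fun h : mor Y Y => h y) fg.
have gfp x : g (f x) = x by have := congr1 (fun h : mor X X => h x) gf.
split.
- by move=> x x' e; rewrite -(gfp x) e gfp.
- move=> U oU; have -> : f @` U = g @^-1` U; last exact: mor_open.
  apply/seteqP; split=> [_ [x Ux <-]|y Uy]; first by rewrite /preimage /= gfp.
  by exists (g y).
move=> V oV _; have ofV := mor_open f oV.
have Vg : V `<=` g @^-1` (f @^-1` V) by move=> y; rewrite /preimage /= fgp.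
pose r' : {rmorphism sec (f @^-1` V) -> sec V} := comap_to g oV ofV Vg.
have k1 : cancel (comap f oV) r'.
  move=> s; rewrite /r'.
  have VV : V `<=` compm f g @^-1` V by move=> y; rewrite /preimage /= fgp.
  have := comap_to_comp oV ofV oV Vg (@subset_refl _ _) VV s.
  rewrite [comap_to f _ _ _ _]comap_toE res_id => <-.
  move: VV; rewrite fg => VV; rewrite comap_to_id; exact: res_id.
have k2 : cancel r' (comap f oV).
  move=> s; rewrite /r'.
  have UU : f @^-1` V `<=` compm g f @^-1` (f @^-1` V) by move=> y; rewrite /preimage /= fgp.
  have := comap_to_comp ofV oV ofV (@subset_refl _ _) Vg UU s.
  rewrite [comap_to f _ _ _ _]comap_toE res_id => <-.
  move: UU; rewrite gf => UU; rewrite comap_to_id; exact: res_id.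
split; first by exists r'.
move=> W oW; have -> : comap f oV @` W = r' @^-1` W.
  apply/seteqP; split=> [_ [s Ws <-]|s Ws]; first by suff: W (r' (comap f oV s)) by []; rewrite (k1 s).
  by exists (r' s) => //; exact: k2.
by apply: open_comp => // s _; exact: comap_to_cont.
Qed.

(** * Pullback of sections to the whole source *)

Section Pull.
Variables T Y : ringedSpace.

Definition lands (f : mor T Y) (V : set Y) := open V /\ [set: T] `<=` f @^-1` V.

Definition pullm (f : mor T Y) (V : set Y) (h : lands f V) : {rmorphism sec V -> sec [set: T]} :=
  comap_to f openT h.1 h.2.

(* The pullback of a section over V along a morphism with values in V, as a total function. *)
Definition pull (f : mor T Y) (V : set Y) (s : sec V) : sec [set: T] :=
  match pselect (lands f V) with left h => pullm h s | right _ => 0 end.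

Lemma pullmE (f : mor T Y) (V : set Y) (h : lands f V) s : pull f s = pullm h s.
Proof.
by rewrite /pull; case: pselect => [h'|/(_ h)] //; rewrite (Prop_irrelevance h h').
Qed.

Lemma pullE (f : mor T Y) (V : set Y) (oV : open V) (h : [set: T] `<=` f @^-1` V) s :
  pull f s = comap_to f openT oV h s.
Proof. rewrite (@pullmE f V (conj oV h) s); exact: comap_toP. Qed.

Lemma pull_gcomap (f : mor T Y) s : pull f s = global_comap f s.
Proof. by rewrite (pullE openT (fun _ _ => Logic.I)) gcomapE. Qed.

Lemma pull_unit (f : mor T Y) V (s : sec V) p : lands f V ->
  unit_at (pull f s) p <-> unit_at s (f p).
Proof. by move=> [oV fV]; rewrite (pullE oV fV); exact: comap_to_unit. Qed.

Lemma pull_nil (f : mor T Y) V (s : sec V) : lands f V -> nil s -> nil (pull f s).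
Proof. by move=> h ns p /(pull_unit _ _ h) /ns. Qed.

Lemma pull_cont (f : mor T Y) (V : set Y) (h : lands f V) : continuous (pullm h).
Proof. exact: comap_to_cont. Qed.

Lemma pullD (f : mor T Y) V (a b : sec V) : lands f V -> pull f (a + b) = pull f a + pull f b.
Proof. by move=> h; rewrite !(pullmE h) rmorphD. Qed.

Lemma pullB (f : mor T Y) V (a b : sec V) : lands f V -> pull f (a - b) = pull f a - pull f b.
Proof. by move=> h; rewrite !(pullmE h) rmorphB. Qed.

Lemma pullM (f : mor T Y) V (a b : sec V) : lands f V -> pull f (a * b) = pull f a * pull f b.
Proof. by move=> h; rewrite !(pullmE h) rmorphM. Qed.

Lemma pull_res (f : mor T Y) U V (oU : open U) (oV : open V) (VU : V `<=` U) (s : sec U) :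
  lands f V -> pull f (res oU oV VU s) = pull f s.
Proof.
move=> [oV' fV]; have fU : [set: T] `<=` f @^-1` U by move=> p /fV /VU.
rewrite (pullE oV fV) (pullE oU fU) (comap_to_res openT oU openT oV fU fV VU (@subset_refl _ _)).
by rewrite res_id.
Qed.

End Pull.
Arguments pull {T Y} f [V] s.
Arguments lands {T Y} f V.

Lemma lands_sub (T Y : ringedSpace) (f : mor T Y) V W : lands f V -> V `<=` W -> open W -> lands f W.
Proof. by move=> [oV fV] VW oW; split=> // p /fV /VW. Qed.

Lemma landsT (T Y : ringedSpace) (f : mor T Y) : lands f setT.
Proof. by split=> //; exact: openT. Qed.

Lemma lands_comp (T Y Z : ringedSpace) (g : mor Y Z) (f : mor T Y) V : lands g V -> lands (compm g f) V.
Proof. by move=> [oV h]; split=> // p _; exact: h. Qed.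

Lemma lands_compl (T Y Z : ringedSpace) (g : mor Y Z) (f : mor T Y) V :
  lands (compm g f) V <-> open V /\ lands f (g @^-1` V).
Proof.
by split=> [[oV h]|[oV [_ h]]]; split=> //; split=> //; exact: mor_open.
Qed.

Lemma pull_comp (T Y Z : ringedSpace) (g : mor Y Z) (f : mor T Y) V (s : sec V) : lands g V ->
  pull (compm g f) s = global_comap f (pull g s).
Proof.
move=> h; have [oV gV] := h; have [_ gfV] := lands_comp f h.
rewrite (pullE oV gV) (pullE oV gfV).
by rewrite (comap_to_comp openT openT oV (fun _ _ => Logic.I) gV gfV) gcomapE.
Qed.

Lemma pull_comap (T Y Z : ringedSpace) (g : mor Y Z) (f : mor T Y) V (oV : open V) (s : sec V) :
  lands (compm g f) V -> pull (compm g f) s = pull f (comap g oV s).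
Proof.
move=> [oV' h]; have h' : [set: T] `<=` f @^-1` (g @^-1` V) by move=> p /h.
rewrite (pullE oV h) (pullE (mor_open g oV) h').
by rewrite (comap_to_comp openT (mor_open g oV) oV h' (@subset_refl _ _) h) [comap_to g _ _ _ _]comap_toE res_id.
Qed.

Lemma affine_mor_ext (T Y : formalScheme) (U : set Y) (I : set (sec U)) (f g : mor T Y) :
  affine I -> lands f U -> lands g U -> (forall s : sec U, pull f s = pull g s) -> f = g.
Proof.
move=> aI [oU fU] [_ gU] h.
apply: (@hom_affine_uniq T Y U I (@fs_local Y) aI f g fU gU) => s.
by rewrite -!pullE h.
Qed.

Lemma affine_mor_ex (T Y : formalScheme) (U : set Y) (I : set (sec U))
  (phi : {rmorphism sec U -> sec [set: T]}) : affine I -> continuous phi ->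
  exists f : mor T Y, lands f U /\ forall s : sec U, pull f s = phi s.
Proof.
move=> aI cphi; have [f [fU hf]] := hom_affine_ex (@fs_local Y) aI cphi.
exists f; split; first by split=> //; exact: affine_open aI.
by move=> s; rewrite (pullE (affine_open aI) fU).
Qed.

(** * Factoring morphisms through a closed immersion *)

Section ClosedLift.
Variables (Z Y : formalScheme) (f : mor Z Y) (V : set Y) (I : set (sec V)) (J : set (sec [set: Z])).
Hypotheses (aI : affine I) (fV : lands f V) (aJ : affine J)
  (f_surj : forall c, exists s : sec V, pull f s = c).

Lemma closed_mono (T : formalScheme) (r r' : mor T Z) : compm f r = compm f r' -> r = r'.
Proof.
move=> e; apply: hom_gaff_uniq; first by exists J.
by move=> c; have [s <-] := f_surj c; rewrite -!pull_comp // e.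
Qed.

(** Functions on [Z] are lifted to [V] and pulled back along [b]; the kernel condition makes this
    well defined. The comparison of [J] with the ideal generated by [I] is what makes the resulting
    ring map continuous. *)
Lemma closed_lift a (T : formalScheme) (b : mor T Y) : 
  ideal_pow J a `<=` ideal_span ([eta pull f (V := V)] @` I) ->
  lands b V -> (forall s : sec V, pull f s = 0 -> pull b s = 0) ->
  exists r : mor T Z, compm f r = b.
Proof.
move=> JI bV ker.
have [|||||phi hphi] := @hom_of_rel (sec [set: Z]) (sec [set: T])
   (fun c g => exists2 s : sec V, pull f s = c & pull b s = g).
- by move=> c; have [s hs] := f_surj c; exists (pull b s), s.
- move=> c g g' [s hs <-] [s' hs' <-]; apply/eqP; rewrite -subr_eq0; apply/eqP.
  by rewrite -pullB //; apply: ker; rewrite pullB // hs hs' subrr.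
- by exists 1; rewrite ?(pullmE fV) ?(pullmE bV) rmorph1.
- by move=> ? ? ? ? [s <- <-] [s' <- <-]; exists (s - s'); rewrite pullB.
- by move=> ? ? ? ? [s <- <-] [s' <- <-]; exists (s * s'); rewrite pullM.
have hp (s : sec V) : phi (pull f s) = pull b s.
  have [s' e <-] := hphi (pull f s).
  have : pull b (s' - s) = 0 by apply: ker; rewrite pullB // e subrr.
  by rewrite pullB // => /subr0_eq.
have eI : [eta pull f (V := V)] @` I = pullm fV @` I.
  by apply/seteqP; split=> _ [s Is <-]; exists s => //; rewrite (pullmE fV).
have [|r hr] := @hom_gaff_ex T Z phi (ex_intro _ J aJ).
  apply/cont0P => N /((cont0P (pullm bV)).1 (@pull_cont _ _ _ _ bV)) /(nbhs_adic (affine_top aI)) [n hn].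
  apply/(nbhs_adic (affine_top aJ)); exists (a * n)%N => c /pow_mulS /(pow_mono JI).
  rewrite eI => hc.
  have [x Ix ex] : exists2 x, ideal_pow I n x & pullm fV x = c.
    apply: surj_pow hc => [c'|]; last exact: affine_ideal aI.
    by have [s <-] := f_surj c'; exists s; rewrite (pullmE fV).
  by rewrite /preimage /= -ex -(pullmE fV) hp (pullmE bV); exact: hn.
exists r; apply: (affine_mor_ext aI) => //; first exact: lands_comp.
by move=> s; rewrite pull_comp // hr.
Qed.

End ClosedLift.

(** * Formal affine n-space over a formal scheme *)

Fixpoint ptow (Y : formalScheme) n : formalScheme := if n is m.+1 then pserF (ptow Y m) else Y.

Section Tower.
Variable Y : formalScheme.

Fixpoint tproj n : mor (ptow Y n) Y :=
  if n is m.+1 return mor (ptow Y n) Y then compm (tproj m) (@fproj (ptow Y m)) else idm Y.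

Fixpoint tX n (i : nat) : sec [set: ptow Y n] :=
  if n is m.+1 return sec [set: ptow Y n]
  then if i == m then gX (ptow Y m) else global_comap (@fproj (ptow Y m)) (tX m i) else 0.

Fixpoint tI (I : set (sec [set: Y])) n : set (sec [set: ptow Y n]) :=
  if n is m.+1 return set (sec [set: ptow Y n]) then pideal (@tI I m) else I.
Arguments tI I n _ : clear implicits.

Lemma tI_affine I n : affine I -> affine (tI I n).
Proof. by move=> aI; elim: n => //= n IH; exact: pser_affine. Qed.

Lemma tow_gaff n : gaff Y -> gaff (ptow Y n).
Proof. by move=> [I aI]; exists (tI I n); exact: tI_affine. Qed.

Lemma tow_noetherian n : noetherian_ring (sec [set: Y]) -> noetherian_ring (sec [set: ptow Y n]).
Proof. by move=> nY; elim: n => //= n IH; exact: (@pser_noetherian (sec [set: ptow Y n])). Qed.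

Lemma tX_nil n i : nil (tX n i).
Proof.
elim: n => [|n IH] /=; last by case: eqP => _; [exact: gX_nil|exact: (@gcomap_nil _ _ (fproj (ptow Y n)) _ IH)].
by move=> x; have [] := @fs_local Y setT x openT Logic.I.
Qed.

Lemma tow_hom (gY : gaff Y) n (T : formalScheme) (a : mor T Y) (g : nat -> sec [set: T]) :
  (forall i, (i < n)%N -> nil (g i)) ->
  exists b : mor T (ptow Y n), compm (tproj n) b = a /\
    forall i, (i < n)%N -> global_comap b (tX n i) = g i.
Proof.
elim: n => [|n IH] hg; first by exists a; rewrite comp1m.
have [i ni|b [hb hX]] := IH; first by apply: hg; lia.
have [c [hc hcX]] := pser_hom b (tow_gaff n gY) (hg n (ltnSn n)).
exists c; split; first by rewrite /= -compmA hc.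
move=> i ni /=; case: eqP => [->//|/eqP ne].
by apply: etrans (esym (gcomapM (fproj (ptow Y n)) c (tX n i))) _; rewrite hc hX //; lia.
Qed.

Lemma tow_hom_uniq (gY : gaff Y) n (T : formalScheme) (b b' : mor T (ptow Y n)) :
  compm (tproj n) b = compm (tproj n) b' ->
  (forall i, (i < n)%N -> global_comap b (tX n i) = global_comap b' (tX n i)) -> b = b'.
Proof.
elim: n b b' => [|n IH] b b' e h; first by rewrite -[b]comp1m e comp1m.
apply: pser_hom_uniq; first exact: tow_gaff.
  apply: IH => [|i ni]; first by rewrite !compmA.
  rewrite !gcomapM; have := h i (ltnW ni); rewrite /= (ltn_eqF ni); exact.
by have := h n (ltnSn n); rewrite /= eqxx.
Qed.

Lemma tow_resid n b : exists a (c : nat -> sec [set: ptow Y n]), b = global_comap (tproj n) a + \sum_(i < n) c i * tX n i.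
Proof.
elim: n b => [|n IH] b.
  by exists b, (fun=> 0); rewrite big_ord0 addr0.
have [a [c hb]] := IH ((b : pser (sec [set: ptow Y n])) 0%N).
exists a, (fun i => if i == n then (pshift b : sec [set: ptow Y n.+1]) else global_comap (@fproj (ptow Y n)) (c i)).
rewrite /tproj -/tproj gcomapM big_ord_recr /= eqxx.
under eq_bigr => i _ do rewrite (ltn_eqF (ltn_ord i)) -rmorphM.
rewrite addrA -rmorph_sum -rmorphD -hb mulrC; exact: pser_recl.
Qed.

Lemma tI_X I n i : is_ideal I -> (i < n)%N -> tI I n (tX n i).
Proof.
move=> iI; elim: n => // n IH ni /=; case: eqP => [_|/eqP ne].
  apply: (@ideal0 (sec [set: ptow Y n])).
  by elim: (n) => //= k iK; exact: (@pideal_ideal (sec [set: ptow Y k])).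
by apply: IH; lia.
Qed.

Lemma tI_ideal I n : is_ideal I -> is_ideal (tI I n).
Proof. by move=> iI; elim: n => //= n IH; exact: (@pideal_ideal (sec [set: ptow Y n])). Qed.

Lemma tI_proj I n a : tI I n (global_comap (tproj n) a) <-> I a.
Proof.
by elim: n => [|n IH] //; rewrite /tproj -/tproj gcomapM; exact: IH.
Qed.

(** The coordinates lie in [tI I n], and every function is a constant plus a combination of
    coordinates, so the zero section detects membership. *)
Lemma tI_zero I n (z : mor Y (ptow Y n)) b : is_ideal I -> compm (tproj n) z = idm Y ->
  (forall i, (i < n)%N -> global_comap z (tX n i) = 0) ->
  tI I n b <-> I (global_comap z b).
Proof.
move=> iI zp zX; have [a [c ->]] := tow_resid b.
have iT := tI_ideal n iI.
have sT : tI I n (\sum_(i < n) c i * tX n i).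
  by apply: ideal_sum => // i _; apply: idealM => //; exact: tI_X.
rewrite rmorphD -gcomapM zp rmorph_sum.
have -> : \sum_(i < n) global_comap z (c i * tX n i) = 0.
  by apply: big1 => i _; rewrite rmorphM zX ?mulr0.
rewrite addr0 -[global_comap (idm Y) a]/a; split=> [h|Ia].
  by apply/(tI_proj I n); rewrite -[global_comap _ _](addrK (\sum_(i < n) c i * tX n i)); exact: idealB.
by apply: idealD => //; exact/tI_proj.
Qed.

End Tower.
Arguments tI [Y] I n _.

(** * Quotient rings and one-point schemes *)

Section Quotient.
Variables (A : comPzRingType) (G : set A).
Let Q := ideal_span G.
Let iQ : is_ideal Q := span_ideal G.

(* The quotient by the ideal spanned by G, as the set of chosen representatives of cosets. *)
Definition qrep (a : A) : A := xget 0 [set b | Q (a - b)].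

Let qrepP a : Q (a - qrep a).
Proof. by apply: (@xgetPex _ 0 [set b | Q (a - b)]); exists a; rewrite /= subrr; exact: ideal0. Qed.

Let qrep_eq a b : Q (a - b) -> qrep a = qrep b.
Proof.
move=> h; congr (xget _ _); apply/seteqP; split=> c /= hc.
  have -> : b - c = (a - c) - (a - b) by ring.
  exact: idealB.
have -> : a - c = (b - c) + (a - b) by ring.
exact: idealD.
Qed.

Record quot := Quot { qval : A; qvalP : qrep qval = qval }.
HB.instance Definition _ := gen_eqMixin quot.
HB.instance Definition _ := gen_choiceMixin quot.

Let qval_inj x y : qval x = qval y -> x = y.
Proof. by case: x y => x hx [y hy] /= e; case: _ / e in hy *; rewrite (Prop_irrelevance hx hy). Qed.

Definition qpi a : quot := Quot (esym (qrep_eq (qrepP a))).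

Lemma qpi_eq a b : qpi a = qpi b <-> Q (a - b).
Proof.
split=> [/(congr1 qval) /= e|h]; last by apply: qval_inj; exact: qrep_eq.
have -> : a - b = (a - qrep a) - (b - qrep a) by ring.
by apply: idealB => //; rewrite e.
Qed.

Lemma qpi_surj x : exists a, qpi a = x.
Proof. by exists (qval x); apply: qval_inj; rewrite /= qvalP. Qed.

Let qK x : qpi (qval x) = x. Proof. by apply: qval_inj; rewrite /= qvalP. Qed.
Let qvQ a : Q (a - qval (qpi a)). Proof. exact: qrepP. Qed.

Definition qzero := qpi 0.
Definition qone := qpi 1.
Definition qopp x := qpi (- qval x).
Definition qadd x y := qpi (qval x + qval y).
Definition qmul x y := qpi (qval x * qval y).

Let qaddE a b : qadd (qpi a) (qpi b) = qpi (a + b).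
Proof.
apply/qpi_eq; set a' := qval _; set b' := qval _.
have -> : a' + b' - (a + b) = - ((a - a') + (b - b')) by ring.
by apply: idealN => //; apply: idealD => //; exact: qvQ.
Qed.
Let qmulE a b : qmul (qpi a) (qpi b) = qpi (a * b).
Proof.
apply/qpi_eq; set a' := qval _; set b' := qval _.
have -> : a' * b' - a * b = - (b * (a - a') + a' * (b - b')) by ring.
by apply: idealN => //; apply: idealD => //; apply: idealM => //; exact: qvQ.
Qed.
Let qoppE a : qopp (qpi a) = qpi (- a).
Proof.
apply/qpi_eq; set a' := qval _; have -> : - a' - - a = a - a' by ring.
exact: qvQ.
Qed.

Let addqA : associative qadd.
Proof. by move=> x y z; rewrite -(qK x) -(qK y) -(qK z) !qaddE addrA. Qed.
Let addqC : commutative qadd. Proof. by move=> x y; rewrite /qadd addrC. Qed.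
Let add0q : left_id qzero qadd.
Proof. by move=> x; rewrite -(qK x) qaddE add0r. Qed.
Let addNq : left_inverse qzero qopp qadd.
Proof. by move=> x; rewrite -(qK x) qoppE qaddE addNr. Qed.
HB.instance Definition _ := GRing.isZmodule.Build quot addqA addqC add0q addNq.

Let mulqA : associative qmul.
Proof. by move=> x y z; rewrite -(qK x) -(qK y) -(qK z) !qmulE mulrA. Qed.
Let mulqC : commutative qmul. Proof. by move=> x y; rewrite /qmul mulrC. Qed.
Let mul1q : left_id qone qmul. Proof. by move=> x; rewrite -(qK x) qmulE mul1r. Qed.
Let mulqDl : left_distributive qmul qadd.
Proof. by move=> x y z; rewrite -(qK x) -(qK y) -(qK z) !(qaddE, qmulE) mulrDl. Qed.
HB.instance Definition _ := GRing.Zmodule_isComPzRing.Build quot mulqA mulqC mul1q mulqDl.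

Let qpiB : zmod_morphism qpi.
Proof. by move=> x y; rewrite -[RHS]/(qadd _ (qopp _)) qoppE qaddE. Qed.
Let qpiM : monoid_morphism qpi.
Proof. by split=> // x y; rewrite -[RHS]/(qmul _ _) qmulE. Qed.
HB.instance Definition _ := GRing.isZmodMorphism.Build A quot qpi qpiB.
HB.instance Definition _ := GRing.isMonoidMorphism.Build A quot qpi qpiM.

Lemma qpi0 a : qpi a = 0 <-> Q a.
Proof. by rewrite -[0]/(qpi 0) qpi_eq subr0. Qed.

Lemma qval_pi x : qpi (qval x) = x. Proof. exact: qK. Qed.

End Quotient.

Section Discrete.
Variable A : comPzRingType.
Let Z : set (set A) := [set [set 0]].
Let Zex : exists N, Z N. Proof. by exists [set 0]. Qed.
Let Z0 N : Z N -> N 0. Proof. by move=> ->. Qed.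
Let ZI N M : Z N -> Z M -> exists2 K, Z K & K `<=` N `&` M.
Proof. by move=> -> ->; exists [set 0]. Qed.
Let ZB N : Z N -> exists2 M, Z M & forall x y, M x -> M y -> N (x - y).
Proof. by move=> ->; exists [set 0] => // _ _ -> ->; rewrite subrr. Qed.
Let ZZ N a : Z N -> exists2 M, Z M & forall x, M x -> N (a * x).
Proof. by move=> ->; exists [set 0] => // _ ->; rewrite mulr0. Qed.
Let ZM N : Z N -> exists2 M, Z M & forall x y, M x -> M y -> N (x * y).
Proof. by move=> ->; exists [set 0] => // _ _ -> ->; rewrite mulr0. Qed.
Definition disc : topComRingType := topd (NBase Zex Z0 ZI ZB ZZ ZM).

Lemma disc_nbhs (x : disc) (S : set disc) : nbhs x S <-> S x.
Proof.
rewrite nbhs_topd; split=> [[N -> h]|Sx]; first by rewrite -[x]addr0; apply: h.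
by exists [set 0] => // y ->; rewrite addr0.
Qed.

Lemma disc_open (S : set disc) : open S.
Proof. by rewrite openE => x Sx; apply/disc_nbhs. Qed.

Lemma disc_cont (B : topComRingType) (f : disc -> B) : continuous f.
Proof. by move=> x N /nbhs_singleton Nx; apply/disc_nbhs. Qed.

Lemma disc_adic : @adic_topology disc [set 0].
Proof.
move=> W; split=> [_ w Ww|_]; last exact: disc_open.
by exists 1%N => a; rewrite pow1; [move=> ->; rewrite addr0|exact: set0_ideal].
Qed.

End Discrete.

(** When [1 - a * b] is nilpotent modulo an ideal, the truncated geometric series inverts [a]
    there. *)
Lemma geom_inv (A : comPzRingType) (a b : A) k :
  a * (b * \sum_(i < k) (1 - a * b) ^+ i) - 1 = - (1 - a * b) ^+ k.
Proof.
elim: k => [|k IH]; first by rewrite big_ord0; ring.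
rewrite big_ord_recr exprS /=.
transitivity ((a * (b * \sum_(i < k) (1 - a * b) ^+ i) - 1) + a * b * (1 - a * b) ^+ k); first by ring.
by rewrite IH; ring.
Qed.

Section OnePoint.
Variables (A : comPzRingType) (G : set A).

(** The ideal spanned by [G] if [U] contains the point, and the whole ring otherwise; in this way
    the sections over every [U], the empty set included, are quotients of [A], without a case
    distinction in the type. *)
Let GU (U : set unit) : set A := [set a | U tt -> ideal_span G a].
Let GUi U : is_ideal (GU U).
Proof.
have iG := span_ideal G; split.
- by move=> _; exact: ideal0.
- by move=> a b ha hb /[dup] /ha Ga /hb Gb; exact: idealD.
- by move=> c a ha /ha Ga; exact: idealM.
Qed.

Let osec (U : set unit) : topComRingType := disc (quot (GU U)).
Let opi (U : set unit) : {rmorphism A -> quot (GU U)} := @qpi A (GU U).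

Let opi0 U a : opi U a = 0 <-> (U tt -> ideal_span G a).
Proof. by rewrite qpi0 spanE. Qed.

Let resf (U V : set unit) (x : osec U) : osec V := opi V (qval x).
Let resE (U V : set unit) (VU : V `<=` U) a : resf V (opi U a : osec U) = opi V a.
Proof.
apply/subr0_eq; rewrite -rmorphB; apply/opi0 => /VU Ut.
have : opi U (qval (opi U a : quot (GU U)) - a) = 0.
  by rewrite rmorphB; apply/eqP; rewrite subr_eq0; apply/eqP; exact: qval_pi.
by move=> /opi0; apply.
Qed.

Let opi_surj U (x : osec U) : exists a, opi U a = x. Proof. exact: qpi_surj. Qed.

Let resB (U V : set unit) (VU : V `<=` U) : zmod_morphism (@resf U V).
Proof.
move=> x y; have [a <-] := opi_surj x; have [b <-] := opi_surj y.
by rewrite -[opi U a - opi U b]rmorphB !resE // rmorphB.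
Qed.
Let resM (U V : set unit) (VU : V `<=` U) : monoid_morphism (@resf U V).
Proof.
split=> [|x y]; first by rewrite -[1](rmorph1 (opi U)) resE // rmorph1.
have [a <-] := opi_surj x; have [b <-] := opi_surj y.
by rewrite -[opi U a * opi U b]rmorphM !resE // rmorphM.
Qed.

Let T1 : topologicalType := discrete_topology unit.
Let o1 (U : set T1) : open U. Proof. exact: discrete_open. Qed.

Let ores (U V : set T1) (oU : open U) (oV : open V) (VU : V `<=` U) : {rmorphism osec U -> osec V} :=
  HB.pack_for {rmorphism osec U -> osec V} (@resf U V)
   (GRing.isZmodMorphism.Build (osec U) (osec V) (@resf U V) (resB VU))
   (GRing.isMonoidMorphism.Build (osec U) (osec V) (@resf U V) (resM VU)).

Let oresE (U V : set T1) (oU : open U) (oV : open V) (VU : V `<=` U) a :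
  ores oU oV VU (opi U a : osec U) = opi V a.
Proof. exact: resE. Qed.

Let ores_cont (U V : set T1) (oU : open U) (oV : open V) (VU : V `<=` U) : continuous (ores oU oV VU).
Proof. exact: disc_cont. Qed.
Let ores_id (U : set T1) (oU oU' : open U) (UU : U `<=` U) s : ores oU oU' UU s = s.
Proof. by have [a <-] := opi_surj s; exact: oresE. Qed.
Let ores_res (U V W : set T1) (oU : open U) (oV : open V) (oW : open W)
    (VU : V `<=` U) (WV : W `<=` V) (WU : W `<=` U) s :
    ores oV oW WV (ores oU oV VU s) = ores oU oW WU s.
Proof. by have [a <-] := opi_surj s; rewrite !oresE. Qed.

Let ores0 (U V : set T1) (oU : open U) (oV : open V) (VU : V `<=` U) (s : osec U) :
  (U tt -> V tt) -> ores oU oV VU s = 0 -> s = 0.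
Proof.
move=> h; have [a <-] := opi_surj s; rewrite oresE => /opi0 Va.
by apply/opi0 => Ut; apply: Va; exact: h.
Qed.

Let osep (U : set T1) (C : set (set T1)) (oU : open U)
    (oC : forall W, C W -> open W) (CU : forall W, C W -> W `<=` U) (s : osec U) :
    U `<=` \bigcup_(W in C) W ->
    (forall W (CW : C W), ores oU (oC W CW) (CU W CW) s = 0) -> s = 0.
Proof.
move=> cov h; have [Ut|Ut] := pselect (U tt).
  by have [W CW Wt] := cov _ Ut; apply: ores0 (h W CW).
by have [a <-] := opi_surj s; apply/opi0.
Qed.

Let oglue (U : set T1) (C : set (set T1)) (oU : open U)
    (oC : forall W, C W -> open W) (CU : forall W, C W -> W `<=` U)
    (f : forall W, osec W) :
    U `<=` \bigcup_(W in C) W ->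
    (forall W W' (CW : C W) (CW' : C W') V (oV : open V)
       (VW : V `<=` W) (VW' : V `<=` W'),
       ores (oC W CW) oV VW (f W) = ores (oC W' CW') oV VW' (f W')) ->
    exists s, forall W (CW : C W), ores oU (oC W CW) (CU W CW) s = f W.
Proof.
move=> cov h; have [Ut|Ut] := pselect (U tt).
  have [W0 CW0 Wt0] := cov _ Ut; have [a ha] := opi_surj (f W0).
  exists (opi U a) => W CW; rewrite oresE; have [b hb] := opi_surj (f W).
  have hV : (W `&` W0) `<=` W by move=> x [].
  have hV0 : (W `&` W0) `<=` W0 by move=> x [].
  have := h W W0 CW CW0 (W `&` W0) (@o1 (W `&` W0)) hV hV0; rewrite -ha -hb !oresE => e.
  apply/subr0_eq; rewrite -rmorphB; apply/opi0 => Wt.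
  have : opi (W `&` W0) (a - b) = 0 by rewrite rmorphB e subrr.
  by move=> /opi0; apply.
exists 0 => W CW; rewrite rmorph0; have [b <-] := opi_surj (f W).
by apply/esym/opi0 => Wt; case: Ut; exact: (CU W CW _ Wt).
Qed.

Let otop (U : set T1) (C : set (set T1)) (oU : open U)
    (oC : forall W, C W -> open W) (CU : forall W, C W -> W `<=` U)
    (N : set (osec U)) :
    U `<=` \bigcup_(W in C) W -> nbhs 0 N ->
    exists (D : set (set T1)) (M : forall W, set (osec W)),
      [/\ finite_set D, D `<=` C, forall W, nbhs 0 (M W) &
          forall s, (forall W (CW : C W), D W ->
            M W (ores oU (oC W CW) (CU W CW) s)) -> N s].
Proof.
move=> cov /disc_nbhs N0; have [Ut|Ut] := pselect (U tt).
  have [W CW Wt] := cov _ Ut; exists [set W], (fun=> [set 0]); split=> //.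
  - by move=> _ ->.
  - by move=> V; apply/disc_nbhs.
  - by move=> s /(_ W CW erefl) /ores0 ->.
exists set0, (fun=> [set 0]); split=> //.
- by move=> V; apply/disc_nbhs.
- by move=> s _; have [a <-] := opi_surj s; have -> : opi U a = 0 by exact/opi0.
Qed.

Definition pt_ringed : ringedSpace := {|
  space := T1;
  sec := osec;
  res := ores;
  res_continuous := ores_cont;
  res_id := ores_id;
  res_res := ores_res;
  sheaf_separated := osep;
  sheaf_glue := oglue;
  sheaf_topology := otop |}.

Variables (M : set A) (k : nat).
Hypotheses (iM : is_ideal M) (M1 : ~ M 1) (Mmax : forall a, ~ M a -> exists b, M (1 - a * b))
  (MG : ideal_pow M k `<=` ideal_span G) (GM : ideal_span G `<=` M).

Let opi1 (U : set T1) a : (U tt -> ideal_span G (a - 1)) -> opi U a = 1 :> osec U.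
Proof.
move=> h; apply: etrans (rmorph1 (opi U)).
by apply/subr0_eq; rewrite -rmorphB; apply/opi0.
Qed.

Let unitE (U : set T1) a p : @unit_at pt_ringed U (opi U a) p <-> U tt /\ ~ M a.
Proof.
case: p; split=> [[W [oU [oW [WU [Wt [c]]]]]]|[Ut na]].
  have [b <-] := opi_surj c; move=> h; split; first exact: (WU _ Wt).
  have : opi W (a * b - 1) = 0.
    by rewrite rmorphB rmorphM rmorph1 -h [res _ _ _ _]oresE subrr.
  move=> /opi0 /(_ Wt) /GM h1 Ma; apply: M1.
  have -> : 1 = a * b - (a * b - 1) by ring.
  by apply: idealB => //; exact: idealMr.
exists U, (@o1 U), (@o1 U), (@subset_refl _ U); split=> //.
have [b hb] := Mmax na; exists (opi U (b * \sum_(i < k) (1 - a * b) ^+ i)).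
rewrite [res _ _ _ _]oresE -[_ * _]rmorphM; apply: opi1 => _.
have -> : a * (b * \sum_(i < k) (1 - a * b) ^+ i) - 1 = - (1 - a * b) ^+ k.
  exact: geom_inv.
by apply: idealN; [exact: span_ideal|apply: MG; exact: powX].
Qed.

Lemma pt_locally_ringed : locally_ringed pt_ringed.
Proof.
move=> U p _ _; split.
  by rewrite -[0](rmorph0 (opi U)) => /unitE [_]; apply; exact: ideal0.
move=> s t; have [a <-] := opi_surj s; have [b <-] := opi_surj t.
rewrite -[_ + _]rmorphD => /unitE [Ut nab].
have [Ma|na] := pselect (M a); last by left; apply/unitE.
by right; apply/unitE; split=> // Mb; apply: nab; exact: idealD.
Qed.

Lemma pt_affine : @affine pt_ringed setT [set 0].
Proof.
have eT (p : pt_ringed) a : @vanishing pt_ringed setT p (opi setT a) <-> M a.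
  split; last by move=> Ma /unitE [].
  by move=> h; apply: contrapT => na; apply: h; apply/unitE.
have i0 := set0_ideal.
apply: (@Build_affine pt_ringed setT [set 0] (@o1 setT)).
- by apply/fgP; exists [::]; rewrite spans_nil.
- move=> x _; split; first exact: (vanishing_prime pt_locally_ringed (@o1 _)).
  move=> _ ->; have [n0 _] := pt_locally_ringed (@o1 setT) (Logic.I : [set: T1] x); exact: n0.
- move=> p pp p0; exists tt; split; last by case.
  split=> //; apply/seteqP; split=> s; have [a <-] := opi_surj s.
    move=> pa; apply/eT; apply: contrapT => na.
    have [iP P1 _] := pp; apply: P1; have [b hb] := Mmax na.
    have hk : p (opi setT ((1 - a * b) ^+ k)).
      apply: p0; apply/opi0 => _; apply: MG; exact: powX.
    rewrite rmorphXn in hk; have := primeX pp hk.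
    rewrite rmorphB rmorph1 rmorphM => h.
    have -> : 1 = (1 - opi setT a * opi setT b) + opi setT a * opi setT b by ring.
    by apply: idealD => //; exact: idealMr.
  move=> /eT Ma; apply: (primeX (n := k) pp); rewrite -rmorphXn.
  by apply: p0; apply/opi0 => _; apply: MG; exact: powX.
- move=> W x oW Wx _; exists 1; split; first exact: (unit_at1 (X := pt_ringed)).
  by move=> y _; move: Wx; case: x; case: y.
move=> s /=; have [a <-] := opi_surj s; set U := basic_open _.
have eJ : ideal_span (resf U @` [set 0 : osec setT]) = [set 0].
  have -> : resf U @` [set 0 : osec setT] = [set 0].
    apply/seteqP; split=> [_ [_ -> <-]|_ ->]; last exists 0 => //.
      exact: (rmorph0 (ores (@o1 setT) (@o1 U) (@subsetT _ _))).
    exact: (rmorph0 (ores (@o1 setT) (@o1 U) (@subsetT _ _))).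
  exact: spanE.
rewrite [X in adically_complete X]eJ eJ; split.
- exact: (@rtowI_complete (osec U) 0).
- exact: disc_adic.
have rE b : resf U (opi setT b : osec setT) = opi U b by exact: resE.
have hU : U tt -> ~ M a by move=> /unitE [].
have hV : ~ U tt -> M a.
  by move=> nU; apply: contrapT => na; apply: nU; apply/unitE.
have i0n n : ideal_pow [set 0 : osec U] n 0 by exact: ideal0 (pow_ideal _ _).
move=> n; split.
- have [Ut|nU] := pselect (U tt); last first.
    exists 0; have -> : resf U (opi setT a : osec setT) * 0 - 1 = 0 :> osec U; last exact: i0n.
    by rewrite mulr0 -(@opi1 U 0) ?rmorph0 ?subr0.
  have [b hb] := Mmax (hU Ut); exists (opi U (b * \sum_(i < k) (1 - a * b) ^+ i)).
  rewrite rE -[_ * _]rmorphM opi1 ?subrr; first exact: i0n.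
  move=> _.
  have -> : a * (b * \sum_(i < k) (1 - a * b) ^+ i) - 1 = - (1 - a * b) ^+ k.
    exact: geom_inv.
  by apply: idealN; [exact: span_ideal|apply: MG; exact: powX].
- move=> b; have [c <-] := opi_surj b; exists 0%N, (opi setT c).
  by rewrite expr0 mul1r rE subrr.
move=> c; have [d <-] := opi_surj c; rewrite rE => h.
have [Ut|nU] := pselect (U tt); last first.
  exists k; rewrite -rmorphXn -[_ * _]rmorphM.
  have -> : opi setT (a ^+ k * d) = 0; last exact: ideal0 (pow_ideal _ _).
  apply/opi0 => _; apply: idealMr; first exact: span_ideal.
  by apply: MG; apply: powX; exact: hV.
exists 0%N; rewrite expr0 mul1r; case: n h => [|n] h; first by [].
have {}h := pow_subI (set0_ideal _) (ltn0Sn n) h.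
have -> : opi setT d = 0; last exact: ideal0 (pow_ideal _ _).
by apply/opi0 => _; have /opi0 := h; apply.
Qed.

Definition pt_scheme : formalScheme.
Proof.
apply: (@FormalScheme pt_ringed); first exact: pt_locally_ringed.
by move=> x; exists setT, [set 0]; split=> //; exact: pt_affine.
Defined.

Definition pt_quot : {rmorphism A -> @sec pt_scheme setT} := opi setT.

Lemma pt_quot_surj s : exists a, pt_quot a = s. Proof. exact: opi_surj. Qed.
Lemma pt_quot0 a : pt_quot a = 0 <-> ideal_span G a.
Proof. by rewrite opi0; split=> [|h _] //; apply. Qed.

Lemma pt_unit a (p : pt_scheme) : @unit_at pt_scheme setT (pt_quot a) p <-> ~ M a.
Proof. by split=> [/unitE []|na] //; apply/unitE. Qed.

Lemma pt_scheme_cont (B : topComRingType) (J : set B) (f : {rmorphism B -> @sec pt_scheme setT}) n :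
  adic_topology J -> (forall b, ideal_pow J n b -> f b = 0) -> continuous f.
Proof.
move=> top h; apply/cont0P => N /disc_nbhs N0; apply/(nbhs_adic top).
by exists n => b /h fb; rewrite /preimage /= fb.
Qed.

End OnePoint.

(* The closed subscheme tau of Y, concentrated at y, is cut out over W by Q. *)
Definition inf_sub (T Y : formalScheme) (tau : mor T Y) (W : set Y) (Q : set (sec W)) (y : Y) :=
  [/\ affine_scheme T, lands tau W, forall s, exists a : sec W, pull tau a = s,
      forall a : sec W, pull tau a = 0 <-> Q a & forall p, tau p = y].

(** The functions on [W] already surject onto the residue field of [y]; closed points satisfy this
    by [closed_residue_max]. *)
Definition residue_max (Y : ringedSpace) (W : set Y) (y : Y) :=
  forall a : sec W, unit_at a y -> exists b, vanishing y (1 - a * b).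

(** * Infinitesimal neighbourhoods of a point as test objects *)

Section InfSub.
Variables (Y : formalScheme) (W : set Y) (I : set (sec W)) (y : Y).
Hypotheses (aI : affine I) (Wy : W y) (ym : residue_max W y).
Let M : set (sec W) := vanishing y.

Lemma inf_sub_ex k (Q : set (sec W)) : is_ideal Q -> ideal_pow M k `<=` Q -> Q `<=` M ->
  exists (T : formalScheme) (tau : mor T Y), inf_sub tau Q y.
Proof.
move=> iQ MQ QM.
have [iM M1 _] : prime_ideal M := affine_van aI Wy.
have Mmax a : ~ M a -> exists b, M (1 - a * b) by move=> /contrapT; exact: ym.
have eQ := spanE iQ; rewrite -eQ in MQ QM.
pose T := pt_scheme iM M1 Mmax MQ QM.
have [|tau [tW htau]] := @affine_mor_ex T Y W I (pt_quot iM M1 Mmax MQ QM) aI.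
  apply: (pt_scheme_cont (n := k) (affine_top aI)) => b Ib; apply/pt_quot0; apply: (MQ _).
  by apply: pow_mono Ib; exact: (affine_vanI aI Wy).
exists T, tau; split=> //.
- exact: (pt_affine iM M1 Mmax MQ QM).
- by move=> s; have [a <-] := pt_quot_surj s; exists a.
- by move=> a; rewrite htau pt_quot0 eQ.
move=> p; apply: (affine_pt_uniq aI) => //; first by case: tW => _; apply.
move=> c; rewrite -(pull_unit _ _ tW) htau pt_unit /M /vanishing /=.
by split=> [/contrapT|h] //; apply.
Qed.

Lemma inf_lift (T : formalScheme) (tau : mor T Y) (Q : set (sec W)) (Z : formalScheme) (b : mor Z Y) :
  inf_sub tau Q y -> lands b W -> (forall a, Q a -> pull b a = 0) -> exists r, compm tau r = b.
Proof.
move=> [aT tW ts tk _] bW h; apply: (closed_lift aI tW aT ts (a := 1) _ bW); last first.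
  by move=> s /tk /h.
have i0 : is_ideal [set 0 : sec [set: T]] by exact: set0_ideal.
by rewrite (pow1 i0) => _ ->; exact: ideal0 (span_ideal _).
Qed.

(** The kernel of [i] is the image of [Q0], which lies in [M], while [M^k] lies in [Q]. These are
    the thickenings to which [formally_smooth] gets applied. *)
Lemma inf_closed k (T T0 : formalScheme) (tau : mor T Y) (tau0 : mor T0 Y) (Q Q0 : set (sec W))
   (i : mor T0 T) : inf_sub tau Q y -> inf_sub tau0 Q0 y -> compm tau i = tau0 ->
   ideal_pow M k `<=` Q -> Q0 `<=` M ->
   closed_immersion i /\ nilpotent_ideal (global_kernel i).
Proof.
move=> [aT tW ts tk _] [aT0 tW0 ts0 tk0 _] e MQ QM; split.
  move=> t; exists setT, openT, [set 0]; split=> //; split=> //.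
    have -> : ideal_span (comap i openT @` [set 0]) = [set 0]; last exact: aT0.
    have -> : comap i openT @` [set 0] = [set 0].
      apply/seteqP; split=> [_ [_ -> <-]|_ ->]; last exists 0 => //.
        exact: (rmorph0 (global_comap i)).
      exact: (rmorph0 (global_comap i)).
    by apply: spanE; exact: set0_ideal.
  move=> b; have [a <-] := ts0 b; exists (pull tau a).
  by rewrite -e pull_comp.
exists k => s; have [oW tW'] := tW.
have -> : global_kernel i = ideal_span (pullm tW @` Q0).
  apply/seteqP; split=> [c|].
    have [a <-] := ts c; rewrite /global_kernel /= -pull_comp // e => /tk0 Qa.
    by apply: subspan; exists a => //; rewrite (pullmE tW).
  apply: span_min; last first.
    by move=> _ [a /tk0 Qa <-]; rewrite -(pullmE tW) /global_kernel /= -pull_comp // e.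
  have := preim_ideal (global_comap i) (set0_ideal _); exact.
rewrite span_map_pow => h; have : ideal_span (pullm tW @` ideal_pow M k) s.
  by apply: span_mono h => _ [x Qx <-]; exists x => //; exact: pow_mono Qx.
apply: span_min; first exact: set0_ideal.
by move=> _ [x /MQ /tk Qx <-]; rewrite -(pullmE tW).
Qed.

End InfSub.

(* Points of T not in the image of a closed immersion with nilpotent kernel would give functions
   on T that are not nilpotent but vanish on a power. *)
Lemma nilpotent_closed_surj (T0 T : formalScheme) (i : mor T0 T) : affine_scheme T ->
  closed_immersion i -> nilpotent_ideal (global_kernel i) -> forall z : T, exists z0, i z0 = z.
Proof.
move=> aT ci [N hN] z; apply: contrapT => nz.
have lrT := @fs_local T; have lrT0 := @fs_local T0.
pose A := sec [set: T].
have [c0 uc0 nc0] : exists2 c0 : A, unit_at c0 z & nil (global_comap i c0).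
  have [V [oV [I [Vz [aI aJ sur]]]]] := ci z.
  (* If all functions in the kernel vanished at [z], the prime of [z] would be the inverse image of
     a prime upstairs, that is, of a point over [z]. *)
  have [b [b0 ub]] : exists b : sec V, comap i oV b = 0 /\ unit_at b z.
    apply: contrapT => nb.
    have ker b : comap i oV b = 0 -> vanishing z b by move=> b0 ub; apply: nb; exists b.
    have pz := affine_van aI Vz; have [iz z1 pz'] := pz.
    pose q := comap i oV @` vanishing z.
    have qE b : q (comap i oV b) -> vanishing z b.
      move=> [b' vb' e]; rewrite -[b](subrK b'); apply: (idealD iz _ vb').
      by apply: ker; rewrite rmorphB e subrr.
    have pq : prime_ideal q.
      split; first exact: im_ideal.
        by rewrite -(rmorph1 (comap i oV)) => /qE.
      move=> a' b'; have [a <-] := sur a'; have [b <-] := sur b'.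
      by rewrite -rmorphM => /qE /pz' [] h; [left|right]; eexists; eauto.
    have Iq : ideal_span (comap i oV @` I) `<=` q.
      apply: span_min; first by case: pq.
      by move=> _ [a Ia <-]; exists a => //; exact: (affine_vanI aI Vz Ia).
    have [z0 [[Vz0 e] _]] := affine_prime aJ pq Iq.
    apply: nz; exists z0; apply: (affine_pt_uniq aI) => // c.
    have h : vanishing (i z0) c <-> vanishing z c.
      have -> : vanishing (i z0) c <-> vanishing z0 (comap i oV c).
        by split=> nu uu; apply: nu; apply/(comap_unit i oV c Vz0).
      rewrite -e; split=> [/qE//|vc]; by exists c.
    by split=> uc; apply: contrapT => nu; have /h := nu; apply.
  have oD := basic_open_open b.
  have [c0 [uc cD]] := affine_basis aT oD ub Logic.I.
  exists c0 => // p /(comap_unit i openT c0 Logic.I) /cD ubp.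
  have [] := lrT0 _ p (mor_open i oV) (unit_at_in ubp).
  by rewrite -b0 => + _; apply; apply/comap_unit => //; exact: unit_at_in ubp.
pose D c := i @^-1` basic_open (c : A).
have oD c : open (D c) := mor_open i (basic_open_open c).
(* The functions [c] such that a power of the pullback of [c0] vanishes over D(c). They form the
   unit ideal: near each point the pullback is nil on an affine whose topology is discrete, hence
   nilpotent. *)
pose B := [set c : A | exists n, res openT (oD c) (@subsetT _ _) (global_comap i c0 ^+ n) = 0].
have B1 : B 1.
  apply: contrapT => nB1.
  have iB : is_ideal B.
    split.
    - exists 0%N; apply: sec_empty => // p; rewrite /D /preimage /=.
      by have [] := lrT setT (i p) openT Logic.I.
    - move=> c c' [n hn] [n' hn']; exists (n + n')%N.
      apply: (@sec_sep_pt _ _ (oD _)) => p Dp.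
      have [_ /(_ c c' Dp) h] := lrT setT (i p) openT Logic.I.
      have fin d m k : unit_at d (i p) -> 
        res openT (oD d) (@subsetT _ _) (global_comap i c0 ^+ m) = 0 -> (m <= k)%N ->
        exists W (oW : open W) (WU : W `<=` D (c + c')), W p /\
          res (oD (c + c')) oW WU (res openT (oD (c + c')) (@subsetT _ _) (global_comap i c0 ^+ k)) = res (oD (c + c')) oW WU 0.
        move=> ud h0 mk; have oW : open (D d `&` D (c + c')) by apply: openI; exact: oD.
        have W1 : D d `&` D (c + c') `<=` D d by move=> ? [].
        have W2 : D d `&` D (c + c') `<=` D (c + c') by move=> ? [].
        exists (D d `&` D (c + c')), oW, W2; split=> //.
        rewrite (res_res _ _ _ _ _ (@subsetT _ _)) -(res_res openT (oD d) oW (@subsetT _ _) W1).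
        by rewrite -(subnK mk) exprD rmorphM h0 mulr0 !rmorph0.
      case: h => u; [have [W [oW [WU [Wp e]]]] := fin _ _ (n + n')%N u hn (leq_addr _ _)|
                     have [W [oW [WU [Wp e]]]] := fin _ _ (n + n')%N u hn' (leq_addl _ _)];
      by exists W, oW, WU.
    - move=> c d [n hn]; exists n.
      have DD : D (c * d) `<=` D d by move=> p; rewrite /D /preimage /= => /unit_atM [].
      by rewrite -(res_res openT (oD d) (oD _) (@subsetT _ _) DD) hn rmorph0.
  have [M BM [pM _]] := maximal_ideal iB nB1.
  have [|x [[_ eM] _]] := affine_prime aT pM; first by move=> _ ->; case: pM => -[].
  have [V [oV [I [Vx cl]]]] := ci x; have [aI _ _] := cl.
  have [c [d [ecd uc cV]]] := common_basic lrT aT aI (openI oV openT) Logic.I Vx (conj Vx Logic.I).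
  have oc := basic_open_open c; have cT := @subsetT _ (basic_open c).
  have cV' : basic_open c `<=` V by rewrite ecd; exact: basic_open_sub.
  have [_ aJ _] := closed_shrink lrT0 lrT oc cV' ecd cl.
  have aT' := affine_basic_aux aT lrT openT oc cT erefl.
  have aI' := affine_basic_aux aI lrT oV oc cV' ecd.
  have e0 : ideal_span (res openT oc cT @` [set 0]) = [set 0].
    have -> : res openT oc cT @` [set 0] = [set 0].
      by apply/seteqP; split=> [_ [_ -> <-]|_ ->]; [exact: rmorph0|exists 0 => //; exact: rmorph0].
    by apply: spanE; exact: set0_ideal.
  have [a ha] := adic_compare (affine_ideal aT') (affine_top aI') (affine_top aT').
  rewrite e0 in ha.
  have na : nil (res openT (oD c) (@subsetT _ _) (global_comap i c0)).
    move=> p up; have Dp := unit_at_in up.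
    by have /(unit_atW openT (oD c) (@subsetT _ _) _ Dp)/nc0 := up.
  have [n hn] := affine_nil aJ na a.
  have : B c.
    exists n; rewrite rmorphXn; move: hn; rewrite span_map_pow => hn.
    apply: (span_min (set0_ideal _) _ hn).
    by move=> _ [s /ha -> <-]; exact: rmorph0.
  by move=> /BM; rewrite eM; apply.
have [n hn] := B1.
have {}hn : global_comap i c0 ^+ n = 0.
  apply: (@sec_sep_pt _ _ openT) => p _.
  exists (D 1), (oD 1), (@subsetT _ _); split; last by rewrite hn rmorph0.
  by apply: unit_at1 => //; exact: openT.
have : c0 ^+ n ^+ N = 0.
  by apply: hN; apply: powX; rewrite /global_kernel /= rmorphXn.
rewrite -exprM => e; have := unit_atX openT (n * N)%N uc0.
by rewrite e; have [] := lrT setT z openT Logic.I.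
Qed.

(** * Closed and open immersions on global sections *)

Lemma closed_pull (Z Y : ringedSpace) (f : mor Z Y) (V : set Y) (oV : open V) (I : set (sec V)) :
  lands f V -> closed_immersion_over f oV I ->
  [/\ affine (ideal_span ([eta pull f (V := V)] @` I)),
      forall c, exists a : sec V, pull f a = c &
      forall a : sec V, pull f a = 0 <-> comap f oV a = 0].
Proof.
move=> fV [aI aJ sur]; have [_ h] := fV.
have eV : f @^-1` V = setT by apply/seteqP; split=> // p _; exact: h.
have hp (s : sec V) : pull f s = res (mor_open f oV) openT h (comap f oV s).
  by rewrite (pullE oV h) comap_toE.
have -> : [eta pull f (V := V)] @` I = res (mor_open f oV) openT h @` (comap f oV @` I).
  apply/seteqP; split=> [_ [s Is <-]|_ [_ [s Is <-] <-]].
    by exists (comap f oV s); [exists s|rewrite hp].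
  by exists s => //=; rewrite hp.
(* The preimage of [V] is the whole space only up to a proved equality, which can be substituted
   once the set is a variable. *)
have aux (V' : set Z) (oV' : open V') (h' : [set: Z] `<=` V') : V' = setT ->
  [/\ forall G : set (sec V'), affine (ideal_span G) -> affine (ideal_span (res oV' openT h' @` G)),
      forall c, exists a, res oV' openT h' a = c & forall a, res oV' openT h' a = 0 <-> a = 0].
  move=> e; subst V'; split=> [G|c|a]; rewrite ?res_id //; last by exists c; rewrite res_id.
  have -> : res oV' openT h' @` G = G; last by [].
  by apply/seteqP; split=> [_ [s Gs <-]|s Gs]; [rewrite res_id|exists s; rewrite ?res_id].
have [h1 h2 h3] := aux _ (mor_open f oV) h eV; split; first exact: h1.
- by move=> c; have [b <-] := h2 c; have [a <-] := sur b; exists a.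
- by move=> a; rewrite hp.
Qed.

Lemma fsub_closed (Y : formalScheme) (D V : set Y) (oD : open D) (oV : open V) I : V `<=` D ->
  @affine Y V I -> closed_immersion_over (finc oD) oV I.
Proof.
move=> VD aI; have VR : V `<=` range (finc oD) by move=> y /VD; exact: rinc_range.
split=> //.
  by apply: open_pull aI => //; [exact: rinc_open_immersion|exact: fs_local].
have [_ _ /(_ V oV VR) [[g k1 k2] _]] := rinc_open_immersion oD.
by move=> b; exists (g b); exact: k2.
Qed.

Lemma finc_lands (Y : formalScheme) (D : set Y) (oD : open D) : lands (finc oD) D.
Proof. by split=> // p _; exact: (svalP p). Qed.

Lemma finc_inj (Y : formalScheme) (D : set Y) (oD : open D) (a : sec D) I : @affine Y D I ->
  pull (finc oD) a = 0 -> a = 0.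
Proof.
move=> aI; have [_ _ h] := closed_pull (finc_lands oD) (fsub_closed oD oD (@subset_refl _ D) aI).
move=> /h a0; have VR : D `<=` range (finc oD) by move=> y; exact: rinc_range.
have [_ _ /(_ D oD VR) [[g k1 k2] _]] := rinc_open_immersion oD.
by apply: (can_inj k1); rewrite [RHS](rmorph0 (comap (rinc oD) oD)); exact: a0.
Qed.

Lemma finc_lift (Y : formalScheme) (D : set Y) (oD : open D) I (T : formalScheme) (b : mor T Y) :
  @affine Y D I -> lands b D -> exists r, compm (finc oD) r = b.
Proof.
move=> aI bD; have [aJ sur _] := closed_pull (finc_lands oD) (fsub_closed oD oD (@subset_refl _ D) aI).
apply: (closed_lift aI (finc_lands oD) aJ sur (a := 1) _ bD).
  exact: pow1_sub (span_ideal _).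
by move=> s /(finc_inj aI) ->; rewrite (pullmE bD) rmorph0.
Qed.

Lemma finc_mono (Y : formalScheme) (D : set Y) (oD : open D) I (T : formalScheme) (r r' : mor T (fsub oD)) :
  @affine Y D I -> compm (finc oD) r = compm (finc oD) r' -> r = r'.
Proof.
move=> aI; have [aJ sur _] := closed_pull (finc_lands oD) (fsub_closed oD oD (@subset_refl _ D) aI).
exact: (closed_mono (finc_lands oD) aJ sur).
Qed.

Lemma closed_restrict (Z Y : formalScheme) (f : mor Z Y) (V : set Y) (oV : open V) (I : set (sec V)) :
  closed_immersion_over f oV I ->
  closed_immersion_over (compm f (finc (mor_open f oV))) oV I.
Proof.
move=> [aI aJ sur]; have [_ aK sur'] := fsub_closed (mor_open f oV) (mor_open f oV) (@subset_refl _ _) aJ.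
split=> //.
  by rewrite span_map_map in aK.
by move=> b; have [c <-] := sur' b; have [a <-] := sur c; exists a.
Qed.

(** * A formally smooth morphism with a homeomorphic section is a formal affine space *)

Section Structure.
Variables (X R : formalScheme) (s : mor R X) (e : mor X R) (W : set R) (oW : open W)
  (I : set (sec W)) (x : X).
Hypotheses (se : compm s e = idm X) (homeo : homeomorphism e) (fs : formally_smooth s)
  (cl : closed_immersion_over e oW I) (nW : noetherian_ring (sec W)) (Wx : W (e x))
  (xmax : residue_max W (e x)).
Variables (n : nat) (w : nat -> sec W).
Hypotheses (ew : forall i, (i < n)%N -> comap e oW (w i) = 0)
  (gen : forall c, comap e oW c = 0 -> exists d : nat -> sec W, c = \sum_(i < n) d i * w i)
  (ind : forall c : nat -> sec W, \sum_(i < n) c i * w i = 0 ->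
     forall i, (i < n)%N -> vanishing (e x) (c i)).

Let U := e @^-1` W.
Let oU : open U := mor_open e oW.

Let aW : affine I. Proof. by case: cl. Qed.
Let aU : @affine X U (ideal_span (comap e oW @` I)). Proof. by case: cl. Qed.
Let esurj b : exists a, comap e oW a = b. Proof. by case: cl => _ _; apply. Qed.

Let sep z : s (e z) = z. Proof. by have := congr1 (fun h : mor X X => h z) se. Qed.
Let esp y : e (s y) = y.
Proof. by case: homeo => -[g k1 k2] _; rewrite -(k2 y) sep. Qed.

Lemma unit_section_open y : U (s y) <-> W y.
Proof. by rewrite /U /preimage /= esp. Qed.

Lemma unit_section_lands (T : formalScheme) (r : mor T R) : lands (compm s r) U <-> lands r W.
Proof.
split=> [[_ h]|[_ h]]; split=> // p /h; rewrite /preimage /=.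
  exact: (unit_section_open (r p)).1.
exact: (unit_section_open (r p)).2.
Qed.

Let w_nil i : (i < n)%N -> nil (w i).
Proof.
move=> ni y uy; have Wy := unit_at_in uy; rewrite -(esp y) in uy.
have sW : W (e (s y)) by rewrite esp.
move: uy => /(comap_unit e oW (w i) sW); rewrite (ew ni).
by have [] := @fs_local X _ (s y) oU sW.
Qed.

Let Y := fsub oU.
Let RW := fsub oW.
Let iU : mor Y X := finc oU.
Let iW : mor RW R := finc oW.
Let iUl : lands iU U. Proof. exact: finc_lands. Qed.
Let iWl : lands iW W. Proof. exact: finc_lands. Qed.
Let JY := ideal_span ([eta pull iU (V := U)] @` ideal_span (comap e oW @` I)).
Let aY : @affine Y setT JY.
Proof. by have [] := closed_pull iUl (fsub_closed oU oU (@subset_refl _ U) aU). Qed.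
Let iU_surj c : exists a : sec U, pull iU a = c.
Proof. by have [_ + _] := closed_pull iUl (fsub_closed oU oU (@subset_refl _ U) aU); apply. Qed.
Let iW_surj c : exists a : sec W, pull iW a = c.
Proof. by have [_ + _] := closed_pull iWl (fsub_closed oW oW (@subset_refl _ W) aW); apply. Qed.
Let gY : gaff Y. Proof. by exists JY. Qed.

Let sig_ex : exists sig : mor RW Y, compm iU sig = compm s iW.
Proof. by apply: (finc_lift oU aU); apply/unit_section_lands. Qed.
Let sig := sval (cid sig_ex).
Let sigE : compm iU sig = compm s iW. Proof. by rewrite /sig; case: cid. Qed.

Let eps_ex : exists eps : mor Y RW, compm iW eps = compm e iU.
Proof. by apply: (finc_lift oW aW); split=> // p _; exact: (svalP p). Qed.
Let eps := sval (cid eps_ex).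
Let epsE : compm iW eps = compm e iU. Proof. by rewrite /eps; case: cid. Qed.
Let sig_eps : compm sig eps = idm Y.
Proof.
apply: (finc_mono aU).
by rewrite compmA -[finc oU]/iU sigE -compmA epsE compmA se comp1m compm1.
Qed.

(** [th], with components [s] and [w], maps the arrows in [W] to n-space over [U]. The hypothesis
    [gen] makes it a closed immersion, [ind] puts its ideal [H] into [M^2], and smoothness then
    makes [H] vanish near the point. *)
Let E := ptow Y n.
Let th_ex : exists th : mor RW E, compm (tproj Y n) th = sig /\
  forall i, (i < n)%N -> global_comap th (tX Y n i) = pull iW (w i).
Proof. by apply: tow_hom => // i ni; apply: pull_nil => //; exact: w_nil. Qed.
Let th := sval (cid th_ex).
Let thE : compm (tproj Y n) th = sig. Proof. by rewrite /th; case: cid => ? []. Qed.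
Let thX i : (i < n)%N -> global_comap th (tX Y n i) = pull iW (w i).
Proof. by have [_] := svalP (cid th_ex); apply. Qed.

Let IE := tI JY n.
Let aE : affine IE. Proof. exact: tI_affine. Qed.
Let JC := ideal_span (global_comap th @` IE).

(** The difference of [c] and its pullback along e after s vanishes on the unit section, so [gen]
    applies. *)
Let decomp c : exists (a : sec [set: Y]) (d : nat -> sec [set: RW]),
  c = global_comap sig a + \sum_(i < n) d i * pull iW (w i).
Proof.
have [c' <-] := iW_surj c.
pose a' := comap e oW c'.
have sUW : s @^-1` U = W by apply/seteqP; split=> y /unit_section_open.
have k : comap e oW (c' - res (mor_open s oU) oW (fun y Wy => (unit_section_open y).2 Wy) (comap s oU a')) = 0.
  rewrite rmorphB; apply/eqP; rewrite subr_eq0; apply/eqP; rewrite -/a'.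
  have h1 : U `<=` e @^-1` (s @^-1` U) by move=> z Uz; rewrite /preimage /= sep.
  rewrite (comap_res e (mor_open s oU) oW _ h1).
  have := comap_to_comp oU (mor_open s oU) oU h1 (@subset_refl _ _) h1 a'.
  rewrite [comap_to s _ _ _ _]comap_toE res_id [comap_to e _ _ _ _]comap_toE.
  rewrite [RHS](resP _ (mor_open e (mor_open s oU)) _ (mor_open e oW) _ h1) => <-.
  have aux (f : mor X X) (hf : U `<=` f @^-1` U) : f = idm X -> comap_to f oU oU hf a' = a'.
    by move=> ef; subst f; rewrite comap_to_id res_id.
  by rewrite (aux (compm s e) h1 se).
have [d hd] := gen k.
exists (pull iU a'), (fun i => pull iW (d i)).
have -> : global_comap sig (pull iU a') = pull iW (c' - \sum_(i < n) d i * w i).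
  rewrite -hd opprB addrC subrK pull_res // -pull_comap ?sigE //.
    by rewrite -pull_comp // sigE.
  exact: (unit_section_lands iW).2.
rewrite pullB // [pull iW (bigop.body _ _ _)](pullmE iWl) rmorph_sum.
have -> : \sum_(i < n) pull iW (d i) * pull iW (w i) = \sum_(i < n) pullm iWl (d i * w i).
  by apply: eq_bigr => i _; rewrite !(pullmE iWl) rmorphM.
by rewrite subrK.
Qed.

Let gn i : (i < n)%N -> nil (pull iW (w i)).
Proof. by move=> ni; apply: pull_nil => //; exact: w_nil. Qed.

Let JC_sig a : JY a -> JC (global_comap sig a).
Proof.
move=> Ja; apply: subspan; exists (global_comap (tproj Y n) a); first exact/tI_proj.
by rewrite -gcomapM thE.
Qed.

Let JC_w i : (i < n)%N -> JC (pull iW (w i)).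
Proof.
move=> ni; apply: subspan; exists (tX Y n i); last by rewrite thX.
by apply: tI_X => //; exact: (affine_ideal aY).
Qed.

(** [JC] is comparable with the ideal of definition coming from [I]: its elements are nil, which
    gives one inclusion up to a power, and [decomp] gives the other. *)
Let aC : @affine RW setT JC.
Proof.
have aW' : affine (ideal_span ([eta pull iW (V := W)] @` I)).
  by have [] := closed_pull iWl (fsub_closed oW oW (@subset_refl _ W) aW).
have iJC : is_ideal JC := span_ideal _.
have fgJ : fg_ideal JC by apply: fg_map; exact: (affine_fg aE).
have [b hb] : exists b, ideal_pow JC b `<=` ideal_span ([eta pull iW (V := W)] @` I).
  apply: fg_pow_nil fgJ (affine_ideal aW') _ => c Jc.
  have nc : nil c.
    move=> p uc; suff : vanishing p c by apply.
    have ip : is_ideal (@vanishing RW setT p) by case: (vanishing_prime (@fs_local RW) openT (Logic.I : setT p)).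
    apply: (span_min ip _ Jc) => _ [z Iz <-] up.
    have : nil z := affine_open_nil aE Iz.
    by move=> /gcomap_nil h; exact: (h _ th p up).
  have [k hk] := affine_nil aW' nc 1; exists k; move: hk; rewrite pow1 //; exact: span_ideal.
apply: (affine_change (a := 1) (b := b) aW' fgJ _ hb).
rewrite pow1; last exact: span_ideal.
apply: span_min => // _ [i Ii <-].
have [a [d hd]] := decomp (pull iW i).
have ha : a = global_comap eps (pull iW i).
  rewrite hd rmorphD rmorph_sum -gcomapM sig_eps.
  have -> : \sum_(i0 < n) global_comap eps (d i0 * pull iW (w i0)) = 0.
    apply: big1 => j _; rewrite rmorphM -pull_comp // epsE.
    have lU : lands (compm e iU) W by split=> // p _; exact: (svalP p).
    by rewrite (pull_comap oW) // ew // (pullmE iUl) rmorph0 mulr0.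
  by rewrite addr0.
rewrite hd; apply: idealD => //; last by apply: ideal_sum => // j _; apply: idealM => //; exact: JC_w.
apply: JC_sig; rewrite ha -pull_comp // epsE.
have lU : lands (compm e iU) W by split=> // p _; exact: (svalP p).
rewrite (pull_comap oW) //; apply: subspan; exists (comap e oW i) => //.
by apply: subspan; exists i.
Qed.

Let th_surj c : exists z, global_comap th z = c.
Proof.
apply: (complete_surj (affine_ideal aE) (affine_ideal aC) (affine_complete aE) _ erefl); last first.
  move=> b; have [a [d ->]] := decomp b; exists (global_comap (tproj Y n) a).
  rewrite -gcomapM thE addrAC subrr add0r; apply: ideal_sum; first exact: (affine_ideal aC).
  by move=> i _; apply: idealM; [exact: (affine_ideal aC)|exact: JC_w].
by have [] := affine_complete aC.
Qed.

Let th_closed : closed_immersion_over th openT IE.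
Proof. by split; [exact: aE|exact: aC|exact: th_surj]. Qed.

Let RWx : RW := exist _ (e x) Wx.
Let yE : E := th RWx.
Let M : set (sec [set: E]) := vanishing yE.
Let H : set (sec [set: E]) := [set z | global_comap th z = 0].

Let pM : prime_ideal M. Proof. exact: (affine_van aE Logic.I). Qed.
Let iM : is_ideal M. Proof. by case: pM. Qed.
Let iH : is_ideal H. Proof. have := preim_ideal (global_comap th) (set0_ideal _); exact. Qed.

Let M_th z : M z <-> @vanishing RW setT RWx (global_comap th z).
Proof. by split=> nu u; apply: nu; apply/(comap_unit th openT z (Logic.I : setT (th RWx))). Qed.

Let HM : H `<=` M.
Proof.
move=> z Hz; apply/M_th; rewrite /H /= in Hz; rewrite Hz.
by case: (vanishing_prime (@fs_local RW) openT (Logic.I : setT RWx)) => -[].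
Qed.

Let Emax : residue_max setT yE.
Proof.
move=> z /(comap_unit th openT z (Logic.I : setT (th RWx))) uz.
have [c hc] := iW_surj (global_comap th z).
have [b hb] : exists b, vanishing (e x) (1 - c * b).
  by apply: xmax; apply/(pull_unit c RWx iWl); rewrite hc.
have [z' hz'] := th_surj (pull iW b); exists z'; apply/M_th.
rewrite rmorphB rmorph1 rmorphM hz' -hc => u; apply: hb.
apply/(pull_unit _ RWx iWl); rewrite pullB // pullM //.
by move: u; rewrite (pullmE iWl 1) rmorph1.
Qed.

(** Write [z] in [H] as a constant plus a combination of the coordinates. Restriction to the unit
    section kills the constant; what remains is a linear relation among the [w i], whose
    coefficients vanish at the point by [ind]. *)
Let HM2 : H `<=` ideal_pow M 2.
Proof.
move=> z Hz; have [a [c hz]] := tow_resid z.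
have thd i : exists c' : sec W, pull iW c' = global_comap th (c i) by exact: iW_surj.
have /choice [c' hc'] := thd.
have [lU oU'] : lands (compm e iU) W /\ True by split=> //; split=> // p _; exact: (svalP p).
have s0 : global_comap eps (global_comap th (\sum_(i < n) c i * tX Y n i)) = 0.
  rewrite !rmorph_sum; apply: big1 => j _; rewrite !rmorphM thX // -(pull_comp eps) // epsE.
  by rewrite (pull_comap oW) // ew // (pullmE iUl) rmorph0 mulr0.
have a0 : a = 0.
  have : global_comap eps (global_comap th z) = 0 by rewrite Hz rmorph0.
  rewrite hz rmorphD rmorphD s0 addr0 -gcomapM -gcomapM compmA thE sig_eps; exact.
rewrite hz a0 rmorph0 add0r in Hz *.
have h0 : \sum_(i < n) c' i * w i = 0.
  apply: (@finc_inj _ _ oW _ _ aW); rewrite (pullmE iWl) rmorph_sum.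
  rewrite /H /= rmorph_sum in Hz; rewrite -[RHS]Hz; apply: eq_bigr => j _.
  by rewrite !rmorphM thX // -hc' !(pullmE iWl).
apply: ideal_sum; first exact: pow_ideal.
move=> i _; apply: (powD (m := 1) (n := 1)); apply: sub_pow1.
  apply/M_th; rewrite -hc' => u; apply: (ind h0 (ltn_ord i)).
  exact/(pull_unit _ RWx iWl).
by move=> u; exact: (tX_nil u).
Qed.

Let nE : noetherian_ring (sec [set: E]).
Proof.
apply: tow_noetherian; have nU : noetherian_ring (sec U) := noetherian_surj esurj nW.
apply: (noetherian_surj (f := pullm iUl)) nU => b; have [a <-] := iU_surj b.
by exists a; rewrite (pullmE iUl).
Qed.

(** [T] and [T0] are cut out by [M^k] and [H + M^k]; the latter lies in the closed image of [th].
    Its map to R extends to [c] on [T] by smoothness, and [th] after this extension is compared with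
    the inclusion [tau]. *)
Let HMH : H `<=` ideal_mul M H.
Proof.
have [k0 ar] := artin_rees nE iM iH; pose k := k0.+1.
have {}ar : ideal_pow M k `&` H `<=` ideal_mul M H.
  by move=> z [/pow_sub h1 h2]; apply: ar.
have iQ : is_ideal (ideal_pow M k) := pow_ideal M k.
have iQ0 : is_ideal (ideal_add H (ideal_pow M k)) := addid_ideal iH iQ.
have QM : ideal_pow M k `<=` M := pow_subI iM (ltn0Sn k0).
have Q0M : ideal_add H (ideal_pow M k) `<=` M by apply: addid_min.
have [T [tau hT]] := inf_sub_ex aE (Logic.I : setT yE) Emax iQ (@subset_refl _ _) QM.
have [T0 [tau0 hT0]] := inf_sub_ex (k := k) aE (Logic.I : setT yE) Emax iQ0
  (fun z hz => addidr iH hz) Q0M.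
have [aT tT ts tk _] := hT; have [aT0 tT0 ts0 tk0 _] := hT0.
have [i hi] : exists i, compm tau i = tau0.
  apply: (inf_lift aE hT tT0) => z hz; apply/tk0; exact: addidr.
have [ci ni] := inf_closed hT hT0 hi (@subset_refl _ _) Q0M.
have [rho0 hrho0] : exists rho0, compm th rho0 = tau0.
  have [aJ sur kr] := closed_pull (landsT th) th_closed.
  apply: (closed_lift aE (landsT th) aJ sur (a := 1) _ tT0); first exact: pow1_sub (span_ideal _).
  move=> z; rewrite pull_gcomap => hz; apply/tk0; exact: addidl.
have [c [hc1 hc2]] : exists c : mor T R, compm c i = compm iW rho0 /\ compm s c = compm iU (compm (tproj Y n) tau).
  apply: fs => //.
  by rewrite compmA -sigE -thE -!compmA hrho0 hi.
have [ch hch] : exists ch : mor T RW, compm iW ch = c.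
  apply: (finc_lift oW aW); apply/unit_section_lands; rewrite hc2; exact: lands_comp.
have tch : compm (tproj Y n) (compm th ch) = compm (tproj Y n) tau.
  by apply: (finc_mono aU); rewrite (compmA (tproj Y n) th ch) thE (compmA (finc oU) sig ch) -[finc oU]/iU sigE -compmA hch hc2.
have chi : compm ch i = rho0.
  by apply: (finc_mono aW); rewrite compmA -[finc oW]/iW hch hc1.
have lift z : exists2 z', global_comap tau z' = global_comap (compm th ch) z &
    ideal_add H (ideal_pow M k) (z' - z).
  have [z' hz'] := ts (global_comap (compm th ch) z); rewrite pull_gcomap in hz'.
  exists z' => //; apply/tk0; rewrite pull_gcomap rmorphB; apply/eqP; rewrite subr_eq0; apply/eqP.
  by rewrite -hi gcomapM hz' -gcomapM -compmA chi hrho0 hi.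
(* The two maps from [T] agree modulo [H + M^k] on all functions, hence modulo [L] on products of
   two functions in [M]. *)
pose L := ideal_add (ideal_mul M H) (ideal_pow M k).
have iL : is_ideal L by apply: addid_ideal; [exact: mulid_ideal|exact: pow_ideal].
have ML z h : M z -> ideal_add H (ideal_pow M k) h -> L (z * h).
  move=> Mz [h1 [h2 [Hh1 Mh2 ->]]]; rewrite mulrDr; exists (z * h1), (z * h2); split=> //.
    exact: mulidI.
  exact: idealM.
pose K := [set z | M z /\ exists2 z', global_comap tau z' = global_comap (compm th ch) z & L (z' - z)].
have iK : is_ideal K.
  split.
  - by split; [exact: (ideal0 iM)|exists 0; rewrite ?rmorph0 // subrr; exact: (ideal0 iL)].
  - move=> a b [Ma [a' ea La]] [Mb [b' eb Lb]]; split; first exact: (idealD iM Ma Mb).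
    exists (a' + b'); first by rewrite !rmorphD ea eb.
    have -> : a' + b' - (a + b) = (a' - a) + (b' - b) by ring.
    exact: (idealD iL La Lb).
  - move=> d a [Ma [a' ea La]]; split; first exact: (idealM d iM Ma).
    have [d' ed hd] := lift d; exists (d' * a'); first by rewrite !rmorphM ed ea.
    have -> : d' * a' - d * a = d' * (a' - a) + a * (d' - d) by ring.
    by apply: (idealD iL); [exact: (idealM _ iL La)|exact: ML].
have M2K : ideal_pow M 2 `<=` K.
  rewrite powS; apply: mulid_min => // a b Ma; rewrite pow1 // => Mb.
  split; first exact: (idealM a iM Mb).
  have [a' ea ha] := lift a; have [b' eb hb] := lift b.
  exists (a' * b'); first by rewrite !rmorphM ea eb.
  have -> : a' * b' - a * b = a' * (b' - b) + b * (a' - a) by ring.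
  apply: (idealD iL); apply: ML => //; rewrite -[a'](subrK a); apply: (idealD iM _ Ma).
  exact: Q0M.
(* The extension goes through R, so it kills [z]; thus [z] lies in [L], and its part in [M^k] lies
   also in [H], where Artin-Rees applies. *)
move=> z Hz; have [Mz [z' ez [z1 [z2 [hz1 hz2 e12]]]]] := M2K _ (HM2 Hz).
have z'0 : ideal_pow M k z'.
  apply/tk; rewrite pull_gcomap ez gcomapM; rewrite /H /= in Hz; rewrite Hz; exact: rmorph0.
have e3 : z = (z' - z2) - z1 by rewrite -[z1](addrK z2) -e12; ring.
have h3 : ideal_mul M H (z' - z2).
  apply: ar; split; first exact: (idealB iQ).
  have -> : z' - z2 = z + z1 by rewrite {1}e3; ring.
  apply: (idealD iH) => //.
  by apply: (mulid_min iH _ hz1) => a b _ Hb; exact: (idealM a iH Hb).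
by rewrite e3; apply: (idealB (mulid_ideal M H)).
Qed.

Lemma structure_uniq (T : formalScheme) (r r' : mor T R) : lands (compm s r) U ->
  compm s r = compm s r' -> (forall i, (i < n)%N -> pull r (w i) = pull r' (w i)) -> r = r'.
Proof.
move=> rU srr h; have rU' : lands (compm s r') U by rewrite -srr.
have [r1 hr1] : exists r1, compm iW r1 = r by apply: (finc_lift oW aW); exact/unit_section_lands.
have [r2 hr2] : exists r2, compm iW r2 = r' by apply: (finc_lift oW aW); exact/unit_section_lands.
rewrite -hr1 -hr2; congr (compm iW _).
have [_ sur _] := closed_pull (landsT th) th_closed.
apply: (closed_mono (landsT th) aC sur); apply: (tow_hom_uniq gY).
  rewrite (compmA (tproj Y n) th r1) (compmA (tproj Y n) th r2) thE; apply: (finc_mono aU).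
  by rewrite (compmA (finc oU) sig r1) (compmA (finc oU) sig r2) -[finc oU]/iU sigE -!compmA hr1 hr2.
by move=> i ni; rewrite !gcomapM thX // -!pull_comp // hr1 hr2 h.
Qed.

(** Nakayama yields [c], invertible at the point, with [c H = 0]; over D(c) the closed immersion
    [th] has zero kernel, so points of n-space with values there lift to arrows. *)
Lemma structure_ex : exists2 a : sec U, unit_at a x &
  forall (T : formalScheme) (b : mor T X) (g : nat -> sec [set: T]), lands b (basic_open a) ->
  (forall i, (i < n)%N -> nil (g i)) ->
  exists r, compm s r = b /\ forall i, (i < n)%N -> pull r (w i) = g i.
Proof.
have [|c Mc cH] := nakayama iM (set0_ideal _) (nE iH).
  by move=> z /HMH hz; apply: addidr => //; exact: set0_ideal.
have uc : unit_at c yE.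
  apply: contrapT => nc; case: pM => _ M1 _; apply: M1.
  by rewrite -(subrK c 1); exact: (idealD iM).
have [a0 [d hc]] := tow_resid c.
have [a ha] := iU_surj a0.
(* Coordinates vanish at all points, so D(c) is the preimage of an open of the base. *)
have unitE (p : E) : unit_at c p <-> unit_at a (iU (tproj Y n p)).
  rewrite -(pull_unit a _ iUl) ha -(comap_unit (tproj Y n) openT a0 (Logic.I : setT (tproj Y n p))).
  have ip : is_ideal (@vanishing E setT p) by case: (affine_van aE (Logic.I : setT p)).
  have vs : @vanishing E setT p (\sum_(i < n) d i * tX Y n i).
    apply: (@ideal_sum _ (@vanishing E setT p) _ _ _ _ ip) => j _.
    apply: (@idealM _ (@vanishing E setT p) _ _ ip) => u; exact: (tX_nil u).
  split=> u; apply: contrapT => nu.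
    suff : @vanishing E setT p c by apply.
    by rewrite hc; apply: (idealD ip _ vs).
  suff : @vanishing E setT p (global_comap (tproj Y n) a0) by apply.
  have -> : global_comap (tproj Y n) a0 = c - \sum_(i < n) d i * tX Y n i by rewrite {1}hc addrK.
  exact: (idealB ip nu vs).
exists a.
  move/unitE: uc; have -> : tproj Y n yE = sig RWx.
    by have := congr1 (fun f : mor RW Y => f RWx) thE.
  have -> : iU (sig RWx) = s (e x) by have := congr1 (fun f : mor RW X => f RWx) sigE.
  by rewrite sep.
move=> T b g bD ng.
have aUl : basic_open a `<=` U by exact: basic_open_sub.
have bU : lands b U by apply: lands_sub bD aUl oU.
have [b1 hb1] := finc_lift oU aU bU.
have [be [hbe1 hbeX]] := tow_hom gY b1 ng.
have oD := basic_open_open c; have DT := @basic_open_sub _ _ c.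
have cD := closed_shrink (@fs_local RW) (@fs_local E) oD DT erefl th_closed.
have beD : lands be (basic_open c).
  split=> // p _; apply/unitE.
  have -> : tproj Y n (be p) = b1 p by have := congr1 (fun f : mor T Y => f p) hbe1.
  have -> : iU (b1 p) = b p by have := congr1 (fun f : mor T X => f p) hb1.
  by case: bD => _; apply.
have cR := closed_restrict cD.
set Z := fsub (mor_open th oD) in cR; set iZ : mor Z RW := finc (mor_open th oD) in cR.
have fl : lands (compm th iZ) (basic_open c) by split=> // p _; exact: (svalP p).
have [aJ sur kr] := closed_pull fl cR.
have aD : affine (ideal_span (res openT oD DT @` IE)) by case: cD.
have [ze hze] : exists ze, compm (compm th iZ) ze = be.
  apply: (closed_lift aD fl aJ sur (a := 1) _ beD); first exact: pow1_sub (span_ideal _).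
  move=> z /kr hz.
  have thz : comap th oD z = 0.
    have aD' : @affine RW (th @^-1` basic_open c) (ideal_span (comap th oD @` ideal_span (res openT oD DT @` IE))).
      by case: cD.
    apply: (@finc_inj _ _ (mor_open th oD) _ _ aD').
    have [_ _ kr'] := closed_pull (finc_lands (mor_open th oD))
      (fsub_closed (mor_open th oD) (mor_open th oD) (@subset_refl _ _) aD').
    exact/kr'.
  have nD : noetherian_ring (sec (basic_open c)) := loc_noetherian aE openT oD DT erefl nE.
  (* Over D(c) the kernel is generated by [H], which is killed by the unit [c]. *)
  have hzH := closed_kernel_shrink (@fs_local E) DT erefl th_closed nD iH (fun _ h => h) thz.
  have -> : z = 0; last by rewrite (pullmE beD) rmorph0.
  suff : [set 0] z by [].
  apply: (span_min (set0_ideal _) _ hzH) => _ [h Hh <-].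
  apply: (unit_cancel (a := res openT oD DT c)); first exact: res_unit.
  by rewrite -rmorphM cH // rmorph0.
exists (compm iW (compm iZ ze)); split.
  rewrite compmA -sigE -thE -!compmA (compmA th) hze hbe1; exact: hb1.
move=> i ni; rewrite pull_comp // -(thX ni) -gcomapM compmA hze; exact: hbeX.
Qed.

End Structure.

(** * Bases modulo a maximal ideal; closed points; immersions *)

(** Since [M] times [q] lies in [N], the span of [q] modulo [N] is a vector space over the field
    [C / M]. An independent list is extended by those members of [h] that do not depend on the
    earlier ones. *)
Lemma greedy_basis (C : comPzRingType) (M q N : set C) : is_ideal M -> is_ideal N ->
  (forall a, ~ M a -> exists b, M (1 - a * b)) -> (forall a x, M a -> q x -> N (a * x)) ->
  forall (h l : seq C), (forall x, x \in h -> q x) ->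
  (forall c : nat -> C, N (\sum_(i < size l) c i * l`_i) -> forall i, (i < size l)%N -> M (c i)) ->
  exists l', [/\ forall x, x \in l' -> x \in h,
    forall c : nat -> C, N (\sum_(i < size (l ++ l')) c i * (l ++ l')`_i) ->
      forall i, (i < size (l ++ l'))%N -> M (c i) &
    forall x, x \in h -> exists d : nat -> C, N (x - \sum_(i < size (l ++ l')) d i * (l ++ l')`_i)].
Proof.
move=> iM iN Mmax MN; elim=> [|x h IH] l hq hl.
  by exists [::]; rewrite cats0; split.
have hq' y : y \in h -> q y by move=> yh; apply: hq; rewrite inE yh orbT.
have qx : q x by apply: hq; rewrite inE eqxx.
have [[d hd]|nx] := pselect (exists d : nat -> C, N (x - \sum_(i < size l) d i * l`_i)).
  have [l' [h1 h2 h3]] := IH l hq' hl; exists l'; split=> //.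
    by move=> y /h1 yh; rewrite inE yh orbT.
  move=> y; rewrite inE => /orP [/eqP ->|]; last exact: h3.
  exists (fun i => if (i < size l)%N then d i else 0).
  rewrite size_cat big_split_ord /= [X in _ - (_ + X)]big1 ?addr0; last first.
    by move=> i _; rewrite ltnNge leq_addr mul0r.
  suff -> : \sum_(i < size l) (if (i < size l)%N then d i else 0) * (l ++ l')`_i =
            \sum_(i < size l) d i * l`_i by [].
  by apply: eq_bigr => i _; rewrite ltn_ord nth_cat ltn_ord.
have hl' (c : nat -> C) : N (\sum_(i < size (rcons l x)) c i * (rcons l x)`_i) ->
   forall i, (i < size (rcons l x))%N -> M (c i).
  rewrite size_rcons big_ord_recr /= nth_rcons ltnn eqxx => hN.
  have e1 : \sum_(i < size l) c i * (rcons l x)`_i = \sum_(i < size l) c i * l`_i.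
    by apply: eq_bigr => i _; rewrite nth_rcons ltn_ord.
  rewrite e1 in hN.
  have Mc : M (c (size l)).
    (* Were the last coefficient invertible modulo [M], the relation could be solved for [x]. *)
    apply: contrapT => nc; have [b hb] := Mmax _ nc; apply: nx.
    exists (fun i => - b * c i).
    have -> : x - \sum_(i < size l) - b * c i * l`_i =
      (1 - c (size l) * b) * x + b * (\sum_(i < size l) c i * l`_i + c (size l) * x).
      have -> : \sum_(i < size l) - b * c i * l`_i = - b * \sum_(i < size l) c i * l`_i.
        by rewrite mulr_sumr; apply: eq_bigr => i _; rewrite mulrA.
      ring.
    by apply: (idealD iN); [exact: MN|exact: (idealM _ iN)].
  move=> i; rewrite ltnS leq_eqVlt => /orP [/eqP ->//|il]; apply: hl il.
  rewrite -[X in N X](addrK (c (size l) * x)); apply: (idealB iN) => //; exact: MN.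
have [l' [h1 h2 h3]] := IH (rcons l x) hq' hl'; exists (x :: l').
rewrite -cat_rcons; split=> //.
  move=> y; rewrite !inE => /orP [->//|/h1 ->]; exact: orbT.
move=> y; rewrite inE => /orP [/eqP ->|]; last exact: h3.
exists (fun i => if i == size l then 1 else 0).
have il : (size l < size (rcons l x ++ l'))%N by rewrite size_cat size_rcons; lia.
rewrite (bigD1 (Ordinal il)) //= eqxx mul1r nth_cat size_rcons ltnSn nth_rcons ltnn eqxx.
rewrite big1 ?addr0 ?subrr; first exact: ideal0.
by move=> i /negPf ni; rewrite -[nat_of_ord i == _]/(i == Ordinal il :> nat) -val_eqE in ni *; rewrite ni mul0r.
Qed.

(** Otherwise some maximal ideal contains [a] and the ideal of [y]. It belongs to a point [z] other
    than [y], and as [y] is closed, some function is a unit at [z] and not at [y], a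
    contradiction. *)
Lemma closed_residue_max (Y : ringedSpace) (W : set Y) (I : set (sec W)) (y : Y) : affine I -> W y ->
  closed [set y] -> residue_max W y.
Proof.
move=> aI Wy cy a ua; apply: contrapT => nb.
have [iv v1 _] : prime_ideal (vanishing (U := W) y) := affine_van aI Wy.
pose K := ideal_add (vanishing (U := W) y) [set z | exists c, z = c * a].
have iK : is_ideal K by apply: addid_ideal => //; exact: princ_ideal.
have K1 : ~ K 1.
  move=> [v [_ [vv [c ->] e]]]; apply: nb; exists c.
  by rewrite e mulrC addrK.
have [M KM [pM _]] := maximal_ideal iK K1.
have vM : vanishing y `<=` M by move=> z hz; apply: KM; apply: addidl => //; exact: princ_ideal.
have IM : I `<=` M by move=> z /(affine_vanI aI Wy) /vM.
have [z [[Wz eM] _]] := affine_prime aI pM IM.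
have [zy|zy] := pselect (z = y).
  have : M a by apply: KM; apply: addidr => //; exists 1; rewrite mul1r.
  by rewrite eM zy; apply.
have oz : open (~` [set y]) by apply: closed_openC.
have [b [ub bo]] := affine_basis aI oz (zy : (~` [set y]) z) Wz.
have : vanishing y b by move=> uby; have := bo _ uby; apply.
by move=> /vM; rewrite eM; apply.
Qed.

Section ImmLocal.
Variables (Z Y : formalScheme) (f : mor Z Y).

(** The open in which the immersion is closed is shrunk to a basic open common to the affine of the
    closed immersion and to an affine of [Y]. *)
Lemma imm_local (z : Z) : immersion f -> exists (D : set Y) (oD : open D) (I : set (sec D)),
  D (f z) /\ closed_immersion_over f oD I.
Proof.
move=> [U [j [i [oj ci ef]]]]; have [V [oV [I [Vz cl]]]] := ci (i z).
have [jinj jop jsec] := oj.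
have efz : f z = j (i z) by rewrite ef.
have [D0 [I0 [aD0 D0z D0V]]] := affine_nbhd (jop V oV) (ex_intro2 _ _ (i z) Vz erefl : (j @` V) (j (i z))).
have oD0 := affine_open aD0.
have D0R : D0 `<=` range j by move=> y /D0V [u _ <-]; exists u.
have aP := open_pull oD0 oj (@fs_local U) D0R aD0.
have [aI aJ sur] := cl.
have D0i : (j @^-1` D0) (i z) by [].
have [a [b [ab ua aV]]] := common_basic (@fs_local U) aI aP oV Vz D0i Vz.
have [[g k1 k2] _] := jsec D0 oD0 D0R.
pose b' := g b.
have eb : comap j oD0 b' = b by exact: k2.
have ob' := basic_open_open b'; have b'D := @basic_open_sub _ _ b'.
pose D := basic_open b'.
have jD : j @^-1` D = basic_open a.
  rewrite ab -eb; apply/seteqP; split=> p; rewrite /D /preimage /basic_open /= => up.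
    by apply/(comap_unit j oD0 b' (b'D _ up)).
  have Dp := unit_at_in up; exact/(comap_unit j oD0 b' Dp).
have aD := affine_basic_aux aD0 (@fs_local Y) oD0 ob' b'D erefl.
exists D, ob', (ideal_span (res oD0 ob' b'D @` I0)); split.
  by rewrite efz; apply/(comap_unit j oD0 b' D0i); rewrite eb; move: ua; rewrite -[unit_at a _]/((basic_open a) _) ab.
have DR : D `<=` range j by move=> y /b'D /D0R.
have aDU := open_pull ob' oj (@fs_local U) DR aD.
pose ojD := mor_open j ob'.
have jDV : j @^-1` D `<=` V by rewrite jD.
have [aK aKJ surK] := closed_shrink (@fs_local Z) (@fs_local U) ojD jDV jD cl.
have [[g' k1' k2'] _] := jsec D ob' DR.
subst f; split=> //; last first.
  move=> c; have [c1 hc1] := surK c; exists (g' c1); rewrite -hc1.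
  exact: (congr1 (comap i ojD) (k2' c1)).
have [m1 hm1] := adic_compare (affine_ideal aDU) (affine_top aK) (affine_top aDU).
have [m2 hm2] := adic_compare (affine_ideal aK) (affine_top aDU) (affine_top aK).
have := affine_change (a := m1) (b := m2) aKJ (fg_map (comap i ojD) (affine_fg aDU))
  (span_map_pow_sub (f := comap i ojD) hm1) (span_map_pow_sub (f := comap i ojD) hm2).
by rewrite span_map_map.
Qed.

End ImmLocal.

(** * Tor_0 and Tor_1 of two quotients *)

Section Tor.
Variables (A : comPzRingType) (J K : set A).
Hypotheses (iJ : is_ideal J) (iK : is_ideal K).

Let Kmx m n (u : 'rV[A]_m) (d : 'M[A]_(m, n)) : (forall j, K (u 0 j)) -> forall j, K ((u *m d) 0 j).
Proof. by move=> h j; rewrite mxE; apply: ideal_sum => // i _; exact: idealMr. Qed.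

Let mxB n (u v : 'rV[A]_n) j : (u - v) 0 j = u 0 j - v 0 j.
Proof. by rewrite !mxE. Qed.

(** Tor_0 is A / (J + K), whose annihilator is J + K; the element [u], of augmentation 1 modulo [J],
    represents the class of 1. *)
Lemma tor0_sum (M : set A) : tor_is_cyclic J K 0%N M -> forall a, M a <-> ideal_add J K a.
Proof.
move=> [rk [d [aug [[r1 r2 r3] [g [_ gen ann]]]]]] a.
have augd (w : 'rV[A]_(rk 1%N)) : J ((w *m d 0%N *m aug) 0 0) by apply/r2; exists w.
have augZ c (u : 'rV[A]_(rk 0%N)) : ((c *: u) *m aug) 0 0 = c * (u *m aug) 0 0 by rewrite -scalemxAl mxE.
split=> [/ann [w hw]|[b [c [Jb Kc ->]]]].
  have [u hu] := r1 1; have [c [w' hw']] := gen u Logic.I.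
  have hJK : ideal_add J K (a * (u *m aug) 0 0).
    pose k := a *: (u - c *: g - w' *m d 0%N) + c *: (a *: g - w *m d 0%N).
    have ek : a *: u = k + (a *: w' + c *: w) *m d 0%N.
      rewrite /k mulmxDl -!scalemxAl; set p := w' *m _; set q := w *m _.
      by apply/matrixP => i j; rewrite !mxE; ring.
    rewrite -augZ ek mulmxDl mxE addrC.
    exists (((a *: w' + c *: w) *m d 0%N *m aug) 0 0), ((k *m aug) 0 0); split=> //.
    apply: Kmx => j; rewrite /k mxE [X in X + _]mxE [X in _ + X]mxE.
    by apply: idealD => //; apply: idealM.
  have -> : a = a * (1 - (u *m aug) 0 0) + a * (u *m aug) 0 0 by ring.
  by apply: idealD; [exact: addid_ideal|apply: addidl => //; exact: idealM|].
apply/ann.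
have [w hw] : exists w, b *: g = w *m d 0%N by apply/r2; rewrite augZ; exact: idealMr.
exists w => j; rewrite scalerDl hw addrAC subrr add0r mxE; exact: idealMr.
Qed.

(** Tor_1 is the intersection of [J] and [K] modulo their product. For [a] in both, a multiple of a
    lift of 1 is the differential of a cycle modulo [K]; subtracting a boundary makes the entries of
    the cycle lie in [K], and the differentials of basis vectors have augmentation in [J]. *)
Lemma tor1_int : tor_is_cyclic J K 1%N setT -> J `&` K `<=` ideal_mul J K.
Proof.
move=> [rk [d [aug [[r1 r2 r3] [g [_ gen ann]]]]]] a [Ja Ka].
have [u hu] := r1 1.
have [w hw] : exists w, a *: u = w *m d 0%N.
  apply/r2; rewrite -scalemxAl mxE; exact: idealMr.
have cyc : tor_cycle K d (i := 1) w by move=> j; rewrite -hw mxE; exact: idealMr.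
have [c [w1 hw1]] := gen w cyc; have [w2 hw2] := (ann c).2 Logic.I.
pose k := w - (w1 + w2) *m d 1%N.
have hk j : K (k 0 j).
  have -> : k = (w - c *: g - w1 *m d 1%N) + (c *: g - w2 *m d 1%N).
    rewrite /k mulmxDl; set p := w1 *m _; set q := w2 *m _.
    by apply/matrixP => i l; rewrite !mxE; ring.
  by rewrite mxE; apply: idealD.
have ek : a *: u = k *m d 0%N.
  rewrite hw /k mulmxBl -[X in _ - X]mulmxA.
  have -> : d 1%N *m d 0%N = 0.
    apply/row_matrixP => i; rewrite row_mul row0; apply/r3.
    by exists (row i 1%:M); rewrite -row_mul mul1mx.
  by rewrite mulmx0 subr0.
have -> : a = a * (1 - (u *m aug) 0 0) + ((a *: u) *m aug) 0 0.
  by rewrite -scalemxAl [X in _ + X]mxE; ring.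
apply: (idealD (mulid_ideal J K)); first by rewrite mulrC; exact: mulidI.
rewrite ek -mulmxA mxE; apply: ideal_sum => [|i _]; first exact: mulid_ideal.
rewrite mulrC; apply: mulidI => //.
have -> : (d 0%N *m aug) i 0 = ((row i 1%:M *m d 0%N) *m aug) 0 0.
  by rewrite -mulmxA -row_mul mul1mx [RHS]mxE.
by apply/r2; eexists.
Qed.

End Tor.

(** * Completion at a point *)

Lemma nil_span (X : formalScheme) (U : set X) (oU : open U) (G : set (sec U)) :
  (forall g, G g -> nil g) -> forall z, ideal_span G z -> nil z.
Proof.
move=> hG z Gz p up; have Up := unit_at_in up.
have [ip _ _] := vanishing_prime (@fs_local X) oU Up.
by have := span_min ip (fun g Gg => hG g Gg p) Gz; apply.
Qed.

(** Locally on [T], finite generation makes some power of [m] map into an ideal of definition. This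
    serves for m-adic convergence in a ring whose own topology is a different one. *)
Lemma nil_tz_ideal (T : formalScheme) (A : comPzRingType) (m : set A)
  (phi : {rmorphism A -> sec [set: T]}) (u : nat -> A) : fg_ideal m ->
  (forall a, m a -> nil (phi a)) ->
  (forall N, exists K, forall k, (K <= k)%N -> ideal_pow m N (u k)) -> tz (fun k => phi (u k)).
Proof.
move=> fgm nm hu; apply: (tz_loc openT) => p _.
have [V [I [aI Vp VT]]] := affine_nbhd openT (Logic.I : [set: T] p).
have oV := affine_open aI; exists V, oV, VT; split=> //.
pose psi : {rmorphism A -> sec V} := GRing.RMorphism.clone _ _ (res openT oV VT \o phi) _.
have nilpsi z : ideal_span (psi @` m) z -> nil z.
  apply: (nil_span oV) => _ [a ma <-] q uq; apply: (nm a ma q).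
  exact/(unit_atW openT oV VT (phi a) (unit_at_in uq)).
have [M hM] : exists M, ideal_pow (ideal_span (psi @` m)) M `<=` I.
  apply: fg_pow_nil; [exact: fg_map|exact: (affine_ideal aI)|].
  move=> z /nilpsi nz; have [k hk] := affine_nil aI nz 1; exists k; move: hk.
  by rewrite pow1 //; exact: (affine_ideal aI).
apply/(tz_adic _ (affine_top aI)) => N; have [K hK] := hu (M * N)%N; exists K => k /hK h.
exact: (pow_mono hM (pow_mulS (map_pow psi h))).
Qed.

Definition compl (X Xh : formalScheme) (h : mor Xh X) (U : set X) (x : X) :=
  [/\ lands h U, affine (@nonunits (sec [set: Xh])),
      forall n (b : sec [set: Xh]), exists a : sec U, ideal_pow (@nonunits _) n (b - pull h a) &
      forall n (a : sec U), ideal_pow (@nonunits _) n (pull h a) <-> ideal_pow (vanishing x) n a].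

Lemma completion_compl (X Xh : formalScheme) (x : X) (h : mor Xh X) : completion_at x h ->
  exists (U : set X) (I : set (sec U)), [/\ U x, affine I & compl h U x].
Proof.
move=> [U [oU [I [Ux aI hU aN hn]]]]; exists U, I; split=> //.
have hT : [set: Xh] `<=` h @^-1` U by rewrite hU.
have aux (V' : set Xh) (oV' : open V') (h' : [set: Xh] `<=` V') : V' = setT ->
  affine (@nonunits (sec V')) -> [/\ affine (@nonunits (sec [set: Xh])),
   forall n a, ideal_pow (@nonunits (sec [set: Xh])) n (res oV' openT h' a) <->
    ideal_pow (@nonunits (sec V')) n a & forall b, exists a, res oV' openT h' a = b].
  by move=> e; subst V' => aV; split=> [|n a|b] //; [rewrite res_id|exists b; rewrite res_id].
have [aT hpow hsur] := aux _ (mor_open h oU) hT hU aN.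
have hp (s : sec U) : pull h s = res (mor_open h oU) openT hT (comap h oU s).
  by rewrite (pullE oU hT) comap_toE.
split=> // n.
  move=> b; have [b' <-] := hsur b; have [/(_ b') [a ha] _] := hn n.
  by exists a; rewrite hp -rmorphB; apply/hpow.
by move=> a; rewrite hp hpow; have [_] := hn n; apply.
Qed.

Section Compl.
Variables (X Xh : formalScheme) (h : mor Xh X) (U : set X) (I : set (sec U)) (x : X).
Hypotheses (aI : affine I) (Ux : U x) (hc : compl h U x).
Let hU : lands h U. Proof. by case: hc. Qed.
Let aN : affine (@nonunits (sec [set: Xh])). Proof. by case: hc. Qed.

Lemma compl_van (p : Xh) b : @vanishing Xh setT p b <-> nonunits b.
Proof.
split=> [nb ub|nb]; last exact: (affine_vanI aN (Logic.I : setT p) nb).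
by apply: nb; apply: unit_unit_at => //; exact: openT.
Qed.

Lemma compl_pt (p : Xh) : h p = x.
Proof.
apply: (affine_pt_uniq aI) => //; first by case: hU => _; apply.
move=> a; rewrite -(pull_unit a p hU).
have [_ _ _ /(_ 1%N a)] := hc; rewrite !pow1; last 2 first.
- by have [] := affine_van aI Ux.
- exact: (affine_ideal aN).
move=> e; split=> u; apply: contrapT => nu.
  by have /e /(affine_vanI aN (Logic.I : setT p)) := nu; apply.
by have /compl_van /e := nu; apply.
Qed.

Lemma compl_pt_ex : exists p : Xh, True.
Proof.
apply: contrapT => np; have [n0 _ _] := affine_ideal aN.
have e : 0 = 1 :> sec [set: Xh] by apply/esym/sec_empty; [exact: openT|move=> p; case: np; exists p].
by apply: n0; exists 0; rewrite mulr0 {1}e.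
Qed.

Lemma compl_mono (T : formalScheme) (r r' : mor T Xh) : compm h r = compm h r' -> r = r'.
Proof.
move=> e; apply: hom_gaff_uniq; first by exists (@nonunits _).
move=> b; have [_ _ ap _] := hc.
have /choice [a ha] : forall n, exists a : sec U, ideal_pow (@nonunits _) n (b - pull h a) by move=> n; exact: ap.
have lb : lims (fun n => pull h (a n)) b.
  apply: (tz_pow (affine_top aN)) => n; rewrite -opprB; apply: idealN; first exact: pow_ideal.
  exact: ha.
apply: (lims_uniq openT (lims_map (@gcomap_cont _ _ r) lb)).
apply: eq_tz (lims_map (@gcomap_cont _ _ r') lb) => n /=.
by congr (_ - _); rewrite -!pull_comp // e.
Qed.

(** Functions vanishing at [x] pull back to nil ones, so [b] is continuous for the m-adic topology
    and extends from the dense image of O(U) to the completion. *)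
Lemma compl_lift (T : formalScheme) (b : mor T X) : fg_ideal (@vanishing X U x) ->
  (forall p, b p = x) -> exists b', compm h b' = b.
Proof.
move=> fgm bx; have oU := affine_open aI.
have bU : lands b U by split=> // p _; rewrite /preimage /= bx.
have [_ _ ap pw] := hc.
have nm (a : sec U) : vanishing x a -> nil (pullm bU a).
  by move=> va p; rewrite -pullmE => /(pull_unit a p bU); rewrite bx.
have [|||||phi [cphi hphi]] := @dense_extend T (sec [set: Xh]) (@nonunits _) setT openT
  (fun c g => exists2 a : sec U, pull h a = c & pull b a = g) (affine_top aN).
- by exists 1; rewrite ?(pullmE hU) ?(pullmE bU) rmorph1.
- by move=> ? ? ? ? [s <- <-] [s' <- <-]; exists (s - s'); rewrite pullB.
- by move=> ? ? ? ? [s <- <-] [s' <- <-]; exists (s * s'); rewrite pullM.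
- move=> c n; have [a ha] := ap n c; exists (pull h a), (pull b a); split; first by exists a.
  by rewrite -opprB; apply: idealN => //; exact: pow_ideal.
- move=> c g hS /(tz_adic _ (affine_top aN)) tc.
  have /choice [a ha] : forall n, exists a : sec U, pull h a = c n /\ pull b a = g n.
    by move=> n; have [a e1 e2] := hS n; exists a.
  have : tz (fun k => pullm bU (a k)).
    apply: (nil_tz_ideal fgm nm) => N; have [K hK] := tc N; exists K => k /hK.
    by have [<- _] := ha k; move/pw.
  by apply: eq_tz => k; rewrite -pullmE; case: (ha k).
have [b' hb'] := @hom_gaff_ex T Xh phi (ex_intro _ _ aN) cphi.
exists b'; apply: (affine_mor_ext aI) => //; first exact: lands_comp.
move=> a; rewrite pull_comp // hb'; apply: hphi; by exists a.
Qed.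

(** [c] is a unit at the only point of the completion, and over D(c) a function is a fraction up to
    any power of the ideal of [x]. *)
Lemma compl_shrink (c : sec U) : unit_at c x -> compl h (basic_open c) x.
Proof.
move=> uc; have oU := affine_open aI; have oD := basic_open_open c.
have DU := @basic_open_sub _ _ c; have [_ _ ap pw] := hc.
have hD : lands h (basic_open c) by split=> // p _; rewrite /preimage /= compl_pt.
have pwr n (z : sec U) : ideal_pow (vanishing x) n z ->
   ideal_pow (vanishing x) n (res oU oD DU z).
  move=> /(map_pow (res oU oD DU)); apply: pow_mono; apply: span_min.
    by have [] := vanishing_prime (@fs_local X) oD (uc : basic_open c x).
  by move=> _ [a va <-]; apply/(vanishing_res oU oD DU).
split=> //.
  move=> n b; have [a ha] := ap n b; exists (res oU oD DU a).
  by rewrite pull_res.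
move=> n a; split=> [hn|].
  have aD := affine_basic_aux aI (@fs_local X) oU oD DU erefl.
  have [_ _ /(_ n) [_ /(_ a) [k [a' ha']] _]] := affine_loc aI oU oD DU erefl.
  have iv : is_ideal (@vanishing X (basic_open c) x) by have [] := affine_van aD uc.
  have {}ha' : ideal_pow (vanishing x) n (res oU oD DU c ^+ k * a - res oU oD DU a').
    apply: pow_mono ha'; apply: (affine_vanI aD uc).
  have back (z : sec (basic_open c)) : ideal_pow (vanishing x) n z -> ideal_pow (@nonunits _) n (pull h z).
    move=> /(map_pow (pullm hD)); rewrite -(pullmE hD); apply: pow_mono.
    apply: span_min; first exact: (affine_ideal aN).
    move=> _ [w vw <-]; rewrite -(pullmE hD) => uw; apply: vw.
    have [p _] := compl_pt_ex.
    rewrite -(compl_pt p); apply/(pull_unit w p hD); apply: unit_unit_at => //; exact: openT.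
  have : ideal_pow (vanishing x) n a'.
    apply/pw; have -> : pull h a' = pull h (res oU oD DU c ^+ k * a) - pull h (res oU oD DU c ^+ k * a - res oU oD DU a').
      by rewrite -pullB // subKr pull_res.
    apply: idealB; [exact: pow_ideal| |exact: back].
    by rewrite pullM //; apply: (@idealM _ (ideal_pow (@nonunits (sec [set: Xh])) n)) hn; exact: pow_ideal.
  move=> /pwr h2; apply: (unit_ideal (a := res oU oD DU c ^+ k)); first exact: pow_ideal.
    by apply: unitX; apply: res_unit.
  by rewrite -[_ * a](subrK (res oU oD DU a')); exact: (idealD (pow_ideal _ _) ha' h2).
move=> hn; rewrite (pullmE hD); have := map_pow (pullm hD) hn; apply: pow_mono.
apply: span_min; first exact: (affine_ideal aN).
move=> _ [w vw <-]; rewrite -(pullmE hD).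
have [p _] := compl_pt_ex.
by apply/(compl_van p) => /(pull_unit w p hD); rewrite compl_pt.
Qed.

End Compl.

(** * The residue field of a closed point *)

Section Kappa.
Variables (X P : formalScheme) (x : X) (kappa : mor P X) (U : set X) (I : set (sec U)).
Hypotheses (rp : residue_point x kappa) (aI : affine I) (Ux : U x) (xmax : residue_max U x).
Let oU := affine_open aI.
Let aP : affine [set 0 : sec [set: P]]. Proof. by case: rp => -[]. Qed.

Lemma kap_pt : exists p : P, True.
Proof.
have [[_ [n1 un]] _ _] := rp.
have pr : prime_ideal [set 0 : sec [set: P]].
  split; [exact: set0_ideal|exact: n1|] => a b /= ab.
  have [->|na] := pselect (a = 0); [by left|right].
  exact: (unit_cancel (un a na)).
have [p _] := affine_prime aP pr (@subset_refl _ _); by exists p.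
Qed.

Lemma kap_lands : lands kappa U.
Proof. by split=> // p _; rewrite /preimage /=; have [_ -> _] := rp. Qed.

Lemma kap_ker (a : sec U) : pull kappa a = 0 <-> vanishing x a.
Proof.
have [[_ [n1 un]] kp _] := rp; have [p _] := kap_pt; split=> [a0 ua|va].
  have : unit_at (pull kappa a) p by apply/(pull_unit a p kap_lands); rewrite kp.
  by rewrite a0; have [] := @fs_local P setT p openT Logic.I.
apply: contrapT => na; apply: va; rewrite -(kp p); apply/(pull_unit a p kap_lands).
by apply: unit_unit_at => //; [exact: openT|exact: un].
Qed.

(** A residue is represented by a germ, which is a fraction modulo an ideal of definition;
    [residue_max] inverts the denominator by a function on [U]. *)
Lemma kap_surj c : exists a : sec U, pull kappa a = c.
Proof.
have [_ kp ks] := rp; have [U' [oU' [s [U'x es]]]] := ks c.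
have oI := openI oU' oU.
have [d [ud dU]] := affine_basis aI oU' U'x Ux.
have oD := basic_open_open d; have DU := @basic_open_sub _ _ d.
have kD : lands kappa (basic_open d) by split=> // p _; rewrite /preimage /= kp.
have kU' : lands kappa U' by split=> // p _; rewrite /preimage /= kp.
have aD := affine_basic_aux aI (@fs_local X) oU oD DU erefl.
have ec : pull kappa (res oU' oD dU s) = c.
  rewrite pull_res // (pullE oU' kU'.2) comap_toE es.
  by rewrite (res_res _ _ _ _ _ (@subset_refl _ _)) res_id.
have [_ _ /(_ 1%N) [_ /(_ (res oU' oD dU s)) [k [a]]]] := affine_loc aI oU oD DU erefl.
rewrite pow1; last exact: (affine_ideal aD).
move=> hI _.
have h0 : pull kappa (res oU oD DU d ^+ k * res oU' oD dU s - res oU oD DU a) = 0.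
  have nz := affine_open_nil aD hI.
  have := pull_nil kD nz; set z := pull _ _ => nz'; apply: contrapT => z0.
  have [[_ [_ un]] _ _] := rp; have [p _] := kap_pt; apply: (nz' p).
  by apply: unit_unit_at => //; [exact: openT|exact: un].
have [b hb] := xmax ud.
have eb : pull kappa d * pull kappa b = 1.
  apply/esym/subr0_eq; rewrite -pullM //; last exact: kap_lands.
  have <- : pull kappa (1 : sec U) = 1 by rewrite (pullmE kap_lands) rmorph1.
  by rewrite -pullB ?kap_ker //; exact: kap_lands.
have kX n : pull kappa (d ^+ n) = pull kappa d ^+ n by rewrite !(pullmE kap_lands) rmorphXn.
exists (b ^+ k * a); have bX : pull kappa (b ^+ k) = pull kappa b ^+ k by rewrite !(pullmE kap_lands) rmorphXn.
rewrite pullM ?bX; last exact: kap_lands.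
have := h0; rewrite -rmorphXn pullB // pullM // ec !pull_res // kX => /subr0_eq <-.
by rewrite mulrA -exprMn [pull _ b * _]mulrC eb expr1n mul1r.
Qed.

Lemma kap_mono (T : formalScheme) (z z' : mor T P) : compm kappa z = compm kappa z' -> z = z'.
Proof. exact: (closed_mono kap_lands aP kap_surj). Qed.

Lemma kap_lift (T : formalScheme) (b : mor T X) : lands b U ->
  (forall a : sec U, vanishing x a -> pull b a = 0) -> exists z, compm kappa z = b.
Proof.
move=> bU hb; apply: (closed_lift aI kap_lands aP kap_surj (a := 1) _ bU).
  move=> c /(pow1_sub (set0_ideal _)) ->; exact: ideal0 (span_ideal _).
by move=> a /kap_ker /hb.
Qed.

End Kappa.

Lemma imm_single (L Y : formalScheme) (l : mor L Y) : immersion l -> nonempty_scheme L ->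
  (forall p q : Y, p = q) ->
  exists I : set (sec [set: Y]), [/\ affine I, affine (ideal_span (global_comap l @` I)) &
    forall c, exists b, global_comap l b = c].
Proof.
move=> il [p _] single; have [D [oD [I [Dp cl]]]] := imm_local p il.
have eD : D = setT by apply/seteqP; split=> // q _; rewrite (single q (l p)).
subst D; have [aJ sur _] := closed_pull (landsT l) cl; exists I; split.
- by case: cl.
- have -> : global_comap l @` I = [eta pull l (V := setT)] @` I; last exact: aJ.
  by apply/seteqP; split=> _ [s Is <-]; exists s => //=; rewrite pull_gcomap.
- by move=> c; have [b <-] := sur c; exists b; rewrite pull_gcomap.
Qed.

(** * Noetherian neighbourhoods of the unit at x *)

Section Chart.
Variables (X R V : formalScheme) (e : mor X R) (x : X) (v : mor V X) (y : V).
Hypothesis (vy : v y = x).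

(** Neighbourhoods are chosen in R and not in X: [W] determines the neighbourhood of [x] as its
    preimage under [e], and that of [y] in V in turn. *)
Definition chart (W : set R) (oW : open W) := 
  [/\ exists IW, closed_immersion_over e oW IW, noetherian_ring (sec W) & W (e x)].

Lemma chart_shrink (W : set R) (oW : open W) (c : sec W) : chart oW -> unit_at c (e x) ->
  chart (basic_open_open c).
Proof.
move=> [[IW cl] nW Wx] uc; have [aI _ _] := cl; split=> //.
  exists (ideal_span (res oW (basic_open_open c) (@basic_open_sub _ _ c) @` IW)).
  exact: (closed_shrink (@fs_local X) (@fs_local R) (basic_open_open c) (@basic_open_sub _ _ c) erefl cl).
exact: (loc_noetherian aI oW (basic_open_open c) (@basic_open_sub _ _ c) erefl nW).
Qed.

Lemma chart_pre (W : set R) (oW : open W) (c : sec W) :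
  e @^-1` basic_open c = basic_open (comap e oW c).
Proof.
apply/seteqP; split=> p; rewrite /preimage /basic_open /= => up.
  by apply/(comap_unit e oW c (basic_open_sub up)).
exact/(comap_unit e oW c (unit_at_in up)).
Qed.

Lemma chart_common (W : set R) (oW : open W) (D : set X) (ID : set (sec D)) : chart oW ->
  affine ID -> D x -> exists (c : sec W) (d : sec D),
   [/\ unit_at c (e x), unit_at d x & e @^-1` basic_open c = basic_open d].
Proof.
move=> [[IW [aI aJ sur]] nW Wx] aD Dx.
have [a [d [ad ua _]]] := common_basic (@fs_local X) aJ aD openT Wx Dx Logic.I.
have [c hc] := sur a; exists c, d; split.
- by apply/(comap_unit e oW c Wx); rewrite hc.
- by rewrite -[unit_at d x]/(basic_open d x) -ad.
- by rewrite chart_pre hc.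
Qed.

Variables (Xh Vh : formalScheme) (h : mor Xh X) (hv : mor Vh V).

(** One condition after the other is reached by passing to basic opens, which preserves those
    already reached. A basic open of X or V is induced from R by lifting its function along the
    surjective comorphisms of [v] and [e]. *)
Lemma chart_ex : closed_immersion e -> locally_noetherian R -> immersion v -> completion_at x h ->
  completion_at y hv -> exists (W : set R) (oW : open W),
   [/\ chart oW, exists IV, closed_immersion_over v (mor_open e oW) IV, compl h (e @^-1` W) x &
       compl hv (v @^-1` (e @^-1` W)) y].
Proof.
move=> ce nR iv ch cv.
have [W0 [oW0 [I0 [W0x cl0]]]] := ce (e x).
have [U1 [I1 [U1x aU1 nU1]]] := nR (e x).
have [aI0 _ _] := cl0.
have [a [b [ab ua _]]] := common_basic (@fs_local R) aI0 aU1 openT W0x U1x Logic.I.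
have oW1 := basic_open_open a; have W1s := @basic_open_sub _ _ a.
have W1U : basic_open a `<=` U1 by rewrite ab; exact: basic_open_sub.
have ch1 : chart oW1.
  split=> //; last exact: (loc_noetherian aU1 (affine_open aU1) oW1 W1U ab nU1).
  by eexists; exact: (closed_shrink (@fs_local X) (@fs_local R) oW1 W1s erefl cl0).
have [D1 [oD1 [J1 [D1x cl1]]]] := imm_local y iv; rewrite vy in D1x.
have [aJ1 _ _] := cl1.
have [c2 [d2 [uc2 ud2 e2]]] := chart_common ch1 aJ1 D1x.
have ch2 := chart_shrink ch1 uc2.
have [U3 [I3 [U3x aI3 cp3]]] := completion_compl ch.
have [c3 [d3 [uc3 ud3 e3]]] := chart_common ch2 aI3 U3x.
have ch3 := chart_shrink ch2 uc3.
pose U2 := e @^-1` basic_open c2; have oU2 : open U2 := mor_open e (basic_open_open c2).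
have U2D : U2 `<=` D1 by rewrite /U2 e2; exact: basic_open_sub.
have cl2 := closed_shrink (@fs_local V) (@fs_local X) oU2 U2D e2 cl1.
pose U4 := e @^-1` basic_open c3; have oU4 : open U4 := mor_open e (basic_open_open c3).
have U4U : U4 `<=` U2 by rewrite /U4 (chart_pre (basic_open_open c2) c3); exact: basic_open_sub.
have cl3 := closed_shrink (@fs_local V) (@fs_local X) oU4 U4U (chart_pre (basic_open_open c2) c3) cl2.
have cp4 : compl h U4 x by rewrite /U4 e3; exact: (compl_shrink aI3 U3x cp3 ud3).
have [U5 [I5 [U5y aI5 cp5]]] := completion_compl cv.
have [aU4 aV4 sur4] := cl3.
have U4x : U4 x by exact: uc3.
have V4y : (v @^-1` U4) y by rewrite /preimage /= vy.
have [g [g' [gg ug _]]] := common_basic (@fs_local V) aV4 aI5 openT V4y U5y Logic.I.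
have [k hk] := sur4 g.
have [[I4 [_ _ sure]] _ _] := ch3.
have [c4 hc4] := sure k.
have ukx : unit_at k x by rewrite -vy; apply/(comap_unit v oU4 k V4y); rewrite hk.
have uc4 : unit_at c4 (e x) by apply/(comap_unit e (basic_open_open c3) c4 U4x); rewrite hc4.
have e4 : e @^-1` basic_open c4 = basic_open k by rewrite (chart_pre (basic_open_open c3)) hc4.
exists (basic_open c4), (basic_open_open c4); split.
- exact: (chart_shrink ch3 uc4).
- have h4 : e @^-1` basic_open c4 `<=` U4 by rewrite e4; exact: basic_open_sub.
  by eexists; exact: (closed_shrink (@fs_local V) (@fs_local X) (mor_open e (basic_open_open c4)) h4 e4 cl3).
- by rewrite e4; exact: (compl_shrink aU4 U4x cp4 ukx).
- have -> : v @^-1` (e @^-1` basic_open c4) = basic_open g'.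
    rewrite e4 -gg; apply/seteqP; split=> p; rewrite /preimage /basic_open /= => up.
      by rewrite -hk; apply/(comap_unit v oU4 k (basic_open_sub up)).
    by apply/(comap_unit v oU4 k (unit_at_in up)); rewrite hk.
  apply: (compl_shrink aI5 U5y cp5).
  by rewrite -[unit_at g' y]/(basic_open g' y) -gg.
Qed.

End Chart.

(** * Infinitesimal groupoids near x: conormal space and leaf *)

Section GroupoidChart.
Variables (S X : formalScheme) (pX : mor X S) (R : groupoid pX) (x : X).
Let s := src R.
Let t := tgt R.
Let e := unit_arr R.
Hypotheses (infR : infinitesimal R) (cx : closed [set x]).
Variables (W : set R) (oW : open W).
Hypothesis (ch : chart e x oW).
Let U := e @^-1` W.
Let oU : open U := mor_open e oW.

(** [e] is a bijection on points with left inverses [s] and [t], so both are its inverse. *)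
Lemma groupoid_top (p : R) : e (s p) = p /\ t p = s p.
Proof.
have [_ [[g k1 k2] _]] := infR.
have se z : s (e z) = z by have := congr1 (fun h : mor X X => h z) (src_unit R).
have te z : t (e z) = z by have := congr1 (fun h : mor X X => h z) (tgt_unit R).
have es : e (s p) = p by rewrite -(k2 p) se.
by split=> //; rewrite -{1}es te.
Qed.

Lemma src_chart : W `<=` s @^-1` U.
Proof. by move=> p Wp; rewrite /U /preimage /= (groupoid_top p).1. Qed.
Lemma tgt_chart : W `<=` t @^-1` U.
Proof. by move=> p Wp; rewrite /U /preimage /= (groupoid_top p).2 (groupoid_top p).1. Qed.

Lemma lands_chart (T : formalScheme) (r : mor T R) : lands r W <-> lands (compm s r) U.
Proof.
split=> [[_ h]|[_ h]]; split=> // p /h; first exact: src_chart.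
by rewrite /U /preimage /= (groupoid_top (r p)).1.
Qed.

Definition csrc : {rmorphism sec U -> sec W} := comap_to s oW oU src_chart.
Definition ctgt : {rmorphism sec U -> sec W} := comap_to t oW oU tgt_chart.

Lemma pull_csrc (T : formalScheme) (r : mor T R) a : lands r W -> pull r (csrc a) = pull (compm s r) a.
Proof.
move=> rW; rewrite (pull_comap oU) ?pull_res //.
by apply/lands_chart.
Qed.

Lemma pull_ctgt (T : formalScheme) (r : mor T R) a : lands r W -> pull r (ctgt a) = pull (compm t r) a.
Proof.
move=> rW; rewrite (pull_comap oU) ?pull_res //.
split=> // p _; apply: tgt_chart; by case: rW => _; apply.
Qed.

Let unit_sec (f : mor R X) (h1 : W `<=` f @^-1` U) a : compm f e = idm X ->
  comap e oW (comap_to f oW oU h1 a) = a.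
Proof.
move=> fe; have h2 : U `<=` (compm f e) @^-1` U by rewrite fe.
have := comap_to_comp oU oW oU (@subset_refl _ U) h1 h2 a.
rewrite [comap_to e _ _ _ _]comap_toE res_id => <-.
have aux (f' : mor X X) (hf : U `<=` f' @^-1` U) : f' = idm X -> comap_to f' oU oU hf a = a.
  by move=> ef; subst f'; rewrite comap_to_id res_id.
exact: (aux (compm f e) h2 fe).
Qed.

Lemma unit_csrc a : comap e oW (csrc a) = a. Proof. exact: (unit_sec src_chart a (src_unit R)). Qed.
Lemma unit_ctgt a : comap e oW (ctgt a) = a. Proof. exact: (unit_sec tgt_chart a (tgt_unit R)). Qed.

Let Wx : W (e x). Proof. by case: ch. Qed.
Let nW : noetherian_ring (sec W). Proof. by case: ch. Qed.
Let aW : exists I : set (sec W), affine I. Proof. by case: ch => -[I [aI _ _]] _ _; exists I. Qed.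
Let aU : exists I : set (sec U), affine I. Proof. by case: ch => -[I [_ aI _]] _ _; eexists; exact: aI. Qed.

Lemma chart_surj a : exists c, comap e oW c = a.
Proof. by case: ch => -[I [_ _ +]] _ _; apply. Qed.

Lemma chart_noeth : noetherian_ring (sec U). Proof. exact: noetherian_surj chart_surj nW. Qed.

Lemma chart_max : residue_max W (e x).
Proof.
have [I aI] := aW; apply: (closed_residue_max aI Wx).
have -> : [set e x] = s @^-1` [set x].
  apply/seteqP; split=> p /=.
    by move=> ->; have := congr1 (fun h : mor X X => h x) (src_unit R).
  by rewrite /preimage /= => sp; rewrite -(groupoid_top p).1 sp.
rewrite -openC preimage_setC; apply: mor_open; exact: closed_openC.
Qed.

Lemma chart_maxU : residue_max U x.
Proof. by have [I aI] := aU; exact: (closed_residue_max aI Wx cx). Qed.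

Let M := vanishing (U := W) (e x).
Let m := vanishing (U := U) x.
(** The ideal of the unit section; [q / N] is its conormal space at [x], a vector space over the
    residue field, in which the coordinates w will form a basis. *)
Let q := [set c | comap e oW c = 0].
Let N := ideal_mul M q.

Lemma chart_primeM : prime_ideal M. Proof. by have [I aI] := aW; exact: (affine_van aI Wx). Qed.
Lemma chart_primem : prime_ideal m. Proof. by have [I aI] := aU; exact: (affine_van aI Wx). Qed.
Let iM : is_ideal M. Proof. by case: chart_primeM. Qed.
Let im : is_ideal m. Proof. by case: chart_primem. Qed.
Lemma chart_kerI : is_ideal q. Proof. exact: (preim_ideal (comap e oW) (set0_ideal _)). Qed.
Let iq := chart_kerI.
Let iN : is_ideal N := mulid_ideal M q.

Lemma chart_vanE c : M c <-> m (comap e oW c).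
Proof. by split=> nu u; apply: nu; apply/(comap_unit e oW c Wx). Qed.

Lemma chart_qM : q `<=` M.
Proof. by move=> c qc; apply/chart_vanE; rewrite qc; exact: ideal0. Qed.

Lemma csrc_van a : m a -> M (csrc a). Proof. by move=> ma; apply/chart_vanE; rewrite unit_csrc. Qed.
Lemma ctgt_van a : m a -> M (ctgt a). Proof. by move=> ma; apply/chart_vanE; rewrite unit_ctgt. Qed.

Lemma delta_ker a : q (ctgt a - csrc a).
Proof. by rewrite /q /= rmorphB unit_ctgt unit_csrc subrr. Qed.

Let qpr c : q (c - csrc (comap e oW c)).
Proof. by rewrite /q /= rmorphB unit_csrc subrr. Qed.

(** Subtracting from a function its pullback along e after s retracts [M] onto [q]. Modulo [N] this
    retraction kills the pullbacks of [m] along [s] and the square of [M]. *)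
Lemma chart_Mq c : q c -> ideal_add (ideal_span (csrc @` m)) (ideal_pow M 2) c -> N c.
Proof.
move=> qc hc; pose K := [set c | M c /\ N (c - csrc (comap e oW c))].
have iK : is_ideal K.
  split.
  - by split; [exact: ideal0|rewrite !rmorph0 subrr; exact: ideal0].
  - move=> a b [Ma Na] [Mb Nb]; split; first exact: (idealD iM).
    by rewrite !rmorphD opprD addrACA; exact: (idealD iN).
  - move=> d a [Ma Na]; split; first exact: (idealM d iM Ma).
    rewrite !rmorphM; set a' := csrc (comap e oW a) in Na *; set d' := csrc _.
    have -> : d * a - d' * a' = d * (a - a') + a' * (d - d') by ring.
    apply: (idealD iN); first exact: (idealM _ iN Na).
    apply: mulidI; last exact: qpr.
    by apply: csrc_van; apply/chart_vanE.
suff [_] : K c by rewrite qc rmorph0 subr0.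
apply: (addid_min iK _ _ hc).
  apply: span_min => // _ [a ma <-]; split; first exact: csrc_van.
  by rewrite unit_csrc subrr; exact: ideal0.
rewrite powS; apply: mulid_min => // a b Ma; rewrite pow1 // => Mb.
split; first exact: (idealM a iM Mb).
rewrite !rmorphM; set a' := csrc (comap e oW a); set b' := csrc (comap e oW b).
have -> : a * b - a' * b' = a * (b - b') + b' * (a - a') by ring.
apply: (idealD iN); first by apply: mulidI => //; exact: qpr.
apply: mulidI; last exact: qpr.
by apply: csrc_van; apply/chart_vanE.
Qed.

Lemma chart_tau_top (T : formalScheme) (tau : mor T R) (Q : set (sec W)) : inf_sub tau Q (e x) ->
  (forall p, compm s tau p = x) /\ (forall p, compm t tau p = x).
Proof.
move=> [_ _ _ _ hp]; split=> p; rewrite /= hp.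
  by have := congr1 (fun h : mor X X => h x) (src_unit R).
by have := congr1 (fun h : mor X X => h x) (tgt_unit R).
Qed.

Variables (P : formalScheme) (kappa : mor P X).
Hypothesis (rp : residue_point x kappa).

Section Leaf.
Variables (Xh Rh L : formalScheme) (h : mor Xh X) (r0 : mor Rh R) (sh th : mor Rh Xh) (lh : mor L Xh).
Hypotheses (cp : compl h U x) (Rhr : is_restriction s t h r0 sh th) (leaf : is_leaf sh th lh).
Let K := global_kernel lh.

Lemma leaf_K : is_ideal K /\ K `<=` @nonunits _.
Proof.
have iK : is_ideal K := preim_ideal (global_comap lh) (set0_ideal _).
split=> // b Kb ub; have [_ [l0 _] _ _] := leaf.
have [c hc] := is_unit_map (global_comap lh) ub.
move: hc; rewrite Kb mul0r => e01; have [n0 _] := @fs_local L setT l0 openT Logic.I.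
by apply: n0; rewrite e01; apply: unit_at1 => //; exact: openT.
Qed.

Let fgm : fg_ideal m. Proof. exact: chart_noeth. Qed.

(** The completion has a single point, so the immersion of the leaf is a closed immersion. *)
Lemma leaf_lift (T : formalScheme) (b : mor T Xh) : (forall c, K c -> global_comap b c = 0) ->
  exists l, compm lh l = b.
Proof.
have [I aI] := aU; move=> hb; have [il ne _ _] := leaf.
have single (p p' : Xh) : p = p'.
  have aN : affine (@nonunits (sec [set: Xh])) by case: cp.
  apply: (affine_pt_uniq aN) => // c.
  by split=> u; apply: contrapT => nu;
    have /(compl_van cp) nc := nu; move: u; have /(compl_van cp) := nc; exact.
have [J [aJ aJL sur]] := imm_single il ne single.
apply: (closed_lift aJ (landsT lh) aJL _ (a := 1) _ (landsT b)).
- by move=> c; have [c' <-] := sur c; exists c'; rewrite pull_gcomap.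
- have -> : [eta pull lh (V := setT)] @` J = global_comap lh @` J.
    by apply/seteqP; split=> _ [c Jc <-]; exists c => //=; rewrite pull_gcomap.
  exact: pow1_sub (span_ideal _).
- by move=> c; rewrite !pull_gcomap; exact: hb.
Qed.

Lemma leaf_src (T : formalScheme) (r : mor T R) (l : mor T L) : compm s r = compm h (compm lh l) ->
  exists l', compm t r = compm h (compm lh l').
Proof.
move=> sr; have [I aI] := aU.
have px p : compm t r p = x.
  have e1 : t (r p) = s (r p) by case: (groupoid_top (r p)).
  rewrite [LHS]e1; have := congr1 (fun f : mor T X => f p) sr => /= ->.
  exact: (compl_pt aI Wx cp).
have [b hb] := compl_lift aI Wx cp fgm px.
have [_ _ univ] := Rhr.
have [m0 [[m1 m2 m3] _]] := univ T r (compm lh l) b sr (esym hb).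
have [_ _ [RZ [rz [s' [t' [[e1 e2 _] [e3 pb] _]]]]] _] := leaf.
have [n [[n1 n2] _]] := pb T m0 l m2.
exists (compm t' n); rewrite -hb; congr (compm h _).
by rewrite -m3 -n1 !compmA e2.
Qed.

Lemma leaf_point : exists lam : mor P L, compm h (compm lh lam) = kappa.
Proof.
have [I aI] := aU; have [[aP [n1 un]] kp _] := rp.
have [pi hpi] := compl_lift aI Wx cp fgm kp.
have [|lam hlam] := @leaf_lift P pi; last by exists lam; rewrite hlam hpi.
move=> c /leaf_K.2 nc; apply: contrapT => nz.
have [p _] := kap_pt rp.
have : unit_at (global_comap pi c) p by apply: unit_unit_at => //; [exact: openT|exact: un].
move=> /(comap_unit pi openT c (Logic.I : setT (pi p))).
by have /(compl_van cp) := nc; apply.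
Qed.

(** The ideal in the conclusion cuts out the first-order arrows starting at [x]. Their targets stay
    in the leaf by invariance, so functions vanishing on the leaf to second order pull back to 0
    along [t]. *)
Lemma leaf_tgt a k : K k -> ideal_pow (@nonunits _) 2 (pull h a - k) ->
  ideal_add (ideal_span (csrc @` m)) (ideal_pow M 2) (ctgt a).
Proof.
move=> Kk hak; have [IW aIW] := aW; have [I aI] := aU.
pose Q := ideal_add (ideal_span (csrc @` m)) (ideal_pow M 2).
have iQ : is_ideal Q by apply: addid_ideal; [exact: span_ideal|exact: pow_ideal].
have QM : Q `<=` M.
  apply: addid_min => //; last exact: pow_subI.
  by apply: span_min => // _ [b mb <-]; exact: csrc_van.
have MQ : ideal_pow M 2 `<=` Q by move=> c hc; apply: addidr => //; exact: span_ideal.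
have [T [tau hT]] := inf_sub_ex aIW Wx chart_max iQ MQ QM.
have [aT tW ts tk _] := hT; have [ps pt] := chart_tau_top hT.
have sU : lands (compm s tau) U by apply/lands_chart.
have [z hz] : exists z, compm kappa z = compm s tau.
  apply: (kap_lift rp aI Wx chart_maxU sU) => b mb.
  rewrite -pull_csrc //; apply/tk; apply: addidl; first exact: pow_ideal.
  by apply: subspan; exists b.
have [lam hlam] := leaf_point.
have [l' hl'] : exists l', compm t tau = compm h (compm lh l').
  by apply: (@leaf_src _ tau (compm lam z)); rewrite -hz -hlam !compmA.
apply/tk; rewrite pull_ctgt // hl' pull_comp; last by case: cp.
have -> : pull h a = k + (pull h a - k) by ring.
rewrite rmorphD gcomapM Kk rmorph0 add0r.
have : ideal_pow (ideal_span (global_comap (compm lh l') @` @nonunits _)) 2 (global_comap (compm lh l') (pull h a - k)).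
  exact: map_pow.
have hM b : nonunits b -> exists2 c, M c & pull tau c = global_comap (compm lh l') b.
  move=> nb; have [c hc] := ts (global_comap (compm lh l') b); exists c => // uc.
  have [p _] : exists p : T, True.
    apply: contrapT => np; have e01 : 1 = 0 :> sec [set: T].
      by apply: sec_empty; [exact: openT|move=> p; case: np; exists p].
    have [_ M1 _] := chart_primeM; apply: M1; apply: QM; apply/tk.
    by rewrite (pullmE tW) rmorph1.
  have := (pull_unit c p tW).2; have -> : tau p = e x by case: hT.
  move=> /(_ uc).
  rewrite hc => /(comap_unit (compm lh l') openT b (Logic.I : setT (compm lh l' p))).
  by have /(compl_van cp) := nb; apply.
suff h0 : ideal_pow (ideal_span (global_comap (compm lh l') @` @nonunits _)) 2 `<=` [set 0] by move=> /h0.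
rewrite span_map_pow; apply: span_min; first exact: set0_ideal.
move=> _ [b hb <-].
have iB : is_ideal (global_comap (compm lh l') @^-1` [set 0]) := preim_ideal _ (set0_ideal _).
suff : ideal_pow (@nonunits _) 2 `<=` global_comap (compm lh l') @^-1` [set 0] by move=> /(_ _ hb).
have iK : is_ideal (@nonunits (sec [set: Xh])) by apply: affine_ideal; case: cp.
rewrite powS; apply: mulid_min => // b1 b2 n1; rewrite pow1 // => n2.
have [c1 M1 e1] := hM _ n1; have [c2 M2 e2] := hM _ n2.
suff : global_comap (compm lh l') (b1 * b2) = 0 by [].
rewrite rmorphM -e1 -e2 -pullM //; apply/tk; apply: MQ.
by apply: (powD (m := 1) (n := 1)); exact: sub_pow1.
Qed.

End Leaf.
End GroupoidChart.

(** * Choice of the coordinates w and of the equations f *)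

Section Choice.
Variables (S X : formalScheme) (pX : mor X S) (R : groupoid pX) (x : X).
Let s := src R.
Let t := tgt R.
Let e := unit_arr R.
Hypotheses (infR : infinitesimal R) (cx : closed [set x]).
Variables (W : set R) (oW : open W).
Hypothesis (ch : chart e x oW).
Let U := e @^-1` W.
Let oU : open U := mor_open e oW.
Let sg := csrc infR oW.
Let tg := ctgt infR oW.
Let M := vanishing (U := W) (e x).
Let m := vanishing (U := U) x.
Let q := [set c | comap e oW c = 0].
Let N := ideal_mul M q.
Let Wx : W (e x). Proof. by case: ch. Qed.
Let nW : noetherian_ring (sec W). Proof. by case: ch. Qed.
Let aW : exists I : set (sec W), affine I. Proof. by case: ch => -[I [aI _ _]] _ _; exists I. Qed.
Let aU : exists I : set (sec U), affine I. Proof. by case: ch => -[I [_ aI _]] _ _; eexists; exact: aI. Qed.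
Let pM : prime_ideal M := chart_primeM ch.
Let pm : prime_ideal m := chart_primem ch.
Let iM : is_ideal M. Proof. by case: pM. Qed.
Let im : is_ideal m. Proof. by case: pm. Qed.
Let iq : is_ideal q := chart_kerI oW.
Let iN : is_ideal N := mulid_ideal M q.

Variables (P : formalScheme) (kappa : mor P X).
Hypothesis (rp : residue_point x kappa).

Section Transversal.
Variables (Xh Rh L : formalScheme) (h : mor Xh X) (r0 : mor Rh R) (sh th : mor Rh Xh) (lh : mor L Xh).
Hypotheses (cp : compl h U x) (Rhr : is_restriction s t h r0 sh th) (leaf : is_leaf sh th lh).
Let K := global_kernel lh.
Variables (V Vh : formalScheme) (v : mor V X) (y : V) (hv : mor Vh V) (j : mor Vh Xh) (IV : set (sec U)).
Hypotheses (vy : v y = x) (hj : compm h j = compm v hv) (clv : closed_immersion_over v oU IV)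
  (cpv : compl hv (v @^-1` U) y).
Let J := global_kernel j.

Let hU : lands h U. Proof. by case: cp. Qed.
Let Vy : (v @^-1` U) y. Proof. by rewrite /preimage /= vy. Qed.

Let jv a : pull hv (comap v oU a) = global_comap j (pull h a).
Proof.
rewrite -pull_comap; last by rewrite -hj; exact: lands_comp.
by rewrite -hj pull_comp.
Qed.

Lemma trans_kernel a : comap v oU a = 0 -> J (pull h a).
Proof.
move=> a0; rewrite /J /global_kernel /= -[comap j openT _]/(global_comap j _) -jv a0.
have hvU : lands hv (v @^-1` U) by case: cpv.
by rewrite (pullmE hvU) rmorph0.
Qed.

Lemma trans_van a : vanishing (U := v @^-1` U) y (comap v oU a) <-> m a.
Proof. by rewrite /m -vy; split=> nu u; apply: nu; apply/(comap_unit v oU a Vy). Qed.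

(** Up to high order [b] is a function on [U] that is small on the completion of V, that is, lies
    there in a power of the ideal of [y]; surjectivity onto O(V) allows this error to be
    subtracted. *)
Lemma trans_approx b n : J b -> exists2 a : sec U, comap v oU a = 0 &
  ideal_pow (@nonunits _) n (b - pull h a).
Proof.
move=> Jb; have [I aI] := aU; have [_ aVI sur] := clv.
have [_ aN ap pw] := cp; have [a0 ha0] := ap n b.
have [_ aNV _ pwv] := cpv.
have jn c : nonunits c -> nonunits (global_comap j c).
  move=> nc; have [p _] := compl_pt_ex cpv.
  apply/(compl_van cpv p) => /(comap_unit j openT c (Logic.I : setT (j p))).
  by have /(compl_van cp) := nc; apply.
have : ideal_pow (vanishing (U := v @^-1` U) y) n (comap v oU a0).
  apply/pwv; rewrite jv.
  have -> : pull h a0 = b - (b - pull h a0) by ring.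
  rewrite rmorphB Jb sub0r; apply: idealN; first exact: pow_ideal.
  have := map_pow (global_comap j) ha0; apply: pow_mono.
  apply: span_min; first exact: (affine_ideal aNV).
  by move=> _ [c nc <-]; exact: jn.
have vm : vanishing (U := v @^-1` U) y `<=` ideal_span (comap v oU @` m).
  move=> c vc; have [a ha] := sur c; apply: subspan; exists a => //.
  by apply/trans_van; rewrite ha.
move=> /(pow_mono vm) /(surj_pow sur im) [a1 ma1 e1].
exists (a0 - a1); first by rewrite rmorphB e1 subrr.
rewrite pullB //; have -> : b - (pull h a0 - pull h a1) = (b - pull h a0) + pull h a1 by ring.
by apply: (idealD (pow_ideal _ _)) => //; apply/pw.
Qed.

Hypothesis (JK : forall b, nonunits b -> ideal_add J K b).

(** With [dl a] the pullback of [a] along [t] minus that along [s], a basis of the span of all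
    [dl f], for f in the ideal of V, is chosen in [q / N] and completed to a basis of [q / N]. The
    last clause says that [dl] maps [m] into the span of the first part; it holds since [m] is, up
    to second order, the sum of the ideals of V and of the leaf, and the latter contributes
    nothing. *)
Lemma choice_ex : exists (mm n : nat) (f : nat -> sec U) (w : nat -> sec W),
 [/\ (mm <= n)%N,
   forall i, (i < mm)%N -> [/\ m (f i), comap v oU (f i) = 0 & w i = tg (f i) - sg (f i)],
   (forall i, (i < n)%N -> comap e oW (w i) = 0) /\
   (forall c : nat -> sec W, N (\sum_(i < n) c i * w i) -> forall i, (i < n)%N -> M (c i)),
   forall z, q z -> exists d : nat -> sec W, N (z - \sum_(i < n) d i * w i) &
   forall a, m a -> exists d : nat -> sec W, N (tg a - sg a - \sum_(i < mm) d i * w i)].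
Proof.
have Mmax a : ~ M a -> exists b, M (1 - a * b).
  by move=> /contrapT; exact: (chart_max infR cx ch).
have nU : noetherian_ring (sec U) := chart_noeth ch.
have ijv : is_ideal [set a | comap v oU a = 0] := preim_ideal (comap v oU) (set0_ideal _).
have /fgP [hs hhs] := nU _ ijv.
have /fgP [qs hqs] := nW iq.
pose dl a := tg a - sg a.
have dlq a : q (dl a) by exact: delta_ker.
have [||l1 [l1h ind1 sp1]] := @greedy_basis _ M q N iM iN Mmax (fun a c Ma qc => mulidI Ma qc) (map dl hs) [::].
- by move=> _ /mapP [a _ ->]; exact: dlq.
- by move=> c _ i.
rewrite cat0s in ind1 sp1.
have [||l2 [l2h ind2 sp2]] := @greedy_basis _ M q N iM iN Mmax (fun a c Ma qc => mulidI Ma qc) qs l1.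
- by move=> c cq; rewrite hqs; exact: mem_spans.
- exact: ind1.
have /choice [f hf] : forall i, exists a, (i < size l1)%N -> a \in hs /\ l1`_i = dl a.
  move=> i; have [il|il] := boolP (i < size l1)%N; last by exists 0 => h'.
  have /mapP [a ahs ea] := l1h _ (mem_nth 0 il); by exists a.
have nthE i : (i < size l1)%N -> (l1 ++ l2)`_i = l1`_i by move=> il; rewrite nth_cat il.
have l2q c : c \in l1 ++ l2 -> q c.
  rewrite mem_cat => /orP [/l1h /mapP [a _ ->]//|/l2h cq]; rewrite hqs; exact: mem_spans.
exists (size l1), (size (l1 ++ l2)), f, (fun i => (l1 ++ l2)`_i); split.
- by rewrite size_cat leq_addr.
- move=> i il; have [fh fe] := hf i il; rewrite nthE // fe.
  have f0 : comap v oU (f i) = 0.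
    have : spans hs (f i) by exact: mem_spans.
    by rewrite -hhs.
  split=> //; apply/trans_van; rewrite f0.
  by have [_ aVI _] := clv; have [] := affine_van aVI Vy => -[].
- by split=> // i il; apply: l2q; exact: mem_nth.
- pose Q := [set z | exists d : nat -> sec W, N (z - \sum_(i < size (l1 ++ l2)) d i * (l1 ++ l2)`_i)].
  have iQ : is_ideal Q.
    split.
    - exists (fun=> 0); rewrite big1 ?subrr; first exact: ideal0.
      by move=> i _; rewrite mul0r.
    - move=> a b [d hd] [d' hd']; exists (fun i => d i + d' i).
      under eq_bigr => i _ do rewrite mulrDl.
      by rewrite big_split /= opprD addrACA; exact: (idealD iN).
    - move=> c a [d hd]; exists (fun i => c * d i).
      under eq_bigr => i _ do rewrite -mulrA.
      by rewrite -mulr_sumr -mulrBr; exact: (idealM c iN hd).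
  move=> z; rewrite hqs => hz; exact: (spans_min iQ sp2 hz).
move=> a ma.
pose Q := [set z | exists d : nat -> sec W, N (z - \sum_(i < size l1) d i * l1`_i)].
have iQ : is_ideal Q.
  split.
  - exists (fun=> 0); rewrite big1 ?subrr; first exact: ideal0.
    by move=> i _; rewrite mul0r.
  - move=> c b [d hd] [d' hd']; exists (fun i => d i + d' i).
    under eq_bigr => i _ do rewrite mulrDl.
    by rewrite big_split /= opprD addrACA; exact: (idealD iN).
  - move=> c b [d hd]; exists (fun i => c * d i).
    under eq_bigr => i _ do rewrite -mulrA.
    by rewrite -mulr_sumr -mulrBr; exact: (idealM c iN hd).
have NQ : N `<=` Q.
  by move=> z Nz; exists (fun=> 0); rewrite big1 ?subr0 // => i _; rewrite mul0r.
suff [d hd] : Q (dl a).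
  exists d; under eq_bigr => i _ do rewrite nthE //; exact: hd.
have [I aI] := aU.
have dlJ g : comap v oU g = 0 -> Q (dl g).
  move=> g0; have : spans hs g by rewrite -hhs.
  have iG : is_ideal [set g | m g /\ Q (dl g)].
    split.
    - by split; [exact: ideal0|rewrite /dl !rmorph0 subrr; exact: ideal0].
    - move=> b c [mb Qb] [mc Qc]; split; first exact: (idealD im).
      by rewrite /dl !rmorphD opprD addrACA; exact: (idealD iQ).
    - move=> c b [mb Qb]; split; first exact: (idealM c im mb).
      (* [dl] is a twisted derivation; [b] vanishes at [x], so the second term lies in [N]. *)
      have -> : dl (c * b) = tg c * dl b + sg b * dl c by rewrite /dl !rmorphM; ring.
      apply: (idealD iQ); first exact: (idealM _ iQ Qb).
      apply: NQ; apply: mulidI; [exact: (csrc_van ch mb)|exact: dlq].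
  move=> /(spans_min iG) -[] // b bh; split; last exact: sp1 (map_f _ bh).
  have b0 : comap v oU b = 0 by have : spans hs b by [exact: mem_spans]; rewrite -hhs.
  apply/trans_van; rewrite b0.
  by have [_ aVI _] := clv; have [] := affine_van aVI Vy => -[].
have [_ aN ap pw] := cp.
have iNh : is_ideal (@nonunits (sec [set: Xh])) := affine_ideal aN.
have nha : nonunits (pull h a).
  have : ideal_pow (@nonunits _) 1 (pull h a) by apply/pw; exact: sub_pow1.
  exact: pow1_sub.
(* [a] splits on the completion into parts in the ideals of V and of the leaf. The first is replaced
   by an equation [g] of V up to order 2, and [a - g] is handled by [leaf_tgt] and [chart_Mq]. *)
have [b [k [Jb Kk eb]]] := JK nha.
have [g g0 hg] := trans_approx 2 Jb.
have -> : a = g + (a - g) by ring.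
have -> : dl (g + (a - g)) = dl g + dl (a - g) by rewrite /dl !rmorphD; ring.
apply: (idealD iQ); first exact: dlJ.
apply: NQ; apply: (chart_Mq ch (dlq _)); rewrite /dl.
have iQ2 : is_ideal (ideal_add (ideal_span (sg @` m)) (ideal_pow M 2)).
  by apply: addid_ideal; [exact: span_ideal|exact: pow_ideal].
apply: (idealB iQ2).
  apply: (leaf_tgt infR cx ch rp cp Rhr leaf Kk).
  rewrite pullB // eb.
  by have -> : b + k - pull h g - k = b - pull h g by ring.
apply: addidl; first exact: pow_ideal.
apply: subspan; exists (a - g) => //; apply: (idealB im) => //.
apply/trans_van; rewrite g0.
by have [_ aVI _] := clv; have [] := affine_van aVI Vy => -[].
Qed.

End Transversal.

(** * Equations of the stabiliser among the arrows out of x *)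

Section Stabiliser.
Variables (G : formalScheme) (g : mor G R) (sG tG : mor G P).
Hypotheses (Gr : is_restriction s t kappa g sG tG) (smG : formally_smooth sG).
Variables (mm : nat) (f : nat -> sec U) (w : nat -> sec W).
Hypotheses (hf : forall i, (i < mm)%N -> m (f i) /\ w i = tg (f i) - sg (f i))
  (fspan : forall a, m a -> exists d : nat -> sec W, N (tg a - sg a - \sum_(i < mm) d i * w i)).

(** [Q] is the ideal of the conclusion, and [Q0] adds the pullbacks of [m] along [t], so that [Q0]
    cuts out arrows of the stabiliser. Smoothness of the stabiliser extends these over the subscheme
    cut out by [Q]; comparing the extension [r'] with the inclusion [tau] gives that [Q0] lies in
    [Q + M Q0]. *)
Lemma stab_ideal k a : m a -> ideal_add (ideal_add (ideal_span (sg @` m))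
   (ideal_span [set c | exists2 i, (i < mm)%N & c = w i])) (ideal_pow M k.+1) (tg a).
Proof.
have [IW aIW] := aW; have [I aI] := aU.
set Sg := ideal_span _; set Ph := ideal_span [set c | _].
set Q := ideal_add (ideal_add Sg Ph) _.
have iSP : is_ideal (ideal_add Sg Ph) by apply: addid_ideal; exact: span_ideal.
have iQ : is_ideal Q by apply: addid_ideal; [exact: iSP|exact: pow_ideal].
have MQ : ideal_pow M k.+1 `<=` Q by move=> c hc; apply: addidr.
have SQ c : Sg c -> Q c.
  by move=> hc; apply: addidl; [exact: pow_ideal|apply: addidl => //; exact: span_ideal].
have PQ i : (i < mm)%N -> Q (w i).
  move=> il; apply: addidl; [exact: pow_ideal|apply: addidr; first exact: span_ideal].
  by apply: subspan; exists i.
have wM i : (i < mm)%N -> M (w i).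
  by move=> il; rewrite (hf il).2; apply: (chart_qM ch); exact: delta_ker.
have QM : Q `<=` M.
  apply: addid_min => //; last exact: pow_subI.
  apply: addid_min => //; first by apply: span_min => // _ [b mb <-]; exact: (csrc_van ch mb).
  by apply: span_min => // _ [i il ->]; exact: wM.
pose Q0 := ideal_add Q (ideal_span (tg @` m)).
have iQ0 : is_ideal Q0 by apply: addid_ideal => //; exact: span_ideal.
have Q0M : Q0 `<=` M.
  apply: addid_min => //; apply: span_min => // _ [b mb <-]; exact: (ctgt_van ch mb).
have QQ0 : Q `<=` Q0 by move=> c Qc; apply: addidl => //; exact: span_ideal.
have [T [tau hT]] := inf_sub_ex aIW Wx (chart_max infR cx ch) iQ MQ QM.
have [T0 [tau0 hT0]] := inf_sub_ex aIW Wx (chart_max infR cx ch) iQ0 (fun c hc => QQ0 c (MQ c hc)) Q0M.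
have [aT tW ts tk _] := hT; have [aT0 tW0 ts0 tk0 _] := hT0.
have [i hi] : exists i, compm tau i = tau0.
  by apply: (inf_lift aIW hT tW0) => c /QQ0 /tk0.
have [ci ni] := inf_closed hT hT0 hi MQ Q0M.
have sU : lands (compm s tau) U by apply/(lands_chart infR).
have tU0 : lands (compm t tau0) U.
  by split=> // p _; apply: (tgt_chart infR); case: tW0 => _; apply.
have [z hz] : exists z, compm kappa z = compm s tau.
  apply: (kap_lift rp aI Wx (chart_maxU cx ch) sU) => b mb.
  rewrite -(pull_csrc infR oW) //; apply/tk; apply: SQ.
  by apply: subspan; exists b.
have [z0 hz0] : exists z0, compm kappa z0 = compm t tau0.
  apply: (kap_lift rp aI Wx (chart_maxU cx ch) tU0) => b mb.
  rewrite -(pull_ctgt infR oW) //; apply/tk0; apply: addidr => //.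
  by apply: subspan; exists b.
have [_ _ univ] := Gr.
have [|g0 [[g1 g2 g3] _]] := univ T0 tau0 (compm z i) z0 _ (esym hz0).
  by rewrite compmA hz -compmA hi.
have [c [c1 c2]] := smG aT ci ni g2.
pose r' := compm g c.
have [eG1 eG2 _] := Gr.
have sr' : compm s r' = compm kappa z by rewrite /r' compmA eG1 -compmA c2.
have tr' : compm t r' = compm kappa (compm tG c) by rewrite /r' compmA eG2 -compmA.
have rW : lands r' W by apply/(lands_chart infR oW); rewrite -/s sr' hz; apply/(lands_chart infR oW).
have kU := kap_lands rp aI Wx.
have kill (u : mor T P) b : m b -> pull (compm kappa u) b = 0.
  by move=> mb; rewrite pull_comp // (kap_ker rp aI Wx _).2 // rmorph0.
have ks b : m b -> pull r' (sg b) = 0 by move=> mb; rewrite (pull_csrc infR oW) // -/s sr' kill.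
have kt b : m b -> pull r' (tg b) = 0 by move=> mb; rewrite (pull_ctgt infR oW) // -/t tr' kill.
have lift u : exists2 u', pull tau u' = pull r' u & Q0 (u' - u).
  have [u' hu'] := ts (pull r' u); exists u' => //; apply/tk0.
  rewrite pullB // -hi [pull (compm tau i) u']pull_comp // hu' -pull_comp // /r' -compmA c1 g1 -hi.
  by rewrite subrr.
pose MQ0 := ideal_mul M Q0.
pose LL := ideal_add Q MQ0.
have iMQ : is_ideal MQ0 := mulid_ideal M Q0.
have iL : is_ideal LL := addid_ideal iQ iMQ.
have ML u u' : M u -> Q0 u' -> LL (u * u') by move=> Mu Qu; apply: addidr => //; exact: mulidI.
pose K := [set u | M u /\ exists2 u', pull tau u' = pull r' u & LL (u' - u)].
have iK : is_ideal K.
  split.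
  - split; [exact: (ideal0 iM)|exists 0; rewrite ?subrr; last exact: (ideal0 iL)].
    by rewrite (pullmE tW) (pullmE rW) !rmorph0.
  - move=> u u' [Mu [b eb Lb]] [Mu' [b' eb' Lb']]; split; first exact: (idealD iM Mu Mu').
    exists (b + b'); first by rewrite !pullD // eb eb'.
    have -> : b + b' - (u + u') = (b - u) + (b' - u') by ring.
    exact: (idealD iL Lb Lb').
  - move=> d u [Mu [b eb Lb]]; split; first exact: (idealM d iM Mu).
    have [d' ed hd] := lift d; exists (d' * b); first by rewrite !pullM // ed eb.
    have -> : d' * b - d * u = d' * (b - u) + u * (d' - d) by ring.
    by apply: (idealD iL); [exact: (idealM _ iL Lb)|exact: ML].
have NK : N `<=` K.
  apply: mulid_min => // u u' Mu qu'; have Mu' := chart_qM ch qu'.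
  split; first exact: (idealM u iM Mu').
  have [b eb hb] := lift u; have [b' eb' hb'] := lift u'.
  exists (b * b'); first by rewrite !pullM // eb eb'.
  have -> : b * b' - u * u' = b * (b' - u') + u' * (b - u) by ring.
  apply: (idealD iL); apply: ML => //; rewrite -[b](subrK u).
  by apply: (idealD iM _ Mu); exact: Q0M.
(* [eta] lies in [N], where [r'] and [tau] agree modulo [M Q0], and [r'] kills it because both ends
   of [r'] are at [x]. *)
have key b : m b -> LL (tg b).
  move=> mb; have [d hd] := fspan mb; have [_ [u' eu hu]] := NK _ hd.
  set eta := tg b - sg b - _ in hd eu hu.
  have eta0 : pull r' eta = 0.
    rewrite /eta !pullB // ks // kt // subrr sub0r (pullmE rW) rmorph_sum big1 ?oppr0 // => l _.
    rewrite rmorphM -!(pullmE rW); have [mf ->] := hf (ltn_ord l).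
    by rewrite pullB // ks // kt // subrr mulr0.
  have Qu' : Q u' by apply/tk; rewrite eu.
  have -> : tg b = (u' - (u' - eta)) + (sg b + \sum_(l < mm) d l * w l) by rewrite /eta; ring.
  apply: (idealD iL); first by apply: (idealB iL) => //; exact: addidl.
  apply: addidl => //; apply: (idealD iQ); first by apply: SQ; apply: subspan; exists b.
  by apply: (@ideal_sum _ Q _ _ _ _ iQ) => l _; apply: (@idealM _ Q _ _ iQ); exact: PQ.
have Q0L : Q0 `<=` LL.
  apply: addid_min => //; first by move=> u Qu; apply: addidl.
  by apply: span_min => // _ [b mb <-]; exact: key.
have [c' hc' kc'] := nakayama iM iQ (nW iQ0) Q0L.
move=> ma; have Q0a : Q0 (tg a) by apply: addidr => //; apply: subspan; exists a.
(* The factor [c'] from Nakayama is congruent to 1 modulo [M], hence invertible modulo [M^(k+1)], a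
   part of [Q]. *)
have := geom_inv c' 1 k.+1; rewrite mulr1 mul1r; set Ssum := \sum_(_ < _) _ => eg.
have -> : tg a = Ssum * (c' * tg a) + tg a * (1 - c') ^+ k.+1.
  have -> : (1 - c') ^+ k.+1 = - (c' * Ssum - 1) by rewrite eg opprK.
  ring.
apply: (idealD iQ); first by apply: (@idealM _ Q _ _ iQ); exact: kc'.
by apply: (@idealM _ Q _ _ iQ); apply: MQ; exact: powX.
Qed.

(** For every k, [stab_ideal] shows that the pullback of [tg a] along [r] is that of an element of
    [M^(k+1)]; these pullbacks tend to 0, so the constant value is 0. *)
Lemma stab_point (T : formalScheme) (r : mor T R) (z : mor T P) : compm s r = compm kappa z ->
  (forall i, (i < mm)%N -> pull r (w i) = 0) -> exists z', compm t r = compm kappa z'.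
Proof.
move=> sr rw; have [IW aIW] := aW; have [I aI] := aU.
have kU := kap_lands rp aI Wx.
have rW : lands r W by apply/(lands_chart infR oW); rewrite -/s sr; exact: lands_comp.
have tU : lands (compm t r) U.
  by split=> // p _; apply: (tgt_chart infR); case: rW => _; apply.
have rp' p : r p = e x.
  rewrite -(groupoid_top infR (r p)).1; congr (e _).
  have := congr1 (fun h : mor T X => h p) sr => /= ->; by have [_ -> _] := rp.
suff [z' hz'] : exists z', compm kappa z' = compm t r by exists z'.
apply: (kap_lift rp aI Wx (chart_maxU cx ch) tU) => a ma.
rewrite -(pull_ctgt infR oW) //; apply: (tz_cst openT).
have /choice [c hc] : forall k, exists c, ideal_pow M k.+1 c /\ pull r c = pull r (tg a).
  move=> k; have [a1 [c [h1 hc ->]]] := stab_ideal k ma; exists c; split=> //.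
  rewrite pullD //; suff -> : pull r a1 = 0 by rewrite add0r.
  have iB : is_ideal (pullm rW @^-1` [set 0]) := preim_ideal _ (set0_ideal _).
  suff : (pullm rW @^-1` [set 0]) a1 by rewrite /preimage /= (pullmE rW).
  apply: (addid_min iB _ _ h1); apply: span_min => //.
    move=> _ [b mb <-]; rewrite /preimage /mkset -(pullmE rW) (pull_csrc infR oW) // -/s sr pull_comp //.
    by rewrite (kap_ker rp aI Wx _).2 // rmorph0.
  by move=> _ [i il ->]; rewrite /preimage /mkset -(pullmE rW) rw.
have nM b : M b -> nil (pullm rW b).
  by move=> Mb p; rewrite -pullmE => /(pull_unit b p rW); rewrite rp'.
have := nil_tz_ideal (nW iM) nM (u := c).
have hk : forall n, exists K, forall k, (K <= k)%N -> ideal_pow M n (c k).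
  by move=> n; exists n => k nk; apply: (@pow_le _ M n k.+1 _ _ (hc k).1); lia.
move=> /(_ hk); apply: eq_tz => k; by rewrite -(pullmE rW) (hc k).2.
Qed.

End Stabiliser.
End Choice.

(** * Composition, inverses and smoothness of the target map *)

Section GroupoidLaws.
Variables (S X : formalScheme) (pX : mor X S) (R : groupoid pX).

Lemma comp_pair (T : formalScheme) (a b : mor T R) : compm (src R) a = compm (tgt R) b ->
  exists ab : mor T (arr2 R), compm (fst_arr R) ab = a /\ compm (snd_arr R) ab = b.
Proof. by move=> h; have [_ /(_ T a b h) [m [hm _]]] := arr2_pullback R; exists m. Qed.

Lemma arrow_comp (T : formalScheme) (a b : mor T R) : compm (src R) a = compm (tgt R) b ->
  exists c : mor T R, compm (src R) c = compm (src R) b /\ compm (tgt R) c = compm (tgt R) a.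
Proof.
move=> /comp_pair [ab [h1 h2]]; exists (compm (comp_arr R) ab).
by rewrite !compmA src_comp tgt_comp -!compmA h1 h2.
Qed.

(** Associativity for the composable triple consisting of the double inverse of r, the inverse of r,
    and r. *)
Lemma inv_invm : compm (inv_arr R) (inv_arr R) = idm R.
Proof.
set i := inv_arr R; have [|m1 [f1 s1]] := @comp_pair R i (idm R); first by rewrite src_inv compm1.
have [|m2 [f2 s2]] := @comp_pair R (idm R) (compm (unit_arr R) (src R)).
  by rewrite compmA tgt_unit compm1 comp1m.
have [|m3 [f3 s3]] := @comp_pair R (compm (unit_arr R) (tgt R)) (idm R).
  by rewrite compmA src_unit compm1 comp1m.
have sii : compm (src R) (compm i i) = src R by rewrite compmA src_inv tgt_inv.
have := @comp_assoc _ _ _ R R (compm m1 i) m1 m3 (compm m2 (compm i i)).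
rewrite !compmA f1 s1 f2 s2 f3 s3 comp1m (comp_invl f1 s1) (comp_unitr f2 s2) (comp_unitl f3 s3) !comp1m.
move=> ->//.
- by rewrite -compmA src_inv.
- by rewrite -!compmA (compmA (src R)) src_inv tgt_inv.
Qed.

Lemma tgt_smooth : formally_smooth (src R) -> formally_smooth (tgt R).
Proof.
move=> sm T0 T i a b aT ci ni hab.
have [|c [c1 c2]] := sm T0 T i (compm (inv_arr R) a) b aT ci ni; first by rewrite compmA src_inv.
exists (compm (inv_arr R) c); rewrite compmA tgt_inv -compmA c1 compmA inv_invm comp1m; split=> //.
Qed.

End GroupoidLaws.

(** * Slice coordinates and their restriction to smaller opens *)

Section Slice.
Variables (S X : formalScheme) (pX : mor X S) (R : groupoid pX) (x : X).
Local Notation s := (src R).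
Local Notation t := (tgt R).
Local Notation e := (unit_arr R).
Hypotheses (infR : infinitesimal R) (cx : closed [set x]).
Variables (P V Vh Xh : formalScheme) (kappa : mor P X) (v : mor V X) (y : V) (h : mor Xh X) (hv : mor Vh V).
Hypotheses (vy : v y = x) (kx : forall p, kappa p = x).

Record geom (W : set R) (oW : open W) (IV : set (sec (e @^-1` W))) : Prop := Geom {
  gm_chart : chart e x oW;
  gm_v : closed_immersion_over v (mor_open e oW) IV;
  gm_h : compl h (e @^-1` W) x;
  gm_hv : compl hv (v @^-1` (e @^-1` W)) y }.

(* The w_i are coordinates on the arrows with given source, and on those with given target. *)
Record slice (W : set R) (oW : open W) (m n : nat) (f : nat -> sec (e @^-1` W)) (w : nat -> sec W) :
  Prop := Slice {
  sl_mn : (m <= n)%N;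
  sl_f : forall i, (i < m)%N -> vanishing x (f i) /\ comap v (mor_open e oW) (f i) = 0;
  sl_delta : forall (T : formalScheme) (r : mor T R) i, lands (compm s r) (e @^-1` W) -> (i < m)%N ->
    pull r (w i) = pull (compm t r) (f i) - pull (compm s r) (f i);
  sl_stab : forall (T : formalScheme) (r : mor T R) (z : mor T P), compm s r = compm kappa z ->
    (forall i, (i < m)%N -> pull r (w i) = 0) -> exists z', compm t r = compm kappa z';
  sl_unit : forall (T : formalScheme) (b : mor T X) i, lands b (e @^-1` W) -> (i < n)%N ->
    pull (compm e b) (w i) = 0;
  sl_sex : forall (T : formalScheme) (b : mor T X) (g : nat -> sec [set: T]), lands b (e @^-1` W) ->
    (forall i, (i < n)%N -> nil (g i)) ->
    exists r, compm s r = b /\ forall i, (i < n)%N -> pull r (w i) = g i;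
  sl_suniq : forall (T : formalScheme) (r r' : mor T R), lands (compm s r) (e @^-1` W) ->
    compm s r = compm s r' -> (forall i, (i < n)%N -> pull r (w i) = pull r' (w i)) -> r = r';
  sl_tex : forall (T : formalScheme) (b : mor T X) (g : nat -> sec [set: T]), lands b (e @^-1` W) ->
    (forall i, (i < n)%N -> nil (g i)) ->
    exists r, compm t r = b /\ forall i, (i < n)%N -> pull r (w i) = g i;
  sl_tuniq : forall (T : formalScheme) (r r' : mor T R), lands (compm t r) (e @^-1` W) ->
    compm t r = compm t r' -> (forall i, (i < n)%N -> pull r (w i) = pull r' (w i)) -> r = r' }.

Section Shrink.
Variables (W : set R) (oW : open W) (c : sec W).
Hypothesis uc : unit_at c (e x).
Let W' := basic_open c.
Let oW' : open W' := basic_open_open c.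
Let W'W : W' `<=` W := @basic_open_sub _ _ c.
Let U'U : e @^-1` W' `<=` e @^-1` W. Proof. by move=> p /W'W. Qed.

Lemma geom_shrink IV : @geom W oW IV -> exists IV', @geom W' oW' IV'.
Proof.
move=> [ch clv cph cpv]; have e1 := chart_pre e oW c.
have [[IW [_ aIU _]] _ Wx] := ch; have [_ aIV _] := clv.
have cl' := closed_shrink (@fs_local V) (@fs_local X) (mor_open e oW') U'U e1 clv.
have Vy : (v @^-1` (e @^-1` W)) y by rewrite /preimage /= vy.
eexists; split; [exact: (chart_shrink ch uc)|exact: cl'| |].
  by rewrite e1; apply: (compl_shrink aIU Wx cph); apply/(comap_unit e oW c Wx).
have -> : v @^-1` (e @^-1` W') = basic_open (comap v (mor_open e oW) (comap e oW c)).
  rewrite e1; apply/seteqP; split=> p; rewrite /preimage /basic_open /= => up.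
    by apply/(comap_unit v (mor_open e oW) _ (basic_open_sub up)).
  exact/(comap_unit v (mor_open e oW) _ (unit_at_in up)).
apply: (compl_shrink aIV Vy cpv); apply/(comap_unit v (mor_open e oW) _ Vy); rewrite vy.
exact/(comap_unit e oW c Wx).
Qed.

Let oU := mor_open e oW.
Let oU' := mor_open e oW'.
Let landsU (T : formalScheme) (b : mor T X) : lands b (e @^-1` W') -> lands b (e @^-1` W).
Proof. by move=> h1; apply: lands_sub h1 U'U oU. Qed.

Lemma slice_shrink m n f w : chart e x oW -> @slice W oW m n f w ->
  @slice W' oW' m n (fun i => res oU oU' U'U (f i)) (fun i => res oW oW' W'W (w i)).
Proof.
move=> ch [mn hf hd hs hu se su te tu]; have Wx' : (e @^-1` W') x by exact: uc.
have rW (T : formalScheme) (r : mor T R) : lands (compm s r) (e @^-1` W') -> lands r W'.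
  by move=> /(lands_chart infR oW').
have tW (T : formalScheme) (r : mor T R) : lands (compm t r) (e @^-1` W') -> lands (compm s r) (e @^-1` W').
  by move=> [oo hh]; split=> // p /hh; rewrite /preimage /= (groupoid_top infR (r p)).2.
have tW2 (T : formalScheme) (r : mor T R) : lands (compm s r) (e @^-1` W') -> lands (compm t r) (e @^-1` W').
  by move=> [oo hh]; split=> // p /hh; rewrite /preimage /= (groupoid_top infR (r p)).2.
split=> //.
- move=> i im; have [h1 h2] := hf i im; split; first exact/vanishing_res.
  have vv : v @^-1` (e @^-1` W') `<=` v @^-1` (e @^-1` W) by move=> p /U'U.
  by rewrite (comap_res v oU oU' U'U vv) h2 rmorph0.
- move=> T r i rU im; rewrite !pull_res ?hd //; [exact: landsU|exact: tW2|exact: rW].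
- move=> T r z sr hr; have kU' : lands (compm s r) (e @^-1` W').
    by rewrite sr; split=> // p _; rewrite /preimage /= kx.
  apply: (hs T r z sr) => i im; have := hr i im; rewrite pull_res //; exact: rW.
- move=> T b i bU ni; rewrite pull_res ?hu //; first exact: landsU.
  by apply/lands_compl.
- move=> T b g bU ng; have [r [sr hr]] := se T b g (landsU bU) ng; exists r; split=> // i ni.
  by rewrite pull_res ?hr //; apply: rW; rewrite sr.
- move=> T r r' rU srr hh; apply: su => //; first exact: landsU.
  by move=> i ni; have := hh i ni; rewrite !pull_res //; [apply: rW; rewrite -srr|apply: rW].
- move=> T b g bU ng; have [r [sr hr]] := te T b g (landsU bU) ng; exists r; split=> // i ni.
  by rewrite pull_res ?hr //; apply: rW; apply: tW; rewrite sr.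
- move=> T r r' rU srr hh; apply: tu => //; first exact: landsU.
  move=> i ni; have := hh i ni.
  by rewrite !pull_res //; [apply: rW; apply: tW; rewrite -srr|apply: rW; exact: tW].
Qed.

End Shrink.
End Slice.

Lemma comb_ideal (A : comPzRingType) n (w : nat -> A) :
  is_ideal [set z | exists d : nat -> A, z = \sum_(i < n) d i * w i].
Proof.
split.
- by exists (fun=> 0); rewrite big1 // => i _; rewrite mul0r.
- move=> _ _ [d ->] [d' ->]; exists (fun i => d i + d' i).
  by rewrite -big_split; apply: eq_bigr => i _; rewrite mulrDl.
- move=> c _ [d ->]; exists (fun i => c * d i).
  by rewrite mulr_sumr; apply: eq_bigr => i _; rewrite mulrA.
Qed.

Lemma mem_comb (A : comPzRingType) n (w : nat -> A) i : (i < n)%N ->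
  exists d : nat -> A, w i = \sum_(i < n) d i * w i.
Proof.
move=> ni; exists (fun k => if k == i then 1 else 0).
rewrite (bigD1 (Ordinal ni)) //= eqxx mul1r big1 ?addr0 // => k.
by rewrite -val_eqE /= => /negPf ->; rewrite mul0r.
Qed.

Lemma inf_sub_pt (T Y : formalScheme) (tau : mor T Y) (W : set Y) (Q : set (sec W)) (y : Y) :
  inf_sub tau Q y -> ~ Q 1 -> exists p : T, True.
Proof.
move=> [_ tW _ tk _] Q1; apply: contrapT => np; apply: Q1; apply/tk; rewrite (pullmE tW) rmorph1.
by apply: sec_empty; [exact: openT|move=> p; case: np; exists p].
Qed.

(** * Existence of slice coordinates *)

Section SliceEx.
Variables (S X : formalScheme) (pX : mor X S) (R : groupoid pX) (x : X).
Local Notation s := (src R).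
Local Notation t := (tgt R).
Local Notation e := (unit_arr R).
Hypotheses (infR : infinitesimal R) (smR : formally_smooth s) (cx : closed [set x]).
Variables (P G Xh Rh L V Vh : formalScheme) (kappa : mor P X) (g : mor G R) (sG tG : mor G P)
  (h : mor Xh X) (r0 : mor Rh R) (sh th : mor Rh Xh) (lh : mor L Xh)
  (v : mor V X) (y : V) (hv : mor Vh V) (j : mor Vh Xh).
Hypotheses (rp : residue_point x kappa) (Gr : is_restriction s t kappa g sG tG)
  (smG : formally_smooth sG) (Rhr : is_restriction s t h r0 sh th) (leaf : is_leaf sh th lh)
  (vy : v y = x) (hj : compm h j = compm v hv)
  (JK : forall b, nonunits b -> ideal_add (global_kernel j) (global_kernel lh) b).

Lemma slice_ex (W : set R) (oW : open W) IV : @geom _ _ _ R x V Vh Xh v y h hv W oW IV ->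
  exists (W2 : set R) (oW2 : open W2) IV2 m n f w,
   @geom _ _ _ R x V Vh Xh v y h hv W2 oW2 IV2 /\
   @slice _ _ _ R x P V kappa v W2 oW2 m n f w.
Proof.
move=> gm; have [ch clv cph cpv] := gm.
have [m [n [f [w [mn hf [hq ind] gen fsp]]]]] := choice_ex infR cx ch rp cph Rhr leaf vy hj clv cpv JK.
have [[IW cl] nW Wx] := ch; have [aIW _ _] := cl.
set M := vanishing (U := W) (e x); set q := [set c | comap e oW c = 0]; set N := ideal_mul M q.
have [iM M1 _] := chart_primeM ch.
have iq : is_ideal q := chart_kerI oW.
have iN : is_ideal N := mulid_ideal M q.
have Nq : N `<=` q by apply: mulid_min => // a b _ qb; exact: (idealM a iq qb).
pose K0 := [set z | exists d : nat -> sec W, z = \sum_(i < n) d i * w i].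
have iK0 : is_ideal K0 := comb_ideal n w.
(* The [w i] generate [q] modulo [M q]; by Nakayama they generate it once [a], a unit at e(x), is
   inverted. *)
have [a Ma aq] : exists2 a, M (1 - a) & forall z, q z -> K0 (a * z).
  apply: (nakayama iM iK0 (nW _ iq)) => z qz; have [d hd] := gen z qz.
  by exists (\sum_(i < n) d i * w i), (z - \sum_(i < n) d i * w i); split=> //; [exists d|ring].
have ua : unit_at a (e x).
  by apply: contrapT => na; apply: M1; rewrite -[1](subrK a); exact: (idealD iM Ma).
have [IV1 gm1] := geom_shrink vy ua gm.
have oW1 := basic_open_open a; have W1W := @basic_open_sub _ _ a.
have [ch1 _ _ _] := gm1; have [[I1 cl1] nW1 W1x] := ch1.
pose w1 i := res oW (basic_open_open a) (@basic_open_sub _ _ a) (w i).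
have UU : e @^-1` basic_open a `<=` e @^-1` W by move=> p /W1W.
have ew1 i : (i < n)%N -> comap e (basic_open_open a) (w1 i) = 0.
  move=> ni; rewrite /w1 (comap_res e oW (basic_open_open a) (@basic_open_sub _ _ a) UU).
  by rewrite (hq i ni) rmorph0.
have gen1 c : comap e (basic_open_open a) c = 0 -> exists d : nat -> sec (basic_open a), c = \sum_(i < n) d i * w1 i.
  move=> c0; have hc := closed_kernel_shrink (@fs_local R) (@basic_open_sub _ _ a) erefl cl nW1 iq (fun _ h => h) c0.
  have iK1 := comb_ideal n w1; apply: (span_min iK1 _ hc) => _ [z /aq [d hd] <-].
  apply: (unit_ideal (a := res oW (basic_open_open a) (@basic_open_sub _ _ a) a) iK1); first exact: res_unit.
  exists (fun i => res oW (basic_open_open a) (@basic_open_sub _ _ a) (d i)).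
  by rewrite -rmorphM hd rmorph_sum; apply: eq_bigr => i _; rewrite rmorphM.
(* A relation over the smaller open is known over [W] only on the infinitesimal neighbourhood [T];
   the error in a power of [M] lies also in [q], so Artin-Rees puts it into [N], where [ind]
   applies. *)
have ind1 (c : nat -> sec (basic_open a)) : \sum_(i < n) c i * w1 i = 0 ->
     forall i, (i < n)%N -> vanishing (e x) (c i).
  move=> c0; have [k ar] := artin_rees nW iM iq.
  have {}ar : ideal_pow M k.+1 `&` q `<=` N by move=> z [/pow_sub h1 h2]; exact: ar.
  pose Q := ideal_add N (ideal_pow M k.+1).
  have iQ : is_ideal Q by apply: addid_ideal => //; exact: pow_ideal.
  have MQ : ideal_pow M k.+1 `<=` Q by move=> z hz; exact: addidr.
  have QM : Q `<=` M.
    by apply: addid_min => //; [move=> z /Nq /(chart_qM ch)|exact: pow_subI].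
  have [T [tau hT]] := inf_sub_ex aIW Wx (chart_max infR cx ch) iQ MQ QM.
  have [p _] : exists p : T, True by apply: (inf_sub_pt hT) => /QM.
  have [aT tW ts tk tp] := hT.
  have tW1 : lands tau (basic_open a) by split=> // p' _; rewrite /preimage /= tp.
  have /choice [c' hc'] : forall i, exists c' : sec W, pull tau c' = pull tau (c i) by move=> i; exact: ts.
  have NS : N (\sum_(i < n) c' i * w i).
    have QS : Q (\sum_(i < n) c' i * w i).
      have e1 : pullm tW1 (\sum_(i < n) c i * w1 i) = 0 by rewrite c0 rmorph0.
      apply/tk; rewrite (pullmE tW) -[RHS]e1 !rmorph_sum; apply: eq_bigr => i _.
      by rewrite !rmorphM -!(pullmE tW) -!(pullmE tW1) hc' /w1 pull_res.
    have qS : q (\sum_(i < n) c' i * w i).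
      by apply: (@ideal_sum _ q _ _ _ _ iq) => i _; apply: (@idealM _ q _ _ iq); exact: hq.
    have [eta [mu [Ne Mm e1]]] := QS; rewrite e1; apply: (idealD iN Ne); apply: ar; split=> //.
    have -> : mu = (\sum_(i < n) c' i * w i) - eta by rewrite e1; ring.
    by apply: (idealB iq qS); exact: Nq.
  move=> i ni ui; apply: (ind _ NS i ni); rewrite -(tp p).
  by apply/(pull_unit (c' i) p tW); rewrite hc'; apply/(pull_unit (c i) p tW1); rewrite tp.
have hom : homeomorphism e by case: infR.
have mx1 := chart_max infR cx ch1.
(* [e] is a section of [s] and of [t], both of them smooth, so the same [w] are coordinates for
   either map, possibly after shrinking. *)
have [as_ us hs] := structure_ex (src_unit R) hom smR cl1 nW1 W1x mx1 ew1 gen1 ind1.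
have [at_ ut ht] := structure_ex (tgt_unit R) hom (tgt_smooth smR) cl1 nW1 W1x mx1 ew1 gen1 ind1.
have su := @structure_uniq X R s e (basic_open a) (basic_open_open a) _ (src_unit R) hom cl1 n w1 ew1 gen1.
have tu := @structure_uniq X R t e (basic_open a) (basic_open_open a) _ (tgt_unit R) hom cl1 n w1 ew1 gen1.
have [c hc] := chart_surj ch1 (as_ * at_).
have uc : unit_at c (e x).
  by apply/(comap_unit e (basic_open_open a) c W1x); rewrite hc unit_atM.
have [IV2 gm2] := geom_shrink vy uc gm1.
have [ch2 _ _ _] := gm2; have [_ _ W2x] := ch2.
have e2 : e @^-1` basic_open c = basic_open (as_ * at_) by rewrite (chart_pre e (basic_open_open a)) hc.
have oW2 := basic_open_open c; have W21 := @basic_open_sub _ _ c.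
have W2W : basic_open c `<=` W by move=> p /W21 /W1W.
have U21 : e @^-1` basic_open c `<=` e @^-1` basic_open a by move=> p /W21.
have U2W : e @^-1` basic_open c `<=` e @^-1` W by move=> p /W2W.
have lW2 (T : formalScheme) (r : mor T R) : lands (compm s r) (e @^-1` basic_open c) -> lands r (basic_open c).
  by move=> /(lands_chart infR (basic_open_open c)).
have lt (T : formalScheme) (r : mor T R) : lands (compm t r) (e @^-1` basic_open c) <-> lands (compm s r) (e @^-1` basic_open c).
  by split=> -[oo hh]; split=> // p /hh; rewrite /preimage /= (groupoid_top infR (r p)).2.
have lU1 (T : formalScheme) (b : mor T X) : lands b (e @^-1` basic_open c) -> lands b (e @^-1` basic_open a).
  by move=> hb; apply: lands_sub hb U21 (mor_open e (basic_open_open a)).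
have lU (T : formalScheme) (b : mor T X) : lands b (e @^-1` basic_open c) -> lands b (e @^-1` W).
  by move=> hb; apply: lands_sub hb U2W (mor_open e oW).
have lW (T : formalScheme) (r : mor T R) : lands r (basic_open c) -> lands r W.
  by move=> hb; apply: lands_sub hb W2W oW.
have lW1 (T : formalScheme) (r : mor T R) : lands r (basic_open c) -> lands r (basic_open a).
  by move=> hb; apply: lands_sub hb W21 oW1.
exists (basic_open c), (basic_open_open c), IV2, m, n,
  (fun i => res (mor_open e oW) (mor_open e (basic_open_open c)) U2W (f i)),
  (fun i => res oW (basic_open_open c) W2W (w i)); split=> //.
have pw (T : formalScheme) (r : mor T R) i : lands r (basic_open c) ->
   pull r (res oW (basic_open_open c) W2W (w i)) = pull r (w1 i).
  by move=> rl; rewrite /w1 !pull_res //; exact: lW1.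
split=> //.
- move=> i im; have [h1 h2 _] := hf i im; split; first exact/vanishing_res.
  have vv : v @^-1` (e @^-1` basic_open c) `<=` v @^-1` (e @^-1` W) by move=> p /U2W.
  by rewrite (comap_res v (mor_open e oW) (mor_open e (basic_open_open c)) U2W vv) h2 rmorph0.
- move=> T r i rU im; have rl := lW2 _ _ rU; rewrite !pull_res //; last exact/lt.
  have [_ _ ->] := hf i im; rewrite pullB; last exact: lW.
  by rewrite (pull_ctgt infR oW) ?(pull_csrc infR oW) //; exact: lW.
- move=> T r z sr hr.
  have hf' i : (i < m)%N -> vanishing x (f i) /\ w i = ctgt infR oW (f i) - csrc infR oW (f i).
    by move=> im; have [] := hf i im.
  have h0 := @stab_point _ _ _ _ _ infR cx _ _ ch _ _ rp _ _ _ _ Gr smG m f w hf' fsp T r z sr.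
  apply: h0.
  move=> i im; have := hr i im; rewrite pull_res //; apply: lW2; rewrite sr.
  by split=> // [|p _]; [exact: mor_open|rewrite /preimage /=; have [_ -> _] := rp].
- move=> T b i bU ni; rewrite pull_res; last by apply/lands_compl.
  rewrite (pull_comap oW); last by apply: lW; apply/lands_compl.
  by rewrite (hq i ni) (pullmE (lU _ _ bU)) rmorph0.
- move=> T b g0 bU ng; have [|r [sr hr]] := hs T b g0 _ ng.
    by apply: (lands_sub bU) => [p|]; [rewrite e2 => /unit_atM []|exact: basic_open_open].
  exists r; split=> // i ni; rewrite pw ?hr //; apply: lW2; by rewrite sr.
- move=> T r r' rU srr hh; apply: su => //; first exact: lU1.
  move=> i ni; have := hh i ni; rewrite !pw //; [apply: lW2; by rewrite -srr|exact: lW2].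
- move=> T b g0 bU ng; have [|r [sr hr]] := ht T b g0 _ ng.
    by apply: (lands_sub bU) => [p|]; [rewrite e2 => /unit_atM []|exact: basic_open_open].
  exists r; split=> // i ni; rewrite pw ?hr //; apply: lW2; apply/lt; by rewrite sr.
- move=> T r r' rU srr hh; apply: tu => //; first exact: lU1.
  move=> i ni; have := hh i ni; rewrite !pw //; [apply: lW2; apply/lt; by rewrite -srr|apply: lW2; exact/lt].
Qed.

End SliceEx.

(** * The leaf as the orbit of x; equations of the transversal *)

Section LeafSlice.
Variables (S X : formalScheme) (pX : mor X S) (R : groupoid pX) (x : X).
Local Notation s := (src R).
Local Notation t := (tgt R).
Local Notation e := (unit_arr R).
Local Notation i_ := (inv_arr R).
Hypotheses (infR : infinitesimal R) (cx : closed [set x]).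
Variables (P Xh Rh L V Vh : formalScheme) (kappa : mor P X)
  (h : mor Xh X) (r0 : mor Rh R) (sh th : mor Rh Xh) (lh : mor L Xh)
  (v : mor V X) (y : V) (hv : mor Vh V) (j : mor Vh Xh).
Hypotheses (rp : residue_point x kappa) (Rhr : is_restriction s t h r0 sh th)
  (leaf : is_leaf sh th lh) (vy : v y = x) (hj : compm h j = compm v hv)
  (JK : global_kernel j `&` global_kernel lh `<=` ideal_mul (global_kernel j) (global_kernel lh)).
Variables (W : set R) (oW : open W) (IV : set (sec (e @^-1` W))) (m n : nat)
  (f : nat -> sec (e @^-1` W)) (w : nat -> sec W).
Hypotheses (gm : @geom _ _ _ R x V Vh Xh v y h hv W oW IV)
  (sl : @slice _ _ _ R x P V kappa v W oW m n f w).
Let U := e @^-1` W.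
Let ch : chart e x oW. Proof. by case: gm. Qed.
Let cp : compl h U x. Proof. by case: gm. Qed.
Let Wx : U x. Proof. by case: ch. Qed.
Let aU : exists I : set (sec U), affine I. Proof. by case: ch => -[I [_ aI _]] _ _; eexists; exact: aI. Qed.
Let oU : open U := mor_open e oW.
Let kx p : kappa p = x. Proof. by case: rp. Qed.
Let aP : affine [set 0 : sec [set: P]]. Proof. by case: rp => -[]. Qed.
Let gP : gaff P. Proof. by exists [set 0]. Qed.
Let xU (T : formalScheme) (b : mor T X) : (forall p, b p = x) -> lands b U.
Proof. by move=> hb; split=> // p _; rewrite /preimage /= hb. Qed.
Let mu := @chart_maxU _ _ _ R x cx W oW ch.
Let fgm : fg_ideal (vanishing (U := U) x).
Proof. by apply: (chart_noeth ch); case: (chart_primem ch). Qed.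

Lemma kap_kill (T : formalScheme) (z : mor T P) a : vanishing (U := U) x a -> pull (compm kappa z) a = 0.
Proof.
have [I aI] := aU; move=> va; rewrite pull_comp; last exact: xU.
by rewrite (kap_ker rp aI Wx _).2 // rmorph0.
Qed.

Let Lp := ptow P m.
(** Arrows ending at [x] with coordinates (-T, 0). The sign makes [f i] equal to T_i at the source:
    [w i] is the value of [f i] at the target minus that at the source, and [f i] vanishes at
    [x]. *)
Let orb_ex : exists r : mor Lp R, compm t r = compm kappa (tproj P m) /\
  forall i, (i < n)%N -> pull r (w i) = if (i < m)%N then - tX P m i else 0.
Proof.
apply: (sl_tex sl); first by apply: xU => p; exact: kx.
move=> i ni; case: ifP => im p; last by have [] := @fs_local Lp setT p openT Logic.I.
move=> u; have [ip _ _] := vanishing_prime (@fs_local Lp) openT (Logic.I : setT p).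
by have := idealN ip (@tX_nil P m i p); rewrite /vanishing /=; apply.
Qed.
Definition orb := sval (cid orb_ex).
Definition zeta : mor Lp X := compm s orb.

Lemma orb_tgt : compm t orb = compm kappa (tproj P m).
Proof. by have [] := svalP (cid orb_ex). Qed.
Let orb_w i : (i < n)%N -> pull orb (w i) = if (i < m)%N then - tX P m i else 0.
Proof. by have [_] := svalP (cid orb_ex); apply. Qed.

Let top_t (T : formalScheme) (r : mor T R) p : compm t r p = compm s r p.
Proof. by have [_] := groupoid_top infR (r p). Qed.

Lemma zeta_pt p : zeta p = x.
Proof. by rewrite /zeta -top_t orb_tgt /= kx. Qed.

Let mn i : (i < m)%N -> (i < n)%N. Proof. by move=> im; exact: leq_trans im (sl_mn sl). Qed.
Let fv i : (i < m)%N -> vanishing x (f i). Proof. by move=> /(sl_f sl) []. Qed.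
Let lW (T : formalScheme) (r : mor T R) : (forall p, compm s r p = x) -> lands r W.
Proof. by move=> hr; apply/(lands_chart infR oW); exact: xU. Qed.
Let lorb : lands orb W. Proof. by apply: lW; exact: zeta_pt. Qed.

Lemma zeta_f i : (i < m)%N -> pull zeta (f i) = tX P m i.
Proof.
move=> im; have e1 := sl_delta sl (r := orb) (xU zeta_pt) im.
have e2 := orb_w (mn im); rewrite im in e2.
have e3 := kap_kill (tproj P m) (fv im).
move: e1; rewrite e2 orb_tgt e3 sub0r => /eqP; rewrite eqr_opp => /eqP ->; exact: erefl.
Qed.

(** Let [r1] be the arrow out of the source a of [r] with coordinates (-f(a), 0). Then [r1] after
    the inverse of [r] starts at [x] with w_1 = ... = w_m = 0, so it ends at [x] by [sl_stab]. Hence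
    [r1] ends at [x] and is a member of the family [orb]. *)
Lemma orbit_lift (T : formalScheme) (r : mor T R) z : compm t r = compm kappa z ->
  exists u, compm zeta u = compm s r.
Proof.
move=> tr; have px p : compm s r p = x by rewrite -top_t tr /= kx.
pose a := compm s r; have aUl : lands a U := xU px.
have nf i : (i < m)%N -> nil (pull a (f i)).
  by move=> im p /(pull_unit (f i) p aUl); rewrite /a px; exact: fv.
have [r1 [sr1 wr1]] : exists r1, compm s r1 = a /\ forall i, (i < n)%N -> pull r1 (w i) = if (i < m)%N then - pull a (f i) else 0.
  apply: (sl_sex sl) => // i ni; case: ifP => im p; last by have [] := @fs_local T setT p openT Logic.I.
  move=> u; have [ip _ _] := vanishing_prime (@fs_local T) openT (Logic.I : setT p).
  by have := idealN ip (nf i im p); rewrite /vanishing /=; apply.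
have [|c [sc tc]] := @arrow_comp _ _ _ R T r1 (compm i_ r); first by rewrite compmA tgt_inv sr1.
rewrite compmA src_inv tr in sc.
have pc p : compm s c p = x by rewrite sc /= kx.
have [z' hz'] : exists z', compm t c = compm kappa z'.
  apply: (sl_stab sl sc) => i im.
  have e1 := sl_delta sl (r := c) (xU pc) im; have e2 := kap_kill z (fv im).
  have r1U : lands (compm s r1) U by rewrite sr1.
  have e3 := sl_delta sl (r := r1) r1U im; have e4 := wr1 i (mn im); rewrite im in e4.
  rewrite sc e2 subr0 tc in e1; rewrite sr1 e4 in e3; rewrite e1.
  have -> : pull (compm t r1) (f i) = (pull (compm t r1) (f i) - pull a (f i)) + pull a (f i) by ring.
  by rewrite -e3; ring.
rewrite tc in hz'.
have [u [u1 u2]] := tow_hom gP z' nf.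
exists u; rewrite -[RHS]/a -sr1 /zeta -compmA; congr (compm _ _).
apply: (sl_tuniq sl).
- by rewrite compmA orb_tgt; apply: xU => p; exact: kx.
- by rewrite compmA orb_tgt -compmA u1 hz'.
move=> i ni; rewrite wr1 // pull_comp // orb_w //; case: ifP => im; last by rewrite rmorph0.
by rewrite rmorphN u2.
Qed.

Lemma zeta_mono (T : formalScheme) (u u' : mor T Lp) : compm zeta u = compm zeta u' -> u = u'.
Proof.
move=> E; have [I aI] := aU.
have g i : (i < m)%N -> global_comap u (tX P m i) = global_comap u' (tX P m i).
  by move=> im; rewrite -zeta_f // -!pull_comp ?E //; exact: xU zeta_pt.
apply: (tow_hom_uniq gP) => //; apply: (kap_mono rp aI Wx mu).
rewrite !compmA -orb_tgt -!compmA; congr (compm _ _); apply: (sl_suniq sl).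
- by apply: xU => p; exact: zeta_pt.
- by rewrite !compmA.
move=> i ni; rewrite !pull_comp // orb_w //; case: ifP => im; last by rewrite !rmorph0.
by rewrite !rmorphN g.
Qed.

Let zh_ex : exists zh : mor Lp Xh, compm h zh = zeta.
Proof. by have [I aI] := aU; exact: (compl_lift aI Wx cp fgm zeta_pt). Qed.
Definition zetah := sval (cid zh_ex).
Lemma zetahE : compm h zetah = zeta. Proof. exact: svalP (cid zh_ex). Qed.

Let hm (T : formalScheme) (b b' : mor T Xh) : compm h b = compm h b' -> b = b'.
Proof. by have [I aI] := aU; exact: (compl_mono cp). Qed.

Let IL : set (sec [set: Lp]) := tI [set 0] m.
Let aL : affine IL. Proof. exact: tI_affine. Qed.
Let iL : is_ideal IL := affine_ideal aL.
Let hUl : lands h U. Proof. by case: cp. Qed.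
Let aN : affine (@nonunits (sec [set: Xh])). Proof. by case: cp. Qed.

Let sg_ex : exists sg : mor P Lp, compm (tproj P m) sg = idm P /\
  forall i, (i < m)%N -> global_comap sg (tX P m i) = 0.
Proof.
apply: (tow_hom gP (idm P) (g := fun=> 0)) => i _ p.
by have [] := @fs_local P setT p openT Logic.I.
Qed.

(** The coordinates of [Lp] are the restrictions of the [f i], and the constants come from residues
    of functions at [x], so [complete_surj] applies. *)
Lemma zeta_closed : [/\ IL = ideal_span (global_comap zetah @` @nonunits _) &
  forall c, exists b, global_comap zetah b = c].
Proof.
have [I aI] := aU; have [sg [sg1 sg2]] := sg_ex.
have i0 : is_ideal [set 0 : sec [set: P]] := set0_ideal _.
have hz0 b : IL b <-> global_comap sg b = 0 by have := @tI_zero P [set 0] m sg b i0 sg1 sg2.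
have zsg : compm zeta sg = kappa.
  have Er : compm orb sg = compm e kappa.
    apply: (sl_tuniq sl).
    - by rewrite compmA orb_tgt; apply: xU => p; exact: kx.
    - by rewrite !compmA orb_tgt tgt_unit comp1m -compmA sg1 compm1.
    move=> i ni; rewrite pull_comp // orb_w // (sl_unit sl) //; last exact: xU.
    by case: ifP => im; rewrite ?rmorphN ?sg2 ?oppr0 ?rmorph0.
  by rewrite /zeta -compmA Er compmA src_unit comp1m.
have kill b : nonunits b -> IL (global_comap zetah b).
  move=> nb; apply/hz0; rewrite -gcomapM; set q := compm _ _.
  have [[_ [n1 un]] _ _] := rp; have [p _] := kap_pt rp; apply: contrapT => nz.
  have : unit_at (global_comap q b) p by apply: unit_unit_at => //; [exact: openT|exact: un].
  by move=> /(comap_unit q openT b (Logic.I : setT (q p))); have /(compl_van cp) := nb; apply.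
have EI : IL = ideal_span (global_comap zetah @` @nonunits _).
  apply/seteqP; split; last by apply: span_min => // _ [b nb <-]; exact: kill.
  move=> b /hz0 b0; have [a [c hb]] := tow_resid b.
  have a0 : a = 0.
    have := b0; rewrite hb rmorphD -gcomapM sg1 rmorph_sum big1 ?addr0 // => i _.
    by rewrite rmorphM sg2 // mulr0.
  rewrite hb a0 rmorph0 add0r; apply: ideal_sum => [|i _]; first exact: span_ideal.
  apply: idealM; first exact: span_ideal.
  apply: subspan; exists (pull h (f i)); last by rewrite -pull_comp // zetahE zeta_f.
  have [_ _ _ /(_ 1%N (f i)) [_ h1]] := cp; apply: (pow1_sub (affine_ideal aN)).
  by apply: h1; apply: sub_pow1; exact: fv.
split=> //; apply: (complete_surj (affine_ideal aN) iL (affine_complete aN) _ EI).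
  by have [] := affine_complete aL.
move=> c; have [a' ha'] := kap_surj rp aI Wx mu (global_comap sg c); exists (pull h a').
apply/hz0; rewrite rmorphB -pull_comp // zetahE -pull_comp ?zsg ?ha' ?subrr //.
exact: xU zeta_pt.
Qed.

Let rr_ex : exists rr : mor (ptow Lp n) R, compm s rr = compm zeta (tproj Lp n) /\
  forall i, (i < n)%N -> pull rr (w i) = tX Lp n i.
Proof.
apply: (sl_sex sl); first by apply: xU => p; exact: zeta_pt.
by move=> i _; exact: tX_nil.
Qed.

(** By the coordinates on arrows with given source, the arrows starting in [Lp] form n-space over
    [Lp]. They also end in [Lp]: composing with [orb] and inverting reduces this to [orbit_lift]. *)
Lemma zeta_invariant : groupoid_invariant sh th zetah.
Proof.
have [I aI] := aU; have gL : gaff Lp by exists IL.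
have [eh1 eh2 univ] := Rhr; have [rr [sr wr]] := rr_ex.
have prr p : compm s rr p = x by rewrite sr; exact: zeta_pt.
have [b hb] := compl_lift aI Wx cp fgm (fun p => etrans (top_t rr p) (prr p)).
have [rz [[z1 z2 z3] _]] : exists! rz : mor (ptow Lp n) Rh,
    [/\ compm r0 rz = rr, compm sh rz = compm zetah (tproj Lp n) & compm th rz = b].
  by apply: univ => //; rewrite compmA zetahE.
have uniq (T : formalScheme) (a a' : mor T Rh) : compm r0 a = compm r0 a' -> a = a'.
  move=> E; have [||k [_ hk]] := univ T (compm r0 a) (compm sh a) (compm th a).
  - by rewrite !compmA eh1.
  - by rewrite !compmA eh2.
  rewrite -(hk a) // -(hk a') //; split=> //; apply: hm; rewrite !compmA -?eh1 -?eh2 -!compmA E //.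
have arrow (T : formalScheme) (a : mor T R) u : compm t a = compm zeta u -> exists u', compm zeta u' = compm s a.
  move=> ta; have [|c [sc tc]] := @arrow_comp _ _ _ R T (compm orb u) a; first by rewrite compmA.
  have [|u' hu'] := @orbit_lift T c (compm (tproj P m) u); first by rewrite tc compmA orb_tgt compmA.
  by exists u'; rewrite hu' sc.
have arrow' (T : formalScheme) (a : mor T R) u : compm s a = compm zeta u -> exists u', compm zeta u' = compm t a.
  move=> sa; have [|u' hu'] := arrow T (compm i_ a) u; first by rewrite compmA tgt_inv sa.
  by exists u'; rewrite hu' compmA src_inv.
have [t' ht'] := arrow' _ rr _ sr.
have lift (T : formalScheme) (a : mor T Rh) (z : mor T Lp) : compm sh a = compm zetah z ->
   exists k, compm rz k = a /\ compm (tproj Lp n) k = z.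
  move=> E; have sa : compm s (compm r0 a) = compm zeta z by rewrite compmA eh1 -compmA E compmA zetahE.
  have pa p : compm s (compm r0 a) p = x by rewrite sa; exact: zeta_pt.
  have nw i : (i < n)%N -> nil (pull (compm r0 a) (w i)).
    move=> ni p /(pull_unit (w i) p (lW pa)) u.
    have xx : U x by [].
    have Ep : compm r0 a p = e x by rewrite -(groupoid_top infR (compm r0 a p)).1 -[s _]/(compm s (compm r0 a) p) pa.
    rewrite Ep in u; have := sl_unit sl (xU (b := kappa) kx) ni.
    have lk : lands (compm e kappa) W by apply/lands_compl; split=> //; exact: xU.
    have [p0 _] := kap_pt rp; move=> e0; have := (pull_unit (w i) p0 lk).2; rewrite /= kx => /(_ u).
    by rewrite e0; have [] := @fs_local P setT p0 openT Logic.I.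
  have [k [k1 k2]] := tow_hom gL z nw; exists k; split=> //; apply: uniq.
  rewrite compmA z1; apply: (sl_suniq sl).
  - by rewrite compmA sr; apply: xU => p; exact: zeta_pt.
  - by rewrite compmA sr -compmA k1 sa.
  by move=> i ni; rewrite pull_comp ?wr ?k2 //; exact: lW.
have luniq (T : formalScheme) (k k' : mor T (ptow Lp n)) : compm rz k = compm rz k' ->
   compm (tproj Lp n) k = compm (tproj Lp n) k' -> k = k'.
  move=> E1 E2; apply: (tow_hom_uniq gL) => // i ni; rewrite -wr // -!pull_comp; try exact: lW.
  by rewrite -z1 -!compmA E1.
have ht : compm th rz = compm zetah t' by rewrite z3; apply: hm; rewrite hb compmA zetahE ht'.
exists (ptow Lp n), rz, (tproj Lp n), t'; split.
- split=> // T a z z' E1 E2; have [k [k1 k2]] := lift T a z E1.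
  exists k; split; last by move=> k' [k1' k2' _]; apply: luniq; rewrite ?k1 ?k2.
  split=> //; apply: zeta_mono; rewrite -zetahE -!compmA; congr (compm _ _).
  by rewrite compmA -ht -compmA k1.
- split=> // T a z E1; have [k [k1 k2]] := lift T a z E1.
  by exists k; split=> // k' [k1' k2']; apply: luniq; rewrite ?k1 ?k2.
split; first by rewrite ht.
move=> T z a E; have [|z0 hz0] := arrow T (compm r0 a) z.
  by rewrite compmA eh2 -compmA -E compmA zetahE.
have E1 : compm sh a = compm zetah z0 by apply: hm; rewrite !compmA zetahE hz0 -eh1 compmA.
have [k [k1 k2]] := lift T a z0 E1; exists k; split.
  split=> //; apply: zeta_mono; rewrite -zetahE -!compmA; congr (compm _ _).
  by rewrite compmA -ht -compmA k1.
move=> k' [k1' k2']; apply: luniq; rewrite ?k1 ?k2' //.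
apply: zeta_mono; rewrite -zetahE -!compmA; congr (compm _ _).
have Z (q : mor T (ptow Lp n)) : compm zetah (compm (tproj Lp n) q) = compm sh (compm rz q).
  by rewrite compmA -z2 compmA.
by rewrite !Z k1 k2'.
Qed.

(** The orbit lies in the leaf, as the leaf contains [x] and is invariant; being invariant itself,
    the orbit is all of the leaf by minimality. *)
Lemma zeta_leaf : exists2 m0 : mor Lp L, is_iso m0 & compm lh m0 = zetah.
Proof.
have [I aI] := aU; have [EI sur] := zeta_closed.
have [lam hlam] := leaf_point ch rp cp leaf.
have [|l' hl'] := @leaf_src _ _ _ R x infR W oW ch _ _ _ h r0 sh th lh cp Rhr leaf Lp (compm i_ orb)
   (compm lam (tproj P m)).
  by rewrite compmA src_inv orb_tgt -hlam !compmA.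
have E : compm lh l' = zetah by apply: hm; rewrite zetahE -hl' compmA tgt_inv.
exists l' => //; have [_ _ _ minL] := leaf; apply: (minL Lp zetah l') => //; last exact: zeta_invariant.
- exists Xh, (idm Xh), zetah; split; last by rewrite comp1m.
    by apply: iso_open_immersion; exists (idm Xh); rewrite comp1m.
  move=> p; exists setT, openT, (@nonunits _); split=> //; split=> //.
  by have := aL; rewrite EI.
have [sg _] := sg_ex; have [p _] := kap_pt rp; by exists (sg p).
Qed.

Lemma zeta_kernel b : global_comap zetah b = 0 -> global_kernel lh b.
Proof.
have [m0 [m1 [h1 h2]] hm0] := zeta_leaf; move=> b0.
rewrite /global_kernel /= -[comap lh openT b]/(global_comap lh b).
have -> : global_comap lh b = global_comap m1 (global_comap m0 (global_comap lh b)).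
  by rewrite -gcomapM h1.
by rewrite -[global_comap m0 _]gcomapM hm0 b0 rmorph0.
Qed.

Let iNn : is_ideal (@nonunits (sec [set: Xh])) := affine_ideal aN.
Let clv : closed_immersion_over v oU IV. Proof. by case: gm. Qed.
Let cpv : compl hv (v @^-1` U) y. Proof. by case: gm. Qed.
Let jv := [set a : sec U | comap v oU a = 0].
Let ijv : is_ideal jv. Proof. exact: (preim_ideal (comap v oU) (set0_ideal _)). Qed.
Let iJ : is_ideal (global_kernel j). Proof. exact: (preim_ideal (global_comap j) (set0_ideal _)). Qed.

(** The [f i] are coordinates of the leaf, so the ideal J of V on the completion is generated by
    them up to its intersection with K, which is J K. Read on [U], the ideal [jv] of V is generated
    by the [f i] modulo [m jv] and high powers; Artin-Rees and Nakayama conclude. *)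
Lemma trans_comb : exists2 g : sec U, vanishing x (1 - g) &
  forall a, comap v oU a = 0 -> exists d : nat -> sec U, g * a = \sum_(i < m) d i * f i.
Proof.
have [I aI] := aU; have [EI sur] := zeta_closed.
have im : is_ideal (vanishing (U := U) x) by case: (chart_primem ch).
have nU := chart_noeth ch.
pose K0 := [set z | exists d : nat -> sec U, z = \sum_(i < m) d i * f i].
have iK0 : is_ideal K0 := comb_ideal m f.
have K0j : K0 `<=` jv.
  move=> _ [d ->]; apply: (@ideal_sum _ jv _ _ _ _ ijv) => i _; apply: (@idealM _ jv _ _ ijv).
  by have [] := sl_f sl (ltn_ord i).
have [_ _ ap pw] := cp.
have Jn b : global_kernel j b -> nonunits b.
  move=> b0 ub; have [p _] := compl_pt_ex cpv.
  have [c hc] := is_unit_map (global_comap j) ub.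
  move: hc; rewrite b0 mul0r => e01; have [n0 _] := @fs_local Vh setT p openT Logic.I.
  by apply: n0; rewrite e01; apply: unit_at1 => //; exact: openT.
pose mj := ideal_mul (vanishing (U := U) x) jv.
have imj : is_ideal mj := mulid_ideal _ _.
have mjj : mj `<=` jv by apply: mulid_min => // a b _ hb; exact: (idealM a ijv hb).
pose T0 := ideal_add K0 mj.
have iT0 : is_ideal T0 := addid_ideal iK0 imj.
have T0j : T0 `<=` jv by exact: addid_min.
have [N ar] := artin_rees nU im ijv.
(* The functions on the completion that agree to order [N], the Artin-Rees bound, with an element of
   [T0]. *)
pose Ap := [set b : sec [set: Xh] | exists2 a', T0 a' & ideal_pow (@nonunits _) N (b - pull h a')].
have iPN : is_ideal (ideal_pow (@nonunits (sec [set: Xh])) N) := pow_ideal _ _.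
have iAp : is_ideal Ap.
  split.
  - by exists 0; [exact: ideal0|rewrite (pullmE hUl) rmorph0 subrr; exact: ideal0].
  - move=> b c [a' ha hb] [c' hc hd]; exists (a' + c'); first exact: (idealD iT0).
    by rewrite pullD // opprD addrACA; exact: (idealD iPN).
  - move=> d b [a' ha hb]; have [d' hd'] := ap N d; exists (d' * a'); first exact: (idealM d' iT0 ha).
    have -> : d * b - pull h (d' * a') = d * (b - pull h a') + pull h a' * (d - pull h d').
      by rewrite pullM //; ring.
    by apply: (idealD iPN); exact: (idealM _ iPN).
have ApJK : ideal_mul (global_kernel j) (global_kernel lh) `<=` Ap.
  apply: mulid_min => // b c Jb Kc.
  have [g g0 hg] := trans_approx ch cp vy hj clv cpv N Jb.
  have [c' hc'] := ap N.+1 c.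
  have nc : nonunits c by apply: (leaf_K leaf).2.
  have mc : vanishing x c'.
    have h1 : ideal_pow (@nonunits _) 1 (pull h c').
      have -> : pull h c' = c - (c - pull h c') by ring.
      by apply: (idealB (pow_ideal _ _)); [exact: sub_pow1|exact: (pow_le (ltn0Sn N))].
    by have /pw := h1; exact: pow1_sub.
  exists (c' * g); first by apply: addidr => //; exact: mulidI.
  have -> : b * c - pull h (c' * g) = c * (b - pull h g) + pull h g * (c - pull h c').
    by rewrite pullM //; ring.
  by apply: (idealD iPN); apply: (idealM _ iPN) => //; exact: (pow_sub hc').
(* On the leaf [b] is a combination of the coordinates; lifting its coefficients gives [z], and
   [b - z] vanishes on V and on the leaf. *)
have JAp b : global_kernel j b -> Ap b.
  move=> Jb; have : ideal_span (global_comap zetah @` @nonunits _) (global_comap zetah b).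
    by apply: subspan; exists b => //; exact: Jn.
  rewrite -EI => hI; have [a [c hc]] := tow_resid (global_comap zetah b).
  have sX : IL (\sum_(i < m) c i * tX P m i).
    by apply: ideal_sum => // i _; apply: idealM => //; apply: tI_X => //; exact: set0_ideal.
  have a0 : a = 0.
    suff : IL (global_comap (tproj P m) a) by move/tI_proj.
    have -> : global_comap (tproj P m) a = global_comap zetah b - \sum_(i < m) c i * tX P m i by rewrite hc addrK.
    exact: (idealB iL).
  rewrite a0 rmorph0 add0r in hc.
  have /choice [c' hc'] : forall i, exists c', global_comap zetah c' = c i by move=> i; exact: sur.
  pose z := \sum_(i < m) c' i * pull h (f i).
  have zh : global_comap zetah z = global_comap zetah b.
    rewrite hc rmorph_sum; apply: eq_bigr => i _; rewrite rmorphM hc' -pull_comp //.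
    by rewrite zetahE zeta_f.
  have Jz : global_kernel j z.
    apply: (@ideal_sum _ (global_kernel j) _ _ _ _ iJ) => i _; apply: (@idealM _ (global_kernel j) _ _ iJ).
    by apply: (trans_kernel cp hj cpv); have [] := sl_f sl (ltn_ord i).
  have Kbz : global_kernel lh (b - z) by apply: zeta_kernel; rewrite rmorphB zh subrr.
  have -> : b = z + (b - z) by ring.
  apply: (idealD iAp); last by apply: ApJK; apply: JK; split=> //; exact: (idealB iJ).
  apply: (@ideal_sum _ Ap _ _ _ _ iAp) => i _; apply: (@idealM _ Ap _ _ iAp).
  exists (f i); last by rewrite subrr; exact: ideal0.
  by apply: addidl => //; exact: (mem_comb f (ltn_ord i)).
apply: (nakayama im iK0 (nU _ ijv)) => a ja.
have [a' ha' hd] := JAp _ (trans_kernel cp hj cpv ja).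
have hm' : ideal_pow (vanishing (U := U) x) N (a - a') by apply/pw; rewrite pullB.
have -> : a = a' + (a - a') by ring.
apply: (idealD iT0) => //; apply: addidr => //; apply: ar; split=> //.
by apply: (idealB ijv) => //; exact: T0j.
Qed.

End LeafSlice.

(** * A criterion for formal finite presentation *)

Lemma mpoly0_const (A : nzRingType) (p : mpoly.mpoly 0 A) :
  p = mpoly.mpolyC 0 (mpoly.mcoeff (@mpoly.mnm0 0) p).
Proof.
apply/mpoly.mpolyP => k; rewrite mpoly.mcoeffC.
have -> : k = @mpoly.mnm0 0 by apply/mpoly.mnmP => -[].
by rewrite eqxx mulr1.
Qed.

(** The ideal of definition of [N] is taken so large that modulo it [N] equals the closed subscheme
    [Z] of [Y]. The quotient map is then presented by no variables and the relations [f i]. *)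
Lemma lffp_tower (Z N Y : formalScheme) (sg : mor Z N) (F : mor N Y) (D : set Y) (I : set (sec D))
    (J : set (sec [set: N])) (IZ : set (sec [set: Z])) m (f : nat -> sec D) :
  locally_noetherian N -> locally_noetherian Y -> affine J -> affine I -> lands F D ->
  (forall b, J b <-> IZ (global_comap sg b)) ->
  IZ = ideal_span ([eta pull (compm F sg) (V := D)] @` I) ->
  (forall c, exists a : sec D, pull (compm F sg) a = c) ->
  (forall a : sec D, pull (compm F sg) a = 0 <-> exists d : nat -> sec D, a = \sum_(i < m) d i * f i) ->
  locally_formally_fp F.
Proof.
move=> nN nY aJ aI FD EJ EI sur ker; split=> // x.
have oD := affine_open aI; have FD' := FD.2.
have FsD : lands (compm F sg) D := lands_comp sg FD.
have nz (Q : formalScheme) (E : set Q) (q : Q) (oE : open E) : E q -> (1 : sec E) != 0.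
  move=> Eq; apply/eqP => e; have [n0 _] := @fs_local Q E q oE Eq; apply: n0.
  by rewrite -e; exact: unit_at1.
have nA := nz Y D (F x) oD (FD' x Logic.I); have nB := nz N setT x openT Logic.I.
pose A : comNzRingType := HB.pack (sec D) (GRing.PzSemiRing_isNonZero.Build (sec D) nA).
pose B : comNzRingType := HB.pack (sec [set: N]) (GRing.PzSemiRing_isNonZero.Build (sec [set: N]) nB).
pose al (a : A) : sec D := a; pose be (b : B) : sec [set: N] := b.
have alB : zmod_morphism al by [].
have alM : monoid_morphism al by [].
have beB : zmod_morphism be by [].
have beM : monoid_morphism be by [].
pose gf (a : A) : B := pullm FD (a : sec D).
have gB : zmod_morphism gf by move=> a b; exact: (rmorphB (pullm FD)).
have gM : monoid_morphism gf by split; [exact: (rmorph1 (pullm FD))|move=> a b; exact: (rmorphM (pullm FD))].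
pose alpha := HB.pack_for {rmorphism A -> sec D} al (GRing.isZmodMorphism.Build A (sec D) al alB)
  (GRing.isMonoidMorphism.Build A (sec D) al alM).
pose beta := HB.pack_for {rmorphism B -> sec [set: N]} be (GRing.isZmodMorphism.Build B (sec [set: N]) be beB)
  (GRing.isMonoidMorphism.Build B (sec [set: N]) be beM).
pose g := HB.pack_for {rmorphism A -> B} gf (GRing.isZmodMorphism.Build A B gf gB)
  (GRing.isMonoidMorphism.Build A B gf gM).
exists setT, D, openT, oD, FD', J, I, A, B, alpha, beta, g; split=> //.
- by split; [exists id|exists id].
- by move=> a; rewrite -[LHS](pullmE FD (a : sec D)) (pullE oD FD').
have iI := affine_ideal aI; have iJ := affine_ideal aJ.
have JI (a : sec D) : J (pull F a) <-> exists2 a', I a' & exists d : nat -> sec D, a - a' = \sum_(i < m) d i * f i.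
  rewrite EJ -pull_comp // EI.
  have -> : [eta pull (compm F sg) (V := D)] @` I = pullm FsD @` I.
    by apply/seteqP; split=> _ [c Ic <-]; exists c => //=; rewrite (pullmE FsD).
  rewrite spanE; last by apply: im_ideal => // c; have [a0 <-] := sur c; exists a0; rewrite (pullmE FsD).
  split=> [[a' Ia' e]|[a' Ia' /ker e]]; exists a' => //.
    by apply/ker; rewrite pullB // [pull _ a'](pullmE FsD) e subrr.
  by move: e; rewrite pullB // => /subr0_eq ->; rewrite (pullmE FsD).
split.
  move=> _ [a Ia <-]; rewrite /preimage /= -[X in J X](pullmE FD (a : sec D)).
  by apply/JI; exists a => //; exists (fun=> 0); rewrite subrr big1 // => i _; rewrite mul0r.
pose b0 (i : 'I_0) : B := 0.
exists 0%N, b0; split.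
  move=> c; have [a ha] := sur (global_comap sg (c : sec [set: N])).
  exists (mpoly.mpolyC 0 (a : A)); rewrite mpoly.mmapC /preimage /=.
  suff : J ((c : sec [set: N]) - pull F a) by rewrite (pullmE FD).
  apply/EJ; rewrite rmorphB -pull_comp // ha subrr EI; exact: ideal0 (span_ideal _).
exists m, (fun i : 'I_m => mpoly.mpolyC 0 (f i : A)) => p.
rewrite {1}[p]mpoly0_const mpoly.mmapC /preimage /=; set a : A := mpoly.mcoeff _ p.
have -> : J (be (gf a)) <-> J (pull F (a : sec D)) by rewrite (pullmE FD).
rewrite JI; set SP := ideal_span _; have iSP : is_ideal SP := span_ideal _; split.
  move=> [a' Ia' [d hd]]; rewrite [p]mpoly0_const -/a.
  have -> : a = (a' : A) + \sum_(i < m) (d i : A) * (f i : A).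
    by rewrite -[a in LHS](subrK (a' : A)) addrC; congr (_ + _); exact: hd.
  rewrite mpoly.mpolyCD; apply: (@idealD _ SP _ _ iSP).
    by apply: subspan; left; exists a'.
  elim/big_rec: _ => [|i z _ hz].
    have -> : mpoly.mpolyC 0 (0 : A) = 0 by rewrite [RHS]mpoly0_const mpoly.mcoeff0.
    exact: (ideal0 iSP).
  rewrite mpoly.mpolyCD; apply: (@idealD _ SP _ _ iSP) hz.
  rewrite mpoly.mpolyCM; apply: (@idealM _ SP _ _ iSP).
  by apply: subspan; right; exists i.
move=> hp; apply/JI.
pose Kp := [set p : mpoly.mpoly 0 A | J (pull F (mpoly.mcoeff (@mpoly.mnm0 0) p : sec D))].
have iKp : is_ideal Kp.
  split.
  - by rewrite /Kp /= mpoly.mcoeff0 (pullmE FD) rmorph0; exact: ideal0.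
  - move=> p1 p2; rewrite /Kp /= mpoly.mcoeffD => h1 h2.
    by rewrite [X in J X](pullD _ _ FD); exact: idealD.
  - move=> p1 p2; rewrite /Kp /= => h2; rewrite [p1]mpoly0_const mpoly.mcoeffCM.
    by rewrite [X in J X](pullM _ _ FD); exact: idealM.
suff : Kp p by [].
apply: (span_min iKp _ hp) => _ [[a' Ia' <-]|[i _ <-]]; rewrite /Kp /= mpoly.mcoeffC eqxx mulr1; apply/JI.
  by exists a' => //; exists (fun=> 0); rewrite subrr big1 // => i _; rewrite mul0r.
by exists 0; [exact: ideal0|rewrite subr0; exact: mem_comb].
Qed.

(** * A neighbourhood on which the f_i generate the ideal of the transversal *)

Section SliceFinal.
Variables (S X : formalScheme) (pX : mor X S) (R : groupoid pX) (x : X).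
Local Notation s := (src R).
Local Notation t := (tgt R).
Local Notation e := (unit_arr R).
Hypotheses (infR : infinitesimal R) (smR : formally_smooth s) (nR : locally_noetherian R)
  (cx : closed [set x]).
Variables (P G Xh Rh L V : formalScheme) (kappa : mor P X) (g : mor G R) (sG tG : mor G P)
  (h : mor Xh X) (r0 : mor Rh R) (sh th : mor Rh Xh) (lh : mor L Xh) (v : mor V X).
Hypotheses (rp : residue_point x kappa) (Gr : is_restriction s t kappa g sG tG)
  (smG : formally_smooth sG) (ch : completion_at x h) (Rhr : is_restriction s t h r0 sh th)
  (leaf : is_leaf sh th lh) (lt : leaf_transversal x h lh v).

Lemma transversal_slice : exists (y : V) (Vh : formalScheme) (hv : mor Vh V) (j : mor Vh Xh)
   (W : set R) (oW : open W) IV m n f w,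
   [/\ v y = x, compm h j = compm v hv,
      @geom _ _ _ R x V Vh Xh v y h hv W oW IV,
      @slice _ _ _ R x P V kappa v W oW m n f w &
      (forall b, nonunits b -> ideal_add (global_kernel j) (global_kernel lh) b) /\
      forall a, comap v (mor_open e oW) a = 0 ->
        exists d : nat -> sec (e @^-1` W), a = \sum_(i < m) d i * f i].
Proof.
have [iv [y [vy [Vh [hv [j [cv hj cj t0 t1]]]]]]] := lt.
have iJ : is_ideal (global_kernel j) := preim_ideal (global_comap j) (set0_ideal _).
have iK : is_ideal (global_kernel lh) := preim_ideal (global_comap lh) (set0_ideal _).
have JK b : nonunits b -> ideal_add (global_kernel j) (global_kernel lh) b.
  by move/(tor0_sum iJ iK t0).
have JK' := tor1_int iJ iK t1.
have [ce _] := infR.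
have [W0 [oW0 [ch0 [IV0 cl0] cp0 cpv0]]] := chart_ex vy ce nR iv ch cv.
have gm0 : @geom _ _ _ R x V Vh Xh v y h hv W0 oW0 IV0 by split.
have [W [oW [IV [m [n [f [w [gm sl]]]]]]]] := slice_ex infR smR cx rp Gr smG Rhr leaf vy hj JK gm0.
(* [ga] is a unit at [x]; once it is inverted, the [f i] generate the ideal of V, and the slice
   coordinates restrict to the smaller neighbourhood. *)
have [ga gv gf] := trans_comb infR cx rp Rhr leaf vy hj JK' gm sl.
have [ch1 cl1 _ _] := gm; have [c hc] := chart_surj ch1 ga.
have [[IW [_ aU _]] nW Wx] := ch1.
have uga : unit_at ga x.
  have [iv' v1 _] := chart_primem ch1; apply: contrapT => nu; apply: v1.
  by rewrite -[1](subrK ga); exact: (idealD iv' gv nu).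
have uc : unit_at c (e x) by apply/(comap_unit e oW c Wx); rewrite hc.
have kx p : kappa p = x by have [_ ->] := rp.
have [IV2 gm2] := geom_shrink vy uc gm.
have UU : e @^-1` basic_open c `<=` e @^-1` W by move=> p; exact: basic_open_sub.
have [f2 [w2 [sl2 hf2]]] : exists f2 w2, @slice _ _ _ R x P V kappa v _ (basic_open_open c) m n f2 w2 /\
    forall i, f2 i = res (mor_open e oW) (mor_open e (basic_open_open c)) UU (f i).
  by do 2 eexists; split; [exact: (slice_shrink infR kx uc ch1 sl)|move=> i; exact: resP].
exists y, Vh, hv, j, (basic_open c), (basic_open_open c), IV2, m, n, f2, w2.
split; [exact: vy|exact: hj|exact: gm2|exact: sl2|split=> // a a0].
suff [d ->] : exists d : nat -> sec (e @^-1` basic_open c), a = \sum_(i < m) d i *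
    res (mor_open e oW) (mor_open e (basic_open_open c)) UU (f i).
  by exists d; apply: eq_bigr => i _; rewrite hf2.
have e1 : e @^-1` basic_open c = basic_open ga by rewrite (chart_pre e oW) hc.
have [ch2 _ _ _] := gm2; have nU2 := chart_noeth ch2.
have ijv : is_ideal [set a | comap v (mor_open e oW) a = 0] := preim_ideal (comap v _) (set0_ideal _).
have := closed_kernel_shrink (@fs_local X) UU e1 cl1 nU2 ijv (fun _ h => h) a0.
have iK0 := comb_ideal m (fun i => res (mor_open e oW) (mor_open e (basic_open_open c)) UU (f i)).
move=> ha; apply: (span_min iK0 _ ha) => _ [z /gf [d hd] <-].
apply: (unit_ideal (a := res (mor_open e oW) (mor_open e (basic_open_open c)) UU ga) iK0).
  by apply: res_unit; rewrite e1.
exists (fun i => res (mor_open e oW) (mor_open e (basic_open_open c)) UU (d i)).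
by rewrite -rmorphM hd rmorph_sum; apply: eq_bigr => i _; rewrite rmorphM.
Qed.

End SliceFinal.

(** * The transversal: statements (A), (B) and (C) *)

Section Transversal.
Variables (S X : formalScheme) (strX : mor X S) (R : groupoid strX) (x : X).
Local Notation s := (src R).
Local Notation t := (tgt R).
Local Notation e := (unit_arr R).
Local Notation i_ := (inv_arr R).
Hypotheses (infR : infinitesimal R) (smR : formally_smooth s) (cx : closed [set x]).
Variables (P V Vh Xh : formalScheme) (kappa : mor P X)
  (h : mor Xh X) (v : mor V X) (y : V) (hv : mor Vh V).
Hypotheses (rp : residue_point x kappa) (vy : v y = x).
Variables (W : set R) (oW : open W) (IV : set (sec (e @^-1` W))) (m n : nat)
  (f : nat -> sec (e @^-1` W)) (w : nat -> sec W).
Hypotheses (gm : @geom _ _ _ R x V Vh Xh v y h hv W oW IV)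
  (sl : @slice _ _ _ R x P V kappa v W oW m n f w)
  (ker : forall a, comap v (mor_open e oW) a = 0 ->
        exists d : nat -> sec (e @^-1` W), a = \sum_(i < m) d i * f i).
Let U := e @^-1` W.
Let oU : open U := mor_open e oW.
Let ch : chart e x oW. Proof. by case: gm. Qed.
Let Wx : U x. Proof. by case: ch. Qed.
Let cl : closed_immersion_over v oU IV. Proof. by case: gm. Qed.
Let aIV : affine IV. Proof. by case: cl. Qed.
Let mu := @chart_maxU _ _ _ R x cx W oW ch.
Let kx p : kappa p = x. Proof. by case: rp. Qed.
Let kU : lands kappa U := kap_lands rp aIV Wx.

Definition V' : formalScheme := fsub (mor_open v oU).
Definition vinc : mor V' V := finc (mor_open v oU).
Definition v' : mor V' X := compm v vinc.

Lemma v'_lands : lands v' U.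
Proof. by split=> // p _; exact: (svalP p). Qed.

Lemma v'_closed : closed_immersion_over v' oU IV.
Proof. exact: closed_restrict cl. Qed.

Let IV' := ideal_span ([eta pull v' (V := U)] @` IV).
Lemma aV' : affine IV'. Proof. by have [] := closed_pull v'_lands v'_closed. Qed.
Lemma v'_surj c : exists a : sec U, pull v' a = c.
Proof. by have [_ + _] := closed_pull v'_lands v'_closed; apply. Qed.
Let gV' : gaff V'. Proof. by exists IV'; exact: aV'. Qed.

Lemma v'_ker (a : sec U) : pull v' a = 0 -> exists d : nat -> sec U, a = \sum_(i < m) d i * f i.
Proof.
have [_ _ kr] := closed_pull v'_lands v'_closed => /kr a0; apply: ker.
have [_ aJ _] := cl; apply: (@finc_inj _ _ (mor_open v oU) _ _ aJ).
by rewrite -pull_comap; [apply/kr|exact: v'_lands].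
Qed.

Lemma v'_f i : (i < m)%N -> pull v' (f i) = 0.
Proof.
move=> im; rewrite /v' (pull_comap oU); last exact: v'_lands.
have [_ ->] := sl_f sl im; have lf : lands vinc (v @^-1` U) := finc_lands (mor_open v oU).
by rewrite (pullmE lf) rmorph0.
Qed.

Lemma v'_lift (T : formalScheme) (b : mor T X) : lands b U ->
  (forall i, (i < m)%N -> pull b (f i) = 0) -> exists z, compm v' z = b.
Proof.
move=> bU hb; apply: (closed_lift aIV v'_lands aV' v'_surj (a := 1) _ bU).
  exact: pow1_sub (span_ideal _).
move=> a /v'_ker [d ->]; rewrite (pullmE bU) rmorph_sum big1 // => i _.
by rewrite rmorphM -!(pullmE bU) hb // mulr0.
Qed.

Lemma v'_mono (T : formalScheme) (z z' : mor T V') : compm v' z = compm v' z' -> z = z'.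
Proof. exact: (closed_mono v'_lands aV' v'_surj). Qed.

Lemma v'_noeth : noetherian_ring (sec [set: V']).
Proof.
apply: (noetherian_surj (f := pullm v'_lands)) (chart_noeth ch) => c.
by have [a <-] := v'_surj c; exists a; rewrite (pullmE v'_lands).
Qed.

Lemma lands_src (T : formalScheme) (r : mor T R) : lands (compm t r) U <-> lands (compm s r) U.
Proof. by split=> -[oo hh]; split=> // p /hh; rewrite /preimage /= (groupoid_top infR (r p)).2. Qed.

Lemma slice_nil (T : formalScheme) (r : mor T R) i : lands (compm s r) U -> (i < n)%N -> nil (pull r (w i)).
Proof.
move=> rU ni p; have rW : lands r W by apply/(lands_chart infR oW).
move=> /(pull_unit (w i) p rW) u.
have zU : U (s (r p)) by case: rU => _; apply.
have lf : lands (compm e (finc oU)) W by split=> // q _; exact: (svalP q).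
pose q : fsub oU := exist _ (s (r p)) zU.
have := pull_unit (w i) q lf; rewrite (sl_unit sl) //; last exact: finc_lands.
have -> : compm e (finc oU) q = r p by rewrite /= (groupoid_top infR (r p)).1.
by move=> [_ /(_ u)]; have [] := @fs_local (fsub oU) setT q openT Logic.I.
Qed.

Lemma slice_f0 (T : formalScheme) (r : mor T R) z : compm t r = compm v' z ->
  forall i, (i < m)%N -> pull r (w i) = - pull (compm s r) (f i).
Proof.
move=> tr i im; have tU : lands (compm t r) U by rewrite tr; exact: lands_comp v'_lands.
rewrite (sl_delta sl (r := r) _ im); last exact/lands_src.
by rewrite tr pull_comp ?v'_f // ?rmorph0 ?sub0r //; exact: v'_lands.
Qed.

(** The equations make every [f i] vanish at the target, and the [f i] generate the ideal of
    [V']. *)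
Lemma slice_to_V (T : formalScheme) (r : mor T R) : lands (compm s r) U ->
  (forall i, (i < m)%N -> pull r (w i) = - pull (compm s r) (f i)) -> exists z, compm v' z = compm t r.
Proof.
move=> rU hr; apply: v'_lift => [|i im]; first exact/lands_src.
have E := sl_delta sl (r := r) rU im; rewrite hr // in E.
have -> : pull (compm t r) (f i) = (pull (compm t r) (f i) - pull (compm s r) (f i)) + pull (compm s r) (f i).
  by ring.
by rewrite -E; ring.
Qed.

(** The base change V' x_X R: an arrow ending in [V'] is given by its target and by its n
    coordinates. *)
Let N0 := ptow V' n.
Let nu_ex : exists nu : mor N0 R, compm t nu = compm v' (tproj V' n) /\
  forall i, (i < n)%N -> pull nu (w i) = tX V' n i.
Proof.
apply: (sl_tex sl); first exact: lands_comp v'_lands.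
by move=> i _; exact: tX_nil.
Qed.
Definition N_ := N0.
Definition nu : mor N_ R := sval (cid nu_ex).
Lemma nu_tgt : compm t nu = compm v' (tproj V' n).
Proof. by have [] := svalP (cid nu_ex). Qed.
Lemma nu_w i : (i < n)%N -> pull nu (w i) = tX V' n i.
Proof. by have [_] := svalP (cid nu_ex); apply. Qed.
Lemma nu_tU : lands (compm t nu) U. Proof. by rewrite nu_tgt; exact: lands_comp v'_lands. Qed.
Lemma nu_sU : lands (compm s nu) U. Proof. by apply/lands_src; exact: nu_tU. Qed.
Lemma nu_lands : lands nu W. Proof. by apply/(lands_chart infR oW); exact: nu_sU. Qed.

Lemma N_lift (T : formalScheme) (r : mor T R) (z : mor T V') : compm t r = compm v' z ->
  exists u : mor T N_, compm (tproj V' n) u = z /\ compm nu u = r.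
Proof.
move=> tr; have tU : lands (compm t r) U by rewrite tr; exact: lands_comp v'_lands.
have [|u [u1 u2]] := @tow_hom V' gV' n T z (fun i => pull r (w i)).
  by move=> i ni; apply: slice_nil => //; exact/lands_src.
exists u; split=> //; apply: (sl_tuniq sl).
- by rewrite compmA nu_tgt; do 2 apply: lands_comp; exact: v'_lands.
- by rewrite compmA nu_tgt -compmA u1.
by move=> i ni; rewrite pull_comp ?nu_w ?u2 //; exact: nu_lands.
Qed.

Lemma N_mono (T : formalScheme) (u u' : mor T N_) : compm nu u = compm nu u' -> u = u'.
Proof.
move=> E; apply: (tow_hom_uniq gV').
  by apply: v'_mono; rewrite !compmA -nu_tgt -!compmA E.
by move=> i ni; rewrite -nu_w // -!pull_comp ?E //; exact: nu_lands.
Qed.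

Lemma N_pullback : is_pullback v' t (tproj V' n : mor N_ V') nu.
Proof.
split; first by rewrite nu_tgt.
move=> T a b E; have [u [u1 u2]] := N_lift (esym E).
by exists u; split=> // u' [_ E']; apply: N_mono; rewrite E' u2.
Qed.

Definition nmap : mor N_ X := compm s nu.

Lemma N_f i : (i < m)%N -> nil (pull nmap (f i)).
Proof.
move=> im p /(pull_unit (f i) p nu_sU); rewrite /nmap -[compm s nu p]/(s (nu p)).
rewrite -(groupoid_top infR (nu p)).2 -[t (nu p)]/(compm t nu p) nu_tgt => /(pull_unit (f i) _ v'_lands).
by rewrite v'_f //; have [] := @fs_local V' setT (tproj V' n p) openT Logic.I.
Qed.

(** Smoothness of [s] lifts the arrow, though its target may leave [V']. Replacing its first m
    coordinates by [-f(b)] brings the target back to [V'], and on [T0] they had these values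
    already. *)
Lemma N_smooth : formally_smooth nmap.
Proof.
move=> T0 T i a b aT ci ni hab; have surj := nilpotent_closed_surj aT ci ni.
have bU : lands b U.
  split=> // p _; have [p0 <-] := surj p.
  have := congr1 (fun q : mor T0 X => q p0) hab => /= E; rewrite /preimage /= -E.
  by case: nu_sU => _; apply.
have fn k : (k < m)%N -> nil (pull b (f k)).
  move=> km p; have [p0 <-] := surj p => /(pull_unit (f k) (i p0) bU).
  have := congr1 (fun q : mor T0 X => q p0) hab => /= <- u.
  by apply: (@N_f _ km (a p0)); apply/(pull_unit (f k) _ nu_sU).
have [|r1 [r1i sr1]] := smR aT ci ni (a := compm nu a) (b := b); first by rewrite compmA.
have [|r [sr wr]] := sl_sex sl (b := b) (g := fun k => if (k < m)%N then - pull b (f k) else pull r1 (w k)) bU.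
  move=> k kn; case: ifP => km; last by apply: slice_nil => //; rewrite sr1.
  move=> p u; have [ip _ _] := vanishing_prime (@fs_local T) openT (Logic.I : setT p).
  by have := idealN ip (fn k km p); rewrite /vanishing /=; apply.
have rU : lands (compm s r) U by rewrite sr.
have [z hz] : exists z, compm v' z = compm t r.
  by apply: (slice_to_V rU) => k km; rewrite wr ?km ?sr //; exact: leq_trans km (sl_mn sl).
have [c [c1 c2]] := N_lift (esym hz).
exists c; split; last by rewrite /nmap -compmA c2.
apply: N_mono; rewrite compmA c2.
have ria : compm s (compm r i) = compm s (compm nu a) by rewrite compmA sr -hab /nmap compmA.
have rW : lands r W by apply/(lands_chart infR oW).
apply: (sl_suniq sl) => //; first by rewrite compmA; exact: lands_comp.
move=> k kn; rewrite pull_comp // wr //; case: ifP => km; last first.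
  rewrite -r1i pull_comp //; apply/(lands_chart infR oW); by rewrite sr1.
rewrite (slice_f0 (r := compm nu a) (z := compm (tproj V' n) a) _ km); last by rewrite compmA nu_tgt -compmA.
by rewrite rmorphN -pull_comp // -hab /nmap compmA.
Qed.

Lemma N_gaff : affine (tI IV' n : set (sec [set: N_])).
Proof. exact: (tI_affine n aV'). Qed.
Lemma N_noeth : noetherian_ring (sec [set: N_]).
Proof. exact: (@tow_noetherian V' n v'_noeth). Qed.

Lemma N_qc (Y : formalScheme) (F : mor N_ Y) : quasi_compact F.
Proof. by move=> D oD _; apply: (noeth_compact N_gaff N_noeth) => //; exact: mor_open. Qed.

Let gN : gaff N_. Proof. by exists (tI IV' n); exact: N_gaff. Qed.

(** Two arrows that end in [V'] and share their source have the same first m coordinates, so the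
    fibre product of N with itself over X is (n-m)-space over N, and N is quasi-compact. *)
Lemma N_qs : quasi_separated nmap.
Proof.
pose P2 := ptow N_ (n - m).
pose b0 := compm nmap (tproj N_ (n - m)).
have bU : lands b0 U := lands_comp _ nu_sU.
have mn := sl_mn sl.
have fb k : (k < m)%N -> nil (pull b0 (f k)).
  by move=> km; rewrite pull_comp; [apply: gcomap_nil; exact: N_f|exact: nu_sU].
have [|r [sr wr]] := sl_sex sl (b := b0) (g := fun k => if (k < m)%N then - pull b0 (f k) else tX N_ (n - m) (k - m)) bU.
  move=> k kn; case: ifP => km; last exact: tX_nil.
  move=> p u; have [ip _ _] := vanishing_prime (@fs_local P2) openT (Logic.I : setT p).
  by have := idealN ip (fb k km p); rewrite /vanishing /=; apply.
have rU : lands (compm s r) U by rewrite sr.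
have [z hz] : exists z, compm v' z = compm t r.
  by apply: (slice_to_V rU) => k km; rewrite wr ?km ?sr //; exact: leq_trans km mn.
have [q [q1 q2]] := N_lift (esym hz).
have rW : lands r W by apply/(lands_chart infR oW).
have lift (T : formalScheme) (a b : mor T N_) : compm nmap a = compm nmap b ->
   exists u : mor T P2, compm (tproj N_ (n - m)) u = a /\ compm q u = b.
  move=> E; have bl : lands (compm s (compm nu b)) U by rewrite compmA; exact: lands_comp nu_sU.
  have [|u [u1 u2]] := @tow_hom N_ gN (n - m) T a (fun k => pull (compm nu b) (w (k + m)%N)).
    by move=> k kn; apply: slice_nil => //; lia.
  exists u; split=> //; apply: N_mono; rewrite compmA q2; apply: (sl_suniq sl).
  - by rewrite compmA sr; exact: lands_comp.
  - by rewrite compmA sr /b0 -compmA u1 E /nmap compmA.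
  move=> k kn; rewrite pull_comp // wr //; case: ifP => km.
    rewrite (slice_f0 (r := compm nu b) (z := compm (tproj V' n) b) _ km); last by rewrite compmA nu_tgt -compmA.
    by rewrite rmorphN -pull_comp // /b0 -compmA u1 E /nmap compmA.
  by rewrite u2; [congr (pull _ (w _)); lia|lia].
have [d [d1 d2]] := lift N_ (idm N_) (idm N_) erefl.
exists P2, (tproj N_ (n - m)), q, d; split=> //; last exact: N_qc.
split.
  have -> : compm nmap q = compm s (compm nu q) by rewrite compmA.
  by rewrite q2 sr.
move=> T a b E; have [u [u1 u2]] := lift T a b E; exists u; split=> // u' [u1' u2'].
apply: (tow_hom_uniq gN); first by rewrite u1 u1'.
move=> k kn; have E2 : compm r u = compm r u' by rewrite -q2 -!compmA u2 u2'.
have kmn : (k + m < n)%N by lia.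
have := congr1 (fun r' : mor T R => pull r' (w (k + m)%N)) E2.
by rewrite !pull_comp // wr // ltnNge leq_addl /= addnK.
Qed.

Hypothesis (nX : locally_noetherian X).

Let zs_ex : exists zs : mor V' N_, compm (tproj V' n) zs = idm V' /\
  forall i, (i < n)%N -> global_comap zs (tX V' n i) = 0.
Proof.
apply: (tow_hom gV' (idm V') (g := fun=> 0)) => i _ p.
by have [] := @fs_local V' setT p openT Logic.I.
Qed.

(** [lffp_tower] is applied with [Z] the zero section of N, formed by the unit arrows at [V'], whose
    composite with [nmap] is the closed immersion [v']. *)
Lemma N_formally_fp : formally_fp nmap.
Proof.
split; [|exact: N_qc|exact: N_qs].
have [zs [zs1 zs2]] := zs_ex.
have E : compm nmap zs = v'.
  suff Ez : compm nu zs = compm e v' by rewrite /nmap -compmA Ez compmA src_unit comp1m.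
  apply: (sl_tuniq sl).
  - by rewrite compmA nu_tgt; do 2 apply: lands_comp; exact: v'_lands.
  - by rewrite !compmA nu_tgt tgt_unit comp1m -compmA zs1 compm1.
  by move=> i ni; rewrite pull_comp ?nu_w ?zs2 ?(sl_unit sl) //; [exact: v'_lands|exact: nu_lands].
apply: (@lffp_tower V' N_ X zs nmap U IV (tI IV' n) IV' m f); rewrite ?E //.
- by move=> p; exists setT, (tI IV' n); split=> //; [exact: N_gaff|exact: N_noeth].
- exact: N_gaff.
- exact: nu_sU.
- by move=> b; exact: (@tI_zero V' IV' n zs b (affine_ideal aV') zs1 zs2).
- exact: v'_surj.
move=> a; split; first exact: v'_ker.
move=> [d ->]; rewrite (pullmE v'_lands) rmorph_sum big1 // => i _.
by rewrite rmorphM -!(pullmE v'_lands) v'_f ?mulr0.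
Qed.

Lemma v'_point : exists y' : mor P V', compm v' y' = kappa.
Proof.
apply: v'_lift => // i im; apply/(kap_ker rp aIV Wx).
by have [] := sl_f sl im.
Qed.

(** Arrows between points of [V'] have w_1 = ... = w_m = 0, so the restricted groupoid is
    (n-m)-space over [V'], and its restriction to [x] is the stabiliser. *)
Lemma point_invariant (G : formalScheme) (g : mor G R) (sG tG : mor G P) :
  is_restriction s t kappa g sG tG ->
  exists (RV : formalScheme) (rV : mor RV R) (sV tV : mor RV V') (y' : mor P V'),
    [/\ is_restriction s t v' rV sV tV, compm v' y' = kappa & groupoid_invariant sV tV y'].
Proof.
move=> [G1 G2 univ]; have mn := sl_mn sl; have [y' hy'] := v'_point.
pose RV := ptow V' (n - m); pose sV : mor RV V' := tproj V' (n - m).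
have [|r [sr wr]] := sl_sex sl (b := compm v' sV)
   (g := fun k => if (k < m)%N then 0 else tX V' (n - m) (k - m)) (lands_comp _ v'_lands).
  move=> k kn; case: ifP => km; last exact: tX_nil.
  by move=> p; have [] := @fs_local RV setT p openT Logic.I.
have rU : lands (compm s r) U by rewrite sr; exact: lands_comp v'_lands.
have fs (T : formalScheme) (z : mor T V') k : (k < m)%N -> pull (compm v' z) (f k) = 0.
  by move=> km; rewrite pull_comp ?v'_f ?rmorph0 //; exact: v'_lands.
have rW : lands r W by apply/(lands_chart infR oW).
have [tV htV] : exists z, compm v' z = compm t r.
  by apply: (slice_to_V rU) => k km; rewrite wr ?km ?sr ?fs ?oppr0 //; exact: leq_trans km mn.
have lift (T : formalScheme) (a : mor T R) z z' : compm s a = compm v' z -> compm t a = compm v' z' ->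
   exists u : mor T RV, [/\ compm r u = a, compm sV u = z & compm tV u = z'].
  move=> sa ta; have aU : lands (compm s a) U by rewrite sa; exact: lands_comp v'_lands.
  have [|u [u1 u2]] := @tow_hom V' gV' (n - m) T z (fun k => pull a (w (k + m)%N)).
    by move=> k kn; apply: slice_nil => //; lia.
  have ra : compm r u = a.
    apply: (sl_suniq sl).
    - by rewrite compmA sr; do 2 apply: lands_comp; exact: v'_lands.
    - by rewrite compmA sr -compmA u1.
    move=> k kn; rewrite pull_comp // wr //; case: ifP => km.
      by rewrite (slice_f0 ta km) sa fs // rmorph0 oppr0.
    by rewrite u2; [congr (pull _ (w _)); lia|lia].
  exists u; split=> //; apply: v'_mono; rewrite compmA htV -compmA ra; exact: ta.
have uniq (T : formalScheme) (u u' : mor T RV) : compm r u = compm r u' -> u = u'.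
  move=> E; apply: (tow_hom_uniq gV').
    by apply: v'_mono; rewrite !compmA -sr -!compmA E.
  move=> k kn; have kmn : (k + m < n)%N by lia.
  have := congr1 (fun r' : mor T R => pull r' (w (k + m)%N)) E.
  by rewrite !pull_comp // wr // ltnNge leq_addl /= addnK.
have guniq (T : formalScheme) (u u' : mor T G) : compm g u = compm g u' -> u = u'.
  move=> E; have k1 : compm sG u = compm sG u'.
    by apply: (kap_mono rp aIV Wx mu); rewrite !compmA -G1 -!compmA E.
  have k2 : compm tG u = compm tG u'.
    by apply: (kap_mono rp aIV Wx mu); rewrite !compmA -G2 -!compmA E.
  have [||c [_ hc]] := univ T (compm g u) (compm sG u) (compm tG u).
  - by rewrite !compmA G1.
  - by rewrite !compmA G2.
  by rewrite -(hc u) // -(hc u') // -?E -?k1 -?k2.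
(* An arrow from [x] into [V'] has its first m coordinates equal to [-f(x)], which is 0; by
   [sl_stab] it ends at [x]. *)
have stab (T : formalScheme) (a : mor T R) z z' : compm s a = compm kappa z -> compm t a = compm v' z' ->
   exists z0, compm t a = compm kappa z0.
  move=> sa ta; apply: (sl_stab sl sa) => k km.
  by rewrite (slice_f0 ta km) sa -hy' -compmA fs // oppr0.
exists RV, r, sV, tV, y'; split=> //.
  split=> // T a z z' sa ta; have [u hu] := lift T a z z' sa ta; exists u; split=> // u' [E _ _].
  by apply: uniq; rewrite E; case: hu.
have [||rg [g1 g2 g3]] := lift G g (compm y' sG) (compm y' tG); rewrite ?compmA ?hy' //.
exists G, rg, sG, tG; split.
- split=> // T a z z' sa ta.
  have [||c [[c1 c2 c3] cu]] := univ T (compm r a) z z'.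
  - by rewrite compmA sr -compmA sa compmA hy'.
  - by rewrite compmA -htV -compmA ta compmA hy'.
  exists c; split; last by move=> c' [E _ _]; apply: guniq; rewrite c1 -g1 -compmA E.
  by split=> //; apply: uniq; rewrite compmA g1 c1.
- split=> // T a z sa.
  have sa' : compm s (compm r a) = compm kappa z by rewrite compmA sr -compmA sa compmA hy'.
  have [|z0 hz0] := stab T (compm r a) z (compm tV a) sa'; first by rewrite compmA -htV -compmA.
  have [c [[c1 c2 c3] cu]] := univ T (compm r a) z z0 sa' hz0.
  exists c; split; last by move=> c' [E _]; apply: guniq; rewrite c1 -g1 -compmA E.
  by split=> //; apply: uniq; rewrite compmA g1 c1.
split=> // T z a za.
have ta : compm t (compm r a) = compm kappa z by rewrite compmA -htV -compmA -za compmA hy'.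
have [||z0 hz0] := stab T (compm i_ (compm r a)) z (compm sV a).
- by rewrite compmA src_inv.
- by rewrite compmA tgt_inv compmA sr compmA.
rewrite compmA tgt_inv in hz0.
have [c [[c1 c2 c3] cu]] := univ T (compm r a) z0 z hz0 ta.
exists c; split; last by move=> c' [_ E]; apply: guniq; rewrite c1 -g1 -compmA E.
by split=> //; apply: uniq; rewrite compmA g1 c1.
Qed.

(* Moving along an arrow with w_i = T changes f_i to f_i + T and fixes the other f_k. *)
Lemma deform (i : nat) : (i < m)%N -> exists tau : {rmorphism sec U -> pser (sec U)},
  [/\ forall a, tau a 0%N = a, tau (f i) = pconst (f i) + pX (sec U) &
      forall k, (k < m)%N -> k != i -> tau (f k) = pconst (f k)].
Proof.
move=> im; pose D := fsub oU; pose iD : mor D X := finc oU.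
have lD : lands iD U := finc_lands oU.
have [aD surD _] := closed_pull lD (fsub_closed oU oU (@subset_refl _ _) aIV).
have gD : gaff D by eexists; exact: aD.
pose T := pserF D; pose b0 : mor T X := compm iD (fproj D).
have bU : lands b0 U := lands_comp _ lD.
have [|r [sr wr]] := sl_sex sl (b := b0) (g := fun k => if k == i then gX D else 0) bU.
  move=> k _; case: ifP => _; first exact: gX_nil.
  by move=> p; have [] := @fs_local T setT p openT Logic.I.
have rU : lands (compm s r) U by rewrite sr.
have tU : lands (compm t r) U by apply/lands_src.
have bij : bijective (pullm lD).
  have /choice [g hg] := surD; exists g => a; last by rewrite -(pullmE lD) hg.
  apply/subr0_eq; apply: (finc_inj aIV (oD := oU)).
  by rewrite pullB // hg (pullmE lD) subrr.
have [g k1 k2] := bij.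
have gB : zmod_morphism g by move=> a b; apply: (can_inj k1); rewrite rmorphB !k2.
have gM : monoid_morphism g by split=> [|a b]; apply: (can_inj k1); rewrite ?rmorph1 ?rmorphM !k2.
pose gr := HB.pack_for {rmorphism sec [set: D] -> sec U} g
  (GRing.isZmodMorphism.Build (sec [set: D]) (sec U) g gB) (GRing.isMonoidMorphism.Build (sec [set: D]) (sec U) g gM).
pose pt : {rmorphism sec U -> pserT (sec [set: D])} := pullm tU.
pose tau : {rmorphism sec U -> pser (sec U)} := GRing.RMorphism.clone _ _ (pmap gr \o pt) _.
have fE k : (k < m)%N -> pullm tU (f k) = global_comap (fproj D) (pullm lD (f k)) + (if k == i then gX D else 0).
  move=> km; have e1 := sl_delta sl (r := r) rU km; rewrite wr ?(leq_trans km (sl_mn sl)) // in e1.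
  have e2 : pull (compm s r) (f k) = global_comap (fproj D) (pullm lD (f k)) by rewrite sr /b0 pull_comp // (pullmE lD).
  by rewrite e1 -e2 -(pullmE tU) addrC subrK.
have tf k : (k < m)%N -> tau (f k) = pconst (f k) + (if k == i then pX (sec U) else 0).
  move=> km; rewrite -[tau (f k)]/(pmap gr (pullm tU (f k))) fE //.
  apply: etrans (rmorphD (pmap gr) (pconst (pullm lD (f k))) (if k == i then pX _ else 0)) _.
  have eC : pmap gr (pconst (pullm lD (f k))) = pconst (f k) by rewrite pmap_const -[gr _]/(g _) k1.
  have eX : pmap gr (if k == i then pX (sec [set: D]) else 0) = (if k == i then pX (sec U) else 0).
    by case: eqP => _; [exact: pmap_X|exact: (rmorph0 (pmap gr))].
  exact: (congr2 +%R eC eX).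
exists tau; split.
- have [|zs [zs1 zs2]] := @pser_hom D D (idm D) 0 gD.
    by move=> p; have [] := @fs_local D setT p openT Logic.I.
  have E : compm r zs = compm e iD.
    apply: (sl_suniq sl).
    - by rewrite compmA sr; do 2 apply: lands_comp.
    - by rewrite !compmA sr src_unit comp1m /b0 -compmA zs1 compm1.
    move=> k kn; have rW : lands r W by apply/(lands_chart infR oW).
    rewrite pull_comp // wr // (sl_unit sl) //.
    by case: eqP => _; rewrite ?zs2 ?rmorph0.
  have key : forall b : sec [set: T], global_comap zs b = (b : pser (sec [set: D])) 0%N.
    move=> b; rewrite {1}[b](pser_recl (b : pser (sec [set: D]))).
    rewrite (rmorphD (global_comap zs)) (rmorphM (global_comap zs)) [global_comap zs (pX _)]zs2 mul0r addr0.
    by rewrite -gcomap_fproj -gcomapM zs1.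
  move=> a; rewrite -[tau a 0%N]/(g ((pullm tU a : pser (sec [set: D])) 0%N)) -key -(pullmE tU).
  rewrite -pull_comp // -compmA E compmA tgt_unit comp1m (pullmE lD); exact: k1.
- by rewrite tf // eqxx.
by move=> k km ki; rewrite tf // (negPf ki) addr0.
Qed.

Lemma transversal_lci : local_complete_intersection v'.
Proof.
have lD : lands (finc oU) U := finc_lands oU.
have [aD surD _] := closed_pull lD (fsub_closed oU oU (@subset_refl _ _) aIV).
split.
  have [i hi] := finc_lift oU aIV v'_lands.
  exists (fsub oU), (finc oU), i; split=> //; first exact: rinc_open_immersion.
  move=> p; exists setT, openT, (ideal_span ([eta pull (finc oU) (V := U)] @` IV)).
  split=> //; split=> //.
    have <- : IV' = ideal_span (global_comap i @` ideal_span ([eta pull (finc oU) (V := U)] @` IV)).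
      have -> : [eta pull (finc oU) (V := U)] @` IV = pullm lD @` IV.
        by apply/seteqP; split=> _ [a Ia <-]; exists a => //=; rewrite (pullmE lD).
      rewrite span_map_map /IV'; congr ideal_span; apply/seteqP.
      by split=> _ [a Ia <-]; exists a => //=; rewrite -hi pull_comp // (pullmE lD).
    exact: aV'.
  move=> c; have [a <-] := v'_surj c; exists (pull (finc oU) a).
  by rewrite -hi pull_comp.
move=> p; exists U, oU, IV, m, (fun i => f i); split.
- by case: v'_lands => _; apply.
- exact: v'_closed.
- have [im m1 _] := chart_primem ch; split.
    move=> h1; apply: m1; apply: (span_min im _ h1) => _ [i _ <-].
    by have [] := sl_f sl (ltn_ord i).
  move=> i a prev; rewrite -/(ideal_span prev); set Q := ideal_span prev => Qa.
  have iQ : is_ideal Q := span_ideal _.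
  have [tau [t0 ti tk]] := deform (ltn_ord i).
  pose g l := tau a l.
  (* [tau] fixes the generators of [Q], so the coefficients of [tau (f i * a)] lie in [Q]; this is
     the coefficient of T^l, as [tau (f i)] is [f i] + T. *)
  have coef l : Q (f i * g l + (if l is l'.+1 then g l' else 0)).
    have -> : f i * g l + (if l is l'.+1 then g l' else 0) = tau (f i * a) l.
      rewrite rmorphM ti mulrDl pserD pconstM pXM; by case: l.
    have iQl : is_ideal [set b | forall l, Q (tau b l)].
      split=> [l'|b c hb hc l'|c b hb l'].
      - by rewrite rmorph0 pser0; exact: (ideal0 iQ).
      - by rewrite rmorphD pserD; exact: (idealD iQ).
      by rewrite rmorphM pserM; apply: (@ideal_sum _ Q _ _ _ _ iQ) => k _; exact: (idealM _ iQ (hb _)).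
    apply: (span_min iQl _ Qa l) => _ [k ki ->] l'.
    rewrite (tk k (ltn_ord k)) ?neq_ltn ?ki //; case: l' => [|l'] /=; last exact: (ideal0 iQ).
    by apply: subspan; exists k.
  (* Iterating the relations between consecutive coefficients, from the constant coefficient [a] of
     [tau a]. *)
  have step l : Q (a - (-1) ^+ l * f i ^+ l * g l).
    elim: l => [|l IH]; first by rewrite !expr0 !mul1r /g t0 subrr; exact: (ideal0 iQ).
    have -> : a - (-1) ^+ l.+1 * f i ^+ l.+1 * g l.+1 = (a - (-1) ^+ l * f i ^+ l * g l) +
      ((-1) ^+ l * f i ^+ l) * (f i * g l.+1 + g l) by rewrite !exprS; ring.
    by apply: (idealD iQ IH); exact: (idealM _ iQ (coef l.+1)).
  (* The colon ideals (Q : f_i^l) become stationary at some N. As [f i * a] is in [Q], [step] puts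
     [g N] into the (N+1)-st, hence into the N-th, and [step] at N then gives [a] in [Q]. *)
  pose ann l := [set z | Q (f i ^+ l * z)].
  have ia l : is_ideal (ann l).
    split=> [|b c|c b]; rewrite /ann /=; first by rewrite mulr0; exact: (ideal0 iQ).
      by move=> hb hc; rewrite mulrDr; exact: (idealD iQ).
    by move=> hb; rewrite mulrCA; exact: (idealM _ iQ).
  have [|N hN] := noetherian_chain (chart_noeth ch) ia.
    by move=> l z; rewrite /ann /= exprS -mulrA => hz; exact: (idealM _ iQ).
  have annN : ann N.+1 (g N).
    rewrite /ann /= exprS -mulrA.
    have -> : f i * (f i ^+ N * g N) = (-1) ^+ N * (f i * a - f i * (a - (-1) ^+ N * f i ^+ N * g N)).
      have h1 : (-1) ^+ N * (-1) ^+ N = 1 :> sec U by rewrite -exprD addnn -mul2n exprM sqrrN !expr1n.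
      by ring: h1.
    by apply: (idealM _ iQ); apply: (idealB iQ Qa); exact: (idealM _ iQ (step N)).
  rewrite (hN N.+1 (leqnSn N)) in annN.
  have -> : a = (a - (-1) ^+ N * f i ^+ N * g N) + (-1) ^+ N * (f i ^+ N * g N) by ring.
  by apply: (idealD iQ (step N)); exact: (idealM _ iQ annN).
have [_ _ kr] := closed_pull v'_lands v'_closed.
apply/seteqP; split=> a.
  move=> /kr /v'_ker [d ->]; apply: (@ideal_sum _ (ideal_span _) _ _ _ _ (span_ideal _)) => i _.
  by apply: (@idealM _ (ideal_span _) _ _ (span_ideal _)); apply: subspan; exists i.
have iK : is_ideal [set a | comap v' oU a = 0] := preim_ideal (comap v' oU) (set0_ideal _).
by apply: (span_min iK) => _ [i _ <-]; apply/kr; exact: v'_f.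
Qed.

(** * One-point X: statements (D) and (E) *)

Section OnePoint.
Hypothesis (xs : forall x' : X, x' = x).
Let lU (T : formalScheme) (b : mor T X) : lands b U.
Proof. by split=> // p _; rewrite /preimage /= (xs (b p)). Qed.
Let lW (T : formalScheme) (r : mor T R) : lands r W. Proof. exact/(lands_chart infR oW). Qed.
Let mn i : (i < m)%N -> (i < n)%N. Proof. by move=> im; exact: leq_trans im (sl_mn sl). Qed.
Let eU : U = setT. Proof. by apply/seteqP; split=> // p _; rewrite (xs p). Qed.

Lemma single_affine : exists2 I : set (sec [set: X]), affine I & noetherian_ring (sec [set: X]).
Proof.
have aux (D : set X) (I : set (sec D)) : D = setT -> affine I -> noetherian_ring (sec D) ->
    exists2 I : set (sec [set: X]), affine I & noetherian_ring (sec [set: X]).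
  by move=> eD; subst D; exists I.
exact: (aux U IV eU aIV (chart_noeth ch)).
Qed.
Let gX_ : gaff X. Proof. by have [I aI _] := single_affine; exists I. Qed.

Let nf (T : formalScheme) (b : mor T X) i : (i < m)%N -> nil (pull b (f i)).
Proof.
by move=> im p /(pull_unit (f i) p (lU b)); rewrite (xs (b p)); have [h1 _] := sl_f sl im; exact: h1.
Qed.
Let nfN (T : formalScheme) (b : mor T X) k : nil (if (k < m)%N then - pull b (f k) else 0).
Proof.
case: ifP => km p; last by have [] := @fs_local T setT p openT Logic.I.
move=> u; have [ip _ _] := vanishing_prime (@fs_local T) openT (Logic.I : setT p).
by have := idealN ip (@nf T b k km p); rewrite /vanishing /=; apply.
Qed.

(* The arrow moving a point a of X to V, with coordinates (-f(a), 0). *)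
Lemma to_V_ex : exists (rho : mor X R) (u : mor X V'),
  [/\ compm s rho = idm X, compm t rho = compm v' u &
      forall k, (k < n)%N -> pull rho (w k) = if (k < m)%N then - pull (idm X) (f k) else 0].
Proof.
have [|rho [sr wr]] := sl_sex sl (b := idm X) (g := fun k => if (k < m)%N then - pull (idm X) (f k) else 0) (lU _).
  by move=> k _; exact: nfN.
have [u hu] : exists u, compm v' u = compm t rho.
  by apply: slice_to_V => // k km; rewrite wr ?mn // km sr.
by exists rho, u.
Qed.

Variables (rho : mor X R) (u : mor X V').
Hypotheses (sr : compm s rho = idm X) (tr : compm t rho = compm v' u)
  (wr : forall k, (k < n)%N -> pull rho (w k) = if (k < m)%N then - pull (idm X) (f k) else 0).

(** The first m coordinates of an arrow into [V'] are minus the values of the [f i] at its source,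
    so the arrow has the source and the coordinates of [rho] there. *)
Let rhoE (T : formalScheme) (r : mor T R) z : compm t r = compm v' z ->
  (forall k, (k < n)%N -> ~~ (k < m)%N -> pull r (w k) = 0) -> compm rho (compm s r) = r.
Proof.
move=> tz hz; apply: (sl_suniq sl); [exact: lU|by rewrite compmA sr comp1m|].
move=> k kn; rewrite pull_comp // wr //; case: ifPn => km; last by rewrite rmorph0 hz.
by rewrite rmorphN -pull_comp // comp1m (slice_f0 tz km).
Qed.

Lemma u_split : compm u v' = idm V'.
Proof.
have ts : compm s (compm e v') = v' by rewrite compmA src_unit comp1m.
have tt : compm t (compm e v') = v' by rewrite compmA tgt_unit comp1m.
have E : compm rho v' = compm e v'.
  rewrite -[in LHS]ts; apply: (@rhoE V' (compm e v') (idm V')); first by rewrite tt compm1.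
  by move=> k kn _; rewrite (sl_unit sl) // ; exact: v'_lands.
by apply: v'_mono; rewrite compmA -tr -compmA E tt compm1.
Qed.

(** Smoothness of [t] lifts the arrow [rho] at [a] to one ending at [b]. Setting its coordinates
    from m on to 0 keeps the target, and then by [rhoE] the arrow is [rho] at its source, which [u]
    therefore sends to [b]. *)
Lemma u_smooth : formally_smooth u.
Proof.
move=> T0 T i a b aT ci ni hab.
have [|r [r1 r2]] := tgt_smooth smR aT ci ni (a := compm rho a) (b := compm v' b).
  by rewrite compmA tr -!compmA hab.
have [|r' [tr' wr']] := sl_tex sl (b := compm v' b) (g := fun k => if (k < m)%N then pull r (w k) else 0) (lU _).
  by move=> k kn; case: ifP => _; [exact: slice_nil|move=> p; have [] := @fs_local T setT p openT Logic.I].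
have E : compm rho (compm s r') = r'.
  by apply: (rhoE (z := b)) => // k kn km; rewrite wr' // (negPf km).
exists (compm s r'); split; last by apply: v'_mono; rewrite compmA -tr -compmA E.
have -> : a = compm s (compm rho a) by rewrite compmA sr comp1m.
rewrite -compmA; congr (compm _ _); apply: (sl_tuniq sl); first exact: lU.
  by rewrite compmA tr' compmA tr -!compmA hab.
move=> k kn; rewrite !pull_comp // wr' // wr //; case: ifP => km; last by rewrite !rmorph0.
by rewrite -pull_comp // r1 pull_comp // wr // km.
Qed.

Let chi_ex : exists chi : mor X (ptow V' m), compm (tproj V' m) chi = u /\
  forall k, (k < m)%N -> global_comap chi (tX V' m k) = pull (idm X) (f k).
Proof. by apply: tow_hom => // k km; exact: nf. Qed.
Definition chi := sval (cid chi_ex).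
Lemma chi_proj : compm (tproj V' m) chi = u. Proof. by have [] := svalP (cid chi_ex). Qed.
Lemma chi_X k : (k < m)%N -> global_comap chi (tX V' m k) = pull (idm X) (f k).
Proof. by have [_] := svalP (cid chi_ex); apply. Qed.

(** The inverse sends (z, T) to the source of the arrow that ends at z and has coordinates (-T,
    0). *)
Lemma chi_iso : is_iso chi.
Proof.
have [|r [tr' wr']] := sl_tex sl (b := compm v' (tproj V' m))
   (g := fun k => if (k < m)%N then - tX V' m k else 0) (lU _).
  move=> k kn; case: ifP => km p; last by have [] := @fs_local (ptow V' m) setT p openT Logic.I.
  move=> h0; have [ip _ _] := vanishing_prime (@fs_local (ptow V' m)) openT (Logic.I : setT p).
  by have := idealN ip (@tX_nil V' m k p); rewrite /vanishing /=; apply.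
have fr k : (k < m)%N -> pull (compm s r) (f k) = tX V' m k.
  by move=> km; have := slice_f0 tr' km; rewrite wr' ?mn // km => /eqP; rewrite eqr_opp => /eqP.
have E : compm rho (compm s r) = r by apply: (rhoE tr') => k kn km; rewrite wr' // (negPf km).
exists (compm s r); split.
  apply: (tow_hom_uniq gV').
    rewrite compm1 compmA chi_proj; apply: v'_mono; by rewrite compmA -tr -compmA E.
  move=> k km; rewrite gcomapM chi_X // -pull_comp // comp1m fr //.
have E2 : compm r chi = rho.
  apply: (sl_tuniq sl); first exact: lU.
    by rewrite compmA tr' -compmA chi_proj tr.
  move=> k kn; rewrite pull_comp // wr' // wr //; case: ifP => km; last by rewrite rmorph0.
  by rewrite rmorphN chi_X.
by rewrite -compmA E2 sr.
Qed.

Lemma u_formally_fp : formally_fp u.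
Proof.
have [I aI nI] := single_affine; have [psi [cp1 cp2]] := chi_iso.
have qcX (Y : formalScheme) (F : mor X Y) : quasi_compact F.
  by move=> D oD _; apply: (noeth_compact aI nI) => //; exact: mor_open.
split=> //; last first.
  (* Through [chi], the fibre product of X with itself over [V'] is m-space over X; the second
     projection keeps [u] and takes the free coordinates as the values of the [f i]. *)
  have [|k [k1 k2]] := @tow_hom V' gV' m (ptow X m) (compm u (tproj X m)) (tX X m).
    by move=> i _; exact: tX_nil.
  pose q := compm psi k.
  have cq : compm chi q = k by rewrite compmA cp1 comp1m.
  have lift (T : formalScheme) (a b : mor T X) : compm u a = compm u b ->
      exists c : mor T (ptow X m), compm (tproj X m) c = a /\ compm q c = b.
    move=> E; have [|c [c1 c2]] := @tow_hom X gX_ m T a (fun i => pull b (f i)).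
      by move=> i im; exact: nf.
    exists c; split=> //; have -> : b = compm psi (compm chi b) by rewrite compmA cp2 comp1m.
    rewrite /q -compmA; congr (compm _ _); apply: (tow_hom_uniq gV').
      by rewrite compmA k1 -compmA c1 E compmA chi_proj.
    by move=> i im; rewrite !gcomapM k2 // c2 // chi_X // -pull_comp // comp1m.
  have [d [d1 d2]] := lift X (idm X) (idm X) erefl.
  exists (ptow X m), (tproj X m), q, d; split=> //.
  split; first by rewrite -[in RHS]chi_proj -compmA cq k1.
  move=> T a b E; have [c [c1 c2]] := lift T a b E; exists c; split=> // c' [c1' c2'].
  apply: (tow_hom_uniq gX_); first by rewrite c1 c1'.
  move=> i im; rewrite -!k2 // -!gcomapM; congr (global_comap _ _).
  have kq (d' : mor T (ptow X m)) : compm k d' = compm chi (compm q d') by rewrite compmA cq.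
  by rewrite !kq c2 c2'.
pose Jt := tI IV' m; have aJt : affine Jt := tI_affine m aV'.
have ic : open_immersion chi := iso_open_immersion chi_iso.
have rT : [set: ptow V' m] `<=` range chi.
  by move=> p _; exists (psi p) => //; have := congr1 (fun F : mor (ptow V' m) (ptow V' m) => F p) cp1.
have aJ := open_pull openT ic (@fs_local X) rT aJt.
have chi_v : compm (tproj V' m) (compm chi v') = idm V' by rewrite compmA chi_proj u_split.
have chi_v0 i : (i < m)%N -> global_comap (compm chi v') (tX V' m i) = 0.
  by move=> im; rewrite gcomapM chi_X // -pull_comp // comp1m v'_f.
have gp b : global_comap chi (global_comap psi b) = b by rewrite -gcomapM cp2.
have pg b : global_comap psi (global_comap chi b) = b by rewrite -gcomapM cp1.
apply: (@lffp_tower V' X V' v' u setT IV' (ideal_span (comap chi openT @` Jt)) IV' 0 (fun=> 0)) => //.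
- by move=> p; exists setT, IV'; split=> //; [exact: aV'|exact: v'_noeth].
- exact: aV'.
- exact: landsT.
- move=> b; apply: (@iff_trans _ (Jt (global_comap psi b))).
    rewrite spanE; last first.
      apply: (im_ideal (f := comap chi openT)) (affine_ideal aJt) => c; exists (global_comap psi c); exact: gp.
    split=> [[c Jc <-]|Jb]; last by exists (global_comap psi b) => //; exact: gp.
    by rewrite -[comap chi openT c]/(global_comap chi c) pg.
  apply: iff_trans (@tI_zero V' IV' m _ (global_comap psi b) (affine_ideal aV') chi_v chi_v0) _.
  by rewrite gcomapM gp.
- rewrite u_split; have -> : [eta pull (idm V') (V := setT)] @` IV' = IV'.
    by apply/seteqP; split=> [_ [c Ic <-]|c Ic]; [rewrite pull_gcomap|exists c; rewrite ?pull_gcomap].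
  by rewrite spanE //; exact: affine_ideal aV'.
- by move=> c; exists c; rewrite u_split pull_gcomap.
by move=> c; rewrite u_split pull_gcomap; split=> [c0|[d ->]]; [exists (fun=> 0)|]; rewrite big_ord0.
Qed.

Lemma u_retraction : smooth_retraction s t v' u.
Proof. by split; [exact: u_smooth|exact: u_formally_fp|exists rho|exact: u_split]. Qed.

Lemma trivial_stabiliser (G : formalScheme) (g : mor G R) (sG tG : mor G P) :
  is_restriction s t kappa g sG tG -> is_iso sG ->
  to_quotient_has s t v' (fun N f => is_iso f) /\ exists! u : mor X V', smooth_retraction s t v' u.
Proof.
move=> [G1 G2 univ] [sG' [i1 i2]].
have [[aP [n1 un]] _ _] := rp; have gP : gaff P by eexists; exact: aP.
have nm : (n <= m)%N.
  (* If m < n, the arrow out of [x] over power series in T whose only nonzero coordinate is w_m = T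
     (indices from 0) lies in the stabiliser; triviality makes it a unit arrow, so T = 0. *)
  rewrite leqNgt; apply/negP => mltn; pose T := pserF P; pose b := compm kappa (fproj P).
  have [|r [sr' wr']] := sl_sex sl (b := b) (g := fun k => if k == m then gX P else 0) (lU _).
    by move=> k _; case: eqP => _; [exact: gX_nil|move=> p; have [] := @fs_local T setT p openT Logic.I].
  have [z' hz'] : exists z', compm t r = compm kappa z'.
    by apply: (sl_stab sl sr') => k km; rewrite wr' ?mn // ltn_eqF.
  have [c [[c1 c2 _] _]] := univ T r (fproj P) z' sr' hz'.
  have [||c' [[c1' c2' _] _]] := univ T (compm e b) (fproj P) (fproj P).
  - by rewrite compmA src_unit comp1m.
  - by rewrite compmA tgt_unit comp1m.
  have cc : c = c' by rewrite -[c]comp1m -[c']comp1m -i2 -!compmA c2 c2'.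
  have e1 := wr' m mltn; rewrite eqxx -c1 cc c1' (sl_unit sl) // in e1.
  by have := congr1 (fun q : pser (sec [set: P]) => q 1%N) e1 => /esym; exact: n1.
split; last first.
  exists u; split; first exact: u_retraction.
  move=> u' [_ _ [rho' [sr' tr']] _]; apply: v'_mono; rewrite -tr -tr'; congr (compm _ _).
  have := rhoE (r := rho') tr'; rewrite sr' compm1; apply.
  by move=> k kn /negP []; exact: leq_trans kn nm.
exists N_, (tproj V' n), nu; split; first exact: N_pullback.
have [th [th1 th2]] := N_lift tr.
exists th; split; first by rewrite -compmA th2.
apply: N_mono; rewrite compmA th2 compm1; apply: rhoE nu_tgt _.
by move=> k kn /negP []; exact: leq_trans kn nm.
Qed.

End OnePoint.
End Transversal.

(** * Unipotent endomorphisms are automorphisms *)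

Section Unipotent.
Variables (X : formalScheme) (I : set (sec [set: X])) (aI : affine I) (nA : noetherian_ring (sec [set: X]))
  (E : set (sec [set: X])) (Phi : mor X X).
Let ph := global_comap Phi.
Let F := ideal_span E.
Hypotheses (nE : forall a, E a -> nil a) (fE : forall a, E a -> ph a = a)
  (df : forall a, F (ph a - a)).
Let iF : is_ideal F := span_ideal E.

(** [ph - id] maps everything into [F] and, because [ph] fixes the generators, [F] into its square;
    the twisted Leibniz rule carries this on to all powers. *)
Let phF k a : ideal_pow F k a -> ideal_pow F k.+1 (ph a - a).
Proof.
elim: k a => [|k IH] a; first by move=> _; apply: sub_pow1; exact: df.
have i2 := pow_ideal F k.+2.
have F2 b : F b -> ideal_pow F 2 (ph b - b).
  move=> [n [c [g0 [hg ->]]]]; have i1 := pow_ideal F 2.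
  rewrite rmorph_sum -sumrB; apply: (@ideal_sum _ _ _ _ _ _ i1) => i _.
  have -> : ph (c i * g0 i) - c i * g0 i = (ph (c i) - c i) * g0 i by rewrite rmorphM (fE (hg i)); ring.
  apply: (@powD _ F 1 1); apply: sub_pow1; first exact: df.
  exact: subspan.
move=> [n [c [g0 [hg ->]]]].
rewrite rmorph_sum -sumrB; apply: (@ideal_sum _ _ _ _ _ _ i2) => i _.
have [b [d [Fb Fd ->]]] := hg i.
have Q : ideal_pow F k.+2 (ph (b * d) - b * d).
  have -> : ph (b * d) - b * d = ph b * (ph d - d) + (ph b - b) * d by rewrite rmorphM; ring.
  apply: (idealD i2); last exact: (@powD _ F 2 k) (F2 b Fb) Fd.
  apply: (@powD _ F 1 k.+1) (IH d Fd); apply: sub_pow1.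
  have -> : ph b = (ph b - b) + b by ring.
  by apply: (idealD iF) => //; exact: df.
have -> : ph (c i * (b * d)) - c i * (b * d) = ph (c i) * (ph (b * d) - b * d) + (ph (c i) - c i) * (b * d).
  by rewrite rmorphM; ring.
apply: (idealD i2); first exact: (idealM _ i2).
apply: (@powD _ F 1 k.+1); first by apply: sub_pow1; exact: df.
by apply: (@powD _ F 1 k) => //; exact: sub_pow1.
Qed.

Let ph_inj a : ph a = 0 -> a = 0.
Proof.
move=> a0; have Fk k : ideal_pow F k a.
  elim: k => [//|k /phF]; rewrite a0 sub0r => /(idealN (pow_ideal F k.+1)).
  by rewrite opprK.
apply: (tz_cst openT).
have nF b : F b -> nil (idfun b) := @nil_span X setT openT E nE b.
exact: (@nil_tz_ideal X _ F idfun (fun=> a) (nA iF) nF (fun N => ex_intro _ 0%N (fun k _ => Fk N))).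
Qed.

(** The elements of [E] are adjoined to [I] to give an ideal of definition [J] that the image of [J]
    under [ph] generates; [ph] is the identity modulo [J], so [complete_surj] applies. Injectivity
    is [phF]: an element of the kernel lies in all powers of [F]. *)
Lemma unipotent_iso : is_iso Phi.
Proof.
pose J := ideal_span (I `|` E); have iJ : is_ideal J := span_ideal _.
have FJ : F `<=` J by apply: span_min => // a Ea; apply: subspan; right.
have nJ a : J a -> nil a.
  by apply: (nil_span openT) => b [/(affine_open_nil aI)|/nE].
have aJ : affine J.
  have jn a : J a -> exists k, I (a ^+ k).
    by move=> Ja; have [k] := affine_nil aI (nJ a Ja) 1; rewrite (pow1 (affine_ideal aI)); exists k.
  have IJ : ideal_pow I 1 `<=` J.
    by move=> a /(pow1_sub (affine_ideal aI)) Ia; apply: subspan; left.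
  have [b hb] := fg_pow_nil (nA iJ) (affine_ideal aI) jn.
  exact: (affine_change aI (nA iJ) (a := 1) IJ hb).
have phJ a : J a -> J (ph a).
  move=> Ja; have -> : ph a = (ph a - a) + a by ring.
  by apply: (idealD iJ) => //; apply: FJ; exact: df.
have JE : J = ideal_span (ph @` J).
  have iS := span_ideal (ph @` J).
  apply/seteqP; split; last by apply: span_min => // _ [a Ja <-]; exact: phJ.
  have FS : F `<=` ideal_span (ph @` J).
    apply: span_min => // a Ea; apply: subspan; exists a; last exact: fE.
    by apply: subspan; right.
  apply: span_min => // a [Ia|Ea]; last by apply: FS; exact: subspan.
  have -> : a = ph a - (ph a - a) by ring.
  apply: (idealB iS); last by apply: FS; exact: df.
  by apply: subspan; exists a => //; apply: subspan; left.
have cJ := affine_complete aJ.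
have sur : forall b, exists a, ph a = b.
  apply: (complete_surj iJ iJ cJ cJ.1 JE) => b; exists b.
  by rewrite -opprB; apply: (idealN iJ); apply: FJ; exact: df.
have sur' (b : sec [set: X]) : exists a : sec [set: X], pull Phi a = b.
    by have [a <-] := sur b; exists a; rewrite pull_gcomap.
have JS : ideal_pow J 1 `<=` ideal_span ([eta pull Phi (V := setT)] @` J).
  have -> : [eta pull Phi (V := setT)] @` J = ph @` J.
    by apply/seteqP; split=> _ [c Jc <-]; exists c; rewrite ?pull_gcomap.
  by rewrite -JE; exact: pow1_sub.
have kr (c : sec [set: X]) : pull Phi c = 0 -> pull (idm X) c = 0.
  by rewrite !pull_gcomap => /ph_inj ->; rewrite rmorph0.
have [r Pr] := closed_lift aJ (landsT Phi) aJ sur' JS (landsT (idm X)) kr.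
exists r; split=> //; apply: (closed_mono (landsT Phi) aJ sur').
by rewrite compmA Pr comp1m compm1.
Qed.
End Unipotent.

(** * The product decomposition (F) *)

Section Product.
Variables (S X : formalScheme) (strX : mor X S) (R : groupoid strX) (x : X).
Local Notation s := (src R).
Local Notation t := (tgt R).
Local Notation e := (unit_arr R).
Hypothesis (infR : infinitesimal R).
Variables (P V Vh Xh L : formalScheme) (kappa : mor P X)
  (h : mor Xh X) (v : mor V X) (y : V) (hv : mor Vh V).
Hypotheses (rp : residue_point x kappa).
Variables (W : set R) (oW : open W) (IV : set (sec (e @^-1` W))) (m n : nat)
  (f : nat -> sec (e @^-1` W)) (w : nat -> sec W).
Hypotheses (gm : @geom _ _ _ R x V Vh Xh v y h hv W oW IV)
  (sl : @slice _ _ _ R x P V kappa v W oW m n f w)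
  (ker : forall a, comap v (mor_open e oW) a = 0 ->
        exists d : nat -> sec (e @^-1` W), a = \sum_(i < m) d i * f i)
  (xs : forall x' : X, x' = x).
Let U := e @^-1` W.
Let oU : open U := mor_open e oW.
Let lU (T : formalScheme) (b : mor T X) : lands b U.
Proof. by split=> // p _; rewrite /preimage /= (xs (b p)); case: gm => -[]. Qed.
Let eU : U = setT. Proof. by apply/seteqP; split=> // p _; case: (lU (idm X)) => _; apply. Qed.
Local Notation V1 := (V' (R := R) v oW).
Local Notation v1 := (v' (R := R) v oW).
Let gV : gaff V1. Proof. by eexists; exact: (aV' gm). Qed.
Let g i : sec [set: X] := pull (idm X) (f i).
Let nf i : (i < m)%N -> nil (g i).
Proof.
by move=> im p /(pull_unit (f i) p (lU (idm X))); rewrite (xs (idm X p)); have [h1 _] := sl_f sl im; exact: h1.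
Qed.
Let gE (T : formalScheme) (b : mor T X) i : global_comap b (g i) = pull b (f i).
Proof. by rewrite /g -pull_comp // comp1m. Qed.
Let v1_g i : (i < m)%N -> pull v1 (f i) = 0. Proof. exact: (v'_f sl). Qed.

Variable u : mor X V1.
Hypothesis uv : compm u v1 = idm V1.
Let c_ := chi gm sl xs u.
Let cp : compm (tproj V1 m) c_ = u := chi_proj gm sl xs u.
Let cX k : (k < m)%N -> global_comap c_ (tX V1 m k) = g k. Proof. exact: chi_X. Qed.

Lemma retraction_chi_iso : is_iso c_.
Proof.
have [rho0 [u0 [sr0 tr0 wr0]]] := to_V_ex infR gm sl ker xs.
have [psi0 [q1 q2]] := chi_iso infR gm sl xs sr0 tr0 wr0.
have uv0 := u_split infR gm sl xs sr0 tr0 wr0.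
set c0 := chi gm sl xs u0 in q1 q2.
have cX0 k : (k < m)%N -> global_comap c0 (tX V1 m k) = g k by exact: chi_X.
have cp0 : compm (tproj V1 m) c0 = u0 := chi_proj gm sl xs u0.
pose Phi := compm psi0 c_.
(* Both identifications send [V'] to the zero section, since both retractions are split by [v1]. So
   [Phi] moves functions only by functions vanishing on [V'], that is, by combinations of the
   [f i]. *)
have Pv : compm Phi v1 = v1.
  have -> : compm Phi v1 = compm psi0 (compm c_ v1) by rewrite compmA.
  have -> : compm c_ v1 = compm c0 v1.
    apply: (tow_hom_uniq gV); first by rewrite [LHS]compmA [RHS]compmA cp cp0 uv uv0.
    by move=> k km; rewrite !gcomapM cX // cX0.
  by rewrite compmA q2 comp1m.
pose E : set (sec [set: X]) := [set a | exists2 i, (i < m)%N & a = g i].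
have c0P : compm c0 Phi = c_ by rewrite compmA q1 comp1m.
have fE a : E a -> global_comap Phi a = a.
  move=> [i im ->]; rewrite -[in LHS]cX0 // -gcomapM c0P; exact: cX.
have sur (c : sec [set: X]) : exists c' : sec U, pull (idm X) c' = c.
  have aux (D : set X) : D = setT -> exists c' : sec D, pull (idm X) c' = c.
    by move=> ->; exists c; rewrite pull_gcomap.
  exact: aux eU.
have df a : ideal_span E (global_comap Phi a - a).
  have [c hc] := sur (global_comap Phi a - a).
  have vc : pull v1 c = 0.
    by rewrite -(comp1m v1) pull_comp // hc rmorphB -gcomapM Pv subrr.
  have [d dE] := v'_ker gm ker vc; rewrite -hc dE (pullmE (lU (idm X))) rmorph_sum.
  have iE := span_ideal E; apply: (@ideal_sum _ _ _ _ _ _ iE) => i _.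
  rewrite rmorphM -!(pullmE (lU (idm X))); apply: (idealM _ iE); apply: subspan.
  by exists i.
have [I aI nI] := single_affine gm xs.
have [r [r1 r2]] : is_iso Phi.
  by apply: (unipotent_iso aI nI _ fE df) => _ [i im ->]; exact: nf.
exists (compm r psi0); split.
  have -> : compm c_ (compm r psi0) = compm c0 (compm (compm Phi r) psi0).
    by rewrite -c0P !compmA.
  by rewrite r1 comp1m.
have -> : compm (compm r psi0) c_ = compm r Phi by rewrite compmA.
exact: r2.
Qed.

Variables (lam : mor P L) (l : mor L X) (zeta : mor (ptow P m) X) (m0 : mor (ptow P m) L) (sigma : mor S P).
Hypotheses (gP : gaff P) (zf : forall i, (i < m)%N -> pull zeta (f i) = tX P m i)
  (pz : compm strX zeta = compm (compm strX kappa) (tproj P m))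
  (m0i : is_iso m0) (lm0 : compm l m0 = zeta) (llam : compm l lam = kappa)
  (linv : forall (T : formalScheme) (r : mor T R) (a : mor T L), compm s r = compm l a ->
     exists a', compm t r = compm l a')
  (sig1 : compm (compm strX kappa) sigma = idm S)
  (sig2 : compm sigma (compm strX kappa) = idm P)
  (ov : over_quotient s t v1 u).

(** The product is X itself. Its projection to the leaf is [la], with components the structure map
    and the [f i], followed by the isomorphism [m0] from m-space over [P]. *)
Lemma leaf_product : exists (LV : formalScheme) (p1 : mor LV L) (p2 : mor LV V1)
    (phi : mor X LV) (xL : mor P L) (xV : mor P V1),
  [/\ is_pullback (strX \oM l) (strX \oM v1) p1 p2 /\ is_iso phi,
      l \oM xL = kappa /\ v1 \oM xV = kappa,
      p1 \oM (phi \oM l) = idm L /\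
      p2 \oM (phi \oM l) = xV \oM (sigma \oM (strX \oM l)),
      p1 \oM (phi \oM v1) = xL \oM (sigma \oM (strX \oM v1)) /\
      p2 \oM (phi \oM v1) = idm V1 &
      p2 \oM phi = u].
Proof.
have [m1 [mm1 mm2]] := m0i; have [rho [sr tr]] := ov.
have [psi [q1 q2]] := retraction_chi_iso.
have [xV hxV] := v'_point rp gm sl ker.
have [la [la1 la2]] : exists la : mor X (ptow P m), compm (tproj P m) la = compm sigma strX /\
    forall i, (i < m)%N -> global_comap la (tX P m i) = g i.
  by apply: tow_hom => // i; exact: nf.
have [o [o1 o2]] : exists o : mor P (ptow P m), compm (tproj P m) o = idm P /\
    forall i, (i < m)%N -> global_comap o (tX P m i) = 0.
  by apply: (@tow_hom P gP m P (idm P) (fun=> 0)) => i _ p; have [] := @fs_local P setT p openT Logic.I.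
have oE (T : formalScheme) (q : mor T (ptow P m)) :
    (forall i, (i < m)%N -> global_comap q (tX P m i) = 0) -> compm o (compm (tproj P m) q) = q.
  move=> hq; apply: (tow_hom_uniq gP); first by rewrite compmA o1 comp1m.
  by move=> i im; rewrite gcomapM o2 // rmorph0 hq.
have lq (T : formalScheme) (a : mor T L) : compm l a = compm zeta (compm m1 a).
  by rewrite -lm0 compmA -[compm (compm l m0) m1]compmA mm1 compm1.
have sk (T : formalScheme) (z : mor T P) : compm sigma (compm (compm strX kappa) z) = z.
  by rewrite compmA sig2 comp1m.
have zq (T : formalScheme) (q : mor T (ptow P m)) i : (i < m)%N ->
    global_comap q (tX P m i) = pull (compm zeta q) (f i).
  by move=> im; rewrite pull_comp // zf.
have tz (T : formalScheme) (q : mor T (ptow P m)) :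
    compm strX (compm zeta q) = compm (compm strX kappa) (compm (tproj P m) q).
  by rewrite compmA pz compmA.
have q0 : compm m1 lam = o.
  have E : compm zeta (compm m1 lam) = kappa by rewrite -lq.
  rewrite -[RHS]compm1; have <- : compm (tproj P m) (compm m1 lam) = idm P.
    by rewrite -[LHS]sk -tz E -[compm strX kappa]compm1 sk.
  rewrite oE // => i im; rewrite zq // E.
  have [Wx aIV] : U x /\ affine IV by case: gm => -[] + + + [].
  by apply/(kap_ker rp aIV Wx); have [] := sl_f sl im.
have m0o : compm m0 o = lam by rewrite -q0 compmA mm1 comp1m.
have laz : compm la zeta = idm _.
  apply: (tow_hom_uniq gP).
    by rewrite compmA la1 compm1 -[compm (compm sigma strX) zeta]compmA pz sk.
  by move=> i im; rewrite gcomapM la2 // gE zf // gcomap1.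
have lal : compm la l = m1 by rewrite -[l]compm1 lq compm1 compmA laz comp1m.
have pX1 : compm strX (compm v1 u) = strX by rewrite -tr compmA -arr_over -compmA sr compm1.
(* The arrow [rho] at a point of the leaf ends in the leaf, by invariance, and in [V'], where the
   leaf coordinates [f i] vanish; so it ends at the base point. *)
have ul : compm u l = compm xV (compm sigma (compm strX l)).
  have [|l' hl'] := linv (r := compm rho l) (a := idm L); first by rewrite compmA sr comp1m compm1.
  set q := compm m1 l'.
  have dq : compm v1 (compm u l) = compm zeta q by rewrite -lq -hl' !compmA tr.
  have qE : compm o (compm (tproj P m) q) = q.
    by apply: oE => i im; rewrite zq // -dq pull_comp // v1_g // rmorph0.
  have zo : compm zeta o = kappa by rewrite -q0 -lq.
  have dk : compm v1 (compm u l) = compm kappa (compm (tproj P m) q).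
    by rewrite dq -[in LHS]qE compmA zo.
  have tq : compm (tproj P m) q = compm sigma (compm strX l).
    rewrite -[LHS]sk -tz -dq; congr (compm sigma _).
    by rewrite [compm v1 _]compmA compmA pX1.
  by apply: (v'_mono gm); rewrite dk tq [RHS]compmA hxV.
exists X, (compm m0 la), u, (idm X), lam, xV; rewrite !comp1m compm1.
have lav : compm la v1 = compm o (compm sigma (compm strX v1)).
  rewrite -[LHS]oE; first by rewrite [compm (tproj P m) _]compmA la1 -compmA.
  by move=> i im; rewrite gcomapM la2 // gE v1_g.
split=> //; last first.
- by rewrite -compmA lav compmA m0o.
- by rewrite -compmA lal.
split; last by exists (idm X); rewrite comp1m.
split.
  rewrite -[LHS]compmA [compm l _]compmA lm0 tz la1 -[RHS]compmA pX1.
  by rewrite compmA sig1 comp1m.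
(* A pair of points of the leaf and of [V'] is the point of X with coordinates (b, f(a)), by the
   isomorphism [chi]; equality over the base recovers the component of [a] in [P]. *)
move=> T a b ab.
have [|ee [ee1 ee2]] := @tow_hom V1 gV m T b (fun i => global_comap (compm m1 a) (tX P m i)).
  move=> i im p; rewrite zq // => /(pull_unit (f i) p (lU _)); rewrite (xs (compm zeta (compm m1 a) p)).
  by have [h1 _] := sl_f sl im; exact: h1.
have cc : compm c_ (compm psi ee) = ee by rewrite compmA q1 comp1m.
have uc : compm u (compm psi ee) = b by rewrite -cp -compmA cc.
exists (compm psi ee); split; first split=> //.
  rewrite -compmA; suff -> : compm la (compm psi ee) = compm m1 a by rewrite compmA mm1 comp1m.
  apply: (tow_hom_uniq gP).
    have E : compm strX (compm psi ee) = compm strX (compm v1 b).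
      have e1 : compm strX (compm psi ee) = compm (compm strX (compm v1 u)) (compm psi ee) by rewrite pX1.
      by rewrite e1 -uc ![in RHS]compmA ![in LHS]compmA.
    rewrite [LHS]compmA la1 -[LHS]compmA E [compm strX _]compmA -ab -[compm (compm strX l) a]compmA.
    by rewrite lq tz sk.
  by move=> i im; rewrite gcomapM la2 // -cX // -gcomapM cc ee2.
move=> c' [c1 c2].
have la' : compm la c' = compm m1 a by rewrite -c1 !compmA mm2 comp1m.
have -> : c' = compm psi (compm c_ c') by rewrite compmA q2 comp1m.
congr (compm psi _); apply: (tow_hom_uniq gV); first by rewrite ee1 compmA cp c2.
by move=> i im; rewrite ee2 // [RHS]gcomapM cX // -la' gcomapM la2.
Qed.
End Product.

(** * Assembly of (A) to (F) on the part of V over the chosen neighbourhood *)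

Theorem theorem4p5 (S X : formalScheme) (pX : mor X S) (R : groupoid pX)
    (x : X) (P : formalScheme) (kappa : mor P X)
    (* the stabiliser G of x *)
    (G : formalScheme) (g : mor G R) (sG tG : mor G P)
    (* the infinitesimal neighbourhood of x, the completed groupoid, the leaf *)
    (Xh : formalScheme) (h : mor Xh X)
    (Rh : formalScheme) (r : mor Rh R) (sh th : mor Rh Xh)
    (L : formalScheme) (lh : mor L Xh)
    (V : formalScheme) (v : mor V X) :
  noetherian S ->
  locally_formally_fp pX ->
  infinitesimal R ->
  formally_smooth (src R) ->
  locally_formally_fp (src R) ->
  closed [set x] ->
  residue_point x kappa ->
  is_restriction (src R) (tgt R) kappa g sG tG ->
  formally_smooth sG ->
  completion_at x h ->
  is_restriction (src R) (tgt R) h r sh th ->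
  is_leaf sh th lh ->
  leaf_transversal x h lh v ->
  exists (V' : formalScheme) (j : mor V' V),
    open_immersion j /\ (exists y : V', v (j y) = x) /\
    let v' := v \oM j in
    [/\ (* A *)
        exists (RV : formalScheme) (rV : mor RV R) (sV tV : mor RV V')
            (y : mor P V'),
          [/\ is_restriction (src R) (tgt R) v' rV sV tV,
              v' \oM y = kappa & groupoid_invariant sV tV y],
        (* B *)
        to_quotient_has (src R) (tgt R) v'
          (fun N f => formally_smooth f /\ formally_fp f),
        (* C *)
        local_complete_intersection v' &
        (forall x' : X, x' = x) ->
        [/\ (* D *)
            exists u : mor X V', smooth_retraction (src R) (tgt R) v' u,
            (* E *)
            is_iso sG ->
              to_quotient_has (src R) (tgt R) v' (fun N f => is_iso f) /\
              exists! u : mor X V', smooth_retraction (src R) (tgt R) v' u &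
            (* F *)
            field_spectrum S ->
            forall sigma : mor S P,
              (pX \oM kappa) \oM sigma = idm S ->
              sigma \oM (pX \oM kappa) = idm P ->
            let l := h \oM lh in
            forall u : mor X V', smooth_retraction (src R) (tgt R) v' u ->
            exists (LV : formalScheme) (p1 : mor LV L) (p2 : mor LV V')
                (phi : mor X LV) (xL : mor P L) (xV : mor P V'),
              [/\ is_pullback (pX \oM l) (pX \oM v') p1 p2 /\ is_iso phi,
                  l \oM xL = kappa /\ v' \oM xV = kappa,
                  p1 \oM (phi \oM l) = idm L /\
                  p2 \oM (phi \oM l) = xV \oM (sigma \oM (pX \oM l)),
                  p1 \oM (phi \oM v') = xL \oM (sigma \oM (pX \oM v')) /\
                  p2 \oM (phi \oM v') = idm V' &
                  p2 \oM phi = u]]].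
Proof.
move=> nS lX infR smR lR cx rp Gr smG ch Rhr leaf lt.
have [_ nX _] := lR; have nR : locally_noetherian R by case: lR.
have [y [Vh [hv [j [W [oW [IV [m [n [f [w [vy hj gm sl [JK ker]]]]]]]]]]]]] :=
  transversal_slice infR smR nR cx rp Gr smG ch Rhr leaf lt.
have Vy : (v @^-1` (unit_arr R @^-1` W)) y by rewrite /preimage /= vy; case: gm => -[].
have chx : chart (unit_arr R) x oW by case: gm.
have cp : compl h (unit_arr R @^-1` W) x by case: gm.
exists (V' v oW), (vinc v oW); split; first exact: rinc_open_immersion.
split; first by exists (exist _ y Vy).
split.
- exact: (point_invariant infR cx rp gm sl ker Gr).
- exists (N_ v oW n), (tproj (V' v oW) n), (nu sl); split; first exact: (N_pullback infR gm sl).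
  split; first exact: (N_smooth infR smR gm (sl := sl) ker).
  exact: (N_formally_fp infR gm sl ker nX).
- exact: (transversal_lci infR gm sl ker).
move=> xs; have [rho [u [sr tr wr]]] := to_V_ex infR gm sl ker xs.
split.
- by exists u; exact: (u_retraction infR smR gm sl nX xs sr tr wr).
- exact: (trivial_stabiliser infR smR rp gm sl nX xs sr tr wr Gr).
move=> _ sigma s1 s2 /= u1 [_ _ ov uv].
have [lam hlam] := leaf_point chx rp cp leaf.
have [m0 m0i hm0] := zeta_leaf infR cx rp Rhr leaf gm sl.
have gP : gaff P by have [[aP _] _ _] := rp; eexists; exact: aP.
apply: (leaf_product infR rp gm sl ker xs uv (lam := lam) (zeta := zeta rp gm sl) gP _ _ m0i _ _ _ s1 s2 ov).
- by move=> i im; exact: (zeta_f infR rp gm sl im).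
- by rewrite /zeta compmA arr_over -compmA orb_tgt compmA.
- by rewrite -compmA hm0 zetahE.
- by rewrite -compmA.
move=> T r1 a; rewrite -compmA => /(leaf_src infR chx cp Rhr leaf) [l' hl'].
by exists l'; rewrite -compmA.
Qed.
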